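(* Let $\mathbf{c}$ be a closed planar or spherical Frenet curve of length $L$ in $\mathbb{R}^3$. Then there exists a germ of an oriented surface containing $\mathbf{c}$ and having it as a hyperbolic principal cycle if and only if $\mathbf{c}$ is not a circle.
   Context: A closed Frenet curve of length $L$ is a smooth simple closed regular curve $c:[0,L]\to\mathbb{R}^3$, parametrized by arc length $s$ (and extended $L$-periodically), with curvature $k(s)>0$ everywhere; $\mathbf{c}=c([0,L])$. It is planar (resp. spherical) if $\mathbf{c}$ is contained in a plane (resp. in a round sphere) of $\mathbb{R}^3$. Let $\alpha:\mathbb{M}\to\mathbb{R}^3$ be a $C^r$ immersion of an oriented surface, where throughout $r\ge 4$, with positive unit normal $N_\alpha$, and fundamental forms $I_\alpha(v,w)=\langle D\alpha\, v,D\alpha\, w\rangle$, $II_\alpha(v,w)=\langle -DN_\alpha\, v,D\alpha\, w\rangle$. The principal curvatures at a point are the minimum and maximum of $II_\alpha$ on $I_\alpha$-unit tangent vectors, and principal directions are the directions where they are attained. The umbilic set $\mathcal{U}_\alpha$ is the set of points where the two principal curvatures coincide. On $\mathbb{M}\setminus\mathcal{U}_\alpha$ the minimal and maximal principal directions define two mutually orthogonal one-dimensional foliations, whose leaves are the principal curvature lines. A principal cycle is a closed principal curvature line (in particular it is disjoint from $\mathcal{U}_\alpha$). It is hyperbolic if the first derivative of its Poincaré return map, i.e. of the first return map on a transversal segment induced by the principal foliation to which the cycle belongs, evaluated at the point of the cycle, is different from $1$. A germ of a surface containing $\mathbf{c}$ is represented by a surface (here, regular and embedded, of class $C^r$, $r\geq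 4$) defined in some neighborhood of $\mathbf{c}$. *)

(* Defs.v *)
(* MathComp-Analysis; R is an arbitrary realType.  Points and vectors of
   Euclidean 3-space are row vectors 'rV[R]_3; the library norm on them is the
   sup norm, so Euclidean notions go through dotp. *)
From HB Require Import structures.
From mathcomp Require Import all_boot all_order all_algebra.
From mathcomp Require Import all_classical all_reals all_analysis.

Set Implicit Arguments.
Unset Strict Implicit.
Unset Printing Implicit Defensive.

Import Order.TTheory GRing.Theory Num.Theory.
Import numFieldNormedType.Exports.

Local Open Scope ring_scope.
Local Open Scope classical_set_scope.

Definition dotp (R : realType) (n : nat) (u v : 'rV[R]_n) : R :=
  \sum_(i < n) u 0 i * v 0 i.

Section Curves.
Variable R : realType.
Implicit Types (c : R -> 'rV[R]_3) (L : R).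

Definition curvature c (s : R) : R :=
  Num.sqrt (dotp (derive1n 2 c s) (derive1n 2 c s)).

Record closed_frenet_curve c L : Prop := ClosedFrenetCurve {
  cfc_length_gt0 : 0 < L;
  cfc_smooth : forall n s, derivable (derive1n n c) s 1;
  cfc_arclength : forall s, dotp (derive1 c s) (derive1 c s) = 1;
  cfc_periodic : forall s, c (s + L) = c s;
  cfc_simple : forall s t, 0 <= s < L -> 0 <= t < L -> c s = c t -> s = t;
  cfc_curvature_gt0 : forall s, 0 < curvature c s
}.

Definition trace c L : set 'rV[R]_3 := c @` `[0, L].

Definition plane (o n : 'rV[R]_3) : set 'rV[R]_3 :=
  [set x | dotp n (x - o) = 0].

Definition sphere (o : 'rV[R]_3) (rho : R) : set 'rV[R]_3 :=
  [set x | dotp (x - o) (x - o) = rho ^+ 2].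

Definition planar c L : Prop :=
  exists o n, n != 0 /\ trace c L `<=` plane o n.

Definition spherical c L : Prop :=
  exists o rho, 0 < rho /\ trace c L `<=` sphere o rho.

Definition is_circle c L : Prop :=
  exists o n rho, [/\ n != 0, 0 < rho &
    trace c L = plane o n `&` sphere o rho].

End Curves.

(* Class C^k on the open set U.  In finite dimension this agrees with the
   definition by continuity of the iterated partial derivatives. *)
Fixpoint class_C (R : realType) (m n k : nat) (U : set 'rV[R]_m.+1)
    (f : 'rV[R]_m.+1 -> 'rV[R]_n.+1) : Prop :=
  match k with
  | 0 => forall x, U x -> {for x, continuous f}
  | k'.+1 => (forall x, U x -> differentiable f x) /\
             (forall v, class_C k' U (fun x => 'd f x v))
  end.

(* X : U -> S is a C^r regular local parametrization of S: a homeomorphism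
   onto a relatively open part V `&` S of S, with injective differential. *)
Definition chart (R : realType) (r : nat) (S : set 'rV[R]_3)
    (U : set 'rV[R]_2) (X : 'rV[R]_2 -> 'rV[R]_3) : Prop :=
  [/\ open U,
      class_C r U X,
      (forall q, U q -> injective ('d X q)) &
      exists (V : set 'rV[R]_3) (Y : 'rV[R]_3 -> 'rV[R]_2),
        [/\ open V, X @` U = V `&` S,
            {within V `&` S, continuous Y} &
            forall q, U q -> Y (X q) = q]].

(* A regular embedded surface of class C^r, oriented by a continuous unit
   normal field.  The values of the normal outside the carrier are irrelevant;
   on the carrier, continuity forces it to be of class C^(r-1) in charts. *)
Record oriented_surface (R : realType) (r : nat) := OrientedSurface {
  carrier : set 'rV[R]_3;
  normal : 'rV[R]_3 -> 'rV[R]_3;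
  surface_charts : forall p, carrier p ->
    exists U X q, [/\ chart r carrier U X, U q & X q = p];
  normal_unit : forall p, carrier p -> dotp (normal p) (normal p) = 1;
  normal_orthogonal : forall U X q, chart r carrier U X -> U q ->
    forall a, dotp (normal (X q)) ('d X q a) = 0;
  normal_continuous : {within carrier, continuous normal}
}.

Section PrincipalLines.
Variables (R : realType) (r : nat).
Implicit Types (S : oriented_surface R r) (X : 'rV[R]_2 -> 'rV[R]_3).
Implicit Types (q a : 'rV[R]_2) (p v : 'rV[R]_3) (c gamma : R -> 'rV[R]_3).

Definition form1 X q a b : R := dotp ('d X q a) ('d X q b).

Definition form2 S X q a b : R :=
  dotp (- ('d (normal S \o X) q a)) ('d X q b).

Definition normal_curvatures S X q : set R :=
  [set form2 S X q a a | a in [set a | form1 X q a a = 1]].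

(* max = false: minimal principal curvature; max = true: maximal one.  At a
   point of a chart the inf and the sup are attained, the I-unit circle being
   compact. *)
Definition principal_curvature (max : bool) S X q : R :=
  if max then sup (normal_curvatures S X q) else inf (normal_curvatures S X q).

Definition umbilic S X q : Prop :=
  principal_curvature false S X q = principal_curvature true S X q.

(* v is one of the two unit vectors spanning, at the non-umbilic point p of S,
   the minimal (resp. maximal) principal direction.  All notions involved are
   independent of the chart. *)
Definition principal_direction (max : bool) S p v : Prop :=
  exists U X q a,
    [/\ chart r (carrier S) U X, U q, X q = p & 'd X q a = v] /\
    [/\ ~ umbilic S X q, form1 X q a a = 1 &
        form2 S X q a a = principal_curvature max S X q].

Definition principal_line_on (max : bool) S gamma (T : R) : Prop :=
  forall tau, 0 <= tau <= T ->
    derivable gamma tau 1 /\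
    principal_direction max S (gamma tau) (derive1 gamma tau).

Definition principal_cycle (max : bool) S c : Prop :=
  forall s, principal_direction max S (c s) (derive1 c s).

(* sigma, restricted to [-delta, delta], is an embedded C^1 segment of S
   transversal to the foliation. *)
Definition transversal_segment (max : bool) S (sigma : R -> 'rV[R]_3)
    (delta : R) : Prop :=
  [/\ 0 < delta,
      {in `[- delta, delta]%R &, injective sigma} &
      forall t, - delta <= t <= delta ->
        [/\ derivable sigma t 1, {for t, continuous (derive1 sigma)},
            carrier S (sigma t) &
            exists v, principal_direction max S (sigma t) v /\
                      forall x : R, derive1 sigma t <> x *: v]].

(* The leaf through sigma t, followed in the direction given by w (which
   orients the foliation near sigma 0), first comes back to the segment at
   sigma t'. *)
Definition first_return (max : bool) S (sigma : R -> 'rV[R]_3) (delta : R)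
    (w : 'rV[R]_3) (t t' : R) : Prop :=
  exists (T : R) (gamma : R -> 'rV[R]_3),
    [/\ 0 < T, principal_line_on max S gamma T,
        gamma 0 = sigma t & 0 < dotp (derive1 gamma 0) w] /\
    [/\ - delta <= t' <= delta, gamma T = sigma t' &
        forall tau, 0 < tau < T -> ~ (sigma @` `[- delta, delta]) (gamma tau)].

(* P is the Poincare return map of the cycle c on a segment which meets c only
   at c s0 = sigma 0. *)
Definition poincare_map (max : bool) S c (s0 : R) (sigma : R -> 'rV[R]_3)
    (delta : R) (P : R -> R) : Prop :=
  [/\ transversal_segment max S sigma delta,
      sigma 0 = c s0,
      (forall s t, - delta <= t <= delta -> c s = sigma t -> t = 0) &
      \forall t \near 0, first_return max S sigma delta (derive1 c s0) t (P t)].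

(* The derivative of P at 0 does not depend on s0 and sigma: changing them
   conjugates P by a C^1 diffeomorphism germ fixing 0. *)
Definition hyperbolic_principal_cycle S c : Prop :=
  exists max : bool, principal_cycle max S c /\
    exists (s0 : R) (sigma : R -> 'rV[R]_3) (delta : R) (P : R -> R),
      [/\ poincare_map max S c s0 sigma delta P,
          derivable P 0 1 & derive1 P 0 <> 1].

End PrincipalLines.

(* Main.v *)
Require Import Defs.
From HB Require Import structures.
From mathcomp Require Import all_boot all_order all_algebra.
From mathcomp Require Import all_classical all_reals all_analysis.
From mathcomp Require Import ring lra.
Set Implicit Arguments.
Unset Strict Implicit.
Unset Printing Implicit Defensive.
Import Order.TTheory GRing.Theory Num.Theory.
Import numFieldNormedType.Exports.
Local Open Scope ring_scope.
Local Open Scope classical_set_scope.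

(** * Hyperbolic principal cycles along planar and spherical curves

    A circle c that is a principal cycle is never hyperbolic.  By Joachimsthal's
    theorem a surface meets the plane of c at a constant angle, so the principal
    curvature kap of c is constant and the deviation w x = N x + kap x - C0
    vanishes along c ([circle_setup]).  At first order w grows linearly away
    from c, in the direction of N x c', because the other principal curvature is
    different ([local_estimate]).  Along a leaf with principal curvature k the
    derivative of w is (kap - k) v, where v is the velocity; close to c the
    factor kap - k is O(|w|), and v . w is o(|w|) since v is almost parallel to
    c' while w is almost orthogonal to it.  Hence |w|^2 has logarithmic
    derivative at most any prescribed eps ([line_gronwall]).  Leaves close to c
    turn around it and cross the transversal again in a time that is bounded
    independently of eps ([revolution], [crossing], [return_time_le]), so w has
    the same length at both ends of the leaf up to a factor that tends to 1,
    and its component along N x J, with J the rotation field of the circle,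
    keeps its sign ([return_estimate]).  As w is equivalent to a nonzero
    multiple of the parameter of the transversal, P'(0) = 1.

    If c is not a circle, let E be the unit normal of the plane or sphere and
    (E, T, N) the frame with T = c'; then T' = a N - lam E, N' = - a T,
    E' = lam T with a constant lam, and the geodesic curvature a is not constant
    ([constant_curvature_circle]).  Choose M with M + a' > 0, m = 1 / (M + a'),
    q = a + m, g = q' / m.  Attach to each point of c the circle tangent to E
    that is the inversion of a line of direction E chosen so that N - q D is
    normal and T - g D is tangent to the swept surface, D being the chord from
    c.  The circles are curvature lines with principal curvature q, the lines
    of the other family follow T - g D with a smaller curvature, equal to a
    on c itself, and they are the graphs y = t rho(s) with rho' = - g rho
    ([ray_principal], [strip_leaf]).  So the return map is exactly the linear
    map t |-> t rho(L), and the choice of m makes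
    rho = (M + a') exp(- M a - h) up to a constant, where h' = (a')^2: its
    multiplier is the exponential of minus the integral of (a')^2 over the
    curve, which is less than 1 ([leaf_profile], [strip_hyperbolic]). *)

(** * Differentiability in epsilon-delta form *)

Section EpsDelta.
Variable R : realType.

Lemma nbhs_deltaP (V : normedModType R) (x : V) (P : V -> Prop) :
  (\forall y \near x, P y) <->
  (exists2 d : R, 0 < d & forall y, `|y - x| < d -> P y).
Proof.
split.
- move=> /nbhs_ballP[d /= d0 H]; exists d => // y yx.
  by apply: H; rewrite -ball_normE /= distrC.
- move=> [d d0 H]; apply/nbhs_ballP; exists d => // y.
  by rewrite -ball_normE /= distrC; exact: H.
Qed.

Lemma diff_eps (V W : normedModType R) (f : V -> W) x :
  differentiable f x -> forall e : R, 0 < e ->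
  exists2 d : R, 0 < d &
    forall y, `|y - x| < d -> `|f y - f x - 'd f x (y - x)| <= e * `|y - x|.
Proof.
move=> /diff_locally /eqaddoP fE e e0.
have /nbhs_deltaP[d d0 H] := fE _ e0.
exists d => // y yd; have := H (y - x); rewrite /= subr0 => /(_ yd).
rewrite -[(_ - (cst _ + _)) _]/(f (y - x + x) - (f x + 'd f x (y - x))) subrK.
by rewrite opprD addrA.
Qed.

Lemma eps_diff (V W : normedModType R) (f : V -> W) x (L : {linear V -> W}) :
  continuous L ->
  (forall e : R, 0 < e -> exists2 d : R, 0 < d &
     forall y, `|y - x| < d -> `|f y - f x - L (y - x)| <= e * `|y - x|) ->
  is_diff x f L.
Proof.
move=> cL H.
have E : f \o shift x = cst (f x) + L +o_ (0 : V) id.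
  apply/eqaddoP => e e0; have [d d0 Hd] := H _ e0.
  apply/nbhs_deltaP; exists d => // y; rewrite subr0 => yd.
  rewrite -[(_ - (cst _ + _)) _]/(f (y + x) - (f x + L y)) opprD addrA.
  by have := Hd (y + x); rewrite addrK; exact.
have EL := diff_unique cL E.
apply: DiffDef => //; apply/diff_locallyP; rewrite EL; split => //.
Qed.

Lemma der_eps (W : normedModType R) (f : R -> W) x :
  derivable f x 1 -> forall e : R, 0 < e ->
  exists2 d : R, 0 < d &
    forall y, `|y - x| < d ->
      `|f y - f x - (y - x) *: derive1 f x| <= e * `|y - x|.
Proof.
move=> fx e e0; have /derivable1_diffP/diff_eps/(_ _ e0)[d d0 H] := fx.
by exists d => // y /H; rewrite deriv1E.
Qed.

Lemma eps_der (W : normedModType R) (f : R -> W) x (l : W) :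
  (forall e : R, 0 < e -> exists2 d : R, 0 < d &
     forall y, `|y - x| < d -> `|f y - f x - (y - x) *: l| <= e * `|y - x|) ->
  is_derive x 1 f l.
Proof.
move=> H.
have lin : linear (fun h : R => h *: l) by move=> ? ? ?; rewrite scalerDl scalerA.
pose M := GRing.isLinear.Build _ _ _ _ _ lin.
pose L : {linear R -> W} := HB.pack (fun h : R => h *: l) M.
have [df fL] : is_diff x f L by apply: eps_diff => //; exact: scalel_continuous.
apply: DeriveDef; first exact/derivable1_diffP.
by rewrite deriveE// fL /L /= scale1r.
Qed.

Lemma is_derive_diff_comp (V W : normedModType R) (f : V -> W) (g : R -> V) (t : R) (v : V) :
  is_derive t 1 g v -> differentiable f (g t) ->
  is_derive t 1 (f \o g) ('d f (g t) v).
Proof.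
move=> [/derivable1_diffP gt gv] ft.
have fg : differentiable (f \o g) t by exact: differentiable_comp.
apply: DeriveDef; first exact/derivable1_diffP.
by rewrite -gv (deriveE _ fg) (deriveE _ gt) diff_comp.
Qed.

Lemma is_derive_line (V : normedModType R) (z u : V) (t : R) :
  is_derive t 1 (fun s : R => z + s *: u) u.
Proof.
apply: eps_der => e e0; exists 1 => // y _.
have -> : z + y *: u - (z + t *: u) - (y - t) *: u = 0.
  by rewrite opprD addrACA subrr add0r scalerBl subrr.
by rewrite normr0 mulr_ge0// ltW.
Qed.

End EpsDelta.

Section RowVectors.
Variable R : realType.

Lemma coord_le_norm n (x : 'rV[R]_n) j : `|x 0 j| <= `|x|.
Proof.
rewrite [leRHS]/Num.Def.normr/= mx_normrE.
exact: (le_bigmax _ (fun i : 'I_1 * 'I_n => `|x i.1 i.2|) (0, j)).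
Qed.

Lemma norm_le_coord n (x : 'rV[R]_n) e :
  0 <= e -> (forall j, `|x 0 j| <= e) -> `|x| <= e.
Proof.
move=> e0 H; rewrite [leLHS]/Num.Def.normr/= mx_normrE.
by apply: bigmax_le => // -[i j] _ /=; rewrite ord1.
Qed.

Lemma rV_expand (W : lmodType R) n (L : {linear 'rV[R]_n -> W}) x :
  L x = \sum_j x 0 j *: L (delta_mx 0 j).
Proof. by rewrite {1}[x]row_sum_delta linear_sum; apply: eq_bigr => j _; rewrite linearZ. Qed.

Lemma rV_linear_bound (W : normedModType R) n (L : {linear 'rV[R]_n -> W}) x e :
  (forall j, `|L (delta_mx 0 j)| <= e) -> `|L x| <= n%:R * e * `|x|.
Proof.
move=> H; rewrite rV_expand (le_trans (ler_norm_sum _ _ _))//.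
have -> : n%:R * e * `|x| = \sum_(j < n) (`|x| * e).
  by rewrite sumr_const card_ord -mulr_natl; ring.
apply: ler_sum => j _; rewrite normrZ ler_pM//; exact: coord_le_norm.
Qed.

Lemma rV_linear_dist (W : normedModType R) n (L1 L2 : {linear 'rV[R]_n -> W}) x e :
  (forall j, `|L1 (delta_mx 0 j) - L2 (delta_mx 0 j)| <= e) ->
  `|L1 x - L2 x| <= n%:R * e * `|x|.
Proof. exact: (@rV_linear_bound _ _ (GRing.sub_fun L1 L2)). Qed.

Lemma rV_linear_continuous (W : normedModType R) n (L : {linear 'rV[R]_n -> W}) :
  continuous L.
Proof.
apply/linear_bounded_continuous/linear_boundedP.
pose K := n%:R * \sum_j `|L (delta_mx 0 j)|.
near=> r => x; rewrite (le_trans (@rV_linear_bound _ _ L x (\sum_j `|L (delta_mx 0 j)|) _))//.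
  by move=> j; rewrite (bigD1 j)//= lerDl sumr_ge0.
by rewrite ler_wpM2r//; near: r; apply: nbhs_pinfty_ge; exact: num_real.
Unshelve. all: by end_near. Qed.

Definition coordf n (j : 'I_n) (x : 'rV[R]_n) : R := x 0 j.

Lemma coordf_linear n (j : 'I_n) : linear (coordf j).
Proof. by move=> a u v; rewrite /coordf !mxE. Qed.

HB.instance Definition _ n (j : 'I_n) :=
  GRing.isLinear.Build _ _ _ _ (@coordf n j) (@coordf_linear n j).

Lemma is_derive_coord n (g : R -> 'rV[R]_n) (t : R) (v : 'rV[R]_n) j :
  is_derive t 1 g v -> is_derive t 1 (fun s => g s 0 j : R) (v 0 j).
Proof.
move=> [dg gv]; have H := (derivable_mxP g t 1).1 dg 0 j.
by apply: DeriveDef => //; rewrite -gv derive_mx// mxE.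
Qed.

Lemma coord_is_derive n (g : R -> 'rV[R]_n) (t : R) (v : 'rV[R]_n) :
  (forall j, is_derive t 1 (fun s => g s 0 j : R) (v 0 j)) -> is_derive t 1 g v.
Proof.
move=> H; have dg : derivable g t 1.
  by apply/derivable_mxP => i j; rewrite ord1; case: (H j).
apply: DeriveDef => //; rewrite derive_mx//; apply/rowP => j; rewrite mxE.
by case: (H j).
Qed.

(** Mean value theorem along the segments of a ball, one coordinate at a
    time. *)
Lemma strict_diff m n (f : 'rV[R]_m -> 'rV[R]_n) x :
  (\forall y \near x, differentiable f y) ->
  (forall v, {for x, continuous (fun y => 'd f y v)}) ->
  forall e : R, 0 < e -> exists2 d : R, 0 < d &
   forall y z, `|y - x| < d -> `|z - x| < d ->
     `|f y - f z - 'd f x (y - z)| <= e * `|y - z|.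
Proof.
move=> /nbhs_deltaP[d0 d00 Hd0] df e e0.
pose e' := e / (m%:R + 1).
have e'0 : 0 < e' by rewrite divr_gt0// ltr_wpDl.
have : \forall y \near x, forall j : 'I_m, `|'d f y (delta_mx 0 j) - 'd f x (delta_mx 0 j)| < e'.
  apply: (@filter_forall _ _ (fun (j : 'I_m) y => `|'d f y (delta_mx 0 j) - 'd f x (delta_mx 0 j)| < e') (nbhs x)) => j.
  have /cvgrPdistC_lt/(_ _ e'0) := df (delta_mx 0 j); exact.
move=> /nbhs_deltaP[d1 d10 Hd1].
exists (Num.min d0 d1); first by rewrite lt_min d00.
move=> y z; rewrite !lt_min => /andP[yd0 yd1] /andP[zd0 zd1].
apply: norm_le_coord => [|i]; first by rewrite mulr_ge0// ltW.
have seg (t d : R) : 0 <= t <= 1 -> `|y - x| < d -> `|z - x| < d ->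
    `|z + t *: (y - z) - x| < d.
  move=> /andP[t0 t1] yd zd.
  have -> : z + t *: (y - z) - x = t *: (y - x) + (1 - t) *: (z - x).
    rewrite scalerBl scale1r !scalerBr opprB addrACA [RHS]addrACA.
    by apply/rowP => k; rewrite !mxE; ring.
  rewrite (le_lt_trans (ler_normD _ _))// !normrZ !ger0_norm ?subr_ge0//.
  have [->|t0'] := eqVneq t 0; first by rewrite mul0r add0r subr0 mul1r.
  have : t * `|y - x| < t * d by rewrite ltr_pM2l// lt_def t0'.
  have : (1 - t) * `|z - x| <= (1 - t) * d by rewrite ler_wpM2l ?subr_ge0// ltW.
  lra.
pose phi (s : R) : R := f (z + s *: (y - z)) 0 i.
pose dphi (s : R) : R := ('d f (z + s *: (y - z)) (y - z)) 0 i.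
have D (t : R) : t \in `[0, 1]%R -> is_derive t 1 phi (dphi t).
  rewrite in_itv/= => t01; apply: is_derive_coord.
  have := is_derive_diff_comp (is_derive_line z (y - z) t).
  by apply; apply: Hd0; exact: seg.
have cphi : {within `[(0 : R), 1], continuous phi}.
  by apply: derivable_within_continuous => t /D[].
have Doo (t : R) : t \in `]0, 1[%R -> is_derive t 1 phi (dphi t).
  by move=> t01; apply: D; apply: subset_itv_oo_cc.
have [t t01] := MVT_segment ler01 Doo cphi.
rewrite {1 2}/phi scale1r scale0r addr0 (addrC z) subrK subr0 mulr1 => E.
move: t01; rewrite in_itv/= => t01.
rewrite !mxE E /dphi.
have -> : e * `|y - z| = (m%:R + 1) * e' * `|y - z|.
  by rewrite /e' mulrCA divff ?mulr1// gt_eqF// ltr_wpDl.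
have -> (u v : 'rV[R]_n) : u 0 i - v 0 i = (u - v) 0 i by rewrite !mxE.
apply: le_trans (coord_le_norm _ _) _.
apply: (@le_trans _ _ (m%:R * e' * `|y - z|)); last first.
  by rewrite !ler_wpM2r ?lerDl// ltW.
apply: rV_linear_dist => j; apply/ltW/Hd1; exact: seg.
Qed.

End RowVectors.

(** * Euclidean algebra of row vectors *)

Section DotProduct.
Variables (R : realType) (n : nat).
Implicit Types (u v w : 'rV[R]_n) (k : R).

Lemma dotpC u v : dotp u v = dotp v u.
Proof. by apply: eq_bigr => i _; rewrite mulrC. Qed.

Lemma dotpDl u v w : dotp (u + v) w = dotp u w + dotp v w.
Proof. by rewrite /dotp -big_split; apply: eq_bigr => i _; rewrite !mxE mulrDl. Qed.

Lemma dotpZl k u v : dotp (k *: u) v = k * dotp u v.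
Proof. by rewrite /dotp mulr_sumr; apply: eq_bigr => i _; rewrite !mxE mulrA. Qed.

Lemma dotpDr u v w : dotp w (u + v) = dotp w u + dotp w v.
Proof. by rewrite dotpC dotpDl !(dotpC w). Qed.

Lemma dotpZr k u v : dotp u (k *: v) = k * dotp u v.
Proof. by rewrite dotpC dotpZl dotpC. Qed.

Lemma dotpNl u v : dotp (- u) v = - dotp u v.
Proof. by rewrite -scaleN1r dotpZl mulN1r. Qed.

Lemma dotpNr u v : dotp u (- v) = - dotp u v.
Proof. by rewrite dotpC dotpNl dotpC. Qed.

Lemma dotpBl u v w : dotp (u - v) w = dotp u w - dotp v w.
Proof. by rewrite dotpDl dotpNl. Qed.

Lemma dotpBr u v w : dotp w (u - v) = dotp w u - dotp w v.
Proof. by rewrite dotpDr dotpNr. Qed.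

Lemma dotp0l u : dotp 0 u = 0.
Proof. by rewrite -(scale0r u) dotpZl mul0r. Qed.

Lemma dotp_ge0 u : 0 <= dotp u u.
Proof. by apply: sumr_ge0 => i _; rewrite -expr2 sqr_ge0. Qed.

Lemma norm_sq_le_dotp u : `|u| ^+ 2 <= dotp u u.
Proof.
have dj j : `|u 0 j| ^+ 2 <= dotp u u.
  rewrite /dotp (bigD1 j)//= real_normK ?num_real// expr2 lerDl sumr_ge0// => i _.
  by rewrite -expr2 sqr_ge0.
rewrite -(@ler_sqrt _ (`|u| ^+ 2)) ?dotp_ge0// sqrtr_sqr normr_id.
apply: norm_le_coord => [|j]; first exact: sqrtr_ge0.
by rewrite -[leLHS]normr_id -sqrtr_sqr ler_sqrt ?dotp_ge0.
Qed.

Lemma dotp_eq0 u : (dotp u u == 0) = (u == 0).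
Proof.
apply/eqP/eqP => [u0|->]; last exact: dotp0l.
apply/eqP; rewrite -normr_eq0 -sqrf_eq0; apply/eqP/le_anti.
by rewrite sqr_ge0 -u0 norm_sq_le_dotp.
Qed.

Lemma dotp_gt0 u : (0 < dotp u u) = (u != 0).
Proof. by rewrite lt_def dotp_eq0 dotp_ge0 andbT. Qed.

Lemma dotp_le u v : `|dotp u v| <= n%:R * `|u| * `|v|.
Proof.
rewrite (le_trans (ler_norm_sum _ _ _))//.
have -> : n%:R * `|u| * `|v| = \sum_(j < n) (`|u| * `|v|).
  by rewrite sumr_const card_ord -mulr_natl; ring.
by apply: ler_sum => j _; rewrite normrM ler_pM// coord_le_norm.
Qed.

Lemma dotp_le_norm_sq u : dotp u u <= n%:R * `|u| ^+ 2.
Proof. by rewrite (le_trans (ler_norm _))// (le_trans (dotp_le _ _))// -mulrA. Qed.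

(** The discriminant of |u + t v|^2. *)
Lemma dotp_CS u v : dotp u v ^+ 2 <= dotp u u * dotp v v.
Proof.
have [->|u0] := eqVneq u 0; first by rewrite !dotp0l mul0r expr0n.
have := dotp_ge0 (dotp u u *: v - dotp u v *: u).
rewrite !(dotpBl, dotpBr, dotpZl, dotpZr) (dotpC v u).
move=> H; rewrite -subr_ge0 -(pmulr_rge0 _ (_ : 0 < dotp u u)) ?dotp_gt0//.
by apply: le_trans H _; rewrite le_eqVlt; apply/orP; left; apply/eqP; ring.
Qed.

Lemma is_derive_dotp (f g : R -> 'rV[R]_n) (t : R) (df dg : 'rV[R]_n) :
  is_derive t 1 f df -> is_derive t 1 g dg ->
  is_derive t 1 (fun s => dotp (f s) (g s)) (dotp df (g t) + dotp (f t) dg).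
Proof.
move=> Hf Hg.
have -> : (fun s => dotp (f s) (g s)) =
   \sum_(i < n) ((fun s => f s 0 i : R) * (fun s => g s 0 i : R)).
  by apply/funext => s; rewrite fct_sumE.
have -> : dotp df (g t) + dotp (f t) dg =
   \sum_(i < n) (f t 0 i *: dg 0 i + g t 0 i *: df 0 i).
  rewrite /dotp -big_split; apply: eq_bigr => i _ /=.
  by rewrite addrC; congr (_ + _); rewrite mulrC.
apply: is_derive_sum => i.
by apply: is_deriveM; exact: is_derive_coord.
Qed.

Lemma cvg_dotp (T : Type) (F : set_system T) (FF : Filter F)
    (f g : T -> 'rV[R]_n) (a b : 'rV[R]_n) :
  f @ F --> a -> g @ F --> b -> (fun s => dotp (f s) (g s)) @ F --> dotp a b.
Proof.
move=> fa gb; apply: cvg_big => [|i _]; first exact: add_continuous.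
apply: cvgM.
  by apply: (cvg_comp f (fun x : 'rV[R]_n => x 0 i : R) fa); exact: coord_continuous.
by apply: (cvg_comp g (fun x : 'rV[R]_n => x 0 i : R) gb); exact: coord_continuous.
Qed.

Lemma continuous_dotp (T : topologicalType) (f g : T -> 'rV[R]_n) (x : T) :
  {for x, continuous f} -> {for x, continuous g} ->
  {for x, continuous (fun s => dotp (f s) (g s))}.
Proof. exact: cvg_dotp. Qed.

End DotProduct.

Section Space.
Variable R : realType.
Implicit Types (u v w x : 'rV[R]_3) (k : R).

Definition o0 : 'I_3 := @Ordinal 3 0 isT.
Definition o1 : 'I_3 := @Ordinal 3 1 isT.
Definition o2 : 'I_3 := @Ordinal 3 2 isT.

Lemma ord3P (P : 'I_3 -> Prop) : P o0 -> P o1 -> P o2 -> forall i, P i.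
Proof.
move=> P0 P1 P2 [[|[|[|i]]] Hi] //.
- by rewrite (_ : Ordinal Hi = o0)//; exact: val_inj.
- by rewrite (_ : Ordinal Hi = o1)//; exact: val_inj.
- by rewrite (_ : Ordinal Hi = o2)//; exact: val_inj.
Qed.

Lemma sum3E (V : nmodType) (F : 'I_3 -> V) : \sum_i F i = F o0 + F o1 + F o2.
Proof.
rewrite !big_ord_recl big_ord0 addr0 addrA.
by congr (F _ + F _ + F _); exact: val_inj.
Qed.

Lemma dotpE u v :
  dotp u v = u 0 o0 * v 0 o0 + u 0 o1 * v 0 o1 + u 0 o2 * v 0 o2.
Proof. exact: sum3E. Qed.

Lemma row3P u v : u 0 o0 = v 0 o0 -> u 0 o1 = v 0 o1 -> u 0 o2 = v 0 o2 -> u = v.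
Proof. by move=> H0 H1 H2; apply/rowP; exact: ord3P. Qed.

Definition crossp u v : 'rV[R]_3 := \row_(j < 3)
  if j == o0 then u 0 o1 * v 0 o2 - u 0 o2 * v 0 o1 else
  if j == o1 then u 0 o2 * v 0 o0 - u 0 o0 * v 0 o2 else
  u 0 o0 * v 0 o1 - u 0 o1 * v 0 o0.

Lemma crosspE u v : (crossp u v 0 o0 = u 0 o1 * v 0 o2 - u 0 o2 * v 0 o1) *
  (crossp u v 0 o1 = u 0 o2 * v 0 o0 - u 0 o0 * v 0 o2) *
  (crossp u v 0 o2 = u 0 o0 * v 0 o1 - u 0 o1 * v 0 o0).
Proof. by rewrite /crossp !mxE. Qed.

Lemma dotp_crosspl u v : dotp (crossp u v) u = 0.
Proof. by rewrite dotpE !crosspE; ring. Qed.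

Lemma dotp_crosspr u v : dotp (crossp u v) v = 0.
Proof. by rewrite dotpE !crosspE; ring. Qed.

Lemma dotp_crossp2 u v :
  dotp (crossp u v) (crossp u v) = dotp u u * dotp v v - dotp u v ^+ 2.
Proof. by rewrite !dotpE !crosspE; ring. Qed.

Lemma crosspDr u v w : crossp w (u + v) = crossp w u + crossp w v.
Proof. by apply: row3P; rewrite !mxE /=; ring. Qed.

Lemma crosspZl k u v : crossp (k *: u) v = k *: crossp u v.
Proof. by apply: row3P; rewrite !mxE /=; ring. Qed.

Lemma crosspZr k u v : crossp u (k *: v) = k *: crossp u v.
Proof. by apply: row3P; rewrite !mxE /=; ring. Qed.

Lemma crossp_crossp u v w :
  crossp u (crossp v w) = dotp u w *: v - dotp u v *: w.
Proof. by apply: row3P; rewrite !mxE /= ?dotpE ?crosspE /=; ring. Qed.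

Record orthonormal3 u v w : Prop := Orthonormal3 {
  on_uu : dotp u u = 1; on_vv : dotp v v = 1; on_ww : dotp w w = 1;
  on_uv : dotp u v = 0; on_uw : dotp u w = 0; on_vw : dotp v w = 0 }.

Lemma orthonormal3_expand u v w x : orthonormal3 u v w ->
  x = dotp x u *: u + dotp x v *: v + dotp x w *: w.
Proof.
case=> uu vv ww uv uw vw.
pose M : 'M[R]_3 := \matrix_(i, j)
  (if i == o0 then u 0 j else if i == o1 then v 0 j else w 0 j).
have MT : M *m M^T = 1%:M.
  apply/matrixP; apply: ord3P; apply: ord3P; rewrite !mxE sum3E !mxE /=;
  by rewrite -dotpE ?uu ?vv ?ww ?(dotpC v u) ?(dotpC w u) ?(dotpC w v) ?uv ?uw ?vw.
have TM : M^T *m M = 1%:M by exact: mulmx1C.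
have E j : x 0 j = \sum_k x 0 k * (M^T *m M) k j.
  rewrite TM (bigD1 j)//= big1 ?addr0 ?mxE ?eqxx ?mulr1// => i /negbTE ij.
  by rewrite mxE ij mulr0.
apply/rowP => j; rewrite {1}E !mxE !dotpE sum3E.
by rewrite ![in LHS]mxE !sum3E ![in LHS]mxE /=; ring.
Qed.

Lemma orthonormal3_crossp u v : dotp u u = 1 -> dotp v v = 1 -> dotp u v = 0 ->
  orthonormal3 u v (crossp u v).
Proof.
move=> uu vv uv; split => //.
- by rewrite dotp_crossp2 uu vv uv; ring.
- by rewrite dotpC dotp_crosspl.
- by rewrite dotpC dotp_crosspr.
Qed.

Lemma dotp_frame u v w a b c a' b' c' : orthonormal3 u v w ->
  dotp (a *: u + b *: v + c *: w) (a' *: u + b' *: v + c' *: w) =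
  a * a' + b * b' + c * c'.
Proof.
case=> uu vv ww uv uw vw.
rewrite !(dotpDl, dotpDr, dotpZl, dotpZr) (dotpC v u) (dotpC w u) (dotpC w v).
by rewrite uu vv ww uv uw vw; ring.
Qed.

End Space.

(** * Functions of class C^k *)

Section ClassCk.
Variable R : realType.

(** The same recursion as in the definition of surfaces, for arbitrary normed
    modules: closure under products and inverses needs real-valued functions. *)
Fixpoint Ck (V W : normedModType R) (k : nat) (U : set V) (f : V -> W) : Prop :=
  match k with
  | 0 => forall x, U x -> {for x, continuous f}
  | k'.+1 => (forall x, U x -> differentiable f x) /\
             (forall v, Ck k' U (fun x => 'd f x v))
  end.

Lemma class_CE m n k (U : set 'rV[R]_m.+1) (f : 'rV[R]_m.+1 -> 'rV[R]_n.+1) :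
  class_C k U f <-> Ck k U f.
Proof.
elim: k f => [//|k IH] f /=.
by split=> -[? H]; split=> // v; apply/IH; exact: H.
Qed.

Section Generic.
Variables (V W W' : normedModType R).

Lemma Ck_sub k (U U' : set V) (f : V -> W) : U' `<=` U -> Ck k U f -> Ck k U' f.
Proof.
move=> UU; elim: k f => [|k IH] f /=; first by move=> H x /UU; exact: H.
by move=> [df H]; split=> [x /UU|v]; [exact: df|exact: IH].
Qed.

Lemma CkS k (U : set V) (f : V -> W) : Ck k.+1 U f -> Ck k U f.
Proof.
elim: k f => [|k IH] f [df H]; first by move=> x /df; exact: differentiable_continuous.
by split=> // v; exact: IH.
Qed.

Lemma Ck_le k k' (U : set V) (f : V -> W) : (k <= k')%N -> Ck k' U f -> Ck k U f.
Proof.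
move=> /subnK <-; elim: (k' - k)%N => [//|j IH].
by rewrite addSn => /CkS; exact: IH.
Qed.

Lemma near_eq_diff (f g : V -> W) x : (\forall y \near x, f y = g y) ->
  differentiable f x -> differentiable g x /\ 'd g x = 'd f x :> (V -> W).
Proof.
move=> /nbhs_deltaP[d0 d00 fg] df.
have [] : is_diff x g ('d f x).
  apply: eps_diff => [|e e0]; first exact: diff_continuous.
  have [d d_gt0 H] := diff_eps df e0.
  exists (Num.min d0 d) => [|y]; first by rewrite lt_min d00.
  rewrite lt_min => /andP[yd0 yd]; rewrite -fg// -fg ?subrr ?normr0//.
  exact: H.
by [].
Qed.

Lemma Ck_eq k (U : set V) (f g : V -> W) : open U ->
  (forall x, U x -> f x = g x) -> Ck k U f -> Ck k U g.
Proof.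
move=> oU; elim: k f g => [|k IH] f g fg.
  move=> H x Ux; have := H _ Ux; rewrite /prop_for /continuous_at.
  rewrite -(fg _ Ux) => fx; apply: cvg_trans fx; apply: near_eq_cvg.
  have : nbhs x U by exact: open_nbhs_nbhs.
  by apply: filterS => y Uy; rewrite fg.
have N x : U x -> \forall y \near x, f y = g y.
  move=> Ux; have : nbhs x U by exact: open_nbhs_nbhs.
  by apply: filterS => y Uy; rewrite fg.
move=> [df H]; split=> [x Ux|v]; first by case: (near_eq_diff (N _ Ux) (df _ Ux)).
apply: (IH _ _ _ (H v)) => x Ux.
have [_ E] := near_eq_diff (N _ Ux) (df _ Ux).
exact: esym (congr1 (@^~ v) E).
Qed.

Lemma Ck_cst k (U : set V) (w : W) : Ck k U (fun=> w).
Proof.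
elim: k w => [|k IH] w /=; first by move=> x _; exact: cst_continuous.
split=> [x _|v]; first exact: differentiable_cst.
have -> : (fun x : V => 'd (fun=> w) x v) = fun=> 0.
  by apply/funext => x; have := diff_cst w x; rewrite /cst => ->.
exact: IH.
Qed.

Lemma CkD k (U : set V) (f g : V -> W) : open U ->
  Ck k U f -> Ck k U g -> Ck k U (fun x => f x + g x).
Proof.
move=> oU; elim: k f g => [|k IH] f g /=.
  by move=> Hf Hg x Ux; apply: continuousD; [exact: Hf|exact: Hg].
move=> [df Hf] [dg Hg]; split=> [x Ux|v].
  by apply: differentiableD; [exact: df|exact: dg].
apply: (@Ck_eq _ _ (fun x => 'd f x v + 'd g x v)) => //; last first.
  by apply: IH; [exact: Hf|exact: Hg].
move=> x Ux; exact: esym (congr1 (@^~ v) (diffD (df _ Ux) (dg _ Ux))).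
Qed.

Lemma Ck_lin k (U : set V) (L : {linear V -> W}) : continuous L -> Ck k U L.
Proof.
move=> cL; case: k => [|k]; first by move=> x _; exact: cL.
split=> [x _|v]; first exact: linear_differentiable.
have -> : (fun x : V => 'd L x v) = fun=> L v by apply/funext => x; rewrite diff_lin.
exact: Ck_cst.
Qed.

End Generic.

Lemma Ck_lincomp (V W W' : normedModType R) k (U : set V) (L : {linear W -> W'})
  (f : V -> W) : open U -> continuous L -> Ck k U f -> Ck k U (fun x => L (f x)).
Proof.
move=> oU cL; elim: k f => [|k IH] f /=.
  by move=> Hf x Ux; apply: (@continuous_comp _ _ _ f L); [exact: Hf|exact: cL].
move=> [df Hf]; split=> [x Ux|v].
  by apply: (@differentiable_comp _ _ _ _ f L); [exact: df|exact: linear_differentiable].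
apply: (@Ck_eq _ _ _ _ (fun x => L ('d f x v))) => //; last exact: IH.
move=> x Ux.
have E := congr1 (@^~ v) (diff_comp (df _ Ux) (linear_differentiable (f x) cL)).
by apply: esym; apply: etrans E _; rewrite /= diff_lin.
Qed.

Section Scalar.
Variable V : normedModType R.
Implicit Types (U : set V) (f g : V -> R).

Lemma CkM k U f g : open U -> Ck k U f -> Ck k U g -> Ck k U (fun x => f x * g x).
Proof.
move=> oU; elim: k f g => [|k IH] f g /=.
  by move=> Hf Hg x Ux; apply: continuousM; [exact: Hf|exact: Hg].
move=> Cf Cg; have [df Hf] := Cf; have [dg Hg] := Cg; split=> [x Ux|v].
  by apply: differentiableM; [exact: df|exact: dg].
apply: (@Ck_eq _ _ _ _ (fun x => f x * 'd g x v + g x * 'd f x v)) => //.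
  move=> x Ux; exact: esym (congr1 (@^~ v) (diffM (df _ Ux) (dg _ Ux))).
apply: CkD => //; apply: IH; [exact: CkS|exact: Hg|exact: CkS|exact: Hf].
Qed.

Lemma CkN k U f : open U -> Ck k U f -> Ck k U (fun x => - f x).
Proof.
move=> oU Cf; apply: (@Ck_eq _ _ _ _ (fun x => (-1) * f x)) => //.
  by move=> x _; rewrite mulN1r.
by apply: CkM => //; exact: Ck_cst.
Qed.

Lemma CkB k U f g : open U -> Ck k U f -> Ck k U g -> Ck k U (fun x => f x - g x).
Proof. by move=> oU Cf Cg; apply: CkD => //; exact: CkN. Qed.

Lemma CkV k U f : open U -> (forall x, U x -> f x != 0) ->
  Ck k U f -> Ck k U (fun x => (f x)^-1).
Proof.
move=> oU f0; elim: k => [|k IH].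
  by move=> Hf x Ux; apply: continuousV; [exact: f0|exact: Hf].
move=> Cf; have [df Hf] := Cf; split=> [x Ux|v].
  by apply: differentiableV; [exact: df|exact: f0].
apply: (@Ck_eq _ _ _ _ (fun x => - ((f x)^-1 * (f x)^-1 * 'd f x v))) => //.
  move=> x Ux; have E := congr1 (@^~ v) (diffV (df _ Ux) (f0 _ Ux)).
  by apply: esym; apply: etrans E _; rewrite -mulNr -expr2 exprVn.
have CI := IH (CkS Cf).
by apply: CkN => //; apply: CkM; [|exact: CkM|exact: Hf].
Qed.

Lemma Ck_sqrt k U f : open U -> (forall x, U x -> 0 < f x) ->
  Ck k U f -> Ck k U (fun x => Num.sqrt (f x)).
Proof.
move=> oU f0; elim: k => [|k IH].
  move=> Hf x Ux; apply: (@continuous_comp _ _ _ f (@Num.sqrt R)); first exact: Hf.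
  exact: sqrt_continuous.
move=> Cf; have [df Hf] := Cf.
have ds x : U x -> differentiable (@Num.sqrt R) (f x).
  by move=> Ux; have [/derivable1_diffP] := is_derive1_sqrt (f0 _ Ux).
split=> [x Ux|v].
  by apply: (@differentiable_comp _ _ _ _ f (@Num.sqrt R)); [exact: df|exact: ds].
apply: (@Ck_eq _ _ _ _ (fun x => (2 * Num.sqrt (f x))^-1 * 'd f x v)) => //.
  move=> x Ux; have [dsx Esx] := is_derive1_sqrt (f0 _ Ux).
  have E := congr1 (@^~ v) (diff_comp (df _ Ux) (ds _ Ux)).
  by apply: esym; apply: etrans E _; rewrite /= deriv1E// derive1E Esx; exact: mulrC.
have f2 x : U x -> 2 * Num.sqrt (f x) != 0.
  by move=> Ux; rewrite mulf_eq0 pnatr_eq0/= sqrtr_eq0 -ltNge f0.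
apply: CkM; [exact: oU| |exact: Hf].
apply: CkV; [exact: oU|exact: f2|].
by apply: CkM; [exact: oU|exact: Ck_cst|exact/IH/CkS].
Qed.

(** The composition with a function of one variable is enough: all
    functions below are built from such compositions by algebra. *)
Lemma Ck_comp1 k U (D : set R) (phi : R -> R) f : open U -> open D ->
  (forall x, U x -> D (f x)) -> Ck k D phi -> Ck k U f -> Ck k U (fun x => phi (f x)).
Proof.
move=> oU oD UD; elim: k phi => [|k IH] phi.
  by move=> Hp Hf x Ux; apply: (@continuous_comp _ _ _ f phi); [exact: Hf|exact/Hp/UD].
move=> [dp Hp] Cf; have [df Hf] := Cf; split=> [x Ux|v].
  by apply: (@differentiable_comp _ _ _ _ f phi); [exact: df|exact/dp/UD].
apply: (@Ck_eq _ _ _ _ (fun x => 'd phi (f x) 1 * 'd f x v)) => //.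
  move=> x Ux.
  have E := congr1 (@^~ v) (diff_comp (df _ Ux) (dp _ (UD _ Ux))).
  apply: esym; apply: etrans E _; rewrite /= -[in LHS](mulr1 ('d f x v)).
  by rewrite [LHS]linearZ mulrC.
apply: CkM; [exact: oU| |exact: Hf].
by apply: (IH (fun y => 'd phi y 1)); [exact: Hp|exact: CkS].
Qed.

End Scalar.

Lemma Ck_coord (V : normedModType R) k (U : set V) n (f : V -> 'rV[R]_n) j :
  open U -> Ck k U f -> Ck k U (fun x => f x 0 j : R).
Proof.
by move=> oU Cf; apply: (@Ck_lincomp _ _ _ k U (@coordf R n j)) => //;
  exact: rV_linear_continuous.
Qed.

Lemma coord_Ck (V : normedModType R) k (U : set V) n (f : V -> 'rV[R]_n) :
  open U -> (forall j, Ck k U (fun x => f x 0 j : R)) -> Ck k U f.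
Proof.
move=> oU H.
apply: (@Ck_eq _ _ _ _ (fun x => \sum_j f x 0 j *: delta_mx 0 j)) => //.
  by move=> x _; rewrite -row_sum_delta.
suff S (r : seq 'I_n) : Ck k U (fun x => \sum_(j <- r) (f x 0 j *: delta_mx 0 j : 'rV[R]_n)).
  exact: S.
elim: r => [|j r IH].
  by apply: (@Ck_eq _ _ _ _ (fun=> 0)) => [//|x _|]; [rewrite big_nil|exact: Ck_cst].
apply: (@Ck_eq _ _ _ _ (fun x => f x 0 j *: delta_mx 0 j +
   \sum_(j <- r) (f x 0 j *: delta_mx 0 j : 'rV[R]_n))) => //.
  by move=> x _; rewrite big_cons.
apply: CkD => //.
have lin : linear (fun h : R => h *: (delta_mx 0 j : 'rV[R]_n)).
  by move=> ? ? ?; rewrite scalerDl scalerA.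
pose M := GRing.isLinear.Build _ _ _ _ _ lin.
pose L : {linear R -> 'rV[R]_n} := HB.pack (fun h : R => h *: (delta_mx 0 j : 'rV[R]_n)) M.
apply: (@Ck_lincomp _ _ _ k U L) => //; exact: scalel_continuous.
Qed.

Definition smooth (W : normedModType R) (f : R -> W) := forall k, Ck k setT f.

Lemma smoothP (W : normedModType R) (f : R -> W) :
  (forall n s, derivable (derive1n n f) s 1) -> smooth f.
Proof.
move=> H k; elim: k f H => [|k IH] f H.
  by move=> x _; apply/differentiable_continuous/derivable1_diffP; exact: (H 0%N).
have df x : derivable f x 1 by exact: (H 0%N).
split=> [x _|v]; first exact/derivable1_diffP.
have -> : (fun x => 'd f x v) = fun x => v *: derive1 f x.
  by apply/funext => x; rewrite deriv1E.
have lin : linear (fun w : W => v *: w).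
  by move=> k' ? ?; rewrite scalerDr !scalerA mulrC.
pose M := GRing.isLinear.Build _ _ _ _ _ lin.
pose L : {linear W -> W} := HB.pack (fun w : W => v *: w) M.
apply: (@Ck_lincomp _ _ _ k setT L); first exact: openT.
  exact: scaler_continuous.
by apply: IH => n s; have := H n.+1 s; rewrite derive1Sn.
Qed.

Lemma smooth_derivable (W : normedModType R) (f : R -> W) s : smooth f -> derivable f s 1.
Proof. by move=> /(_ 1%N)[df _]; apply/derivable1_diffP; exact: df. Qed.

Lemma smooth_derive1 (W : normedModType R) (f : R -> W) : smooth f -> smooth (derive1 f).
Proof.
move=> Cf k; have [df /(_ 1) H] := Cf k.+1.
have -> : derive1 f = fun x => 'd f x 1; last exact: H.
by apply/funext => x; rewrite derive1E'//; exact: df.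
Qed.

Lemma smooth_continuous (W : normedModType R) (f : R -> W) : smooth f -> continuous f.
Proof. by move=> /(_ 0%N) H x; exact: H. Qed.

Lemma smooth_is_derive (W : normedModType R) (f : R -> W) (s : R) :
  smooth f -> is_derive s 1 f (derive1 f s).
Proof. by move=> Cf; rewrite derive1E; apply: DeriveDef => //; exact: smooth_derivable. Qed.

End ClassCk.

(** * Injective differentials and symmetry of second derivatives *)

(** * Inverting and differentiating along charts *)

Section LinearInverse.
Variable R : realType.

Lemma linear_left_inverse m n (L : {linear 'rV[R]_m -> 'rV[R]_n}) :
  injective L ->
  exists A : {linear 'rV[R]_n -> 'rV[R]_m}, forall x, A (L x) = x.
Proof.
move=> injL; pose M := lin1_mx L.
have fM : row_free M.
  rewrite -kermx_eq0; apply/rowV0P => v /sub_kermxP; rewrite mul_rV_lin1 => Lv.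
  by apply: injL; rewrite linear0.
have lin : linear (fun y : 'rV[R]_n => y *m pinvmx M).
  by move=> k u v; rewrite mulmxDl scalemxAl.
pose B := GRing.isLinear.Build _ _ _ _ _ lin.
pose A : {linear 'rV[R]_n -> 'rV[R]_m} := HB.pack (fun y : 'rV[R]_n => y *m pinvmx M) B.
exists A => x; rewrite /A /= -mul_rV_lin1; exact: mulmxKp.
Qed.

(** An immersion is locally bi-Lipschitz: this replaces the inverse
    function theorem throughout. *)
Lemma strict_diff_lower m n (f : 'rV[R]_m -> 'rV[R]_n) x :
  (\forall y \near x, differentiable f y) ->
  (forall v, {for x, continuous (fun y => 'd f y v)}) ->
  injective ('d f x) ->
  exists K d : R, [/\ 0 < K, 0 < d & forall y z, `|y - x| < d -> `|z - x| < d ->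
     `|y - z| <= K * `|f y - f z|].
Proof.
move=> nf cf /linear_left_inverse[A AK].
have [k k0 Ak] := linear_lipschitz (@rV_linear_continuous R _ _ A).
have e0 : 0 < (2 * k)^-1 by rewrite invr_gt0 mulr_gt0.
have [d d0 H] := strict_diff nf cf e0.
exists (2 * k), d; split => [||y z yd zd]//; first by rewrite mulr_gt0.
have h1 := H y z yd zd.
have h2 : `|y - z| <= k * `|'d f x (y - z)| by rewrite -{1}(AK (y - z)).
have h3 : `|'d f x (y - z)| <= `|f y - f z| + (2 * k)^-1 * `|y - z|.
  rewrite -lerBlDl (le_trans _ h1)// (le_trans (lerB_dist _ _))//.
  by rewrite distrC.
have : k * `|'d f x (y - z)| <= k * `|f y - f z| + 2^-1 * `|y - z|.
  have -> : 2^-1 = k * (2 * k)^-1 by rewrite invfM mulrCA divff ?mulr1 ?gt_eqF.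
  by rewrite -mulrA -mulrDr ler_pM2l.
lra.
Qed.

End LinearInverse.

Section Schwarz.
Variable R : realType.

Lemma second_difference (V : normedModType R) (f : V -> R) x (a b : V) :
  (\forall y \near x, differentiable f y) ->
  differentiable (fun y => 'd f y a) x ->
  forall e : R, 0 < e -> exists2 d : R, 0 < d & forall h : R, 0 < h < d ->
    `|f (x + h *: a + h *: b) - f (x + h *: a) - f (x + h *: b) + f x
      - h ^+ 2 * 'd (fun y => 'd f y a) x b| <= e * h ^+ 2.
Proof.
move=> /nbhs_deltaP[d0 d00 nf] dg e e0; set D := 'd (fun y => 'd f y a) x.
pose C := `|a| + `|b| + 1.
have C0 : 0 < C by rewrite ltr_wpDl// addr_ge0.
pose e' := e / (2 * C).
have e'0 : 0 < e' by rewrite divr_gt0// mulr_gt0.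
have [d1 d10 H] := diff_eps dg e'0.
have dm : 0 < Num.min d0 d1 by rewrite lt_min d00.
exists (Num.min d0 d1 / C); first by rewrite divr_gt0.
move=> h /andP[h0]; rewrite ltr_pdivlMr// lt_min => /andP[hd0 hd1].
have sz (t u : R) : 0 <= t <= h -> 0 <= u <= h ->
    `|x + t *: a + u *: b - x| <= h * C.
  move=> /andP[t0 th] /andP[u0 uh].
  have -> : x + t *: a + u *: b - x = t *: a + u *: b by rewrite addrAC [x + _]addrC addrK.
  rewrite (le_trans (ler_normD _ _))// !normrZ !ger0_norm//.
  have : t * `|a| <= h * `|a| by rewrite ler_wpM2r.
  have : u * `|b| <= h * `|b| by rewrite ler_wpM2r.
  rewrite /C !mulrDr; lra.
have h00 : (0 : R) <= 0 <= h by apply/andP; split=> //; exact: ltW.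
have hh : 0 <= h <= h by apply/andP; split=> //; exact: ltW.
pose phi (t : R) : R := f (x + t *: a + h *: b) - f (x + t *: a + 0 *: b).
pose dphi (t : R) : R := 'd f (x + t *: a + h *: b) a - 'd f (x + t *: a + 0 *: b) a.
have line (u t : R) : is_derive t 1 (fun s : R => x + s *: a + u *: b) a.
  have -> : (fun s : R => x + s *: a + u *: b) = (fun s => (x + u *: b) + s *: a).
    by apply/funext => s; rewrite addrAC.
  exact: is_derive_line.
have Dphi (t : R) : t \in `[0, h]%R -> is_derive t 1 phi (dphi t).
  rewrite in_itv/= => th; apply: is_deriveB.
    apply: (is_derive_diff_comp (line h t)); apply: nf.
    by rewrite (le_lt_trans (sz _ _ th hh)).
  apply: (is_derive_diff_comp (line 0 t)); apply: nf.
  by rewrite (le_lt_trans (sz _ _ th h00)).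
have cphi : {within `[(0 : R), h], continuous phi}.
  by apply: derivable_within_continuous => t /Dphi[].
have Doo (t : R) : t \in `]0, h[%R -> is_derive t 1 phi (dphi t).
  by move=> t01; apply: Dphi; apply: subset_itv_oo_cc.
have [t t0h] := MVT_segment (ltW h0) Doo cphi.
move: t0h; rewrite in_itv/= => th.
have -> : phi h - phi 0 =
    f (x + h *: a + h *: b) - f (x + h *: a) - f (x + h *: b) + f x.
  by rewrite /phi !scale0r !addr0; ring.
move=> ->; rewrite subr0.
have -> : dphi t * h - h ^+ 2 * D b = h * (dphi t - h * D b) by ring.
rewrite normrM gtr0_norm// expr2 mulrCA ler_pM2l//.
have E1 := H (x + t *: a + h *: b) (le_lt_trans (sz _ _ th hh) hd1).
have E2 := H (x + t *: a + 0 *: b) (le_lt_trans (sz _ _ th h00) hd1).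
have L1 := le_trans E1 (ler_wpM2l (ltW e'0) (sz _ _ th hh)).
have L2 := le_trans E2 (ler_wpM2l (ltW e'0) (sz _ _ th h00)).
rewrite -/D in L1 L2.
have DD : D (x + t *: a + h *: b - x) - D (x + t *: a + 0 *: b - x) = h * D b.
  rewrite -linearB -[RHS]/(h *: D b) -linearZ; congr (D _).
  by rewrite scale0r addr0 opprB addrA subrK [x + _ + _]addrC addrK.
have -> : dphi t - h * D b =
   ('d f (x + t *: a + h *: b) a - 'd f x a - D (x + t *: a + h *: b - x)) -
   ('d f (x + t *: a + 0 *: b) a - 'd f x a - D (x + t *: a + 0 *: b - x)).
  by rewrite -DD /dphi; ring.
rewrite (le_trans (ler_normB _ _))// (le_trans (lerD L1 L2))//.
have -> : e' * (h * C) + e' * (h * C) = e * h; last by [].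
by rewrite /e'; field; rewrite gt_eqF.
Qed.

(** Both mixed derivatives are the limit of the same symmetric second
    difference quotient. *)
Lemma diff2_sym (V : normedModType R) (f : V -> R) x (a b : V) :
  (\forall y \near x, differentiable f y) ->
  differentiable (fun y => 'd f y a) x -> differentiable (fun y => 'd f y b) x ->
  'd (fun y => 'd f y a) x b = 'd (fun y => 'd f y b) x a.
Proof.
move=> nf da db; apply/eqP; rewrite -subr_eq0 -normr_le0; apply/ler_addgt0Pr => e e0.
rewrite add0r.
have e2 : 0 < e / 2 by rewrite divr_gt0.
have [d1 d10 H1] := second_difference b nf da e2.
have [d2 d20 H2] := second_difference a nf db e2.
pose h := Num.min d1 d2 / 2.
have m0 : 0 < Num.min d1 d2 by rewrite lt_min d10.
have h0 : 0 < h by rewrite divr_gt0.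
have hm : h < Num.min d1 d2 by rewrite ltr_pdivrMr// ltr_pMr// ltr1n.
move: hm; rewrite lt_min => /andP[hd1 hd2].
have := H1 h; rewrite h0 hd1 => /(_ isT).
have := H2 h; rewrite h0 hd2 => /(_ isT).
rewrite [x + h *: b + h *: a]addrAC.
set Da := 'd _ x b; set Db := 'd _ x a.
set A := f _; set B := f (x + h *: b); set C := f (x + h *: a); set F := f x.
move=> h2 h1.
have : h ^+ 2 * `|Da - Db| <= h ^+ 2 * e.
  rewrite -{1}(ger0_norm (sqr_ge0 h)) -normrM.
  have -> : h ^+ 2 * (Da - Db) = (A - B - C + F - h ^+ 2 * Db) - (A - C - B + F - h ^+ 2 * Da) by ring.
  by rewrite (le_trans (ler_normB _ _))// (le_trans (lerD h2 h1))// -mulrDl -splitr mulrC.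
by rewrite ler_pM2l// exprn_gt0.
Qed.

End Schwarz.

Section Charts.
Variables (R : realType) (r : nat).

Lemma within_eps (V W : normedModType R) (A : set V) (f : V -> W) x :
  {within A, continuous f} -> A x -> forall e : R, 0 < e ->
  exists2 d : R, 0 < d & forall y, A y -> `|y - x| < d -> `|f y - f x| < e.
Proof.
move=> /subspace_continuousP/(_ x) H Ax e e0.
have /cvgrPdistC_lt/(_ _ e0) := H Ax.
rewrite near_withinE => /nbhs_deltaP[d d0 Hd].
by exists d => // y Ay yd; exact: Hd.
Qed.

Lemma open_delta (V : normedModType R) (U : set V) x : open U -> U x ->
  exists2 d : R, 0 < d & forall y, `|y - x| < d -> U y.
Proof. by move=> oU Ux; apply/nbhs_deltaP; exact: open_nbhs_nbhs. Qed.

Lemma for_continuous_eps (V W : normedModType R) (f : V -> W) x :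
  {for x, continuous f} -> forall e : R, 0 < e ->
  exists2 d : R, 0 < d & forall y, `|y - x| < d -> `|f y - f x| < e.
Proof.
move=> fx e e0; have /cvgrPdistC_lt/(_ _ e0) := fx.
by move=> /nbhs_deltaP.
Qed.

Lemma eps_for_continuous (V W : normedModType R) (f : V -> W) x :
  (forall e : R, 0 < e -> exists2 d : R, 0 < d & forall y, `|y - x| < d -> `|f y - f x| < e) ->
  {for x, continuous f}.
Proof. by move=> H; apply/cvgrPdistC_lt => e /H/nbhs_deltaP. Qed.

Lemma chart_lower S U X (q0 : 'rV[R]_2) : (0 < r)%N -> chart r S U X -> U q0 ->
  exists K d : R, [/\ 0 < K, 0 < d & forall y z, `|y - q0| < d -> `|z - q0| < d ->
     `|y - z| <= K * `|X y - X z|].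
Proof.
move=> r0 [oU /class_CE CX injX _] Uq.
have [dX cX] := Ck_le r0 CX.
have [d d0 Hd] := open_delta oU Uq.
apply: strict_diff_lower; last exact: injX.
  by apply/nbhs_deltaP; exists d => // y /Hd; exact: dX.
by move=> v; exact: cX.
Qed.

(** The inverse of a chart is Lipschitz by [chart_lower], and the limit of
    its difference quotients is found with a left inverse of the
    differential. *)
Lemma chart_lift S U X (q0 : 'rV[R]_2) (g : R -> 'rV[R]_3) (t0 : R) (v : 'rV[R]_3) :
  (0 < r)%N -> chart r S U X -> U q0 -> g t0 = X q0 ->
  (\forall t \near t0, S (g t)) -> is_derive t0 1 g v ->
  exists (p : R -> 'rV[R]_2) (a : 'rV[R]_2),
    [/\ is_derive t0 1 p a, p t0 = q0, 'd X q0 a = v,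
        \forall t \near t0, U (p t) & \forall t \near t0, X (p t) = g t].
Proof.
move=> r0 chX Uq gq gS gv.
have [K [dK [K0 dK0 HK]]] := chart_lower r0 chX Uq.
have [oU /class_CE CX injX [V [Y [oV XUV cY YX]]]] := chX.
have [dX cX] := Ck_le r0 CX.
have cg : {for t0, continuous g}.
  by apply/differentiable_continuous/derivable1_diffP; case: gv.
have VX q : U q -> V (X q) /\ S (X q).
  by move=> Uq'; have : (V `&` S) (X q) by rewrite -XUV; exists q.
have [Vq Sq] := VX _ Uq.
pose p t := Y (g t).
have [dV dV0 HV] := open_delta oV Vq.
have near_p : \forall t \near t0, U (p t) /\ X (p t) = g t.
  have [d d0 Hd] := for_continuous_eps cg dV0.
  move: gS => /nbhs_deltaP[d' d'0 Hd'].
  apply/nbhs_deltaP; exists (Num.min d d') => [|t]; first by rewrite lt_min d0.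
  rewrite lt_min => /andP[td td'].
  have : (V `&` S) (g t).
    by split; [apply: HV; rewrite -gq; exact: Hd|exact: Hd'].
  by rewrite -XUV => -[q Uq' qt]; rewrite /p -qt YX.
have pq : p t0 = q0 by rewrite /p gq YX.
have [A AK] := linear_left_inverse (injX _ Uq).
have [k k0 Ak] := linear_lipschitz (@rV_linear_continuous R _ _ A).
have cp e : 0 < e -> exists2 d : R, 0 < d & forall t, `|t - t0| < d -> `|p t - q0| < e.
  move=> e0; have [d d0 Hd] := within_eps cY (conj Vq Sq) e0.
  have [d1 d10 Hd1] := for_continuous_eps cg d0.
  have [d2 d20 Hd2] := for_continuous_eps cg dV0.
  move: gS => /nbhs_deltaP[d' d'0 Hd'].
  exists (Num.min d1 (Num.min d2 d')) => [|t]; first by rewrite !lt_min d10 d20.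
  rewrite !lt_min => /and3P[t1 t2 t3].
  rewrite -pq /p gq; apply: Hd; last by rewrite -gq; exact: Hd1.
  by split; [apply: HV; rewrite -gq; exact: Hd2|exact: Hd'].
have dp : is_derive t0 1 p (A v).
  apply: eps_der => e e0.
  pose C := K * (`|v| + 1).
  have C0 : 0 < C by rewrite mulr_gt0// ltr_wpDl.
  pose e1 := e / (2 * k * C). pose e2 := e / (2 * k).
  have e10 : 0 < e1 by rewrite divr_gt0// !mulr_gt0.
  have e20 : 0 < e2 by rewrite divr_gt0// !mulr_gt0.
  have [gd gE] := gv.
  have [d1 d10 H1] := der_eps gd e20.
  have [d1' d1'0 H1'] := der_eps gd ltr01.
  have [d2 d20 H2] := diff_eps (dX _ Uq) e10.
  have [d3 d30 H3] := cp _ d20.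
  have [d4 d40 H4] := cp _ dK0.
  move: near_p => /nbhs_deltaP[d5 d50 H5].
  exists (Num.min d1 (Num.min d1' (Num.min d3 (Num.min d4 d5)))) => [|t].
    by rewrite !lt_min d10 d1'0 d30 d40 d50.
  rewrite !lt_min => /and5P[t1 t1' t3 t4 t5].
  have [Upt Xpt] := H5 _ t5.
  have E1 := H1 _ t1. have E1' := H1' _ t1'. rewrite derive1E gE in E1 E1'.
  have E2 := H2 _ (H3 _ t3).
  have E3 : `|p t - q0| <= K * `|g t - g t0|.
    by rewrite -Xpt gq; apply: HK; [exact: H4|rewrite subrr normr0].
  have E4 : `|g t - g t0| <= (`|v| + 1) * `|t - t0|.
    have := le_trans (lerB_dist _ _) E1'; rewrite normrZ mul1r; lra.
  have E5 : `|p t - q0| <= C * `|t - t0|.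
    by rewrite (le_trans E3)// /C -mulrA ler_wpM2l// ltW.
  have -> : p t - p t0 - (t - t0) *: A v =
     A ((g t - g t0 - (t - t0) *: v) - (X (p t) - X q0 - 'd X q0 (p t - q0))).
    rewrite Xpt gq pq; set w := g t - X q0; set u := p t - q0.
    have -> : w - (t - t0) *: v - (w - 'd X q0 u) = 'd X q0 u - (t - t0) *: v.
      by rewrite opprB addrC addrA subrK.
    by rewrite (linearB A) (linearZ_LR A) AK.
  rewrite (le_trans (Ak _))//.
  have E6 := le_trans (ler_normB _ _) (lerD E1 E2).
  rewrite (le_trans (ler_wpM2l (ltW k0) E6))//.
  have E7 : e1 * `|p t - q0| <= e1 * (C * `|t - t0|) by rewrite ler_wpM2l// ltW.
  have E8 : k * (e2 * `|t - t0| + e1 * (C * `|t - t0|)) = e * `|t - t0|.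
    by rewrite /e1 /e2; field; rewrite !gt_eqF.
  by rewrite -E8 (ler_wpM2l (ltW k0))// lerD2l.
exists p, (A v); split=> //; last 2 first.
- by move: near_p; apply: filterS => t [].
- by move: near_p; apply: filterS => t [].
have dXp : is_derive t0 1 (X \o p) ('d X q0 (A v)).
  by have := is_derive_diff_comp dp; rewrite pq; apply; exact: dX.
have : is_derive t0 1 (X \o p) v.
  apply: near_eq_is_derive gv.
  by move: near_p; apply: filterS => t [_ /= ->].
by case: dXp => _ E1 [_ E2]; rewrite -E1.
Qed.

(** A function on the surface that is differentiable in one chart is
    differentiable along every curve of the surface. *)
Lemma chart_chain (W : normedModType R) S U X (q0 : 'rV[R]_2) (g : R -> 'rV[R]_3)
    (t0 : R) (v : 'rV[R]_3) (h : 'rV[R]_3 -> W) a :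
  (0 < r)%N -> chart r S U X -> U q0 -> g t0 = X q0 ->
  (\forall t \near t0, S (g t)) -> is_derive t0 1 g v ->
  differentiable (h \o X) q0 -> 'd X q0 a = v ->
  is_derive t0 1 (h \o g) ('d (h \o X) q0 a).
Proof.
move=> r0 chX Uq gq gS gv dh av.
have [p [b [dp pq bv _ nXp]]] := chart_lift r0 chX Uq gq gS gv.
have injX : injective ('d X q0) by case: chX => _ _ /(_ _ Uq).
have -> : a = b by apply: injX; rewrite av bv.
have := is_derive_diff_comp dp; rewrite pq => /(_ _ _ dh).
apply: near_eq_is_derive; move: nXp; apply: filterS => t /= ->.
by [].
Qed.

End Charts.

(** * The unit normal in a chart *)

Section Plane.
Variable R : realType.
Implicit Types u v w x : 'rV[R]_3.

Lemma crossp0r u : crossp u 0 = 0.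
Proof. by rewrite -[in LHS](scale0r u) crosspZr scale0r. Qed.

Lemma crossp_linear_neq0 (L : {linear 'rV[R]_2 -> 'rV[R]_3}) : injective L ->
  crossp (L (delta_mx 0 0)) (L (delta_mx 0 1)) != 0.
Proof.
move=> injL; set u := L _; set v := L _; apply/eqP => uv0.
have : crossp u (crossp u v) = 0 by rewrite uv0 crossp0r.
rewrite crossp_crossp /u /v -!linearZ -linearB => E.
have : dotp u v *: delta_mx 0 0 - dotp u u *: (delta_mx 0 1 : 'rV[R]_2) = 0.
  by apply: injL; rewrite E linear0.
move=> /rowP/(_ 1); rewrite !mxE /= mulr0 mulr1 sub0r => /eqP.
rewrite oppr_eq0 dotp_eq0 /u => /eqP u0.
have : (delta_mx 0 0 : 'rV[R]_2) = 0 by apply: injL; rewrite linear0.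
by move=> /rowP/(_ 0); rewrite !mxE /= => /eqP; rewrite oner_eq0.
Qed.

Lemma unit_normal_crossp N u v : dotp N N = 1 -> dotp N u = 0 -> dotp N v = 0 ->
  crossp u v = dotp N (crossp u v) *: N.
Proof.
move=> NN Nu Nv.
have : crossp N (crossp N (crossp u v)) = 0.
  by rewrite (crossp_crossp N u v) Nu Nv !scale0r subrr crossp0r.
rewrite crossp_crossp NN scale1r => /eqP; rewrite subr_eq0 => /eqP E.
by rewrite E.
Qed.

Lemma crossp_expand u v x :
  dotp (crossp u v) (crossp u v) *: x =
  dotp (crossp x v) (crossp u v) *: u + dotp (crossp u x) (crossp u v) *: v +
  dotp x (crossp u v) *: crossp u v.
Proof. by apply: row3P; rewrite !mxE !dotpE !crosspE /=; ring. Qed.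

End Plane.

Section Surface.
Variables (R : realType) (r : nat).
Hypothesis r3 : (3 <= r)%N.
Variable S : oriented_surface R r.
Implicit Types (U : set 'rV[R]_2) (X : 'rV[R]_2 -> 'rV[R]_3).
Let N := normal S.

Let r1 : (0 < r)%N. Proof. by apply: leq_trans r3. Qed.

Lemma chart_carrier U X q : chart r (carrier S) U X -> U q -> carrier S (X q).
Proof.
move=> [_ _ _ [V [Y [_ E _ _]]]] Uq.
by have [] : (V `&` carrier S) (X q) by rewrite -E; exists q.
Qed.

Lemma chart_continuous U X q : chart r (carrier S) U X -> U q -> {for q, continuous X}.
Proof.
move=> [oU /class_CE CX _ _] Uq; have [dX _] := Ck_le r1 CX.
exact/differentiable_continuous/dX.
Qed.

Lemma chart_diff U X q : chart r (carrier S) U X -> U q -> differentiable X q.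
Proof. by move=> [oU /class_CE CX _ _] Uq; have [dX _] := Ck_le r1 CX; exact: dX. Qed.

Lemma chart_normal_eps U X q0 : chart r (carrier S) U X -> U q0 ->
  forall e : R, 0 < e ->
  exists2 d : R, 0 < d & forall q, `|q - q0| < d -> U q /\ `|N (X q) - N (X q0)| < e.
Proof.
move=> ch Uq e e0.
have [oU _ _ _] := ch.
have [d1 d10 H1] := within_eps (@normal_continuous R r S) (chart_carrier ch Uq) e0.
have [d2 d20 H2] := for_continuous_eps (chart_continuous ch Uq) d10.
have [d3 d30 H3] := open_delta oU Uq.
exists (Num.min d2 d3) => [|q]; first by rewrite lt_min d20.
rewrite lt_min => /andP[q2 q3]; split; first exact: H3.
by apply: H1; [exact: (chart_carrier ch (H3 _ q3))|exact: H2].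
Qed.

(** In a chart the normal is, up to a locally constant sign, the normalised
    cross product of the two partial derivatives. *)
Lemma normal_Ck U X q0 : chart r (carrier S) U X -> U q0 ->
  exists2 U0 : set 'rV[R]_2, [/\ open U0, U0 q0 & U0 `<=` U] & Ck r.-1 U0 (N \o X).
Proof.
move=> ch Uq; have [oU /class_CE CX injX _] := ch.
pose w q := crossp ('d X q (delta_mx 0 0)) ('d X q (delta_mx 0 1)).
have wN q : U q -> w q = dotp (N (X q)) (w q) *: N (X q).
  move=> Uq'; apply: unit_normal_crossp.
  - exact/normal_unit/(chart_carrier ch).
  - exact: (normal_orthogonal ch).
  - exact: (normal_orthogonal ch).
have w0 q : U q -> 0 < dotp (w q) (w q).
  by move=> Uq'; rewrite dotp_gt0; apply: crossp_linear_neq0; exact: injX.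
have CXv v : Ck r.-1 U (fun q => 'd X q v).
  by move: CX r1; case: (r) => [//|r'] [_ H] _; exact: H.
have Cw : Ck r.-1 U w.
  apply: coord_Ck => // j.
  have Cj v i : Ck r.-1 U (fun q => 'd X q v 0 i : R) by exact: Ck_coord.
  move: j; apply: ord3P.
  - apply: (@Ck_eq _ _ _ _ _ (fun q => 'd X q (delta_mx 0 0) 0 o1 * 'd X q (delta_mx 0 1) 0 o2
      - 'd X q (delta_mx 0 0) 0 o2 * 'd X q (delta_mx 0 1) 0 o1)) => //.
      by move=> q _; rewrite crosspE.
    by apply: CkB => //; apply: CkM.
  - apply: (@Ck_eq _ _ _ _ _ (fun q => 'd X q (delta_mx 0 0) 0 o2 * 'd X q (delta_mx 0 1) 0 o0
      - 'd X q (delta_mx 0 0) 0 o0 * 'd X q (delta_mx 0 1) 0 o2)) => //.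
      by move=> q _; rewrite crosspE.
    by apply: CkB => //; apply: CkM.
  - apply: (@Ck_eq _ _ _ _ _ (fun q => 'd X q (delta_mx 0 0) 0 o0 * 'd X q (delta_mx 0 1) 0 o1
      - 'd X q (delta_mx 0 0) 0 o1 * 'd X q (delta_mx 0 1) 0 o0)) => //.
      by move=> q _; rewrite crosspE.
    by apply: CkB => //; apply: CkM.
have Cw2 : Ck r.-1 U (fun q => dotp (w q) (w q)).
  apply: (@Ck_eq _ _ _ _ _ (fun q => w q 0 o0 * w q 0 o0 + w q 0 o1 * w q 0 o1 + w q 0 o2 * w q 0 o2)) => //.
    by move=> q _; rewrite dotpE.
  by apply: CkD => //; [apply: CkD => //|]; apply: CkM => //; exact: Ck_coord.
have Cs : Ck r.-1 U (fun q => Num.sqrt (dotp (w q) (w q))) by exact: Ck_sqrt.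
pose s q := dotp (N (X q)) (w q).
have s2 q : U q -> s q ^+ 2 = dotp (w q) (w q).
  move=> Uq'; rewrite {1}(wN q Uq') dotpZl {2}(wN q Uq') dotpZr.
  by rewrite (normal_unit (chart_carrier ch Uq')) mulr1 expr2.
have s0 q : U q -> s q != 0 by move=> Uq'; rewrite -sqrf_eq0 s2// gt_eqF// w0.
pose sg : R := Num.sg (s q0).
have sgs : \forall q \near q0, U q /\ s q = sg * Num.sqrt (dotp (w q) (w q)).
  have cs : {for q0, continuous s}.
    apply: (@continuous_dotp _ _ _ (N \o X) w).
      apply: eps_for_continuous => e e0; have [d d0 Hd] := chart_normal_eps ch Uq e0.
      by exists d => // q /Hd[].
    exact: (Ck_le (leq0n _) Cw _ Uq).
  have sq0 : 0 < `|s q0| by rewrite normr_gt0 s0.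
  have [d d0 Hd] := for_continuous_eps cs sq0.
  have [d' d'0 Hd'] := open_delta oU Uq.
  apply/nbhs_deltaP; exists (Num.min d d') => [|q]; first by rewrite lt_min d0.
  rewrite lt_min => /andP[qd /Hd' Uq']; split => //.
  rewrite -s2// sqrtr_sqr /sg.
  have hd := Hd _ qd; have /orP[p|p] : (s q0 < 0) || (0 < s q0) by rewrite -neq_lt s0.
    rewrite ltr0_sg// mulN1r; rewrite (ltr0_norm p) ltr_norml in hd.
    have {hd}/andP[_ hd] := hd.
    by rewrite ltrBlDr addNr in hd; rewrite ltr0_norm ?opprK.
  rewrite gtr0_sg// mul1r; rewrite (gtr0_norm p) ltr_norml in hd.
  have {hd}/andP[hd _] := hd.
  by rewrite ltrBrDr addNr in hd; rewrite gtr0_norm.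
move: sgs => /nbhs_deltaP[d d0 Hd].
exists (ball q0 d).
  split; [exact: ball_open|exact: ballxx|].
  by move=> q; rewrite -ball_normE /= distrC => /Hd[].
have bU : ball q0 d `<=` U by move=> q; rewrite -ball_normE /= distrC => /Hd[].
have sg0 : sg != 0 by rewrite sgr_eq0 s0.
have ob : open (ball q0 d) by exact: ball_open.
apply: (@Ck_eq _ _ _ _ _ (fun q => (sg * Num.sqrt (dotp (w q) (w q)))^-1 *: w q)) => //.
  move=> q bq; have [Uq' <-] : U q /\ s q = sg * Num.sqrt (dotp (w q) (w q)).
    by move: bq; rewrite -ball_normE /= distrC => /Hd.
  by rewrite {1}(wN _ Uq') scalerA -/(s q) mulVf ?scale1r// s0.
apply: coord_Ck => // j.
apply: (@Ck_eq _ _ _ _ _ (fun q => (sg * Num.sqrt (dotp (w q) (w q)))^-1 * w q 0 j)) => //.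
  by move=> q _; rewrite [RHS]mxE.
apply: CkM => //; last by apply: Ck_coord => //; exact: Ck_sub Cw.
apply: CkV => //.
  by move=> q /bU Uq'; rewrite mulf_neq0// sqrtr_eq0 -ltNge w0.
by apply: CkM => //; [exact: Ck_cst|exact: Ck_sub Cs].
Qed.

Lemma normal_diff U X q : chart r (carrier S) U X -> U q -> differentiable (N \o X) q.
Proof.
move=> ch Uq; have [U0 [_ U0q _] C] := normal_Ck ch Uq.
have /Ck_le : (1 <= r.-1)%N by rewrite -ltnS prednK// ltnW.
by move=> /(_ _ _ _ _ _ C)[H _]; exact: H.
Qed.

End Surface.

(** * The shape operator *)

Section QuadraticExtremum.
Variable R : realType.

(** The value at the point of the circle of slope t exceeds A by a multiple of
    2 t B + t^2 (C - A), which is positive for some small t unless B = 0. *)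
Lemma quadratic_max (A B C : R) :
  (forall x y : R, x ^+ 2 + y ^+ 2 = 1 -> x ^+ 2 * A + 2 * x * y * B + y ^+ 2 * C <= A) ->
  B = 0 /\ C <= A.
Proof.
move=> H; have CA : C <= A.
  have := H 0 1; rewrite expr0n expr1n /= add0r mulr0 !mul0r mul1r !add0r.
  exact.
have Q x : 2 * x * B <= x ^+ 2 * (A - C).
  pose s := Num.sqrt (1 + x ^+ 2).
  have p0 : 0 < 1 + x ^+ 2 by rewrite ltr_pwDl// sqr_ge0.
  have s2 : s ^+ 2 = 1 + x ^+ 2 by rewrite sqr_sqrtr// ltW.
  have s0 : s != 0 by rewrite sqrtr_eq0 -ltNge.
  have /H : (s^-1) ^+ 2 + (x / s) ^+ 2 = 1.
    by rewrite exprVn exprMn exprVn s2; field; rewrite gt_eqF.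
  have -> : s^-1 ^+ 2 * A + 2 * s^-1 * (x / s) * B + (x / s) ^+ 2 * C =
    (A + 2 * x * B + x ^+ 2 * C) / s ^+ 2 by field.
  rewrite s2 ler_pdivrMr//; lra.
split=> //; have D0 : 0 <= A - C by rewrite subr_ge0.
have p1 : 0 < A - C + 1 by rewrite ltr_wpDl.
have := Q (B / (A - C + 1)).
have -> : 2 * (B / (A - C + 1)) * B = (2 * (A - C + 1) * B ^+ 2) / (A - C + 1) ^+ 2.
  by field; rewrite gt_eqF.
have -> : (B / (A - C + 1)) ^+ 2 * (A - C) = ((A - C) * B ^+ 2) / (A - C + 1) ^+ 2.
  by field; rewrite gt_eqF.
rewrite ler_pM2r ?invr_gt0 ?exprn_gt0// => h.
apply/eqP; rewrite -sqrf_eq0; apply/eqP/le_anti; rewrite sqr_ge0 andbT.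
have : (A - C + 2) * B ^+ 2 <= 0 by move: h; lra.
by rewrite pmulr_rle0//; lra.
Qed.

End QuadraticExtremum.

Lemma is_derive_uniq (R : realType) (W : normedModType R) (f : R -> W) (t : R) (a b : W) :
  is_derive t 1 f a -> is_derive t 1 f b -> a = b.
Proof. by move=> [_ <-] [_ <-]. Qed.

Section Shape.
Variables (R : realType) (r : nat).
Hypothesis r3 : (3 <= r)%N.
Variable S : oriented_surface R r.
Implicit Types (U : set 'rV[R]_2) (X : 'rV[R]_2 -> 'rV[R]_3) (v w x : 'rV[R]_3).
Let N := normal S.

Let r1 : (0 < r)%N. Proof. by apply: leq_trans r3. Qed.

(** A relation between vectors of space, so that neither the chart nor the
    tangent plane has to be carried along. *)
Definition shape_op x v w := exists U X q a,
  [/\ chart r (carrier S) U X, U q, X q = x, 'd X q a = v & 'd (N \o X) q a = w].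

Lemma near_line U (q a : 'rV[R]_2) : open U -> U q ->
  \forall t \near (0 : R), U (q + t *: a).
Proof.
move=> oU Uq; have [d d0 Hd] := open_delta oU Uq.
have p0 : 0 < `|a| + 1 by rewrite ltr_wpDl.
apply/nbhs_deltaP; exists (d / (`|a| + 1)) => [|t]; first by rewrite divr_gt0.
rewrite subr0 ltr_pdivlMr// => h; apply: Hd; rewrite addrC addKr normrZ.
by rewrite (le_lt_trans _ h)// ler_wpM2l// lerDl.
Qed.

Lemma is_derive_normal U X (q0 : 'rV[R]_2) (g : R -> 'rV[R]_3) (t0 : R) v a :
  chart r (carrier S) U X -> U q0 -> g t0 = X q0 ->
  (\forall t \near t0, carrier S (g t)) -> is_derive t0 1 g v -> 'd X q0 a = v ->
  is_derive t0 1 (N \o g) ('d (N \o X) q0 a).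
Proof.
move=> ch Uq gq gS gv av.
exact: (chart_chain r1 ch Uq gq gS gv (normal_diff r3 ch Uq) av).
Qed.

Lemma chart_line U X q a : chart r (carrier S) U X -> U q ->
  is_derive (0 : R) 1 (fun t : R => X (q + t *: a)) ('d X q a).
Proof.
move=> ch Uq; have := is_derive_diff_comp (is_derive_line q a 0).
by rewrite scale0r addr0; apply; exact: (chart_diff r3 ch Uq).
Qed.

Lemma chart_line_normal U X q a : chart r (carrier S) U X -> U q ->
  is_derive (0 : R) 1 (fun t : R => N (X (q + t *: a))) ('d (N \o X) q a).
Proof.
move=> ch Uq; have := is_derive_diff_comp (is_derive_line q a 0).
by rewrite scale0r addr0; apply; exact: (normal_diff r3 ch Uq).
Qed.

(** Independence of the chart: lift a line of one chart to the other
    one. *)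
Lemma shape_chart x v w U X q a : shape_op x v w ->
  chart r (carrier S) U X -> U q -> X q = x -> 'd X q a = v ->
  'd (N \o X) q a = w.
Proof.
move=> [U' [X' [q' [a' [ch' Uq' <- <- <-]]]]] ch Uq xE vE.
pose g (t : R) := X' (q' + t *: a').
have oU' : open U' by case: ch'.
have gE : g 0 = X q by rewrite /g scale0r addr0 xE.
have gS : \forall t \near (0 : R), carrier S (g t).
  by apply: filterS (near_line a' oU' Uq') => t; exact: chart_carrier.
exact: (is_derive_uniq (is_derive_normal ch Uq gE gS (chart_line a' ch' Uq') vE)
  (chart_line_normal a' ch' Uq')).
Qed.

Lemma shape_curve x v w (g : R -> 'rV[R]_3) (t0 : R) : shape_op x v w -> g t0 = x ->
  (\forall t \near t0, carrier S (g t)) -> is_derive t0 1 g v ->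
  is_derive t0 1 (N \o g) w.
Proof.
move=> [U [X [q [a [ch Uq <- av <-]]]]] gx gS gv; exact: (is_derive_normal ch Uq gx gS gv).
Qed.

Lemma tangent_lift U X q v : chart r (carrier S) U X -> U q ->
  dotp (N (X q)) v = 0 -> exists a, 'd X q a = v.
Proof.
move=> ch Uq Nv; have injX : injective ('d X q) by case: ch => _ _ /(_ _ Uq).
set u1 := 'd X q (delta_mx 0 0); set u2 := 'd X q (delta_mx 0 1).
have w0 : dotp (crossp u1 u2) (crossp u1 u2) != 0.
  by rewrite dotp_eq0; exact: crossp_linear_neq0.
have Ew : crossp u1 u2 = dotp (N (X q)) (crossp u1 u2) *: N (X q).
  apply: unit_normal_crossp; [exact/normal_unit/(chart_carrier ch)| |];
    exact: (normal_orthogonal ch).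
have vw : dotp v (crossp u1 u2) = 0 by rewrite Ew dotpZr (dotpC v) Nv mulr0.
have := crossp_expand u1 u2 v; rewrite vw scale0r addr0 => E.
pose k := (dotp (crossp u1 u2) (crossp u1 u2))^-1.
exists (k *: (dotp (crossp v u2) (crossp u1 u2) *: delta_mx 0 0 +
  dotp (crossp u1 v) (crossp u1 u2) *: delta_mx 0 1)).
rewrite (linearZ_LR ('d X q)) linearD !(linearZ_LR ('d X q)) -/u1 -/u2 -E.
by rewrite /= scalerA mulVf ?scale1r.
Qed.

Lemma chart_partial_diff U X q a : chart r (carrier S) U X -> U q ->
  differentiable (fun p => 'd X p a) q.
Proof.
move=> [oU /class_CE CX _ _] Uq.
have /Ck_le/(_ CX) : (2 <= r)%N by exact: leq_trans r3.
by case=> _ /(_ a) [H _]; exact: H.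
Qed.

Lemma chart_second_sym U X q a b : chart r (carrier S) U X -> U q ->
  'd (fun p => 'd X p a) q b = 'd (fun p => 'd X p b) q a.
Proof.
move=> ch Uq; have oU : open U by case: ch.
apply/rowP => j; pose f p : R := X p 0 j.
have cj : continuous (@coordf R 3 j) by exact: rV_linear_continuous.
have df p : U p -> differentiable f p.
  move=> Up; apply: (@differentiable_comp _ _ _ _ X (@coordf R 3 j)).
    exact: (chart_diff r3 ch Up).
  exact: linear_differentiable.
have fX p c : U p -> 'd f p c = 'd X p c 0 j.
  move=> Up; have E := diff_comp (chart_diff r3 ch Up) (linear_differentiable (X p) cj).
  by have := congr1 (@^~ c) E; rewrite /= diff_lin.
have nU : \forall p \near q, U p by exact: open_nbhs_nbhs.
have dfX c : differentiable (fun p => 'd X p c 0 j : R) q /\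
    forall b', 'd (fun p => 'd X p c 0 j : R) q b' = 'd (fun p => 'd X p c) q b' 0 j.
  have dc := chart_partial_diff c ch Uq.
  split=> [|b'].
    apply: (@differentiable_comp _ _ _ _ (fun p => 'd X p c) (@coordf R 3 j)) => //.
    exact: linear_differentiable.
  have E := diff_comp dc (linear_differentiable ('d X q c) cj).
  by have := congr1 (@^~ b') E; rewrite /= diff_lin.
have dff c : differentiable (fun p => 'd f p c) q /\
    forall b', 'd (fun p => 'd f p c) q b' = 'd (fun p => 'd X p c) q b' 0 j.
  have [d1 E1] := dfX c.
  have [|d2 E2] := @near_eq_diff R _ _ _ (fun p => 'd f p c) q _ d1.
    by apply: filterS nU => p Up; rewrite fX.
  by split=> // b'; exact: etrans (congr1 (@^~ b') E2) (E1 b').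
have [da Ea] := dff a; have [db Eb] := dff b.
rewrite -Ea -Eb; apply: diff2_sym => //.
by apply: filterS nU.
Qed.

Lemma is_derive_zero (f : R -> R) (l k : R) :
  (\forall t \near (0 : R), f t = k) -> is_derive (0 : R) 1 f l -> l = 0.
Proof.
move=> H fl; have H' : \forall t \near (0 : R), cst k t = f t by apply: filterS H => t ->.
exact: (is_derive_uniq fl (near_eq_is_derive H' (is_derive_cst k (0 : R) 1))).
Qed.

(** Differentiating N . X_b = 0 in the direction a. *)
Lemma form2E U X q a b : chart r (carrier S) U X -> U q ->
  dotp ('d (N \o X) q a) ('d X q b) = - dotp (N (X q)) ('d (fun p => 'd X p b) q a).
Proof.
move=> ch Uq; have oU : open U by case: ch.
apply/eqP; rewrite -addr_eq0; apply/eqP.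
apply: (@is_derive_zero (fun t => dotp (N (X (q + t *: a))) ('d X (q + t *: a) b)) _ 0).
  apply: filterS (near_line a oU Uq) => t Ut; exact: (normal_orthogonal ch).
have := is_derive_diff_comp (is_derive_line q a 0).
rewrite scale0r addr0 => /(_ _ _ (chart_partial_diff b ch Uq)) H.
have := is_derive_dotp (chart_line_normal a ch Uq) H.
by rewrite /= scale0r addr0.
Qed.

Lemma form2_sym U X q a b : chart r (carrier S) U X -> U q ->
  dotp ('d (N \o X) q a) ('d X q b) = dotp ('d (N \o X) q b) ('d X q a).
Proof.
move=> ch Uq; apply: etrans (form2E a b ch Uq) _.
apply: etrans _ (esym (form2E b a ch Uq)).
by congr (- dotp _ _); exact: (chart_second_sym b a ch Uq).
Qed.

Lemma dnormal_orthogonal U X q a : chart r (carrier S) U X -> U q ->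
  dotp ('d (N \o X) q a) (N (X q)) = 0.
Proof.
move=> ch Uq; have oU : open U by case: ch.
have /eqP : 2 * dotp ('d (N \o X) q a) (N (X q)) = 0.
  apply: (@is_derive_zero (fun t => dotp (N (X (q + t *: a))) (N (X (q + t *: a)))) _ 1).
    apply: filterS (near_line a oU Uq) => t Ut; exact/normal_unit/(chart_carrier ch).
  have H := chart_line_normal a ch Uq.
  have := is_derive_dotp H H; rewrite /= scale0r addr0.
  have -> (x y : 'rV[R]_3) : 2 * dotp x y = dotp x y + dotp y x.
    by rewrite (dotpC y) mulr_natl.
  exact.
by rewrite mulf_eq0 pnatr_eq0 /= => /eqP.
Qed.

End Shape.

(** * Principal frames *)

Section PrincipalFrame.
Variable R : realType.

Lemma linear2 (V W : lmodType R) (L : {linear V -> W}) (k l : R) a b :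
  L (k *: a + l *: b) = k *: L a + l *: L b.
Proof. by rewrite linearD !linearZ. Qed.

(** The pure linear algebra of principal directions: LX stands for the
    differential of a chart and LN for that of the normal.  Extremality of the
    quadratic form at LX a kills its mixed term by [quadratic_max], so LX a is
    an eigenvector and its orthogonal complement in the plane is one too. *)
Lemma extremal_frame (max : bool) (LX LN : {linear 'rV[R]_2 -> 'rV[R]_3})
    (n : 'rV[R]_3) (a : 'rV[R]_2) :
  injective LX -> dotp n n = 1 -> (forall c, dotp n (LX c) = 0) ->
  (forall w, dotp n w = 0 -> exists c, LX c = w) ->
  (forall c, dotp (LN c) n = 0) ->
  (forall c d, dotp (LN c) (LX d) = dotp (LN d) (LX c)) ->
  dotp (LX a) (LX a) = 1 ->
  let nc : set R := [set dotp (- LN c) (LX c) | c in [set c | dotp (LX c) (LX c) = 1]] in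
  inf nc <> sup nc ->
  dotp (- LN a) (LX a) = (if max then sup nc else inf nc) ->
  exists b (k k2 : R), [/\ LX b = crossp n (LX a), LN a = - k *: LX a,
     LN b = - k2 *: LX b & if max then k2 < k else k < k2].
Proof.
move=> injX nn nX liftX nN sym; set v := LX a => vv nc numb f2.
have on := orthonormal3_crossp nn vv (nX a).
set u := crossp n v in on *.
have [b bu] : exists b, LX b = u by apply: liftX; case: on.
have av : LX a = v by [].

pose A := - dotp (LN a) v; pose B := - dotp (LN a) u; pose C := - dotp (LN b) u.
have Bs : dotp (LN b) v = - B by rewrite /B opprK -bu; exact: sym.
have A' : dotp (LN a) v = - A by rewrite /A opprK.
have B' : dotp (LN a) u = - B by rewrite /B opprK.
have C' : dotp (LN b) u = - C by rewrite /C opprK.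
have f2E (al be : R) : dotp (- LN (al *: a + be *: b)) (LX (al *: a + be *: b)) =
    al ^+ 2 * A + 2 * al * be * B + be ^+ 2 * C.
  rewrite !linear2 av bu !(dotpNl, dotpDl, dotpDr, dotpZl, dotpZr) Bs A' B' C'.
  by ring.
have f1E (al be : R) : dotp (LX (al *: a + be *: b)) (LX (al *: a + be *: b)) =
    al ^+ 2 + be ^+ 2.
  rewrite !linear2 av bu !(dotpDl, dotpDr, dotpZl, dotpZr) (dotpC u v).
  by case: on => _ -> -> _ _ ->; ring.
have ncP z : nc z <->
    exists al be : R, al ^+ 2 + be ^+ 2 = 1 /\ z = al ^+ 2 * A + 2 * al * be * B + be ^+ 2 * C.
  split; last first.
    by move=> [al [be [ab ->]]]; exists (al *: a + be *: b) => //=; rewrite f1E.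
  move=> [c /= c1 <-].
  have : LX c = LX (dotp (LX c) v *: a + dotp (LX c) u *: b).
    rewrite linear2 av bu {1}(orthonormal3_expand (LX c) on).
    by rewrite (dotpC _ n) nX scale0r add0r.
  move=> /injX cE; exists (dotp (LX c) v), (dotp (LX c) u).
  by split; [rewrite -f1E -cE|rewrite -f2E -cE].
have AE : dotp (- LN a) (LX a) = A by rewrite dotpNl.
have ncA : nc A by apply/ncP; exists 1, 0; split; ring.
have nsq (al be : R) : al ^+ 2 + be ^+ 2 = 1 ->
    `|al ^+ 2 * A + 2 * al * be * B + be ^+ 2 * C| <= `|A| + `|B| + `|C|.
  move=> ab; have a2 := sqr_ge0 al; have b2 := sqr_ge0 be.
  rewrite (le_trans (ler_normD _ _))// lerD//.
    rewrite (le_trans (ler_normD _ _))// lerD//.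
      by rewrite normrM ger0_norm// ler_piMl//; lra.
    rewrite normrM ler_piMl// ler_norml.
    have h1 := sqr_ge0 (al + be); have h2 := sqr_ge0 (al - be).
    by apply/andP; split; lra.
  by rewrite normrM ger0_norm// ler_piMl//; lra.
have hub : has_ubound nc.
  by exists (`|A| + `|B| + `|C|) => z /ncP[al [be [ab ->]]]; rewrite (le_trans (ler_norm _))// nsq.
have hlb : has_lbound nc.
  exists (- (`|A| + `|B| + `|C|)) => z /ncP[al [be [ab ->]]].
  by have := nsq _ _ ab; rewrite ler_norml => /andP[].
have [B0 CA] : B = 0 /\ (if max then C < A else A < C).
  have nAC : B = 0 -> C != A.
    move=> B0; apply/eqP => CA; apply: numb.
    have -> : nc = [set A].
      apply/seteqP; split=> [z /ncP[al [be [ab ->]]]|z ->] //=.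
      by rewrite B0 CA mulr0 addr0 -mulrDl ab mul1r.
    by rewrite inf1 sup1.
  rewrite AE in f2; case: (max) f2 => f2.
    have [|B0 CA] := @quadratic_max R A B C.
      move=> al be ab; rewrite [leRHS]f2; apply: ub_le_sup => //.
      by apply/ncP; exists al, be.
    by split=> //; rewrite lt_def eq_sym nAC.
  have [|B0 CA] := @quadratic_max R (- A) (- B) (- C).
    move=> al be ab.
    have : A <= al ^+ 2 * A + 2 * al * be * B + be ^+ 2 * C.
      rewrite [leLHS]f2; apply: ge_inf => //.
      by apply/ncP; exists al, be.
    by rewrite !mulrN; lra.
  have B00 : B = 0 by apply/eqP; rewrite -oppr_eq0 B0.
  by split=> //; rewrite lt_def nAC//= -lerN2.
have vec w : dotp w n = 0 -> w = dotp w v *: v + dotp w u *: u.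
  by move=> wn; rewrite {1}(orthonormal3_expand w on) wn scale0r add0r.
exists b, A, C; split=> //.
  by rewrite [LHS](vec _ (nN a)) A' B' B0 oppr0 scale0r addr0.
by rewrite [LHS](vec _ (nN b)) Bs B0 oppr0 scale0r add0r bu C'.
Qed.

Variable r : nat.
Hypothesis r3 : (3 <= r)%N.
Variable S : oriented_surface R r.
Let N := normal S.

(** The form in which the definition of principal directions is used: v is
    an eigenvector of the shape operator together with N x v, and the two
    eigenvalues are distinct and ordered by [max]. *)
Lemma principal_frame (max : bool) (x v : 'rV[R]_3) : principal_direction max S x v ->
  exists k k2 : R,
  [/\ carrier S x, dotp v v = 1, dotp (N x) v = 0, shape_op S x v (- k *: v) &
      shape_op S x (crossp (N x) v) (- k2 *: crossp (N x) v)] /\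
  (if max then k2 < k else k < k2).
Proof.
move=> [U [X [q [a [[ch Uq qx av] [numb f1 f2]]]]]].
have Sx : carrier S x by rewrite -qx; exact: chart_carrier ch Uq.
have [b [k [k2 [E1 E2 E3 E4]]]] : exists b (k k2 : R),
    [/\ 'd X q b = crossp (N (X q)) ('d X q a), 'd (N \o X) q a = - k *: 'd X q a,
     'd (N \o X) q b = - k2 *: 'd X q b & if max then k2 < k else k < k2].
  apply: extremal_frame.
  - by case: ch => _ _ /(_ _ Uq).
  - exact/normal_unit/(chart_carrier ch).
  - exact: (normal_orthogonal ch Uq).
  - by move=> w; exact: (tangent_lift ch Uq).
  - by move=> c; exact: (dnormal_orthogonal r3 c ch Uq).
  - by move=> c d; exact: (form2_sym r3 c d ch Uq).
  - exact: f1.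
  - exact: numb.
  - exact: f2.
exists k, k2; split=> //.
have Nv : dotp (N x) v = 0 by rewrite -qx -av; exact: (normal_orthogonal ch Uq).
have vv : dotp v v = 1 by rewrite -av; exact: f1.
split=> //.
  by exists U, X, q, a; split=> //; rewrite -av.
by exists U, X, q, b; split=> //; rewrite -?av -?qx// -E1.
Qed.

End PrincipalFrame.

(** * Perturbation of a principal frame *)

Section Perturbation.
Variable R : realType.
Implicit Types (u v w x : 'rV[R]_3).

Lemma unit_norm_le1 n (v : 'rV[R]_n) : dotp v v = 1 -> `|v| <= 1.
Proof.
move=> vv; have := norm_sq_le_dotp v; rewrite vv -[leRHS](expr1n _ 2).
by rewrite ler_pXn2r// nnegrE.
Qed.

Lemma dotp_le3 u v a b : `|u| <= a -> `|v| <= b -> `|dotp u v| <= 3 * a * b.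
Proof.
move=> ua vb; rewrite (le_trans (dotp_le _ _))// -!mulrA ler_pM2l//.
by rewrite ler_pM.
Qed.

Variables (X0 B0 Xq Bq : {linear 'rV[R]_2 -> 'rV[R]_3}).
Variables (N0 v0 u0 : 'rV[R]_3) (g M e : R).
Hypothesis on : orthonormal3 N0 v0 u0.
Hypothesis M1 : 1 <= M.
Hypothesis e0 : 0 <= e.
Hypothesis X0M : forall a : 'rV[R]_2, `|a| <= M * `|X0 a|.
Hypothesis B0E : forall a, B0 a = g * dotp (X0 a) u0 *: u0.
Hypothesis Xqe : forall a, `|Xq a - X0 a| <= e * `|a|.
Hypothesis Bqe : forall a, `|Bq a - B0 a| <= e * `|a|.
Hypothesis eM : e * M <= 1 / 20.

Lemma perturbed_norm a : dotp (Xq a) (Xq a) = 1 -> `|a| <= 2 * M.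
Proof.
have M0 : 0 < M by apply: lt_le_trans M1.
have eM20 := eM; have M1le := M1; have e_ge0 := e0.
move=> /unit_norm_le1 v1; have h1 := X0M a; have h2 := Xqe a.
have h3 : `|X0 a| <= 1 + e * `|a|.
  have -> : X0 a = Xq a - (Xq a - X0 a) by rewrite subKr.
  by rewrite (le_trans (ler_normB _ _))// lerD.
have h4 : M * `|X0 a| <= M + M * (e * `|a|).
  by rewrite -[X in _ <= X + _]mulr1 -mulrDr ler_pM2l.
have h5 : M * (e * `|a|) <= 1 / 20 * `|a|.
  by rewrite mulrA ler_wpM2r// mulrC.
lra.
Qed.

(** Since v0 is extremal for B0, the extremal eigenvalue k of Bq stays on the
    same side of g as 0; hence k - g is bounded away from 0, and the
    u0-component of the eigenvector, which is multiplied by k - g up to small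
    terms, must be small. *)
Lemma direction_small a0 a (k : R) (sg : R) :
  X0 a0 = v0 -> (sg = 1 \/ sg = -1) -> 0 < sg * - g ->
  dotp (Xq a) (Xq a) = 1 -> Bq a = k *: Xq a ->
  0 <= sg * (k * dotp (Xq a0) (Xq a0) - dotp (Bq a0) (Xq a0)) ->
  24 * (e * M) <= `|g| ->
  `|dotp (Xq a) u0| <= 12 * (e * M) * (1 + `|g|) / `|g|.
Proof.
have M0 : 0 < M by apply: lt_le_trans M1.
have eM20 := eM; have M1le := M1; have e_ge0 := e0.
move=> Xa0 sgE sg0 vv Bk ext eg.
have [NN v00 u00 Nv Nu vu] := on.
have v01 := unit_norm_le1 v00. have u01 := unit_norm_le1 u00.
have v1 := unit_norm_le1 vv.
have a0M : `|a0| <= M by rewrite (le_trans (X0M _))// Xa0 ler_piMr// ltW.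
have eM0 : 0 <= e * M by rewrite mulr_ge0// ltW.
have B00 : B0 a0 = 0 by rewrite B0E Xa0 vu mulr0 scale0r.
have Ba0 : `|Bq a0| <= e * M.
  by have := Bqe a0; rewrite B00 subr0 => /le_trans; apply; rewrite ler_wpM2l.
have Xa0e : `|Xq a0 - v0| <= e * M.
  by have := Xqe a0; rewrite Xa0 => /le_trans; apply; rewrite ler_wpM2l.
have t2 : `|Xq a0| <= 2.
  have -> : Xq a0 = v0 + (Xq a0 - v0) by rewrite addrC subrK.
  rewrite (le_trans (ler_normD _ _))//; lra.
have tt : 1 / 2 <= dotp (Xq a0) (Xq a0).
  have -> : Xq a0 = v0 + (Xq a0 - v0) by rewrite addrC subrK.
  have := dotp_le3 v01 Xa0e; rewrite ler_norml => /andP[h _].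
  rewrite !(dotpDl v0, dotpDr v0) v00 (dotpC _ v0).
  have := dotp_ge0 (Xq a0 - v0); lra.
have Bt : `|dotp (Bq a0) (Xq a0)| <= 6 * (e * M).
  by have := dotp_le3 Ba0 t2; lra.
have kk : - (12 * (e * M)) <= sg * k.
  have : - (6 * (e * M)) <= sg * k * dotp (Xq a0) (Xq a0).
    by move: Bt; rewrite ler_norml => /andP[]; case: sgE ext => ->; lra.
  have [p|p] := leP 0 (sg * k); first by move=> _; lra.
  have : sg * k * dotp (Xq a0) (Xq a0) <= sg * k * (1 / 2).
    by rewrite ler_nM2l.
  lra.
have gE : `|g| = sg * - g.
  case: sgE sg0 => -> ?; first by rewrite mul1r ltr0_norm//; lra.
  by rewrite mulN1r opprK gtr0_norm//; lra.
have kg : `|g| / 2 <= `|k - g|.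
  have : `|g| / 2 <= sg * (k - g) by rewrite mulrBr -[- (sg * g)]mulrN -gE; lra.
  move=> /le_trans; apply; rewrite (le_trans (ler_norm _))// normrM.
  by case: sgE => ->; rewrite ?normrN normr1 mul1r.
have aM := perturbed_norm vv.
set b := dotp (Xq a) u0; set be := dotp (X0 a) u0.
have h1 : `|b - be| <= 6 * (e * M).
  rewrite /b /be -dotpBl.
  have : `|Xq a - X0 a| <= 2 * (e * M).
    by rewrite (le_trans (Xqe _))// mulrCA ler_wpM2l.
  by move=> /dotp_le3/(_ u01); lra.
have h2 : `|k * b - g * be| <= 6 * (e * M).
  have : `|Bq a - B0 a| <= 2 * (e * M).
    by rewrite (le_trans (Bqe _))// mulrCA ler_wpM2l.
  move=> /dotp_le3/(_ u01); rewrite dotpBl Bk B0E !dotpZl u00 mulr1 -/b -/be; lra.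
have h3 : `|k - g| * `|b| <= 6 * (e * M) * (1 + `|g|).
  rewrite -normrM.
  have -> : (k - g) * b = (k * b - g * be) - g * (b - be) by ring.
  rewrite (le_trans (ler_normB _ _))// normrM mulrDr mulr1 lerD// mulrC.
  by rewrite ler_wpM2r.
have g0 : 0 < `|g| by rewrite gE.
rewrite ler_pdivlMr//.
have : `|g| / 2 * `|b| <= `|k - g| * `|b| by rewrite ler_wpM2r.
lra.
Qed.

(** The displacement x from the foot point is nearly orthogonal to v0, and on
    such vectors B0 acts as multiplication by g: w controls h, and w is nearly
    parallel to u0. *)
Lemma foot_small (h : 'rV[R]_2) (j x w : 'rV[R]_3) (sg : R) :
  (forall a : 'rV[R]_2, `|X0 a| <= M * `|a|) -> (forall a, dotp (X0 a) N0 = 0) ->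
  (sg = 1 \/ sg = -1) ->
  `|x - X0 h| <= e * `|h| -> `|w - B0 h| <= e * `|h| ->
  dotp x j = 0 -> `|j - sg *: v0| <= e ->
  18 * M * (e * M) <= 1 / 2 -> 24 * (e * M) <= `|g| -> g != 0 ->
  let K := 4 * M / `|g| in
  [/\ `|h| <= K * `|dotp w u0|, `|dotp w v0| <= 3 * e * `|h| &
      `|dotp w N0| <= 3 * e * `|h|].
Proof.
have M0 : 0 < M by apply: lt_le_trans M1.
have eM20 := eM; have M1le := M1; have e_ge0 := e0.
move=> X0le X0N sgE xe we xj je eM2 eg gn0 K.
have [NN v00 u00 Nv Nu vu] := on.
have v01 := unit_norm_le1 v00. have u01 := unit_norm_le1 u00.
have N01 := unit_norm_le1 NN.
have g0 : 0 < `|g| by rewrite normr_gt0.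
have eM0 : 0 <= e * M by rewrite mulr_ge0// ltW.
have e1 : e <= 1 / 20 by rewrite (le_trans _ eM)// ler_peMr.
have h0 : 0 <= `|h| by [].
have wE y : dotp w y = g * dotp (X0 h) u0 * dotp u0 y + dotp (w - B0 h) y.
  by rewrite -dotpZl -dotpDl -B0E addrC subrK.
have wv : `|dotp w v0| <= 3 * e * `|h|.
  by rewrite wE (dotpC u0) vu mulr0 add0r; have := dotp_le3 we v01; lra.
have wN : `|dotp w N0| <= 3 * e * `|h|.
  by rewrite wE (dotpC u0) Nu mulr0 add0r; have := dotp_le3 we N01; lra.
split=> //.
set al := dotp (X0 h) v0; set be := dotp (X0 h) u0.
have X0hE : X0 h = al *: v0 + be *: u0.
  by rewrite {1}(orthonormal3_expand (X0 h) on) X0N scale0r add0r.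
have j2 : `|j| <= 2.
  have -> : j = (j - sg *: v0) + sg *: v0 by rewrite subrK.
  rewrite (le_trans (ler_normD _ _))// normrZ.
  have -> : `|sg| = 1 by case: sgE => ->; rewrite ?normrN normr1.
  by rewrite mul1r; lra.
have alE : `|al| <= 9 * (e * M) * `|h|.
  have -> : `|al| = `|dotp (X0 h) (sg *: v0)|.
    by rewrite dotpZr normrM; case: sgE => ->; rewrite ?normrN normr1 mul1r.
  have -> : dotp (X0 h) (sg *: v0) = - dotp (X0 h) (j - sg *: v0) - dotp (x - X0 h) j.
    by rewrite dotpBl dotpBr xj; ring.
  have a1 := dotp_le3 (X0le h) je. have a2 := dotp_le3 xe j2.
  rewrite (le_trans (ler_normB _ _))// normrN.
  have : e * `|h| <= e * `|h| * M by rewrite ler_peMr// mulr_ge0.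
  lra.
have hb : `|h| <= 2 * M * `|be|.
  have X0h : `|X0 h| <= `|al| + `|be|.
    rewrite X0hE (le_trans (ler_normD _ _))// !normrZ lerD// ler_piMr//.
  have := le_trans (X0M h) (ler_wpM2l (ltW M0) X0h); rewrite mulrDr.
  have : M * `|al| <= M * (9 * (e * M) * `|h|) by rewrite ler_pM2l.
  have : 18 * M * (e * M) * `|h| <= 1 / 2 * `|h| by rewrite ler_wpM2r.
  lra.
have wu : `|g| * `|be| <= `|dotp w u0| + 3 * e * `|h|.
  rewrite -normrM; have := wE u0; rewrite u00 mulr1 -/be => E.
  have -> : g * be = dotp w u0 - dotp (w - B0 h) u0 by rewrite E addrK.
  rewrite (le_trans (ler_normB _ _))// lerD2l.
  by have := dotp_le3 we u01; lra.
rewrite /K mulrAC ler_pdivlMr// mulrC.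
have b1 : `|g| * `|h| <= `|g| * (2 * M * `|be|) by rewrite ler_pM2l.
have b2 : M * (`|g| * `|be|) <= M * (`|dotp w u0| + 3 * e * `|h|) by rewrite ler_pM2l.
have b3 : 24 * (e * M) * `|h| <= `|g| * `|h| by rewrite ler_wpM2r.
have b4 : 0 <= M * `|dotp w u0| by rewrite mulr_ge0// ltW.
lra.
Qed.

End Perturbation.

Section Assembly.
Variable R : realType.
Implicit Types (u v w x : 'rV[R]_3).

Lemma sqr_normr (x : R) : `|x| ^+ 2 = x ^+ 2.
Proof. by rewrite real_normK ?num_real. Qed.

Lemma crossp_le u v a b : `|u| <= a -> `|v| <= b -> `|crossp u v| <= 2 * a * b.
Proof.
move=> ua vb; have a0 : 0 <= a by exact: le_trans ua.
have b0 : 0 <= b by exact: le_trans vb.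
have P i j : `|u 0 i * v 0 j| <= a * b.
  by rewrite normrM ler_pM// (le_trans (coord_le_norm _ _)).
apply: norm_le_coord => [|j]; first by rewrite !mulr_ge0.
have B i j' i' k : `|u 0 i * v 0 j' - u 0 i' * v 0 k| <= 2 * a * b.
  rewrite (le_trans (ler_normB _ _))//.
  have := P i j'; have := P i' k.
  move: (`|_ * _|) (`|u 0 i * _|) => y z; lra.
by move: j; apply: ord3P; rewrite crosspE.
Qed.

Lemma dotp_sq3 N0 v0 u0 w : orthonormal3 N0 v0 u0 ->
  dotp w w = dotp w N0 ^+ 2 + dotp w v0 ^+ 2 + dotp w u0 ^+ 2.
Proof.
by move=> on; rewrite {1 2}(orthonormal3_expand w on) dotp_frame// !expr2.
Qed.

Lemma dotp_frame_expand N0 v0 u0 v w : orthonormal3 N0 v0 u0 ->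
  dotp v w = dotp v N0 * dotp w N0 + dotp v v0 * dotp w v0 + dotp v u0 * dotp w u0.
Proof.
by move=> on; rewrite {1}(orthonormal3_expand v on) {1}(orthonormal3_expand w on) dotp_frame.
Qed.

Lemma dotp_unit_le1 v w : dotp v v = 1 -> dotp w w = 1 -> `|dotp v w| <= 1.
Proof.
move=> vv ww; have := dotp_CS v w; rewrite vv ww mulr1 -sqr_normr.
by rewrite -[leRHS](expr1n _ 2) ler_pXn2r// nnegrE.
Qed.

(** The estimates at a point x of the surface close to the circle, with all
    smallness assumptions explicit.  X0 and B0 are the differentials of the
    chart and of the deviation w at a point of the circle, Xq and Bq those at
    x, Xf and Bf those at the foot point of x on the circle, z is the vector
    from the foot point to x, and jf, jx are the tangent field J at the foot
    point and at x.  As w vanishes at the foot point, [foot_small] makes w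
    comparable to h and nearly parallel to u0.  A principal direction at x is
    nearly parallel to v0 by [direction_small], hence nearly orthogonal to w,
    and its eigenvalue is O(h) because Bf kills jf.  The product of the two is
    therefore o(|w|^2). *)
Lemma deviation_bounds (X0 B0 Xq Bq Xf Bf : {linear 'rV[R]_2 -> 'rV[R]_3})
  (N0 v0 u0 Nx jx jf z w : 'rV[R]_3) (a0 af h : 'rV[R]_2) (g M M2 e eps sg : R) :
  orthonormal3 N0 v0 u0 -> u0 = crossp N0 v0 -> 1 <= M -> 0 <= M2 -> 0 <= e ->
  (forall a : 'rV[R]_2, `|a| <= M * `|X0 a|) ->
  (forall a : 'rV[R]_2, `|X0 a| <= M * `|a|) ->
  (forall a, dotp (X0 a) N0 = 0) ->
  (forall a, B0 a = g * dotp (X0 a) u0 *: u0) ->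
  (forall a : 'rV[R]_2, `|Xq a - X0 a| <= e * `|a|) ->
  (forall a : 'rV[R]_2, `|Bq a - B0 a| <= e * `|a|) ->
  (forall a : 'rV[R]_2, `|Xf a - X0 a| <= e * `|a|) ->
  (forall a : 'rV[R]_2, `|Bq a - Bf a| <= M2 * `|h| * `|a|) ->
  X0 a0 = v0 -> (sg = 1 \/ sg = -1) -> 0 < sg * - g ->
  `|z - X0 h| <= e * `|h| -> `|w - B0 h| <= e * `|h| ->
  dotp z jf = 0 -> `|jf - v0| <= e -> `|jx - v0| <= e -> `|Nx - N0| <= e ->
  Xf af = jf -> Bf af = 0 -> dotp jf jf = 1 ->
  let K := 4 * M / `|g| in
  let eta := 12 * (e * M) * (1 + `|g|) / `|g| in
  e * M <= 1 / 300 -> 18 * M * (e * M) <= 1 / 2 -> 24 * (e * M) <= `|g| ->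
  e * K * 12 <= 1 -> eta <= 1 / 8 -> 12 * M2 * M * K * (eta + 6 * (e * K)) <= eps ->
  [/\ `|z| <= 6 * M * K * `|w|,
      dotp w w <= 4 * dotp w (crossp Nx jx) ^+ 2 &
      forall a k, dotp (Xq a) (Xq a) = 1 -> Bq a = k *: Xq a -> dotp Nx (Xq a) = 0 ->
        (forall c d, dotp (Bq c) (Xq d) = dotp (Bq d) (Xq c)) ->
        0 <= sg * (k * dotp (Xq a0) (Xq a0) - dotp (Bq a0) (Xq a0)) ->
        `|k * dotp (Xq a) w| <= eps * dotp w w /\ 1 / 2 <= dotp (Xq a) jx ^+ 2].
Proof.
move=> on u0E M1 M20 e0 X0M X0le X0N B0E Xqe Bqe Xfe BqL Xa0 sgE sg0 zh wh zjf.
move=> jfe jxe Nxe Xaf Baf jfjf K eta c1 c2 c3 c4 c5 c6.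
have M0 : 0 < M by exact: lt_le_trans M1.
have g0 : 0 < `|g| by rewrite normr_gt0; apply: contraTneq sg0 => ->; rewrite oppr0 mulr0 ltxx.
have gn0 : g != 0 by rewrite -normr_gt0.
have eM0 : 0 <= e * M by rewrite mulr_ge0// ltW.
have eM20 : e * M <= 1 / 20 by lra.
have K0 : 0 < K by rewrite divr_gt0// mulr_gt0.
have [NN vv uu Nv Nu vu] := on.
have v01 := unit_norm_le1 vv. have u01 := unit_norm_le1 uu. have N01 := unit_norm_le1 NN.
have e1 : e <= 1 / 300 by rewrite (le_trans _ c1)// ler_peMr.
have [] := @foot_small R X0 B0 N0 v0 u0 g M e on M1 e0 X0M B0E eM20 h jf z w 1 X0le X0N
  (or_introl erefl) zh wh zjf _ c2 c3 gn0.
  by rewrite scale1r.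
rewrite -/K; set om := dotp w u0 => hK wv wN.
have eh : 3 * e * `|h| <= 1 / 4 * `|om|.
  have h1 : e * `|h| <= e * (K * `|om|) by rewrite ler_wpM2l.
  have h2 : e * K * 12 * `|om| <= 1 * `|om| by rewrite ler_wpM2r.
  move: h1 h2; clear; lra.
have sq1 (y b : R) : `|y| <= b -> y ^+ 2 <= b ^+ 2.
  by move=> yb; rewrite -sqr_normr ler_pXn2r// nnegrE (le_trans _ yb).
have om2 : `|om| ^+ 2 = om ^+ 2 by rewrite sqr_normr.
have ww : dotp w w <= 9 / 8 * om ^+ 2.
  rewrite (dotp_sq3 w on) -/om.
  have h1 := sq1 _ _ (le_trans wv eh); have h2 := sq1 _ _ (le_trans wN eh).
  rewrite exprMn om2 in h1 h2; move: h1 h2; clear; lra.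
have ww' : om ^+ 2 <= dotp w w.
  by rewrite (dotp_sq3 w on) -/om lerDr addr_ge0// sqr_ge0.
have w2 : `|w| <= 2 * `|om|.
  have : `|w| ^+ 2 <= (2 * `|om|) ^+ 2.
    rewrite (le_trans (norm_sq_le_dotp w))// (le_trans ww)// exprMn om2 ler_wpM2r ?sqr_ge0//; clear; lra.
  by rewrite ler_pXn2r// nnegrE ?mulr_ge0.
have j2 : `|jx| <= 2.
  have -> : jx = (jx - v0) + v0 by rewrite subrK.
  rewrite (le_trans (ler_normD _ _))//; move: jxe v01 e1; clear; lra.
have zeta : `|crossp Nx jx - u0| <= 6 * e.
  have -> : crossp Nx jx - u0 = crossp (Nx - N0) jx + crossp N0 (jx - v0).
    by rewrite u0E; apply: row3P; rewrite !mxE /=; ring.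
  have h1 := crossp_le Nxe j2; have h2 := crossp_le N01 jxe.
  rewrite (le_trans (ler_normD _ _))//; move: h1 h2; clear; lra.
split.
- have h1 : `|z| <= (M + 1) * `|h|.
    have -> : z = (z - X0 h) + X0 h by rewrite subrK.
    rewrite (le_trans (ler_normD _ _))//; have := X0le h.
    have : e * `|h| <= 1 * `|h| by rewrite ler_wpM2r//; move: e1; clear; lra.
    move: zh; clear; lra.
  have h2 : `|om| <= 3 * `|w|.
    by have := dotp_le3 (lexx `|w|) u01; rewrite -/om; clear; lra.
  have h3 : `|h| <= 3 * K * `|w|.
    by rewrite (le_trans hK)// -mulrA mulrCA ler_pM2l.
  apply: le_trans h1 _.
  have : (M + 1) * `|h| <= 2 * M * (3 * K * `|w|) by rewrite ler_pM//; move: M1 M0; clear; lra.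
  move: M0; clear; lra.
- have h1 : `|dotp w (crossp Nx jx) - om| <= 1 / 8 * `|om|.
    have -> : dotp w (crossp Nx jx) - om = dotp w (crossp Nx jx - u0) by rewrite dotpBr.
    apply: le_trans (dotp_le3 w2 zeta) _.
    have : e * `|om| <= 1 / 300 * `|om| by rewrite ler_wpM2r.
    have := normr_ge0 om; clear; lra.
  have h2 : 7 / 8 * `|om| <= `|dotp w (crossp Nx jx)|.
    have := lerB_dist om (dotp w (crossp Nx jx)); rewrite distrC; move: h1; clear; lra.
  have : (7 / 8 * `|om|) ^+ 2 <= dotp w (crossp Nx jx) ^+ 2.
    rewrite -[leRHS]sqr_normr ler_pXn2r// nnegrE// mulr_ge0//; clear; lra.
  rewrite exprMn om2; have := sqr_ge0 om; move: ww; clear; lra.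
move=> a k V1 Bk NxV sym ext.
have eta_bd := direction_small on M1 e0 X0M B0E Xqe Bqe eM20 Xa0 sgE sg0 V1 Bk ext c3.
rewrite -/eta in eta_bd.
set V := Xq a in V1 Bk NxV eta_bd *.
have Vle := unit_norm_le1 V1.
have VN : `|dotp V N0| <= 1 / 8.
  have -> : dotp V N0 = - dotp V (Nx - N0) by rewrite dotpBr (dotpC V Nx) NxV; ring.
  by rewrite normrN; have := dotp_le3 Vle Nxe; move: e1; clear; lra.
have Vv1 := dotp_unit_le1 V1 vv.
have Vv : 31 / 32 <= dotp V v0 ^+ 2.
  have := dotp_sq3 V on; rewrite V1.
  have := sq1 _ _ VN; have := sq1 _ _ (le_trans eta_bd c5); clear; lra.
have Vv2 : 9 / 10 <= `|dotp V v0|.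
  have : (9 / 10) ^+ 2 <= `|dotp V v0| ^+ 2 by rewrite sqr_normr; move: Vv; clear; lra.
  by rewrite ler_pXn2r// nnegrE//; clear; lra.
split; last first.
  have h1 : `|dotp V (jx - v0)| <= 1 / 8 by have := dotp_le3 Vle jxe; move: e1; clear; lra.
  have h2 : 3 / 4 <= `|dotp V jx|.
    have -> : dotp V jx = dotp V v0 - - dotp V (jx - v0) by rewrite dotpBr; ring.
    have := lerB_dist (dotp V v0) (- dotp V (jx - v0)); rewrite normrN; move: h1 Vv2; clear; lra.
  have : (3 / 4) ^+ 2 <= `|dotp V jx| ^+ 2 by rewrite ler_pXn2r// nnegrE//; clear; lra.
  by rewrite sqr_normr; clear; lra.
have afM : `|af| <= 2 * M.
  by apply: (perturbed_norm M1 e0 X0M Xfe eM20); rewrite Xaf.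
have t1 : `|Xq af - v0| <= 4 * (e * M) + e.
  have -> : Xq af - v0 = (Xq af - X0 af) - (Xf af - X0 af) + (jf - v0).
    by rewrite Xaf; apply/rowP => i; rewrite !mxE; ring.
  rewrite (le_trans (ler_normD _ _))// lerD// (le_trans (ler_normB _ _))//.
  have : e * `|af| <= e * (2 * M) by rewrite ler_wpM2l.
  have := Xqe af; have := Xfe af; clear; lra.
have t2 : 1 / 2 <= `|dotp V (Xq af)|.
  have h1 := dotp_le3 Vle t1.
  have -> : dotp V (Xq af) = dotp V v0 - - dotp V (Xq af - v0) by rewrite dotpBr; ring.
  have := lerB_dist (dotp V v0) (- dotp V (Xq af - v0)); rewrite normrN; move: h1 Vv2 c1 e1; clear; lra.
have kh : `|k| <= 12 * M2 * M * `|h|.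
  have h1 : `|Bq af| <= M2 * `|h| * (2 * M).
    have := BqL af; rewrite Baf subr0 => /le_trans; apply.
    by rewrite ler_wpM2l// mulr_ge0.
  have h2 : k * dotp V (Xq af) = dotp (Bq af) V by rewrite /V -sym Bk dotpZl.
  have h3 : `|k| * `|dotp V (Xq af)| <= 6 * M2 * M * `|h|.
    by rewrite -normrM h2; have := dotp_le3 h1 Vle; clear; lra.
  have h4 : `|k| * (1 / 2) <= `|k| * `|dotp V (Xq af)| by rewrite ler_wpM2l.
  move: h3 h4; clear; lra.
have Vw : `|dotp V w| <= (eta + 6 * (e * K)) * `|om|.
  rewrite (dotp_frame_expand V w on) -/om.
  have h1 : `|dotp V N0 * dotp w N0| <= 3 * e * `|h|.
    by rewrite normrM -[leRHS]mul1r ler_pM//; move: VN; clear; lra.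
  have h2 : `|dotp V v0 * dotp w v0| <= 3 * e * `|h|.
    by rewrite normrM -[leRHS]mul1r ler_pM//; lra.
  have h3 : `|dotp V u0 * om| <= eta * `|om| by rewrite normrM ler_wpM2r.
  rewrite (le_trans (ler_normD _ _))// (le_trans (lerD (ler_normD _ _) h3))//.
  have : e * `|h| <= e * (K * `|om|) by rewrite ler_wpM2l.
  move: h1 h2; clear; lra.
have eta0 : 0 <= eta by exact: le_trans eta_bd.
have kK : `|k| <= 12 * M2 * M * K * `|om|.
  rewrite (le_trans kh)// -(mulrA _ K) ler_wpM2l// !mulr_ge0// ltW//.
rewrite normrM (le_trans (ler_pM _ _ kK Vw))//.
have -> : 12 * M2 * M * K * `|om| * ((eta + 6 * (e * K)) * `|om|) =
   12 * M2 * M * K * (eta + 6 * (e * K)) * om ^+ 2 by rewrite -om2; ring.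
apply: (@le_trans _ _ (eps * om ^+ 2)); first by rewrite ler_wpM2r// sqr_ge0.
rewrite ler_wpM2l// (le_trans _ c6)// !mulr_ge0// ?addr_ge0// ?mulr_ge0// ltW//.
Qed.

End Assembly.

(** * Neighbourhoods of a circle *)

Section LocalTools.
Variable R : realType.

(** Finitely many linear smallness conditions on one number. *)
Lemma small_ex (s : seq (R * R)) : (forall p, p \in s -> 0 < p.2) ->
  exists2 e : R, 0 < e & forall p, p \in s -> e * p.1 <= p.2.
Proof.
elim: s => [|[a b] s IH] H; first by exists 1.
have [|e e0 He] := IH; first by move=> p ps; apply: H; rewrite inE ps orbT.
have b0 : 0 < b by apply: (H (a, b)); rewrite inE eqxx.
have a0 : 0 < `|a| + 1 by rewrite ltr_wpDl.
exists (Num.min e (b / (`|a| + 1))) => [|p].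
  by rewrite lt_min e0 divr_gt0.
rewrite inE => /predU1P[->|ps] /=.
  apply: (@le_trans _ _ (b / (`|a| + 1) * (`|a| + 1))); last by rewrite divfK ?gt_eqF.
  apply: (@le_trans _ _ (Num.min e (b / (`|a| + 1)) * (`|a| + 1))).
    rewrite ler_wpM2l ?le_min ?(ltW e0) ?divr_ge0 ?(ltW b0) ?(ltW a0)//.
    by rewrite (le_trans (ler_norm a))// lerDl.
  by rewrite ler_wpM2r ?(ltW a0)// ge_min lexx orbT.
have [q0|q0] := leP p.1 0.
  rewrite (@le_trans _ _ 0)//; last by apply/ltW/H; rewrite inE ps orbT.
  by rewrite mulr_ge0_le0// le_min ltW//= divr_ge0// ltW.
apply: le_trans (He p ps).
by rewrite ler_wpM2r ?(ltW q0)// ge_min lexx.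
Qed.

Lemma ord2P (P : 'I_2 -> Prop) : P 0 -> P 1 -> forall i, P i.
Proof.
move=> P0 P1 [[|[|i]] Hi] //.
- by rewrite (_ : Ordinal Hi = 0)//; exact: val_inj.
- by rewrite (_ : Ordinal Hi = 1)//; exact: val_inj.
Qed.

Lemma diff_lipschitz n (U : set 'rV[R]_2) (f : 'rV[R]_2 -> 'rV[R]_n) q0 :
  open U -> Ck 2 U f -> U q0 -> exists M d : R, [/\ 0 < M, 0 < d &
    forall q q', `|q - q0| < d -> `|q' - q0| < d ->
    forall a : 'rV[R]_2, `|'d f q a - 'd f q' a| <= M * `|q - q'| * `|a|].
Proof.
move=> oU [_ C2] Uq0; have [d0 d00 Hd0] := open_delta oU Uq0.
have P (j : 'I_2) : exists M d : R, [/\ 0 < M, 0 < d &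
    forall q q', `|q - q0| < d -> `|q' - q0| < d ->
      `|'d f q (delta_mx 0 j) - 'd f q' (delta_mx 0 j)| <= M * `|q - q'|].
  have [df cf] := C2 (delta_mx 0 j).
  have [k k0 Hk] := linear_lipschitz (@rV_linear_continuous R _ _ ('d (fun q => 'd f q (delta_mx 0 j)) q0)).
  have [||d d1 Hd] := @strict_diff R _ _ (fun q => 'd f q (delta_mx 0 j)) q0 _ _ 1 ltr01.
  - by apply/nbhs_deltaP; exists d0 => // q /Hd0; exact: df.
  - by move=> v; exact: cf.
  exists (k + 1), d; split=> //; first by rewrite addr_gt0.
  move=> q q' qd qd'; have := Hd _ _ qd qd'; rewrite mul1r => h.
  rewrite mulrDl mul1r; have h2 := Hk (q - q').
  have := ler_distD 0 ('d f q (delta_mx 0 j) - 'd f q' (delta_mx 0 j)) ('d (fun q => 'd f q (delta_mx 0 j)) q0 (q - q')).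
  move=> _; apply: (@le_trans _ _ (`|'d (fun q => 'd f q (delta_mx 0 j)) q0 (q - q')| + `|q - q'|)); last by rewrite lerD2r.
  by rewrite -lerBlDl (le_trans _ h)// lerB_dist.
have [M1 [d1 [M10 d10 H1]]] := P 0; have [M2 [d2 [M20 d20 H2]]] := P 1.
exists (2 * (M1 + M2)), (Num.min d1 d2); split; first by rewrite mulr_gt0// addr_gt0.
  by rewrite lt_min d10.
move=> q q'; rewrite !lt_min => /andP[q1 q2] /andP[q1' q2'] a.
rewrite -(mulrA 2); apply: rV_linear_dist; apply: ord2P.
  by rewrite (le_trans (H1 _ _ q1 q1'))// ler_wpM2r// lerDl ltW.
by rewrite (le_trans (H2 _ _ q2 q2'))// ler_wpM2r// lerDr ltW.
Qed.

(** Charts are open maps into the surface. *)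
Lemma chart_near r S U X (q0 : 'rV[R]_2) (d : R) : chart r S U X -> U q0 -> 0 < d ->
  exists2 e : R, 0 < e & forall x, S x -> `|x - X q0| < e ->
    exists q, [/\ U q, X q = x & `|q - q0| < d].
Proof.
move=> [oU _ _ [V [Y [oV XUV cY YX]]]] Uq d0.
have VX q : U q -> (V `&` S) (X q) by move=> Uq'; rewrite -XUV; exists q.
have [Vq Sq] := VX _ Uq.
have [d1 d10 H1] := within_eps cY (VX _ Uq) d0.
have [d2 d20 H2] := open_delta oV Vq.
exists (Num.min d1 d2) => [|x Sx]; first by rewrite lt_min d10.
rewrite lt_min => /andP[x1 x2].
have VSx : (V `&` S) x by split=> //; exact: H2.
have : (X @` U) x by rewrite XUV.
move=> [q Uq' qx]; exists q; split=> //.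
by have := H1 _ VSx x1; rewrite -qx !YX.
Qed.

End LocalTools.

Section Circle.
Variables (R : realType) (o n : 'rV[R]_3) (rho : R).
Hypothesis nn : dotp n n = 1.
Hypothesis rho0 : 0 < rho.
Implicit Types x y v : 'rV[R]_3.

Definition circle := plane o n `&` sphere o rho.

(** Unit tangent of the circle, extended by rotation to all of space. *)
Definition rotf x := rho^-1 *: crossp n (x - o).

Definition flat x := x - o - dotp (x - o) n *: n.
(** Nearest point of the circle, for points off the axis. *)
Definition foot x := o + (rho / Num.sqrt (dotp (flat x) (flat x))) *: flat x.

Lemma flat_orth x : dotp (flat x) n = 0.
Proof. by rewrite dotpBl dotpZl nn mulr1 subrr. Qed.

Lemma flat_circle x : circle x -> flat x = x - o.
Proof. by move=> [nx _]; rewrite /flat dotpC nx scale0r subr0. Qed.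

Lemma foot_circle x : 0 < dotp (flat x) (flat x) -> circle (foot x).
Proof.
move=> f0; rewrite /circle /plane /sphere /foot /=; split=> /=.
  by rewrite (addrC o) addrK dotpZr dotpC flat_orth mulr0.
rewrite (addrC o) addrK dotpZl dotpZr mulrA -expr2 expr_div_n sqr_sqrtr ?ltW//.
by rewrite divfK// gt_eqF.
Qed.

Lemma foot_id x : circle x -> foot x = x.
Proof.
move=> cx; rewrite /foot flat_circle//; case: cx => _ ->.
by rewrite sqrtr_sqr gtr0_norm// divff ?gt_eqF// scale1r addrC subrK.
Qed.

Lemma foot_orth x : dotp (x - foot x) (rotf (foot x)) = 0.
Proof.
rewrite /rotf /foot; set k := rho / _.
rewrite (addrC o) addrK crosspZr !dotpZr.
have -> : x - (k *: flat x + o) = (1 - k) *: flat x + dotp (x - o) n *: n.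
  by rewrite /flat; apply/rowP => i; rewrite !mxE; ring.
by rewrite (dotpDl ((1 - k) *: flat x)) !dotpZl !(dotpC _ (crossp n _)) dotp_crosspl dotp_crosspr !mulr0 addr0 !mulr0.
Qed.

Lemma rotf_unit x : circle x -> dotp (rotf x) (rotf x) = 1.
Proof.
move=> [nx ox]; rewrite /rotf dotpZl dotpZr dotp_crossp2 nn mul1r.
have -> : dotp n (x - o) = 0 by [].
have -> : dotp (x - o) (x - o) = rho ^+ 2 by [].
by field; rewrite gt_eqF.
Qed.

Lemma rotf_lip x y : `|rotf x - rotf y| <= 2 / rho * `|x - y|.
Proof.
have -> : rotf x - rotf y = rho^-1 *: crossp n (x - y).
  by rewrite /rotf; apply: row3P; rewrite !mxE /=; ring.
rewrite normrZ ger0_norm ?invr_ge0 ?(ltW rho0)//.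
have := crossp_le (unit_norm_le1 nn) (lexx `|x - y|); rewrite mulr1 => h.
have -> : 2 / rho * `|x - y| = rho^-1 * (2 * `|x - y|) by ring.
by apply: ler_wpM2l => //; rewrite invr_ge0 ltW.
Qed.

Lemma circle_tangent x v : circle x -> dotp v v = 1 -> dotp v n = 0 ->
  dotp v (x - o) = 0 -> v = rotf x \/ v = - rotf x.
Proof.
move=> cx vv vn vx; have [nx ox] := cx.
have on : orthonormal3 n (rho^-1 *: (x - o)) (crossp n (rho^-1 *: (x - o))).
  apply: orthonormal3_crossp => //.
    by rewrite dotpZl dotpZr (_ : dotp _ _ = rho ^+ 2)//; field; rewrite gt_eqF.
  by rewrite dotpZr nx mulr0.
have rE : crossp n (rho^-1 *: (x - o)) = rotf x by rewrite crosspZr.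
rewrite rE in on.
have vE : v = dotp v (rotf x) *: rotf x.
  by rewrite {1}(orthonormal3_expand v on) vn dotpZr vx mulr0 !scale0r !add0r.
have [k kE] : exists k, v = k *: rotf x by exists (dotp v (rotf x)).
have := vv; rewrite kE dotpZl dotpZr rotf_unit// mulr1 => /eqP.
rewrite -expr2 sqrf_eq1 => /orP[] /eqP ->; [left|right].
  by rewrite scale1r.
by rewrite scaleN1r.
Qed.

Lemma flat_continuous x : {for x, continuous flat}.
Proof.
apply: eps_for_continuous => e e0.
have p0 : 0 < 1 + 3 * `|n| * `|n| by rewrite ltr_pwDl// !mulr_ge0.
exists (e / (1 + 3 * `|n| * `|n|)) => [|y]; first by rewrite divr_gt0.
rewrite ltr_pdivlMr// => h; apply: le_lt_trans h.
have -> : flat y - flat x = (y - x) - dotp (y - x) n *: n.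
  by rewrite /flat !dotpBl; apply/rowP => i; rewrite !mxE; ring.
rewrite (le_trans (ler_normB _ _))// mulrDr mulr1 lerD2l normrZ.
apply: le_trans (ler_wpM2r (normr_ge0 n) (dotp_le _ _)) _.
by rewrite le_eqVlt; apply/orP; left; apply/eqP; ring.
Qed.

Let sq y := dotp (flat y) (flat y).

Lemma flat_sq_continuous x : {for x, continuous sq}.
Proof. by apply: (@continuous_dotp R 3 _ flat flat x); exact: flat_continuous. Qed.

Lemma foot_continuous x : circle x -> {for x, continuous foot}.
Proof.
move=> cx.
have sx : Num.sqrt (sq x) != 0.
  rewrite /sq flat_circle// (_ : dotp _ _ = rho ^+ 2); last by case: cx.
  by rewrite sqrtr_sqr gtr0_norm// gt_eqF.
have c1 : {for x, continuous (fun y => Num.sqrt (sq y))}.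
  apply: (@continuous_comp _ _ _ sq (@Num.sqrt R)); first exact: flat_sq_continuous.
  exact: sqrt_continuous.
have c2 : {for x, continuous (fun y => (Num.sqrt (sq y))^-1)} by exact: continuousV.
have c3 : {for x, continuous (fun y => rho / Num.sqrt (sq y))}.
  exact: (cvgM (cvg_cst rho) c2).
have c4 : {for x, continuous (fun y => (rho / Num.sqrt (sq y)) *: flat y)}.
  exact: (continuousZ c3 (@flat_continuous x)).
exact: (continuousD (@cst_continuous _ _ o x) c4).
Qed.

Lemma flat_pos x : circle x ->
  exists2 d : R, 0 < d & forall y, `|y - x| < d -> 0 < dotp (flat y) (flat y).
Proof.
move=> cx; have r2 : 0 < rho ^+ 2 by rewrite exprn_gt0.
have [d d0 H] := for_continuous_eps (@flat_sq_continuous x) r2.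
exists d => // y /H; rewrite ltr_norml => /andP[+ _].
rewrite {2}/sq (flat_circle cx) (_ : dotp (x - o) (x - o) = rho ^+ 2); last by case: cx.
by rewrite ltrBrDr addNr.
Qed.

End Circle.

(** * Deviation from the umbilical contact along a circle *)

Lemma pos_consts (R : realType) : [/\ 0 < 1 / 300 :> R, 0 < 1 / 2 :> R & 0 < 1 / 8 :> R].
Proof. by split; lra. Qed.

Lemma order_sign (R : realType) (max : bool) (k k2 : R) :
  (if max then k2 < k else k < k2) -> 0 < (if max then -1 else 1) * - (k - k2).
Proof. by case: max => ?; lra. Qed.

Section LocalEstimate.
Variables (R : realType) (r : nat).
Hypothesis r3 : (3 <= r)%N.
Variable S : oriented_surface R r.
Variables (o n : 'rV[R]_3) (rho kap : R) (C0 : 'rV[R]_3) (max : bool).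
Hypothesis nn : dotp n n = 1.
Hypothesis rho0 : 0 < rho.
Let N := normal S.
Let J := rotf o n rho.
Let Gam := circle o n rho.
Let w x := N x + kap *: x - C0.
Hypothesis HG : forall x, Gam x ->
  [/\ principal_direction max S x (J x), shape_op S x (J x) (- kap *: J x) & w x = 0].

(** Along the circle the deviation w vanishes, and its differential sends J
    to 0 and N x J to a nonzero multiple of itself; nearby, w therefore
    measures the distance to the circle.  The constant K does not depend on
    eps, and neither do the first two estimates. *)
Lemma local_estimate p0 : Gam p0 ->
  exists2 K : R, 0 < K & forall eps : R, 0 < eps -> exists2 d : R, 0 < d &
  forall x, carrier S x -> `|x - p0| < d ->
  [/\ (exists2 y, Gam y & `|x - y| <= K * `|w x|),
      dotp (w x) (w x) <= 4 * dotp (w x) (crossp (N x) (J x)) ^+ 2 &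
      forall v k, principal_direction max S x v -> shape_op S x v (- k *: v) ->
        `|(kap - k) * dotp v (w x)| <= eps * dotp (w x) (w x) /\
        1 / 2 <= dotp v (J x) ^+ 2].
Proof.
move=> Gp; have [pd sh wp] := HG Gp.
have [k1 [k2 [[Sp vv Nv sh1 sh2] ord]]] := principal_frame r3 pd.
have [U [X [q0 [ch Uq qx]]]] := surface_charts Sp.
have [v0 v0E] : exists v, v = J p0 by exists (J p0).
rewrite -v0E in pd sh vv Nv sh1 sh2.
rewrite -/N in Nv sh2; set N0 := N p0 in Nv sh2.
set u0 := crossp N0 v0 in sh2.
have NN : dotp N0 N0 = 1 by exact: normal_unit.
have on : orthonormal3 N0 v0 u0 by exact: orthonormal3_crossp.
have Nu : dotp N0 u0 = 0 by case: on.
have uu : dotp u0 u0 = 1 by case: on.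
have [a0 Xa0] : exists a, 'd X q0 a = v0 by apply: (tangent_lift ch Uq); rewrite qx.
have [b0 Xb0] : exists a, 'd X q0 a = u0 by apply: (tangent_lift ch Uq); rewrite qx.
have k1E : k1 = kap.
  have E1 := shape_chart r3 sh1 ch Uq qx Xa0.
  have E2 := shape_chart r3 sh ch Uq qx Xa0.
  have : dotp (- k1 *: v0) v0 = dotp (- kap *: v0) v0 by rewrite -E1 -E2.
  by rewrite !dotpZl vv !mulr1 => /oppr_inj.
have Nb0 := shape_chart r3 sh2 ch Uq qx Xb0.
have Na0 := shape_chart r3 sh ch Uq qx Xa0.
have [U0 [oU0 U0q U0U] CN] := normal_Ck r3 ch Uq.
pose W q := (N \o X) q + kap *: X q.
have r2 : (2 <= r.-1)%N by rewrite -ltnS prednK// (leq_trans _ r3).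
have CX : Ck 2 U0 X.
  apply: Ck_sub U0U _; case: ch => _ /class_CE CX _ _.
  by apply: Ck_le CX; exact: leq_trans r3.
have lin : linear (fun y : 'rV[R]_3 => kap *: y).
  by move=> c ? ?; rewrite scalerDr !scalerA mulrC.
pose LM := GRing.isLinear.Build _ _ _ _ _ lin.
pose Lk : {linear 'rV[R]_3 -> 'rV[R]_3} := HB.pack (fun y : 'rV[R]_3 => kap *: y) LM.
have CW : Ck 2 U0 W.
  apply: (CkD oU0 (Ck_le r2 CN)).
  exact: (@Ck_lincomp R _ _ _ 2 U0 Lk X oU0 (@rV_linear_continuous R _ _ Lk) CX).
have dW q a : U q -> 'd W q a = 'd (N \o X) q a + kap *: 'd X q a.
  move=> Uq'; have dN := normal_diff r3 ch Uq'; have dX := chart_diff r3 ch Uq'.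
  have E1 := congr1 (@^~ a) (diffZ kap dX).
  have E2 := congr1 (@^~ a) (diffD dN (differentiableZ kap dX)).
  by apply: etrans E2 _; congr (_ + _); exact: E1.
have [MX [dX [MX0 dX0 HX]]] := diff_lipschitz oU0 CX U0q.
have [MW [dW' [MW0 dW0 HW]]] := diff_lipschitz oU0 CW U0q.
have [dU dU0 HU] := open_delta oU0 U0q.
have [dCX pCX] := CX; have [dCW pCW] := CW.
have sX := @strict_diff R _ _ X q0.
have sW := @strict_diff R _ _ W q0.
have nX : \forall y \near q0, differentiable X y.
  by apply/nbhs_deltaP; exists dU; [exact: dU0|move=> y yd; exact: (dCX _ (HU _ yd))].
have nW : \forall y \near q0, differentiable W y.
  by apply/nbhs_deltaP; exists dU; [exact: dU0|move=> y yd; exact: (dCW _ (HU _ yd))].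
have cX v : {for q0, continuous (fun y => 'd X y v)}.
  exact: (differentiable_continuous (proj1 (pCX v) _ U0q)).
have cW v : {for q0, continuous (fun y => 'd W y v)}.
  exact: (differentiable_continuous (proj1 (pCW v) _ U0q)).
have {}sX := sX nX cX. have {}sW := sW nW cW.
have injX : injective ('d X q0) by case: ch => _ _ /(_ _ Uq).
have [A AK] := linear_left_inverse injX.
have [kA kA0 HA] := linear_lipschitz (@rV_linear_continuous R _ _ A).
have [kX kX0 HkX] := linear_lipschitz (@rV_linear_continuous R _ _ ('d X q0)).
pose M := 1 + kA + kX. pose M2 := MX + MW.
have M1 : 1 <= M by rewrite /M -addrA lerDl addr_ge0 ?(ltW kA0) ?(ltW kX0).
have M0 : 0 < M by exact: lt_le_trans M1.
have M20 : 0 < M2 by rewrite addr_gt0.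
have X0M (a : 'rV[R]_2) : `|a| <= M * `|'d X q0 a|.
  rewrite -{1}(AK a) (le_trans (HA _))// ler_wpM2r//.
  by rewrite /M addrAC lerDr addr_ge0// ltW.
have X0le (a : 'rV[R]_2) : `|'d X q0 a| <= M * `|a|.
  by rewrite (le_trans (HkX _))// ler_wpM2r// /M lerDr addr_ge0// ltW.
have X0N a : dotp ('d X q0 a) N0 = 0.
  by rewrite dotpC /N0 -qx; exact: (normal_orthogonal ch Uq).
pose g := kap - k2.
have B0E a : 'd W q0 a = g * dotp ('d X q0 a) u0 *: u0.
  have E : 'd X q0 a = dotp ('d X q0 a) v0 *: v0 + dotp ('d X q0 a) u0 *: u0.
    by rewrite {1}(orthonormal3_expand ('d X q0 a) on) X0N scale0r add0r.
  have : 'd X q0 a = 'd X q0 (dotp ('d X q0 a) v0 *: a0 + dotp ('d X q0 a) u0 *: b0).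
    by apply: etrans E _; rewrite linear2 Xa0 Xb0.
  move=> /injX aE.
  have [LW LWE] : exists LW : {linear 'rV[R]_2 -> 'rV[R]_3}, forall a, LW a = 'd W q0 a.
    by exists ('d W q0).
  have LWa0 : LW a0 = - kap *: v0 + kap *: v0.
    exact: (etrans (LWE _) (etrans (dW _ a0 Uq) (f_equal2 (fun u v => u + kap *: v) Na0 Xa0))).
  have LWb0 : LW b0 = - k2 *: u0 + kap *: u0.
    exact: (etrans (LWE _) (etrans (dW _ b0 Uq) (f_equal2 (fun u v => u + kap *: v) Nb0 Xb0))).
  have [x [y [aE' yE]]] : exists x y : R, a = x *: a0 + y *: b0 /\ y = dotp ('d X q0 a) u0.
    by exists (dotp ('d X q0 a) v0), (dotp ('d X q0 a) u0); split.
  apply: etrans (esym (LWE a)) _; rewrite -yE aE' linear2 LWa0 LWb0 /g.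
  by apply/rowP => i; rewrite !mxE; ring.
pose sg : R := if max then -1 else 1.
have sgE : sg = 1 \/ sg = -1 by rewrite /sg; case: (max); [right|left].
have sg0 : 0 < sg * - g.
  by move: ord; rewrite k1E; exact: order_sign.
have g0 : 0 < `|g|.
  by rewrite normr_gt0; apply: contraTneq sg0 => ->; rewrite oppr0 mulr0 ltxx.
pose K := 4 * M / `|g|.
have K0 : 0 < K by rewrite divr_gt0// mulr_gt0.
exists (6 * M * K); first by rewrite (mulr_gt0 _ K0)// mulr_gt0.
move=> eps eps0.
pose Ce := 12 * M * (1 + `|g|) / `|g|.
have [e e0 He] : exists2 e : R, 0 < e & forall p, p \in [:: (M, 1 / 300);
    (18 * M * M, 1 / 2); (24 * M, `|g|); (12 * K, 1); (Ce, 1 / 8);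
    (12 * M2 * M * K * (Ce + 6 * K), eps)] -> e * p.1 <= p.2.
  apply: small_ex => p; rewrite !inE.
  have [h300 h2 h8] := pos_consts R.
  move=> /predU1P[->|/predU1P[->|/predU1P[->|/predU1P[->|/predU1P[->|/eqP ->]]]]].
  - exact: h300.
  - exact: h2.
  - exact: g0.
  - exact: ltr01.
  - exact: h8.
  - exact: eps0.
have c1 : e * M <= 1 / 300 by apply: (He (_, _)); rewrite !inE eqxx.
have c2 : 18 * M * (e * M) <= 1 / 2.
  have : e * (18 * M * M) <= 1 / 2 by apply: (He (_, _)); rewrite !inE eqxx ?orbT.
  by apply: le_trans; rewrite le_eqVlt; apply/orP; left; apply/eqP; ring.
have c3 : 24 * (e * M) <= `|g|.
  have : e * (24 * M) <= `|g| by apply: (He (_, _)); rewrite !inE eqxx ?orbT.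
  by apply: le_trans; rewrite le_eqVlt; apply/orP; left; apply/eqP; ring.
have c4 : e * K * 12 <= 1.
  have : e * (12 * K) <= 1 by apply: (He (_, _)); rewrite !inE eqxx ?orbT.
  by apply: le_trans; rewrite le_eqVlt; apply/orP; left; apply/eqP; ring.
have etaE : 12 * (e * M) * (1 + `|g|) / `|g| = e * Ce by rewrite /Ce; ring.
have c5 : 12 * (e * M) * (1 + `|g|) / `|g| <= 1 / 8.
  by rewrite etaE; apply: (He (_, _)); rewrite !inE eqxx ?orbT.
have c6 : 12 * M2 * M * K * (12 * (e * M) * (1 + `|g|) / `|g| + 6 * (e * K)) <= eps.
  have : e * (12 * M2 * M * K * (Ce + 6 * K)) <= eps.
    by apply: (He (_, _)); rewrite !inE eqxx ?orbT.
  by apply: le_trans; rewrite etaE le_eqVlt; apply/orP; left; apply/eqP; ring.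
have [d1 d10 H1] := sX _ e0. have [d2 d20 H2] := sW _ e0.
have [d3 d30 H3] := chart_normal_eps r3 ch Uq e0.
pose d := Num.min (Num.min (Num.min d1 d2) (Num.min d3 dU)) (Num.min (Num.min dX dW') (e / M2)).
have d0 : 0 < d by rewrite !lt_min d10 d20 d30 dU0 dX0 dW0 divr_gt0.
have dP (q : 'rV[R]_2) : `|q - q0| < d -> [/\ `|q - q0| < d1, `|q - q0| < d2, `|q - q0| < d3, U0 q &
     `|q - q0| < dX] /\ [/\ `|q - q0| < dW' & M2 * `|q - q0| <= e].
  rewrite /d !lt_min => /andP[/andP[/andP[-> ->] /andP[-> h]] /andP[/andP[-> ->] h2]].
  by split=> //; split=> //; [exact: HU|rewrite mulrC -ler_pdivlMr// ltW].
have [e1 e10 Hn1] := chart_near ch Uq d0.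
rewrite qx in Hn1.
have er : 0 < e * rho / 2 by rewrite divr_gt0// mulr_gt0.
have em : 0 < Num.min e1 (e * rho / 2) by rewrite lt_min e10.
have [e2 e20 Hf] := for_continuous_eps (@foot_continuous R o n rho rho0 p0 Gp) em.
have [e3 e30 Hp] := flat_pos rho0 Gp.
exists (Num.min (Num.min e1 (e * rho / 2)) (Num.min e2 e3)).
  by rewrite !lt_min e10 er e20.
move=> x Sx; rewrite !lt_min => /andP[/andP[x1 xr] /andP[x2 x3]].
have [q [Uq1 qE qd]] := Hn1 x Sx x1.
have fG : Gam (foot o n rho x) by apply: foot_circle => //; exact: Hp.
have [pdf shf wf] := HG fG.
have [kf1 [kf2 [[Sf vvf Nvf _ _] _]]] := principal_frame r3 pdf.
have := Hf _ x2; rewrite (foot_id rho0 Gp) lt_min => /andP[f1 fr].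
have [qf [Uqf qfE qfd]] := Hn1 _ Sf f1.
have [[q1 q2 q3 Uq0 qX] [qW qe]] := dP _ qd.
have [[qf1 qf2 qf3 Uqf0 qfX] [qfW qfe]] := dP _ qfd.
have [d0X [d0W _]] : `|q0 - q0| < dX /\ `|q0 - q0| < dW' /\ True by rewrite subrr normr0.
have jclose y : `|y - p0| < e * rho / 2 -> `|J y - v0| <= e.
  move=> yr; rewrite v0E (le_trans (rotf_lip o nn rho0 y p0))//.
  apply: (@le_trans _ _ (2 / rho * (e * rho / 2))).
    by rewrite ler_wpM2l ?(ltW yr)// divr_ge0// ltW.
  by rewrite le_eqVlt; apply/orP; left; apply/eqP; field; rewrite gt_eqF.
have [af Xaf] : exists a, 'd X qf a = J (foot o n rho x).
  by apply: (tangent_lift ch Uqf); rewrite qfE.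
have Naf := shape_chart r3 shf ch Uqf qfE Xaf.
have Waf : 'd W qf af = 0.
  apply: etrans (dW _ af Uqf) _.
  by apply: etrans (f_equal2 (fun u v => u + kap *: v) Naf Xaf) _; rewrite scaleNr addNr.
have close (Mf df : R) (f : 'rV[R]_2 -> 'rV[R]_3) (p : 'rV[R]_2) : Mf <= M2 ->
    (forall q q' : 'rV[R]_2, `|q - q0| < df -> `|q' - q0| < df ->
      forall a : 'rV[R]_2, `|'d f q a - 'd f q' a| <= Mf * `|q - q'| * `|a|) ->
    `|p - q0| < df -> `|q0 - q0| < df -> M2 * `|p - q0| <= e ->
    forall a : 'rV[R]_2, `|'d f p a - 'd f q0 a| <= e * `|a|.
  move=> MM Hf' pd' qd' pe a; apply: le_trans (Hf' _ _ pd' qd' a) _.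
  by rewrite ler_wpM2r// (le_trans _ pe)// ler_wpM2r.
have MXM : MX <= M2 by rewrite lerDl ltW.
have MWM : MW <= M2 by rewrite lerDr ltW.
have Xqe := close _ _ _ _ MXM HX qX d0X qe.
have Bqe := close _ _ _ _ MWM HW qW d0W qe.
have Xfe := close _ _ _ _ MXM HX qfX d0X qfe.
have BqL (a : 'rV[R]_2) : `|'d W q a - 'd W qf a| <= M2 * `|q - qf| * `|a|.
  apply: le_trans (HW _ _ qW qfW a) _.
  by rewrite ler_wpM2r// ler_wpM2r.
have wE : w x = W q - W qf.
  have Wf : W qf = C0.
    by rewrite /W /= qfE; apply/eqP; rewrite -subr_eq0; apply/eqP; exact: wf.
  by rewrite Wf /W /= qE.
have wh : `|w x - 'd W q0 (q - qf)| <= e * `|q - qf| by rewrite wE; exact: H2.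
have zh : `|x - foot o n rho x - 'd X q0 (q - qf)| <= e * `|q - qf|.
  by rewrite -{1}qE -qfE; exact: H1.
have Nxe : `|N x - N0| <= e.
  by have [_ h] := H3 _ q3; rewrite /N0 -qE -qx; exact: ltW.
have jfjf : dotp (J (foot o n rho x)) (J (foot o n rho x)) = 1 by [].
have [i1 i2 i3] := deviation_bounds on erefl M1 (ltW M20) (ltW e0) X0M X0le X0N B0E Xqe Bqe Xfe BqL
  Xa0 sgE sg0 zh wh (foot_orth o n rho x) (jclose _ fr) (jclose _ xr) Nxe Xaf Waf jfjf
  c1 c2 c3 c4 c5 c6.
split; [by exists (foot o n rho x)|exact: i2|].
move=> v k pdv shv.
have [l1 [l2 [[_ vv1 Nv1 shl1 shl2] ordl]]] := principal_frame r3 pdv.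
have [a Xa] : exists a, 'd X q a = v by apply: (tangent_lift ch Uq1); rewrite qE.
have onl := orthonormal3_crossp (normal_unit Sx) vv1 Nv1.
have [b Xb] : exists a, 'd X q a = crossp (normal S x) v.
  by apply: (tangent_lift ch Uq1); rewrite qE; case: onl.
have El1 := shape_chart r3 shl1 ch Uq1 qE Xa.
have El2 := shape_chart r3 shl2 ch Uq1 qE Xb.
have Ek := shape_chart r3 shv ch Uq1 qE Xa.
have kl : k = l1.
  have := congr1 (fun y => dotp y v) (etrans (esym Ek) El1).
  by rewrite !dotpZl vv1 !mulr1 => /oppr_inj.
have Wa : 'd W q a = (kap - k) *: 'd X q a.
  apply: etrans (dW _ a Uq1) _; apply: etrans (f_equal2 (fun u v => u + kap *: v) Ek erefl) _.
  by rewrite Xa scalerBl scaleNr addrC.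
have Wb : 'd W q b = (kap - l2) *: 'd X q b.
  apply: etrans (dW _ b Uq1) _; apply: etrans (f_equal2 (fun u v => u + kap *: v) El2 erefl) _.
  by rewrite Xb scalerBl scaleNr addrC.
have V1 : dotp ('d X q a) ('d X q a) = 1 by rewrite Xa.
have NV : dotp (N x) ('d X q a) = 0 by rewrite Xa.
have sym c d' : dotp ('d W q c) ('d X q d') = dotp ('d W q d') ('d X q c).
  have Ec := dW _ c Uq1; have Ed := dW _ d' Uq1.
  apply: etrans (f_equal2 (fun u v => dotp u v) Ec erefl) _.
  apply: etrans _ (esym (f_equal2 (fun u v => dotp u v) Ed erefl)).
  have sc (k' : R) (u1 u2 : 'rV[R]_3) : dotp (k' *: u1) u2 = dotp (k' *: u2) u1.
    by rewrite !dotpZl dotpC.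
  apply: etrans (dotpDl _ _ _) _; apply: etrans _ (esym (dotpDl _ _ _)).
  exact: f_equal2 (form2_sym r3 c d' ch Uq1) (sc _ _ _).
suff ext : 0 <= sg * ((kap - k) * dotp ('d X q a0) ('d X q a0) - dotp ('d W q a0) ('d X q a0)).
  have := i3 a (kap - k) V1 Wa NV sym ext.
  by rewrite Xa.
have tE : 'd X q a0 = dotp ('d X q a0) v *: v + dotp ('d X q a0) (crossp (normal S x) v) *: crossp (normal S x) v.
  rewrite {1}(orthonormal3_expand ('d X q a0) onl).
  by rewrite (dotpC _ (normal S x)) -{1}qE (normal_orthogonal ch Uq1) scale0r add0r.
have injXq : injective ('d X q) by case: ch => _ _ /(_ _ Uq1).
have [al [be tE']] : exists al be : R, 'd X q a0 = al *: v + be *: crossp (normal S x) v.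
  by do 2 eexists; exact: tE.
have a0E : a0 = al *: a + be *: b by apply: injXq; rewrite linear2 Xa Xb; exact: tE'.
have WE : 'd W q a0 = (al * (kap - k)) *: v + (be * (kap - l2)) *: crossp (normal S x) v.
  apply: etrans (congr1 ('d W q) a0E) _.
  apply: etrans (linear2 ('d W q) al be a b) _.
  apply: etrans (f_equal2 (fun u v => al *: u + be *: v) Wa Wb) _.
  by rewrite Xa Xb !scalerA.
suff fin (T B : 'rV[R]_3) : T = al *: v + be *: crossp (normal S x) v ->
    B = (al * (kap - k)) *: v + (be * (kap - l2)) *: crossp (normal S x) v ->
    0 <= sg * ((kap - k) * dotp T T - dotp B T) by exact: fin tE' WE.
move=> -> ->; rewrite !(dotpDl, dotpDr, dotpZl, dotpZr) (dotpC (crossp _ _) v).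
case: onl => _ _ -> _ _ ->; rewrite vv1.
apply: (@le_trans _ _ (sg * - (k - l2) * be ^+ 2)).
  by rewrite mulr_ge0 ?sqr_ge0// /sg kl; apply/ltW; exact: order_sign.
by rewrite le_eqVlt; apply/orP; left; apply/eqP; ring.
Qed.

End LocalEstimate.

(** * Real induction, angles and exponential bounds on an interval *)

Section LineTools.
Variable R : realType.

(** The supremum of the initial segments on which P holds. *)
Lemma real_induction (a b : R) (P : R -> Prop) : P a ->
  (forall t, a <= t < b -> (forall s, a <= s <= t -> P s) ->
     exists2 d : R, 0 < d & forall s, t < s < t + d -> s <= b -> P s) ->
  (forall t, a < t <= b -> (forall s, a <= s < t -> P s) -> P t) ->
  forall t, a <= t <= b -> P t.
Proof.
move=> Pa right left t0 /andP[at0 t0b].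
have ab : a <= b by exact: le_trans t0b.
pose A := [set t | a <= t <= b /\ forall s, a <= s <= t -> P s].
have Aa : A a.
  split=> [|s]; [by apply/andP; split|by rewrite -eq_le => /eqP <-].
have ubA : ubound A b by move=> t [/andP[]].
have hs : has_sup A by split; [exists a|exists b].
have as0 : a <= sup A by apply: ub_le_sup => //; exists b.
have sb : sup A <= b by apply: ge_sup => //; exists a.
have Plt s : a <= s < sup A -> P s.
  move=> /andP[as1 ss]; have e0 : 0 < sup A - s by rewrite subr_gt0.
  have [t [_ Pt]] := sup_adherent e0 hs.
  by rewrite subKr => st; apply: Pt; rewrite as1 ltW.
have Ps : P (sup A).
  have [->//|ne] := eqVneq (sup A) a.
  by apply: left => //; rewrite sb lt_def ne as0.
have Ple s : a <= s <= sup A -> P s.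
  move=> /andP[as1]; rewrite le_eqVlt => /predU1P[->//|ss].
  by apply: Plt; rewrite as1.
have [sE|sne] := eqVneq (sup A) b; first by apply: Ple; rewrite at0 sE.
have slt : sup A < b by rewrite lt_def eq_sym sne sb.
have [|d d0 Hd] := right (sup A) _ Ple; first by rewrite as0.
pose t := Num.min b (sup A + d / 2).
have st : sup A < t by rewrite lt_min slt ltrDl divr_gt0.
have tb : t <= b by rewrite ge_min lexx.
have : A t.
  split=> [|s /andP[as1 s_t]]; first by rewrite tb (le_trans as0)// ltW.
  have [ss|ss] := leP s (sup A); first by apply: Ple; rewrite as1.
  apply: Hd; last exact: le_trans tb.
  rewrite ss (le_lt_trans s_t)// gt_min; apply/orP; right.
  by rewrite ltrD2l ltr_pdivrMr// ltr_pMr// ltr1n.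
move=> At; have : t <= sup A by apply: ub_le_sup => //; exists b.
by rewrite leNgt st.
Qed.

(** In epsilon-delta form, since it is combined with pointwise estimates on
    curves whose values outside the interval are arbitrary. *)
Definition cont_on (V : normedModType R) (a b : R) (f : R -> V) := forall t, a <= t <= b ->
  forall e : R, 0 < e -> exists2 d : R, 0 < d &
  forall s, a <= s <= b -> `|s - t| < d -> `|f s - f t| < e.

Lemma first_zero (a b : R) (f : R -> R) : cont_on a b f -> 0 < f a ->
  (exists2 t, a <= t <= b & f t <= 0) ->
  exists t, [/\ a < t <= b, f t = 0 & forall s, a <= s < t -> 0 < f s].
Proof.
move=> cf fa [t1 /andP[at1 t1b] ft1].
apply: contrapT => no.
suff : 0 < f t1 by rewrite ltNge ft1.
have : forall t, a <= t <= b -> 0 < f t; last by apply; rewrite at1.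
apply: real_induction => // t /andP[t1' t2'] H.
  have tt : a <= t <= b by rewrite t1' ltW.
  have ft : 0 < f t by apply: H; rewrite t1' lexx.
  have [d d0 Hd] := cf _ tt _ ft.
  exists d => // s /andP[ts sd] sb.
  have := Hd s; rewrite (le_trans t1' (ltW ts)) sb gtr0_norm ?subr_gt0// ltrBlDl => /(_ isT sd).
  by rewrite ltr_norml => /andP[+ _]; rewrite ltrBrDr addNr.
have tt : a <= t <= b by rewrite (ltW t1').
have ft0 : f t != 0.
  by apply/eqP => ft; apply: no; exists t; split=> //; rewrite t1'.
rewrite lt_def ft0 leNgt; apply/negP => ft.
have nft : 0 < - f t by rewrite oppr_gt0.
have [d d0 Hd] := cf _ tt _ nft.
pose s := Num.max a (t - d / 2).
have as1 : a <= s by rewrite le_max lexx.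
have st : s < t by rewrite gt_max t1' ltrBlDr ltrDl divr_gt0.
have := Hd s; rewrite as1 (le_trans (ltW st) t2') ltr0_norm ?subr_lt0// opprB => /(_ isT).
have h : t - s < d.
  rewrite ltrBlDl -ltrBlDr lt_max; apply/orP; right.
  by rewrite ltrD2l ltrN2 ltr_pdivrMr// ltr_pMr// ltr1n.
move=> /(_ h); rewrite ltr_norml => /andP[_]; rewrite ltrBlDr addNr => fs.
by have := H s; rewrite as1 st => /(_ isT); rewrite ltNge ltW.
Qed.

Lemma derive_cont_on (V : normedModType R) (a b : R) (f : R -> V) :
  (forall t, a <= t <= b -> derivable f t 1) -> cont_on a b f.
Proof.
move=> df t tab e e0.
have cf : {for t, continuous f}.
  exact/differentiable_continuous/derivable1_diffP/df.
by have [d d0 Hd] := for_continuous_eps cf e0; exists d => // s _; exact: Hd.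
Qed.

Lemma cont_on_within (a b : R) (f : R -> R) : cont_on a b f ->
  {within `[a, b], continuous f}.
Proof.
move=> cf; apply/subspace_continuousP => t /=; rewrite in_itv/= => tab.
apply/cvgrPdistC_lt => e e0; have [d d0 Hd] := cf _ tab _ e0.
rewrite near_withinE; apply/(@nbhs_deltaP R R); exists d => // s sd /=.
by rewrite in_itv/= => sab; exact: Hd.
Qed.

(** A derivative does not change sign without vanishing: otherwise the
    function has an interior extremum. *)
Lemma darboux_sign (f df : R -> R) (a b : R) : a <= b ->
  (forall t : R, a <= t <= b -> is_derive t 1 f (df t)) ->
  (forall t, a <= t <= b -> df t != 0) -> 0 < df a * df b.
Proof.
move=> ab Df nz.
wlog da : f df Df nz / 0 < df a.
  move=> H; have /orP[da|da] : (df a < 0) || (0 < df a).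
      by rewrite -neq_lt nz// lexx ab.
    have := H (fun x => - f x) (fun x => - df x); rewrite mulrNN; apply.
    - by move=> t tab; apply: is_deriveN; exact: Df.
    - by move=> t tab; rewrite oppr_eq0 nz.
    - by rewrite oppr_gt0.
  exact: (H f df).
rewrite pmulr_rgt0//; have [//|db|/eqP db] := ltrgt0P (df b); last first.
  by rewrite (negbTE (nz b _))// ab lexx in db.
have cf : {within `[a, b], continuous f}.
  by apply: derivable_within_continuous => t; rewrite in_itv/= => /Df[].
have [c cab Hc] := EVT_max ab cf.
move: cab; rewrite in_itv/= => /andP[ac cb].
have near_a : c != a.
  apply/eqP => ca; subst c.
  have aab : a <= a <= b by rewrite lexx ab.
  have [dfa Ea] := Df _ aab.
  have da2 : 0 < df a / 2 by rewrite divr_gt0.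
  have [d d0 Hd] := der_eps dfa da2; rewrite derive1E Ea in Hd.
  have alb : a < b.
    rewrite lt_def ab andbT; apply/eqP => E; move: da db; rewrite E => h1 h2.
    by have := lt_trans h1 h2; rewrite ltxx.
  pose s := Num.min b (a + d / 2).
  have as1 : a < s by rewrite lt_min alb ltrDl divr_gt0.
  have sb : s <= b by rewrite ge_min lexx.
  have sd : `|s - a| < d.
    rewrite gtr0_norm ?subr_gt0// ltrBlDl gt_min; apply/orP; right.
    by rewrite ltrD2l ltr_pdivrMr// ltr_pMr// ltr1n.
  have sab : s \in `[a, b]%R by rewrite in_itv/= sb ltW.
  have h1 := Hc s sab; have := Hd s sd.
  rewrite [X in _ <= _ * X]gtr0_norm ?subr_gt0// ler_norml => /andP[+ _].
  have h2 : 0 < df a * (s - a) by rewrite mulr_gt0 ?subr_gt0.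
  rewrite -[(s - a) *: _]/((s - a) * df a); lra.
have near_b : c != b.
  apply/eqP => ca; subst c.
  have bab : a <= b <= b by rewrite lexx ab.
  have [dfb Eb] := Df _ bab.
  have db2 : 0 < - df b / 2 by rewrite divr_gt0// oppr_gt0.
  have [d d0 Hd] := der_eps dfb db2; rewrite derive1E Eb in Hd.
  have alb : a < b.
    rewrite lt_def ab andbT; apply/eqP => E; move: da db; rewrite E => h1 h2.
    by have := lt_trans h1 h2; rewrite ltxx.
  pose s := Num.max a (b - d / 2).
  have as1 : s < b by rewrite gt_max alb ltrBlDr ltrDl divr_gt0.
  have sb : a <= s by rewrite le_max lexx.
  have sd : `|s - b| < d.
    rewrite ltr0_norm ?subr_lt0// opprB ltrBlDl -ltrBlDr lt_max; apply/orP; right.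
    by rewrite ltrD2l ltrN2 ltr_pdivrMr// ltr_pMr// ltr1n.
  have sab : s \in `[a, b]%R by rewrite in_itv/= sb ltW.
  have h1 := Hc s sab; have := Hd s sd.
  rewrite [X in _ <= _ * X]ltr0_norm ?subr_lt0// ler_norml => /andP[+ _].
  have h2 : 0 < df b * (s - b) by rewrite nmulr_rgt0 ?subr_lt0.
  rewrite -[(s - b) *: _]/((s - b) * df b); lra.
have alc : a < c by rewrite lt_def near_a.
have clb : c < b by rewrite lt_def eq_sym near_b.
have cab : a <= c <= b by rewrite ac cb.
have H0 : is_derive c 1 f 0.
  apply: (@derive1_at_max R f a b c ab).
  - by move=> t; rewrite in_itv/= => /andP[/ltW t1 /ltW t2]; have [] := Df t; rewrite ?t1 ?t2.
  - by rewrite in_itv/= alc.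
  - by move=> t; rewrite in_itv/= => /andP[/ltW t1 /ltW t2]; apply: Hc; rewrite in_itv/= t1.
by have := nz _ cab; rewrite (is_derive_uniq (Df _ cab) H0) eqxx.
Qed.

(** A planar curve with angular momentum bounded below crosses the next
    quarter axis in bounded time, because its polar angle cannot grow by pi
    inside a half-plane. *)
Lemma quarter_turn (X Y dX dY : R -> R) (a b M om : R) :
  (forall t : R, a <= t <= b -> is_derive t 1 X (dX t)) ->
  (forall t : R, a <= t <= b -> is_derive t 1 Y (dY t)) ->
  (forall t, a <= t <= b -> 0 < X t ^+ 2 + Y t ^+ 2 <= M) ->
  0 < om -> (forall t, a <= t <= b -> om <= X t * dY t - Y t * dX t) ->
  0 < M -> 0 < X a -> - X a <= Y a -> a + pi * M / om <= b ->
  exists t, [/\ a < t <= b, X t = 0 & 0 < Y t].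
Proof.
move=> DX DY XY om0 Hom M0 Xa Ya Hb.
have ab : a < b by rewrite (lt_le_trans _ Hb)// ltrDl divr_gt0// mulr_gt0// pi_gt0.
have cX : cont_on a b X by apply: derive_cont_on => t /DX[].
have cY : cont_on a b Y by apply: derive_cont_on => t /DY[].
have Dz (t : R) : a <= t <= b -> 0 < X t ->
    is_derive t 1 (fun s => Y s / X s) ((X t * dY t - Y t * dX t) / X t ^+ 2).
  move=> tab Xt; have X0 : X t != 0 by rewrite gt_eqF.
  have [d E] := is_deriveM (DY _ tab) (is_deriveV X0 (DX _ tab)).
  apply: DeriveDef; [exact: d|apply: etrans E _].
  rewrite -![_ *: _]/(_ * _); field; exact: X0.
have [t [/andP[at1 tb] Xt Xpos]] : exists t, [/\ a < t <= b, X t = 0 &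
    forall s, a <= s < t -> 0 < X s].
  apply: (first_zero cX Xa); apply: contrapT => no.
  have Xpos t : a <= t <= b -> 0 < X t.
    by move=> tab; rewrite ltNge; apply/negP => Xt; apply: no; exists t.
  pose th t := atan (Y t / X t).
  have Dth (t : R) : a <= t <= b ->
      is_derive t 1 th ((X t * dY t - Y t * dX t) / (X t ^+ 2 + Y t ^+ 2)).
    move=> tab; have Xt := Xpos _ tab.
    have [d E] := @is_derive1_comp R (@atan R) (fun s => Y s / X s) t _ _
      (is_derive1_atan (Y t / X t)) (Dz _ tab Xt).
    apply: DeriveDef; [exact: d|apply: etrans E _].
    have /andP[h _] := XY _ tab.
    by field; rewrite (gt_eqF h) (gt_eqF Xt).
  have cth : {within `[a, b], continuous th}.
    by apply: derivable_within_continuous => t; rewrite in_itv/= => /Dth[].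
  have Doo (t : R) : t \in `]a, b[%R -> is_derive t 1 th ((X t * dY t - Y t * dX t) / (X t ^+ 2 + Y t ^+ 2)).
    by rewrite in_itv/= => /andP[/ltW t1 /ltW t2]; apply: Dth; rewrite t1.
  have [t tab E] := MVT_segment (ltW ab) Doo cth.
  rewrite in_itv/= in tab.
  have /andP[h1 h2] := XY _ tab.
  have h3 : om / M <= (X t * dY t - Y t * dX t) / (X t ^+ 2 + Y t ^+ 2).
    apply: (@le_trans _ _ (om / (X t ^+ 2 + Y t ^+ 2))).
      by rewrite ler_pM2l// lef_pV2.
    by rewrite ler_pM2r ?invr_gt0// Hom.
  have h4 : pi <= th b - th a.
    rewrite E; apply: (@le_trans _ _ (om / M * (b - a))).
      have : pi * M / om <= b - a by rewrite lerBrDl.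
      rewrite -(ler_pM2l (divr_gt0 om0 M0)); apply: le_trans.
      by rewrite le_eqVlt; apply/orP; left; apply/eqP; field; rewrite !gt_eqF.
    by rewrite ler_wpM2r// subr_ge0 ltW.
  have h5 := atan_ltpi2 (Y b / X b); have h6 := atan_gtNpi2 (Y a / X a).
  by rewrite /th in h4; move: h4 h5 h6; clear; lra.
exists t; split=> //; first by rewrite at1.
have tab : a <= t <= b by rewrite (ltW at1).
have YX s : a <= s < t -> - X s <= Y s.
  move=> /andP[as1 st]; have Xs : 0 < X s by apply: Xpos; rewrite as1.
  have D' (u : R) : u \in `[a, s]%R -> is_derive u 1 (fun s => Y s / X s) ((X u * dY u - Y u * dX u) / X u ^+ 2).
    rewrite in_itv/= => /andP[u1 u2]; apply: Dz.
      by rewrite u1 (le_trans u2)// (le_trans (ltW st)).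
    by apply: Xpos; rewrite u1 (le_lt_trans u2).
  have cz : {within `[a, s], continuous (fun s => Y s / X s)}.
    by apply: derivable_within_continuous => u /D'[].
  have Doo (u : R) : u \in `]a, s[%R -> is_derive u 1 (fun s => Y s / X s) ((X u * dY u - Y u * dX u) / X u ^+ 2).
    by move=> uu; apply: D'; apply: subset_itv_oo_cc.
  have [u uas E] := MVT_segment as1 Doo cz.
  have za : -1 <= Y a / X a by rewrite ler_pdivlMr// mulN1r.
  have : -1 <= Y s / X s.
    apply: (le_trans za); rewrite -subr_ge0 E mulr_ge0 ?subr_ge0//.
    rewrite divr_ge0 ?sqr_ge0// (le_trans (ltW om0))// Hom//.
    move: uas; rewrite in_itv/= => /andP[-> u2] /=.
    by rewrite (le_trans u2)// (le_trans (ltW st)).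
  by rewrite ler_pdivlMr// mulN1r.
have Y0 : Y t != 0.
  by apply/eqP => E; have /andP[+ _] := XY _ tab; rewrite Xt E expr0n addr0 ltxx.
rewrite lt_def Y0 leNgt; apply/negP => Yt.
have e0 : 0 < - Y t / 2 by rewrite divr_gt0// oppr_gt0.
have [d1 d10 H1] := cX _ tab _ e0. have [d2 d20 H2] := cY _ tab _ e0.
have dm : 0 < Num.min d1 d2 by rewrite lt_min d10.
pose s := Num.max a (t - Num.min d1 d2 / 2).
have as1 : a <= s by rewrite le_max lexx.
have st : s < t by rewrite gt_max at1 ltrBlDr ltrDl divr_gt0.
have sab : a <= s <= b by rewrite as1 (le_trans (ltW st)).
have : `|s - t| < Num.min d1 d2.
  rewrite ltr0_norm ?subr_lt0// opprB ltrBlDl -ltrBlDr lt_max; apply/orP; right.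
  by rewrite ltrD2l ltrN2 ltr_pdivrMr// ltr_pMr// ltr1n.
rewrite lt_min => /andP[s1 s2].
have := H1 s sab s1; have := H2 s sab s2; have := YX s; rewrite as1 st Xt subr0 => /(_ isT).
rewrite !ltr_norml => h1 /andP[_ h2] /andP[_ h3].
by move: h1 h2 h3; clear; lra.
Qed.

(** Monotonicity of g exp(- k t) and of g exp(k t). *)
Lemma gronwall (g dg : R -> R) (k a b : R) : a <= b -> cont_on a b g ->
  (forall t : R, a < t < b -> is_derive t 1 g (dg t)) ->
  (forall t, a < t < b -> `|dg t| <= k * g t) ->
  g b <= expR (k * (b - a)) * g a /\ g a <= expR (k * (b - a)) * g b.
Proof.
move=> ab cg Dg H.
have [-> |anb] := eqVneq a b; first by rewrite subrr mulr0 expR0 !mul1r.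
have alb : a < b by rewrite lt_def eq_sym anb.
have De (c t : R) : is_derive t 1 (fun t => expR (c * t)) (c * expR (c * t)).
  have Dc : is_derive t 1 (fun t : R => c * t) c.
    have [d E] := is_deriveZ c (is_derive_id t (1 : R)).
    by apply: DeriveDef; [exact: d|apply: etrans E _; exact: mulr1].
  have [d E] := @is_derive1_comp R (@expR R) (fun t => c * t) t _ _ (is_derive_expR _) Dc.
  by apply: DeriveDef; [exact: d|apply: etrans E _; rewrite mulrC].
have key c : exists2 x, a < x < b & expR (c * b) * g b - expR (c * a) * g a =
    expR (c * x) * (c * g x + dg x) * (b - a).
  have ce : continuous (fun t => expR (c * t)).
    by move=> t; apply/differentiable_continuous/derivable1_diffP; case: (De c t).
  have cphi : {within `[a, b], continuous (fun t => expR (c * t) * g t)}.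
    have -> : (fun t => expR (c * t) * g t) = (fun t => expR (c * t)) * g by [].
    move=> t; apply: continuousM; last exact: (cont_on_within cg).
    exact: (continuous_subspaceT ce).
  have Doo (t : R) : t \in `]a, b[%R ->
      is_derive t 1 (fun t => expR (c * t) * g t) (expR (c * t) * (c * g t + dg t)).
    rewrite in_itv/= => tab.
    have [d E] := is_deriveM (De c t) (Dg _ tab).
    apply: DeriveDef; [exact: d|apply: etrans E _].
    by rewrite -![_ *: _]/(_ * _); ring.
  by have [x xab E] := MVT alb Doo cphi; exists x => //; move: xab; rewrite in_itv.
have ba0 : 0 <= b - a by rewrite subr_ge0.
have EE (c : R) : expR (c * (b - a)) = expR (c * b) * expR (- (c * a)).
  by rewrite -expRD; congr expR; ring.
split.
  have [x xab E] := key (- k).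
  have : expR (- k * b) * g b <= expR (- k * a) * g a.
    rewrite -subr_le0 E mulr_le0_ge0// mulr_ge0_le0 ?expR_ge0//.
    by have := H _ xab; rewrite ler_norml => /andP[_]; rewrite mulNr addrC subr_le0.
  rewrite -(ler_pM2l (expR_gt0 (k * b))) !mulrA -!expRD.
  by rewrite mulNr subrr expR0 mul1r; rewrite mulNr -mulrBr.
have [x xab E] := key k.
have : expR (k * a) * g a <= expR (k * b) * g b.
  rewrite -subr_ge0 E mulr_ge0// mulr_ge0 ?expR_ge0//.
  by have := H _ xab; rewrite ler_norml => /andP[+ _]; rewrite -subr_ge0 opprK addrC.
rewrite -(ler_pM2l (expR_gt0 (- (k * a)))) !mulrA -!expRD.
by rewrite addNr expR0 mul1r addrC -mulrBr.
Qed.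

(** Connectedness of the interval; the continuity of D is not assumed, because
    it will be applied to the speed of curves that are only differentiable. *)
Lemma locally_signed (a b : R) (D : R -> R) :
  (forall t, a <= t <= b -> exists2 d : R, 0 < d &
     forall s, a <= s <= b -> `|s - t| < d -> 0 < D s * D t) ->
  forall t, a <= t <= b -> 0 < D t * D a.
Proof.
move=> H.
have sq t : a <= t <= b -> 0 < D t * D t.
  by move=> tab; have [d d0 Hd] := H _ tab; apply: Hd => //; rewrite subrr normr0.
have tr x y z : 0 < D x * D y -> 0 < D y * D z -> 0 < D y * D y -> 0 < D x * D z.
  move=> h1 h2 h3; rewrite -(pmulr_rgt0 _ h3).
  by have := mulr_gt0 h1 h2; congr (0 < _); ring.
move=> t /[dup] tab /andP[at_ tb].
have ab : a <= b by exact: le_trans tb.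
have aab : a <= a <= b by apply/andP.
apply: (@real_induction a b (fun t => 0 < D t * D a)) => //.
- exact: sq.
- move=> u /andP[au ub] Hu.
  have uab : a <= u <= b by rewrite au ltW.
  have [d d0 Hd] := H _ uab; exists d => // s /andP[us sd] sb.
  apply: (tr _ u _); [|by apply: Hu; apply/andP|exact: sq].
  apply: Hd; first by rewrite sb (le_trans au)// ltW.
  by rewrite gtr0_norm ?subr_gt0// ltrBlDl.
- move=> u /andP[au ub] Hu.
  have uab : a <= u <= b by rewrite (ltW au).
  have [d d0 Hd] := H _ uab.
  pose s := Num.max a (u - d / 2).
  have as1 : a <= s by rewrite le_max lexx.
  have su : s < u by rewrite gt_max au ltrBlDr ltrDl divr_gt0.
  have sab : a <= s <= b by rewrite as1 (le_trans (ltW su)).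
  apply: (tr _ s _); [|by apply: Hu; rewrite as1|exact: sq].
  rewrite mulrC; apply: Hd => //.
  rewrite ltr0_norm ?subr_lt0// opprB ltrBlDl -ltrBlDr lt_max; apply/orP; right.
  by rewrite ltrD2l ltrN2 ltr_pdivrMr// ltr_pMr// ltr1n.
Qed.

End LineTools.

(** * Circular principal cycles *)

Section ClosedCurve.
Variable R : realType.

Lemma periodic_int (V : Type) (f : R -> V) (L : R) : (forall s, f (s + L) = f s) ->
  forall (k : int) s, f (s + k%:~R * L) = f s.
Proof.
move=> fL.
have P (k : nat) s : f (s + k%:R * L) = f s.
  elim: k s => [|k IH] s; first by rewrite mul0r addr0.
  by rewrite -natr1 mulrDl mul1r addrA fL IH.
case=> k s; first exact: P.
have -> : (Negz k)%:~R = - k.+1%:R :> R by rewrite NegzE mulrNz.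
by rewrite mulNr -[LHS](P k.+1) subrK.
Qed.

Lemma periodic_reduce (L : R) (s : R) : 0 < L ->
  exists (k : int) (s' : R), 0 <= s' < L /\ s = s' + k%:~R * L.
Proof.
move=> L0; exists (Num.floor (s / L)), (s - (Num.floor (s / L))%:~R * L).
split; last by rewrite subrK.
have := Num.Theory.floor_le (s / L); have := Num.Theory.floorD1_gt (s / L).
rewrite ltr_pdivrMr// ler_pdivlMr// intrD => h1 h2.
by rewrite subr_ge0 h2 /= ltrBlDr; move: h1; rewrite mulrDl mul1r addrC.
Qed.

Variables (c : R -> 'rV[R]_3) (L : R).
Hypothesis hc : closed_frenet_curve c L.

Lemma curve_smooth : smooth c.
Proof. by apply: smoothP; case: hc. Qed.

Lemma curve_derive (s : R) : is_derive s 1 c (derive1 c s).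
Proof. exact: smooth_is_derive curve_smooth. Qed.

Lemma curve_derive2 (s : R) : is_derive s 1 (derive1 c) (derive1n 2 c s).
Proof. exact: (smooth_is_derive s (smooth_derive1 curve_smooth)). Qed.

Lemma trace_curve s : trace c L (c s).
Proof.
have [k [s' [/andP[s0 s1] ->]]] := periodic_reduce s (cfc_length_gt0 hc).
rewrite (periodic_int (cfc_periodic hc)); exists s' => //=.
by rewrite in_itv/= s0 ltW.
Qed.

Lemma is_derive_cst_eq (f : R -> R) (k : R) : (forall s, f s = k) ->
  forall (s l : R), is_derive s 1 f l -> l = 0.
Proof.
move=> fk s l fl; have fE : f = cst k by apply/funext.
by rewrite fE in fl; exact: (is_derive_uniq fl (is_derive_cst k s (1 : R))).
Qed.

Lemma is_derive_dotp_cst (v u : 'rV[R]_3) (f : R -> 'rV[R]_3) (s : R) (df : 'rV[R]_3) :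
  is_derive s 1 f df -> is_derive s 1 (fun t => dotp v (f t - u)) (dotp v df).
Proof.
move=> fd.
have d1 : is_derive s 1 (fun t => f t - u) df.
  have [d E] := is_deriveB fd (is_derive_cst u s (1 : R)).
  by apply: DeriveDef; [exact: d|apply: etrans E _; rewrite subr0].
have [d E] := is_derive_dotp (is_derive_cst v s (1 : R)) d1.
by apply: DeriveDef; [exact: d|apply: etrans E _; rewrite dotp0l add0r].
Qed.

Lemma curve_acc_orth s : dotp (derive1 c s) (derive1n 2 c s) = 0.
Proof.
have H := is_derive_dotp (curve_derive2 s) (curve_derive2 s).
have := is_derive_cst_eq (cfc_arclength hc) H.
rewrite dotpC -mulr2n => /eqP; rewrite mulrn_eq0 /= => /eqP.
by [].
Qed.

End ClosedCurve.

Section Opposite.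
Variables (R : realType) (r : nat) (S : oriented_surface R r).

Lemma shape_op_neg (x v w : 'rV[R]_3) : shape_op S x v w -> shape_op S x (- v) (- w).
Proof.
move=> [U [X [q [a [ch Uq qx <- <-]]]]]; exists U, X, q, (- a).
by split=> //; rewrite linearN.
Qed.

Lemma principal_direction_neg (max : bool) (x v : 'rV[R]_3) :
  principal_direction max S x v -> principal_direction max S x (- v).
Proof.
move=> [U [X [q [a [[ch Uq qx <-] [nu f1 f2]]]]]]; exists U, X, q, (- a).
split; first by split=> //; rewrite linearN.
split=> //.
  apply: etrans f1.
  apply: etrans (f_equal2 (fun u v => dotp u v) (linearN _ a) (linearN _ a)) _.
  by rewrite dotpNl dotpNr opprK.
apply: etrans f2.
apply: etrans (f_equal2 (fun u v => dotp (- u) v) (linearN _ a) (linearN _ a)) _.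
by rewrite dotpNr -dotpNl opprK.
Qed.

End Opposite.

Section CircleSetup.
Variables (R : realType) (r : nat).
Hypothesis r3 : (3 <= r)%N.
Variables (c : R -> 'rV[R]_3) (L : R).
Hypothesis hc : closed_frenet_curve c L.
Variables (S : oriented_surface R r) (max : bool).
Hypothesis pc : principal_cycle max S c.
Let N := normal S.

Lemma unit_axis (o n : 'rV[R]_3) : n != 0 ->
  exists2 n', dotp n' n' = 1 & plane o n = plane o n'.
Proof.
move=> n0; have nn : 0 < dotp n n by rewrite dotp_gt0.
pose k := Num.sqrt (dotp n n).
have k0 : k != 0 by rewrite sqrtr_eq0 -ltNge.
exists (k^-1 *: n).
  by rewrite dotpZl dotpZr mulrA -expr2 exprVn sqr_sqrtr ?ltW// mulVf ?gt_eqF.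
apply/seteqP; split=> x; rewrite /plane /= dotpZl => /eqP h; apply/eqP.
  by rewrite (eqP h) mulr0.
by move: h; rewrite mulf_eq0 invr_eq0 (negbTE k0).
Qed.

(** Along a circular principal line of a surface the normal makes a constant
    angle with the plane of the circle, so that the curvature [kap] of that line
    is constant and [N + kap x] does not move. *)
Lemma circle_setup : is_circle c L ->
  exists o n (rho kap : R) C0,
  [/\ dotp n n = 1, 0 < rho, trace c L = circle o n rho &
  forall x, circle o n rho x ->
  [/\ principal_direction max S x (rotf o n rho x),
      shape_op S x (rotf o n rho x) (- kap *: rotf o n rho x) &
      N x + kap *: x - C0 = 0]].
Proof.
move=> [ctr [n0 [rho [n00 rho0 tE]]]].
have [n nn pE] := unit_axis ctr n00.
rewrite pE -/(circle ctr n rho) in tE.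
have cG s : circle ctr n rho (c s) by rewrite -tE; exact: trace_curve.
have c1 s := curve_derive hc s; have c2 s := curve_derive2 hc s.
set T := derive1 c in c1 c2. set A := derive1n 2 c in c2.
have TT s : dotp (T s) (T s) = 1 by exact: (cfc_arclength hc).
have nT s : dotp n (T s) = 0.
  apply: (is_derive_cst_eq (f := fun s => dotp n (c s - ctr)) (k := 0)) (is_derive_dotp_cst n ctr (c1 s)).
  by move=> t; case: (cG t).
have nA s : dotp n (A s) = 0.
  have := is_derive_dotp_cst n 0 (c2 s).
  by apply: (is_derive_cst_eq (k := 0)) => t; rewrite subr0.
have dco (s : R) : is_derive s 1 (fun t => c t - ctr) (T s).
  have [d E] := is_deriveB (c1 s) (is_derive_cst ctr s (1 : R)).
  by apply: DeriveDef; [exact: d|apply: etrans E _; rewrite subr0].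
have cT s : dotp (c s - ctr) (T s) = 0.
  have H := is_derive_dotp (dco s) (dco s).
  have := is_derive_cst_eq (k := rho ^+ 2) (fun t => proj2 (cG t)) H.
  by rewrite (dotpC (T s)) -mulr2n => /eqP; rewrite mulrn_eq0 /= => /eqP.
have cA s : dotp (c s - ctr) (A s) = - 1.
  have H := is_derive_dotp (dco s) (c2 s).
  by have := is_derive_cst_eq (k := 0) cT H; rewrite TT => /eqP; rewrite addrC addr_eq0 => /eqP.
have frame s := principal_frame r3 (pc s).
pose k s := - dotp (N (c s)) (A s).
have TN s : dotp (N (c s)) (T s) = 0 by have [? [? [[]]]] := frame s.
have cS s : carrier S (c s) by have [? [? [[]]]] := frame s.
have shk s : exists l, shape_op S (c s) (T s) (- l *: T s).
  by have [l [? [[? ? ? ? ?] ?]]] := frame s; exists l.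
have dN (s l : R) : shape_op S (c s) (T s) (- l *: T s) -> is_derive s 1 (N \o c) (- l *: T s).
  by move=> H; apply: (shape_curve r3 H erefl _ (c1 s)); apply/nbhs_deltaP; exists 1 => // t _; exact: cS.
pose be := dotp (N (c 0)) (c 0 - ctr).
have beE s : dotp (N (c s)) (c s - ctr) = be.
  rewrite /be; apply: (@is_derive_0_is_cst R (fun s => dotp (N (c s)) (c s - ctr))) => t.
  have [l Hl] := shk t.
  have [d E] := is_derive_dotp (dN _ _ Hl) (dco t).
  apply: DeriveDef; [exact: d|apply: etrans E _].
  by rewrite /= TN addr0 dotpZl (dotpC (T t)) cT mulr0.
have TE s : T s = rotf ctr n rho (c s) \/ T s = - rotf ctr n rho (c s).
  apply: (circle_tangent nn rho0 (cG s) (TT s)); first by rewrite dotpC.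
  by rewrite dotpC.
have AE s : A s = - rho ^- 2 *: (c s - ctr).
  have e1 : dotp (rho^-1 *: (c s - ctr)) (rho^-1 *: (c s - ctr)) = 1.
    rewrite dotpZl dotpZr (_ : dotp _ _ = rho ^+ 2); last by case: (cG s).
    by field; rewrite gt_eqF.
  have ne : dotp n (rho^-1 *: (c s - ctr)) = 0.
    by rewrite dotpZr; case: (cG s) => -> _; rewrite mulr0.
  have on := orthonormal3_crossp nn e1 ne.
  have TA : dotp (A s) (crossp n (rho^-1 *: (c s - ctr))) = 0.
    rewrite crosspZr -/(rotf ctr n rho (c s)).
    have := curve_acc_orth hc s; rewrite -/T -/A dotpC.
    by case: (TE s) => ->; rewrite ?dotpNr => // /eqP; rewrite oppr_eq0 => /eqP.
  rewrite (orthonormal3_expand (A s) on) TA (dotpC _ n) nA !scale0r addr0 add0r.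
  rewrite dotpZr (dotpC (A s)) cA scalerA; congr (_ *: _).
  by field; rewrite gt_eqF.
pose kap := - (be * rho ^- 2).
have kE s l : shape_op S (c s) (T s) (- l *: T s) -> l = kap.
  move=> Hl; have H := is_derive_dotp (dN _ _ Hl) (c2 s).
  have := is_derive_cst_eq (k := 0) TN H.
  rewrite /= dotpZl TT mulr1 AE dotpZr beE /kap => /eqP.
  by rewrite addr_eq0 => /eqP h; rewrite -[l]opprK h; ring.
have shT s : shape_op S (c s) (T s) (- kap *: T s).
  by have [l Hl] := shk s; rewrite -(kE _ _ Hl).
have dW (s : R) : is_derive s 1 (fun s => N (c s) + kap *: c s) 0.
  have [d E] := is_deriveD (dN _ _ (shT s)) (is_deriveZ kap (c1 s)).
  by apply: DeriveDef; [exact: d|apply: etrans E _; rewrite scaleNr addNr].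
have Wcst s : N (c s) + kap *: c s = N (c 0) + kap *: c 0.
  apply/rowP => j.
  apply: (@is_derive_0_is_cst R (fun s => (N (c s) + kap *: c s) 0 j)) => t.
  by have := is_derive_coord j (dW t); rewrite mxE.
exists ctr, n, rho, kap, (N (c 0) + kap *: c 0); split=> //.
move=> x Gx; have : trace c L x by rewrite tE.
move=> [s _ sx]; rewrite -sx; split.
- case: (TE s) => E; first by rewrite -E; exact: pc.
  by rewrite -[rotf _ _ _ _]opprK -E; apply: principal_direction_neg; exact: pc.
- case: (TE s) => E; first by rewrite -E; exact: shT.
  by rewrite -[rotf _ _ _ _]opprK -E scalerN; apply: shape_op_neg; exact: shT.
- by rewrite Wcst subrr.
Qed.

End CircleSetup.

(** * Leaves in a tube around the circle *)

Section ContOn.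
Variable R : realType.

Lemma cont_on_comp (V W : normedModType R) (a b : R) (f : R -> V) (h : V -> W) :
  continuous h -> cont_on a b f -> cont_on a b (fun t => h (f t)).
Proof.
move=> ch cf t tab e e0.
have [d1 d10 H1] := for_continuous_eps (ch (f t)) e0.
have [d d0 H] := cf t tab _ d10.
by exists d => // s sab sd; apply: H1; exact: H.
Qed.

Lemma cont_onD (V : normedModType R) (a b : R) (f g : R -> V) :
  cont_on a b f -> cont_on a b g -> cont_on a b (fun t => f t + g t).
Proof.
move=> cf cg t tab e e0.
have e2 : 0 < e / 2 by rewrite divr_gt0.
have [d1 d10 H1] := cf t tab _ e2. have [d2 d20 H2] := cg t tab _ e2.
exists (Num.min d1 d2) => [|s sab]; first by rewrite lt_min d10.
rewrite lt_min => /andP[s1 s2]; rewrite opprD addrACA.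
rewrite (le_lt_trans (ler_normD _ _))// [e]splitr ltrD//; [exact: H1|exact: H2].
Qed.

Lemma cont_on_sub (V : normedModType R) (a b b' : R) (f : R -> V) :
  b' <= b -> cont_on a b f -> cont_on a b' f.
Proof.
move=> bb cf t /andP[at_ tb] e e0.
have [|d d0 H] := cf t _ _ e0; first by rewrite at_ (le_trans tb).
by exists d => // s /andP[as_ sb]; apply: H; rewrite as_ (le_trans sb).
Qed.

End ContOn.

Section Tube.
Variables (R : realType) (r : nat).
Hypothesis r3 : (3 <= r)%N.
Variable S : oriented_surface R r.
Variables (o n : 'rV[R]_3) (rho kap : R) (C0 : 'rV[R]_3) (max : bool).
Hypothesis nn : dotp n n = 1.
Hypothesis rho0 : 0 < rho.
Let N := normal S.
Let J := rotf o n rho.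
Let Gam := circle o n rho.
Let w x := N x + kap *: x - C0.
Hypothesis HG : forall x, Gam x ->
  [/\ principal_direction max S x (J x), shape_op S x (J x) (- kap *: J x) & w x = 0].
Hypothesis Gcpt : compact Gam.

Definition near_circle (e : R) x := exists2 y, Gam y & `|x - y| < e.

(** [local_estimate] made uniform by the compactness of the circle. *)
Lemma tube_estimate (eps : R) : 0 < eps -> exists2 e : R, 0 < e &
  forall x, carrier S x -> near_circle e x ->
  [/\ (exists2 y, Gam y & `|x - y| <= e^-1 * `|w x|),
      dotp (w x) (w x) <= 4 * dotp (w x) (crossp (N x) (J x)) ^+ 2 &
      forall v k, principal_direction max S x v -> shape_op S x v (- k *: v) ->
        `|(kap - k) * dotp v (w x)| <= eps * dotp (w x) (w x) /\
        1 / 2 <= dotp v (J x) ^+ 2].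
Proof.
move=> eps0.
pose P (e : R) (y : 'rV[R]_3) := forall x, carrier S x -> `|x - y| < e ->
  [/\ (exists2 y, Gam y & `|x - y| <= e^-1 * `|w x|),
      dotp (w x) (w x) <= 4 * dotp (w x) (crossp (N x) (J x)) ^+ 2 &
      forall v k, principal_direction max S x v -> shape_op S x v (- k *: v) ->
        `|(kap - k) * dotp v (w x)| <= eps * dotp (w x) (w x) /\
        1 / 2 <= dotp v (J x) ^+ 2].
have nc := (compact_near_coveringP Gam).1 Gcpt.
have H : \forall e \near (0 : R)^'+, Gam `<=` P e.
  apply: nc => y0 Gy0.
  have [K K0 HK] := local_estimate r3 nn rho0 HG Gy0.
  have [d d0 Hd] := HK _ eps0.
  have m0 : 0 < Num.min (d / 2) K^-1 by rewrite lt_min divr_gt0//= invr_gt0.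
  exists (ball y0 (d / 2), [set e | 0 < e < Num.min (d / 2) K^-1]).
    split=> /=; first by apply: nbhsx_ballx; rewrite divr_gt0.
    near=> e => /=; apply/andP; split; first by near: e; exact: nbhs_right_gt.
    by near: e; exact: nbhs_right_lt.
  move=> [y e] /= [yb /andP[e0]]; rewrite lt_min => /andP[ed eK] x Sx xy.
  move: yb; rewrite -ball_normE /= distrC => yb.
  have [|[z Gz xz] i2 i3] := Hd x Sx.
    have -> : x - y0 = (x - y) + (y - y0) by rewrite addrA subrK.
    rewrite (le_lt_trans (ler_normD _ _))// [d]splitr ltrD//.
    exact: lt_trans ed.
  split=> //; exists z => //; rewrite (le_trans xz)// ler_wpM2r//.
  by rewrite -[K]invrK lef_pV2 ?posrE ?invr_gt0// ltW.
have [e e0 He] : exists2 e : R, 0 < e & Gam `<=` P e.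
  near (0 : R)^'+ => e; exists e; first by near: e; exact: nbhs_right_gt.
  by near: e; exact: H.
by exists e => // x Sx [y Gy xy]; exact: He Gy x Sx xy.
Unshelve. all: by end_near. Qed.

Section Line.
Variables (g : R -> 'rV[R]_3) (T : R).
Hypothesis pl : principal_line_on max S g T.

Lemma line_derive (t : R) : 0 <= t <= T -> is_derive t 1 g (derive1 g t).
Proof. by move=> /pl[dg _]; rewrite derive1E; apply: DeriveDef. Qed.

Lemma line_frame t : 0 <= t <= T -> exists k k2 : R,
  [/\ carrier S (g t), dotp (derive1 g t) (derive1 g t) = 1,
      dotp (N (g t)) (derive1 g t) = 0,
      shape_op S (g t) (derive1 g t) (- k *: derive1 g t) &
      shape_op S (g t) (crossp (N (g t)) (derive1 g t)) (- k2 *: crossp (N (g t)) (derive1 g t))] /\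
  (if max then k2 < k else k < k2).
Proof. by move=> /pl[_ pd]; exact: (principal_frame r3 pd). Qed.

Lemma line_carrier t : 0 <= t <= T -> carrier S (g t).
Proof. by move=> /line_frame[? [? [[]]]]. Qed.

Lemma line_cont : cont_on 0 T g.
Proof. by apply: derive_cont_on => t /pl[]. Qed.

Lemma line_cont_w : cont_on 0 T (fun t => w (g t)).
Proof.
apply: cont_onD; last by move=> t _ e e0; exists 1 => // s _ _; rewrite subrr normr0.
apply: cont_onD; last first.
  by apply: cont_on_comp line_cont; exact: scaler_continuous.
move=> t tT e e0.
have [d1 d10 H1] := within_eps (@normal_continuous R r S) (line_carrier tT) e0.
have [d d0 H] := line_cont tT d10.
by exists d => // s sT sd; apply: H1; [exact: line_carrier|exact: H].
Qed.

(** Along a leaf the derivative of w is (kap - k) times the velocity, k being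
    the principal curvature, so that of |w|^2 is bounded by 2 eps |w|^2. *)
Lemma line_gronwall (eps e b : R) : 0 <= b <= T ->
  (forall x, carrier S x -> near_circle e x ->
    forall v k, principal_direction max S x v -> shape_op S x v (- k *: v) ->
        `|(kap - k) * dotp v (w x)| <= eps * dotp (w x) (w x)) ->
  (forall t, 0 <= t < b -> near_circle e (g t)) ->
  let q t := dotp (w (g t)) (w (g t)) in
  q b <= expR (2 * eps * b) * q 0 /\ q 0 <= expR (2 * eps * b) * q b.
Proof.
move=> /andP[b0 bT] He Hn q.
have bT' t : 0 < t < b -> 0 <= t <= T.
  by move=> /andP[/ltW -> /ltW tb]; rewrite (le_trans tb).
pose kk t := if pselect (0 <= t <= T) is left H then projT1 (cid (line_frame H)) else 0.
have kkP t : 0 <= t <= T -> shape_op S (g t) (derive1 g t) (- kk t *: derive1 g t).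
  move=> tT; rewrite /kk; case: pselect => // H.
  by case: (cid (line_frame H)) => k /= [k2 [[]]].
have Dw (t : R) : 0 < t < b -> is_derive t 1 (fun t => w (g t)) ((kap - kk t) *: derive1 g t).
  move=> tb; have tT := bT' _ tb; have gt_ := line_derive tT.
  have nS : \forall s \near t, carrier S (g s).
    move: tb => /andP[t0 tb].
    have m0 : 0 < Num.min t (T - t) by rewrite lt_min t0 subr_gt0 (lt_le_trans tb).
    apply/nbhs_deltaP; exists (Num.min t (T - t)) => // s.
    rewrite lt_min !ltr_norml => /andP[/andP[h1 _] /andP[_ h2]].
    apply: line_carrier; apply/andP; split.
      by move: h1; rewrite ltrBrDr addNr => /ltW.
    by move: h2; rewrite ltrBlDr subrK => /ltW.
  have dN := shape_curve r3 (kkP _ tT) erefl nS gt_.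
  have [d E] := is_deriveD (is_deriveD dN (is_deriveZ kap gt_)) (is_derive_cst (- C0) t (1 : R)).
  apply: DeriveDef; [exact: d|apply: etrans E _].
  by rewrite addr0 scaleNr scalerBl addrC.
have Dq (t : R) : 0 < t < b -> is_derive t 1 q (2 * ((kap - kk t) * dotp (derive1 g t) (w (g t)))).
  move=> tb; have H := is_derive_dotp (Dw _ tb) (Dw _ tb).
  have [d E] := H; apply: DeriveDef; [exact: d|apply: etrans E _].
  by rewrite dotpZr dotpZl (dotpC (w _)); ring.
have cq : cont_on 0 b q.
  apply: (@cont_on_sub _ _ 0 T) => //.
  apply: (@cont_on_comp R _ _ 0 T (fun t => w (g t)) (fun v : 'rV[R]_3 => dotp v v)); last exact: line_cont_w.
  by move=> v; apply: (@continuous_dotp R 3 _ id id v); exact: cvg_id.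
have bnd t : 0 < t < b -> `|2 * ((kap - kk t) * dotp (derive1 g t) (w (g t)))| <= 2 * eps * q t.
  move=> tb; rewrite normrM ger0_norm// -mulrA ler_pM2l//.
  have tT := bT' _ tb.
  apply: He; [exact: line_carrier| |by have [] := pl tT|exact: kkP].
  by apply: Hn; move: tb => /andP[/ltW -> ->].
by have := gronwall b0 cq Dq bnd; rewrite subr0.
Qed.

(** A bootstrap by real induction: as long as the leaf is in the tube, the
    deviation w grows at most exponentially, and a small deviation keeps it
    well inside the tube. *)
Lemma stays_in_tube (eps e Tm : R) : 0 <= T <= Tm -> 0 < e -> 0 < eps ->
  (forall x, carrier S x -> near_circle e x ->
    (exists2 y, Gam y & `|x - y| <= e^-1 * `|w x|) /\
    forall v k, principal_direction max S x v -> shape_op S x v (- k *: v) ->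
        `|(kap - k) * dotp v (w x)| <= eps * dotp (w x) (w x)) ->
  near_circle e (g 0) ->
  expR (2 * eps * Tm) * dotp (w (g 0)) (w (g 0)) <= (e ^+ 2 / 2) ^+ 2 ->
  forall t, 0 <= t <= T -> near_circle e (g t).
Proof.
move=> /andP[T0 TTm] e0 eps0 He n0 small.
apply: real_induction => //.
  move=> t /andP[t0 tT] Ht.
  have [y Gy ty] : near_circle e (g t) by apply: Ht; rewrite t0 /=.
  have ey : 0 < e - `|g t - y| by rewrite subr_gt0.
  have tT' : 0 <= t <= T by rewrite t0 ltW.
  have [d d0 Hd] := line_cont tT' ey.
  exists d => // s /andP[ts sd] sT; exists y => //.
  have -> : g s - y = (g s - g t) + (g t - y) by rewrite addrA subrK.
  rewrite (le_lt_trans (ler_normD _ _))// -ltrBrDr; apply: Hd.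
    by rewrite sT (le_trans t0)// ltW.
  by rewrite gtr0_norm ?subr_gt0// ltrBlDl.
move=> t /andP[t0 tT] Ht.
have tT' : 0 <= t <= T by rewrite ltW.
have e2 : 0 < e / 2 by rewrite divr_gt0.
have [d d0 Hd] := line_cont tT' e2.
pose s := Num.max 0 (t - d / 2).
have s0 : 0 <= s by rewrite le_max lexx.
have st : s < t by rewrite gt_max t0 ltrBlDr ltrDl divr_gt0.
have sT : 0 <= s <= T by rewrite s0 (le_trans (ltW st)).
have ns : near_circle e (g s) by apply: Ht; rewrite s0.
have [[y Gy sy] _] := He _ (line_carrier sT) ns.
have [] := @line_gronwall eps e s sT.
- by move=> x Sx nx; have [_ H] := He _ Sx nx; exact: H.
- by move=> u /andP[u0 us]; apply: Ht; rewrite u0 (lt_trans us).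
move=> h _; exists y => //.
have ws : `|w (g s)| <= e ^+ 2 / 2.
  have h2 : `|w (g s)| ^+ 2 <= (e ^+ 2 / 2) ^+ 2.
    rewrite (le_trans (norm_sq_le_dotp _))// (le_trans h)// (le_trans _ small)//.
    rewrite ler_wpM2r ?dotp_ge0// ler_expR ler_pM2l ?mulr_gt0//.
    by case/andP: sT => _ /le_trans; apply.
  by move: h2; rewrite ler_pXn2r ?nnegrE ?divr_ge0 ?sqr_ge0.
have -> : g t - y = (g s - y) - (g s - g t).
  by rewrite opprB [RHS]addrC addrA subrK.
rewrite (le_lt_trans (ler_normB _ _))// [e]splitr ler_ltD//.
  rewrite (le_trans sy)// (le_trans (ler_wpM2l _ ws)) ?invr_ge0 ?(ltW e0)//.
  by rewrite le_eqVlt; apply/orP; left; apply/eqP; field; rewrite gt_eqF.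
apply: Hd => //; rewrite ltr0_norm ?subr_lt0// opprB ltrBlDl -ltrBlDr lt_max; apply/orP; right.
by rewrite ltrD2l ltrN2 ltr_pdivrMr// ltr_pMr// ltr1n.
Qed.

End Line.
End Tube.

(** * Revolutions around the circle *)

Section FullTurn.
Variable R : realType.

Lemma is_derive_opp (f : R -> R) (t l : R) : is_derive t 1 f l ->
  is_derive t 1 (fun s => - f s) (- l).
Proof.
move=> fl; have [d E] := is_deriveN fl.
by apply: DeriveDef; [exact: d|exact: E].
Qed.

(** Four quarter turns; the values at the second and the fourth one are
    recorded. *)
Lemma full_turn (X Y dX dY : R -> R) (T M om : R) :
  (forall t : R, 0 <= t <= T -> is_derive t 1 X (dX t)) ->
  (forall t : R, 0 <= t <= T -> is_derive t 1 Y (dY t)) ->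
  (forall t, 0 <= t <= T -> 0 < X t ^+ 2 + Y t ^+ 2 <= M) ->
  0 < om -> (forall t, 0 <= t <= T -> om <= X t * dY t - Y t * dX t) ->
  0 < M -> 0 < X 0 -> - X 0 <= Y 0 -> 4 * (pi * M / om) <= T ->
  exists t2 t4, [/\ 0 <= t2 <= t4, t4 <= 4 * (pi * M / om) &
    [/\ X t2 < 0, Y t2 = 0, 0 < X t4 & Y t4 = 0]].
Proof.
move=> DX DY XY om0 Hom M0 X0 Y0; set q := pi * M / om => qT.
have q0 : 0 < q by rewrite divr_gt0// mulr_gt0// pi_gt0.
have sub a b : 0 <= a -> b <= T -> forall t, a <= t <= b -> 0 <= t <= T.
  by move=> a0 bT t /andP[h1 h2]; rewrite (le_trans a0 h1) (le_trans h2 bT).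
have h1 : 0 <= (0 : R) by []. have h2 : q <= T.
  by move: qT q0; clear; lra.
have s1 := sub _ _ h1 h2.
have [|t1 [/andP[t1a t1b] X1 Y1]] := @quarter_turn R X Y dX dY 0 q M om
  (fun t H => DX t (s1 t H)) (fun t H => DY t (s1 t H)) (fun t H => XY t (s1 t H))
  om0 (fun t H => Hom t (s1 t H)) M0 X0 Y0; first by rewrite add0r.
have h4 : t1 + q <= T by move: t1b qT q0; clear; lra.
have s2 := sub _ _ (ltW t1a) h4.
have [||||t2 [/andP[t2a t2b] Y2 X2]] := @quarter_turn R Y (fun t => - X t) dY (fun t => - dX t) t1 (t1 + q) M om
  (fun t H => DY t (s2 t H)) (fun t H => is_derive_opp (DX t (s2 t H))) _ om0 _ M0 Y1.
- by move=> t /s2/XY; rewrite sqrrN addrC.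
- by move=> t /s2/Hom; congr (_ <= _); ring.
- by rewrite X1 oppr0 oppr_le0 ltW.
- by [].
have t20 : 0 < t2 by exact: lt_trans t2a.
have h5 : t2 + q <= T by move: t1b t2b qT q0; clear; lra.
have s3 := sub _ _ (ltW t20) h5.
have [||||t3 [/andP[t3a t3b] X3 Y3]] := @quarter_turn R (fun t => - X t) (fun t => - Y t)
  (fun t => - dX t) (fun t => - dY t) t2 (t2 + q) M om
  (fun t H => is_derive_opp (DX t (s3 t H))) (fun t H => is_derive_opp (DY t (s3 t H))) _ om0 _ M0 X2.
- by move=> t /s3/XY; rewrite !sqrrN.
- by move=> t /s3/Hom; congr (_ <= _); ring.
- by rewrite Y2 oppr0 opprK -oppr_ge0 ltW.
- by [].
have t30 : 0 < t3 by exact: lt_trans t3a.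
have h6 : t3 + q <= T by move: t1b t2b t3b qT q0; clear; lra.
have s4 := sub _ _ (ltW t30) h6.
have [||||t4 [/andP[t4a t4b] Y4 X4]] := @quarter_turn R (fun t => - Y t) X
  (fun t => - dY t) dX t3 (t3 + q) M om
  (fun t H => is_derive_opp (DY t (s4 t H))) (fun t H => DX t (s4 t H)) _ om0 _ M0 Y3.
- by move=> t /s4/XY; rewrite sqrrN addrC.
- by move=> t /s4/Hom; congr (_ <= _); ring.
- by move/eqP: X3; rewrite oppr_eq0 opprK => /eqP ->; rewrite -oppr_ge0 ltW.
- by [].
exists t2, t4; split.
- by rewrite ltW// ltW// (lt_trans t3a).
- by move: t1b t2b t3b t4b; clear; lra.
- split=> //; first by rewrite -oppr_gt0.
  by apply/eqP; rewrite -oppr_eq0 Y4.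
Qed.

Lemma unit_speed_le (g dg : R -> 'rV[R]_3) (T : R) (u : 'rV[R]_3) :
  (forall t : R, 0 <= t <= T -> is_derive t 1 g (dg t)) ->
  (forall t, 0 <= t <= T -> dotp (dg t) (dg t) = 1) -> dotp u u = 1 ->
  forall s t, 0 <= s -> s <= t -> t <= T -> `|dotp u (g t - g s)| <= t - s.
Proof.
move=> Dg g1 u1 s t s0 st tT.
have D (x : R) : s <= x <= t -> is_derive x 1 (fun y => dotp u (g y - g s)) (dotp u (dg x)).
  move=> /andP[h1 h2]; apply: is_derive_dotp_cst; apply: Dg.
  by rewrite (le_trans s0 h1) (le_trans h2 tT).
have cth : {within `[s, t], continuous (fun y => dotp u (g y - g s))}.
  by apply: derivable_within_continuous => x; rewrite in_itv/= => /D[].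
have Doo (x : R) : x \in `]s, t[%R -> is_derive x 1 (fun y => dotp u (g y - g s)) (dotp u (dg x)).
  by rewrite in_itv/= => /andP[/ltW h1 /ltW h2]; apply: D; rewrite h1.
have [x xab] := MVT_segment st Doo cth.
rewrite subrr (dotpC u 0) dotp0l subr0 => ->.
rewrite normrM (ger0_norm (_ : 0 <= t - s)) ?subr_ge0// ler_piMl ?subr_ge0//.
apply: dotp_unit_le1 => //; apply: g1; move: xab; rewrite in_itv/= => /andP[h1 h2].
by rewrite (le_trans s0 h1) (le_trans h2 tT).
Qed.

Lemma half_sq (x : R) : 1 / 2 <= x ^+ 2 -> 1 / 2 <= `|x|.
Proof.
move=> h; rewrite leNgt; apply/negP => h2.
have : `|x| * `|x| < 1 / 2 * (1 / 2) by apply: ltr_pM.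
by rewrite -expr2 real_normK ?num_real//; move: h; clear; lra.
Qed.

Lemma same_sign_near (a b : R) : 1 / 2 <= `|a| -> `|a - b| <= 1 / 4 -> 0 < b * a.
Proof.
move=> h1; rewrite ler_norml => /andP[h2 h3]; have [a0|a0] := leP 0 a.
  by rewrite ger0_norm// in h1; apply: mulr_gt0; lra.
by rewrite ltr0_norm// in h1; rewrite nmulr_rgt0; lra.
Qed.

Lemma le_dist_min_max (s t x d : R) : `|s - t| < d ->
  Num.min s t <= x <= Num.max s t -> `|x - t| < d.
Proof.
rewrite ge_min le_max !ltr_distl => /andP[h1 h2].
by move=> /andP[/orP[h3|h3] /orP[h4|h4]]; apply/andP; split; lra.
Qed.

(** (X, Y) and (a, b) are the plane coordinates of a point and of a point
    of the circle at distance at most e. *)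
Lemma circle_bounds (X Y a b e rho : R) : 0 < rho -> 0 < e -> e <= rho / 24 ->
  a ^+ 2 + b ^+ 2 = rho ^+ 2 -> `|X - a| <= 3 * e -> `|Y - b| <= 3 * e ->
  0 < X ^+ 2 + Y ^+ 2 <= 4 * rho ^+ 2 /\
  (Y = 0 -> 0 < X -> `|X - rho| <= 7 * e /\ rho / 2 <= X).
Proof.
move=> r0 e0 er ab Xa Yb.
have ha : `|a| <= rho.
  by rewrite -(@ler_pXn2r _ 2) ?nnegrE ?(ltW r0)// real_normK ?num_real// -ab lerDl sqr_ge0.
have hb : `|b| <= rho.
  by rewrite -(@ler_pXn2r _ 2) ?nnegrE ?(ltW r0)// real_normK ?num_real// -ab lerDr sqr_ge0.
have XE : X ^+ 2 = a ^+ 2 + 2 * (a * (X - a)) + (X - a) ^+ 2 by ring.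
have YE : Y ^+ 2 = b ^+ 2 + 2 * (b * (Y - b)) + (Y - b) ^+ 2 by ring.
have re : rho * e <= rho ^+ 2 / 24 by have := ler_wpM2l (ltW r0) er; rewrite mulrA -expr2.
have ee : e ^+ 2 <= rho * e / 24 by have := ler_wpM2l (ltW e0) er; rewrite expr2; lra.
have re0 : 0 < rho * e by rewrite mulr_gt0.
have bnd x d : `|x| <= rho -> `|d| <= 3 * e -> `|x * d| <= 3 * (rho * e) /\ 0 <= d ^+ 2 <= 9 * e ^+ 2.
  move=> h1 h2; split; first by rewrite normrM; have := ler_pM (normr_ge0 _) (normr_ge0 _) h1 h2; lra.
  rewrite sqr_ge0 /= -(real_normK (num_real d)).
  have := ler_pM (normr_ge0 _) (normr_ge0 _) h2 h2; rewrite !expr2; lra.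
have [] := bnd _ _ ha Xa; rewrite ler_norml => /andP[h1 h2] /andP[h3 h4].
have [] := bnd _ _ hb Yb; rewrite ler_norml => /andP[h5 h6] /andP[h7 h8].
have rr : 0 < rho ^+ 2 by rewrite exprn_gt0.
split; first by apply/andP; split; lra.
move=> Y0 X0; rewrite Y0 in h5 h6 h7 h8 Yb.
have b2 : 0 <= b ^+ 2 <= 9 * e ^+ 2.
  rewrite sqr_ge0 /=; move: Yb; rewrite sub0r normrN => hb2.
  rewrite -(real_normK (num_real b)).
  have := ler_pM (normr_ge0 _) (normr_ge0 _) hb2 hb2; rewrite !expr2; lra.
have {b2}[b20 b2] := andP b2.
have E1 : (X - rho) * (X + rho) = X ^+ 2 - rho ^+ 2 by ring.
have h9 : `|(X - rho) * (X + rho)| <= 7 * e * rho.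
  by rewrite E1 ler_norml; apply/andP; split; lra.
have h10 : `|X - rho| <= 7 * e.
  rewrite -(ler_pM2r r0); apply: le_trans h9; rewrite normrM ler_wpM2l//.
  by rewrite gtr0_norm ?addr_gt0// lerDr ltW.
by split=> //; move: h10; rewrite ler_norml => /andP[h11 _]; lra.
Qed.

End FullTurn.

Section Revolution.
Variables (R : realType) (o n : 'rV[R]_3) (rho : R).
Hypothesis nn : dotp n n = 1.
Hypothesis rho0 : 0 < rho.
Let J := rotf o n rho.
Let Gam := circle o n rho.
Variables (g dg : R -> 'rV[R]_3) (T e : R).
Hypothesis Dg : forall t : R, 0 <= t <= T -> is_derive t 1 g (dg t).
Hypothesis g1 : forall t, 0 <= t <= T -> dotp (dg t) (dg t) = 1.
Hypothesis transv : forall t, 0 <= t <= T -> 1 / 2 <= dotp (dg t) (J (g t)) ^+ 2.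

(** The speed of a leaf along the circle never vanishes; by Darboux's theorem,
    its sign is constant even though the velocity is not known to be
    continuous. *)
Lemma turning_sign (t : R) : 0 <= t <= T ->
  0 < dotp (dg t) (J (g t)) * dotp (dg 0) (J (g 0)).
Proof.
move=> tT; apply: (@locally_signed R 0 T (fun t => dotp (dg t) (J (g t)))) tT => {}t tT.
have cg : cont_on 0 T g by apply: derive_cont_on => s /Dg[].
have r24 : 0 < rho / 24 by rewrite divr_gt0.
have [d d0 Hd] := cg _ tT _ r24.
exists d => // s sT sd.
pose psi y := dotp (J (g t)) (g y - 0).
have close x : 0 <= x <= T -> `|x - t| < d ->
    0 < dotp (J (g t)) (dg x) * dotp (dg x) (J (g x)).
  move=> xT xd; rewrite (dotpC (J (g t))).
  have h := half_sq (transv xT).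
  have h2 : `|dotp (dg x) (J (g x)) - dotp (dg x) (J (g t))| <= 1 / 4.
    rewrite -dotpBr; apply: le_trans (dotp_le3 (unit_norm_le1 (g1 xT)) (rotf_lip o nn rho0 (g x) (g t))) _.
    have -> : 1 / 4 = 3 * 1 * (2 / rho * (rho / 24)) :> R by field; rewrite gt_eqF.
    have p2 : 0 <= 2 / rho by rewrite divr_ge0// ltW.
    by rewrite ler_pM2l// ler_wpM2l// ltW// Hd.
  exact: same_sign_near h h2.
have DP (x : R) : Num.min s t <= x <= Num.max s t -> 0 <= x <= T /\ `|x - t| < d.
  move=> h; split; last exact: le_dist_min_max h.
  move: sT tT h; rewrite ge_min le_max => /andP[s0 sT] /andP[t0 tT].
  by move=> /andP[/orP[h3|h3] /orP[h4|h4]]; apply/andP; split;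
      solve [exact: (le_trans _ h3) | exact: (le_trans h4)].
have mM : Num.min s t <= Num.max s t by rewrite ge_min !le_max lexx.
have := @darboux_sign R psi (fun x => dotp (J (g t)) (dg x)) _ _ mM.
have Dp (x : R) : Num.min s t <= x <= Num.max s t -> is_derive x 1 psi (dotp (J (g t)) (dg x)).
  by move=> /DP[xT _]; apply: is_derive_dotp_cst; exact: Dg.
move=> /(_ Dp) H.
have {}H : 0 < dotp (J (g t)) (dg s) * dotp (J (g t)) (dg t).
  have : 0 < dotp (J (g t)) (dg (Num.min s t)) * dotp (J (g t)) (dg (Num.max s t)).
    apply: H => x /DP[xT xd]; have := close _ xT xd.
    by apply: contraTneq => ->; rewrite mul0r ltxx.
  rewrite /Num.min /Num.max; case: ifP => // _; last by rewrite mulrC.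
have c1 := close _ sT sd.
move: H c1; rewrite (dotpC (J _) (dg t)); move: (dotp (J (g t)) _) => a.
move: (dotp (dg t) _) (dotp (dg s) _) => b f h1 h2.
have a0 : a != 0 by apply: contraTneq h2 => ->; rewrite mul0r ltxx.
have aa : 0 < a ^+ 2 by rewrite exprn_even_gt0.
by rewrite -(pmulr_rgt0 _ aa); have := mulr_gt0 h1 h2; congr (0 < _); ring.
Qed.

(** The speed along the circle is bounded away from 0 with a constant
    sign. *)
Lemma turning_bound : 0 <= T -> exists2 sg : R, sg * sg = 1 &
  forall t : R, 0 <= t <= T -> 1 / 2 <= sg * dotp (dg t) (J (g t)).
Proof.
move=> T0; pose D t := dotp (dg t) (J (g t)).
exists (if 0 < D 0 then 1 else -1); first by case: ifP => _; ring.
move=> t tT; have h1 := turning_sign tT; have := half_sq (transv tT).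
rewrite -/(D t) -/(D 0) in h1 *; case: ifPn => [h|].
  have h2 : 0 < D t by rewrite -(pmulr_lgt0 _ h).
  by rewrite (mul1r (D t)) gtr0_norm.
rewrite -leNgt le_eqVlt => /orP[/eqP h|h]; first by rewrite h mulr0 ltxx in h1.
have h2 : D t < 0 by rewrite -(nmulr_lgt0 _ h).
by rewrite mulN1r ltr0_norm.
Qed.

End Revolution.

Definition turn_time (R : realType) (rho : R) := 4 * (pi * (4 * rho ^+ 2) / (rho / 2)).

(** In the coordinates (X, Y) of the plane of the circle centred at o, the
    angular momentum of the curve is rho times its speed along the circle, so
    [full_turn] brings it back to the half-axis of p0.  The lower bound on the
    time keeps this return apart from the start. *)
Lemma revolution (R : realType) (o n : 'rV[R]_3) (rho : R)
    (g dg : R -> 'rV[R]_3) (T e : R) (p0 : 'rV[R]_3) :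
  dotp n n = 1 -> 0 < rho ->
  (forall t : R, 0 <= t <= T -> is_derive t 1 g (dg t)) ->
  (forall t : R, 0 <= t <= T -> dotp (dg t) (dg t) = 1) ->
  (forall t : R, 0 <= t <= T -> 1 / 2 <= dotp (dg t) (rotf o n rho (g t)) ^+ 2) ->
  0 < e -> e <= rho / 24 ->
  (forall t : R, 0 <= t <= T -> near_circle o n rho e (g t)) ->
  circle o n rho p0 -> turn_time rho <= T -> `|g 0 - p0| <= rho / 24 ->
  exists t, [/\ rho <= t, t <= turn_time rho & `|g t - p0| <= 10 * e].
Proof.
move=> nn rho0 Dg g1 transv e0 e_le Hn Gp0 TT g0.
pose J := rotf o n rho.
have M0 : 0 < 4 * rho ^+ 2 by rewrite mulr_gt0// exprn_gt0.
have om0 : 0 < rho / 2 by rewrite divr_gt0.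
have tt0 : 0 < turn_time rho.
  by rewrite /turn_time mulr_gt0// divr_gt0// mulr_gt0// pi_gt0.
have T0 : 0 <= T by rewrite (le_trans _ TT)// ltW.
have T00 : 0 <= (0 : R) <= T by rewrite lexx.
have [np op] : dotp n (p0 - o) = 0 /\ dotp (p0 - o) (p0 - o) = rho ^+ 2 by case: Gp0.
have [A AE] : exists A, A = rho^-1 *: (p0 - o) by exists (rho^-1 *: (p0 - o)).
have [B BJ] : exists B, B = J p0 by exists (J p0).
have AA : dotp A A = 1 by rewrite AE dotpZl dotpZr op; field; rewrite gt_eqF.
have nA : dotp n A = 0 by rewrite AE dotpZr np mulr0.
have BE : B = crossp n A by rewrite AE crosspZr BJ.
have on := orthonormal3_crossp nn AA nA; rewrite -BE in on.
have [_ _ BB _ nB AB] := on.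
have nxB : crossp n B = - A by rewrite BE crossp_crossp nA nn scale0r sub0r scale1r.
have nxn : crossp n n = 0 by apply: row3P; rewrite !mxE /=; ring.
have Jz z : crossp n z = dotp z A *: B - dotp z B *: A.
  rewrite {1}(orthonormal3_expand z on) !crosspDr !crosspZr -BE nxB nxn.
  by rewrite scaler0 add0r scalerN.
have JE v x : rho * dotp v (J x) = dotp A (x - o) * dotp B v - dotp B (x - o) * dotp A v.
  rewrite (_ : J x = rho^-1 *: crossp n (x - o))// dotpZr mulrA divff ?gt_eqF// mul1r Jz (dotpBr _ _ v) !(dotpZr _ v).
  by rewrite (dotpC v B) (dotpC v A) (dotpC (x - o) A) (dotpC (x - o) B).
pose D t := dotp (dg t) (J (g t)).
have [sg sg2 sD] := turning_bound nn rho0 Dg g1 transv T0.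
have sgn : `|sg| = 1.
  by apply/eqP; rewrite -(@eqrXn2 _ 2)// real_normK ?num_real// expr1n expr2 sg2.
pose X t := dotp A (g t - o); pose Y t := sg * dotp B (g t - o).
have DX (t : R) : 0 <= t <= T -> is_derive t 1 X (dotp A (dg t)).
  by move=> tT; apply: is_derive_dotp_cst; exact: Dg.
have DY (t : R) : 0 <= t <= T -> is_derive t 1 Y (sg * dotp B (dg t)).
  move=> tT; have [d E] := is_deriveZ sg (is_derive_dotp_cst B o (Dg t tT)).
  by apply: DeriveDef; [exact: d|exact: E].
have coords (t : R) : 0 <= t <= T ->
   [/\ 0 < X t ^+ 2 + Y t ^+ 2 <= 4 * rho ^+ 2,
    (Y t = 0 -> 0 < X t -> `|X t - rho| <= 7 * e /\ rho / 2 <= X t),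
    (Y t = 0 -> X t < 0 -> X t <= - (rho / 2)) & `|dotp n (g t - o)| <= 3 * e].
  move=> tT; have [y [ny oy] gy] := Hn t tT.
  have le3 u : dotp u u = 1 -> `|dotp u (g t - o) - dotp u (y - o)| <= 3 * e.
    move=> uu; rewrite -dotpBr opprB addrA subrK.
    by have := dotp_le3 (unit_norm_le1 uu) (ltW gy); rewrite mulr1.
  have hY : `|Y t - sg * dotp B (y - o)| <= 3 * e.
    by rewrite -mulrBr normrM sgn mul1r; exact: le3.
  have ab : dotp A (y - o) ^+ 2 + (sg * dotp B (y - o)) ^+ 2 = rho ^+ 2.
    rewrite exprMn [sg ^+ 2]expr2 sg2 mul1r -oy (dotp_sq3 (y - o) on).
    by rewrite (dotpC _ n) ny !(dotpC (y - o)); ring.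
  have [h1 h2] := circle_bounds rho0 e0 e_le ab (le3 _ AA) hY.
  split=> //.
    move=> Y0 Xn.
    have ab' : (- dotp A (y - o)) ^+ 2 + (sg * dotp B (y - o)) ^+ 2 = rho ^+ 2.
      by rewrite sqrrN.
    have hX' : `|- X t - - dotp A (y - o)| <= 3 * e by rewrite -opprD normrN; exact: le3.
    have [_ h3] := circle_bounds rho0 e0 e_le ab' hX' hY.
    by have [] := h3 Y0; [rewrite oppr_gt0|move=> _; rewrite lerNr].
  by have := le3 _ nn; rewrite ny subr0.
have [h1 h2] : rho / 2 <= X 0 /\ `|Y 0| <= rho / 8.
  have le3 u : dotp u u = 1 -> `|dotp u (g 0 - o) - dotp u (p0 - o)| <= rho / 8.
    move=> uu; rewrite -dotpBr opprB addrA subrK.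
    have -> : rho / 8 = 3 * 1 * (rho / 24) by field.
    exact: dotp_le3 (unit_norm_le1 uu) g0.
  split; last first.
    have := le3 _ BB; rewrite (_ : dotp B (p0 - o) = 0) ?subr0; last first.
      by rewrite BJ (_ : J p0 = rho^-1 *: crossp n (p0 - o))// dotpZl dotp_crosspr mulr0.
    by rewrite /Y normrM sgn mul1r.
  have := le3 _ AA.
  have -> : dotp A (p0 - o) = rho by rewrite AE dotpZl op; field; rewrite gt_eqF.
  by rewrite ler_norml /X => /andP[h _]; move: h rho0; move: (dotp _ _) => x; clear; lra.
have Hom (t : R) : 0 <= t <= T -> rho / 2 <= X t * (sg * dotp B (dg t)) - Y t * dotp A (dg t).
  move=> tT; have -> : X t * (sg * dotp B (dg t)) - Y t * dotp A (dg t) = rho * (sg * D t).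
    by rewrite [RHS]mulrCA JE /X /Y; ring.
  have -> : rho / 2 = rho * (1 / 2) by ring.
  by rewrite ler_pM2l// sD.
have XY (t : R) (tT : 0 <= t <= T) : 0 < X t ^+ 2 + Y t ^+ 2 <= 4 * rho ^+ 2 by have [] := coords _ tT.
have X00 : 0 < X 0 by exact: lt_le_trans h1.
have Y00 : - X 0 <= Y 0.
  by move: h1 h2; rewrite ler_norml => h1 /andP[h2 _]; move: h1 h2 rho0; move: (X 0) (Y 0) => x y; clear; lra.
have [t2 [t4 [/andP[t20 t24] t4T [X2 Y2 X4 Y4]]]] := full_turn DX DY XY om0 Hom M0 X00 Y00 TT.
have t4T' : t4 <= T by exact: le_trans TT.
have t4b : 0 <= t4 <= T by rewrite (le_trans t20).
have t2b : 0 <= t2 <= T by rewrite t20 (le_trans t24).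
have [_ _ /(_ Y2 X2) h3 _] := coords _ t2b.
have [_ /(_ Y4 X4)[h4 h5] _ h6] := coords _ t4b.
exists t4; split=> //.
  have := unit_speed_le Dg g1 AA t20 t24 t4T'.
  have -> : g t4 - g t2 = (g t4 - o) - (g t2 - o) by rewrite opprB addrA subrK.
  rewrite dotpBr -/(X t4) -/(X t2) ler_norml => /andP[_].
  by move: h3 h5 t20; move: (X t2) (X t4) => x y; clear; lra.
have -> : g t4 - p0 = dotp n (g t4 - o) *: n + (X t4 - rho) *: A.
  have -> : g t4 - p0 = (g t4 - o) - rho *: A.
    by rewrite AE scalerA divff ?gt_eqF// scale1r opprB addrA subrK.
  rewrite {1}(orthonormal3_expand (g t4 - o) on).
  have -> : dotp (g t4 - o) B = 0.
    rewrite dotpC; move: Y4 => /eqP; rewrite mulf_eq0 => /orP[/eqP h|/eqP //].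
    by move: sg2; rewrite h mul0r => /eqP; rewrite eq_sym oner_eq0.
  by rewrite scale0r addr0 !(dotpC (g t4 - o)) scalerBl addrA.
rewrite (le_trans (ler_normD _ _))// !normrZ.
have := ler_pM (normr_ge0 _) (normr_ge0 _) h6 (unit_norm_le1 nn).
have := ler_pM (normr_ge0 _) (normr_ge0 _) h4 (unit_norm_le1 AA).
by rewrite !mulr1 => i1 i2; apply: le_trans (lerD i2 i1) _; rewrite -mulrDl le_eqVlt; apply/orP; left; apply/eqP; congr (_ * _); ring.
Qed.

(** * Transverse sections of the foliation *)

Section CurveBounds.
Variable R : realType.

Lemma mvt_le (f df : R -> R) (a b C : R) :
  (forall t : R, a <= t <= b -> is_derive t 1 f (df t)) ->
  (forall t, a <= t <= b -> `|df t| <= C) ->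
  forall s t, a <= s <= b -> a <= t <= b -> `|f t - f s| <= C * `|t - s|.
Proof.
move=> Df dC; have H s t : a <= s -> s <= t -> t <= b -> `|f t - f s| <= C * `|t - s|.
  move=> as_ st tb.
  have D (x : R) : s <= x <= t -> a <= x <= b.
    by move=> /andP[h1 h2]; rewrite (le_trans as_ h1) (le_trans h2 tb).
  have cth : {within `[s, t], continuous f}.
    by apply: derivable_within_continuous => x; rewrite in_itv/= => /D/Df[].
  have Doo (x : R) : x \in `]s, t[%R -> is_derive x 1 f (df x).
    by rewrite in_itv/= => /andP[/ltW h1 /ltW h2]; apply/Df/D; rewrite h1.
  have [x] := MVT_segment st Doo cth.
  by rewrite in_itv/= => /D xab ->; rewrite normrM ler_wpM2r// dC.
move=> s t /andP[s1 s2] /andP[t1 t2]; have [st|/ltW st] := leP s t; first exact: H.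
by rewrite distrC (distrC t); exact: H.
Qed.

Lemma curve_lipschitz n (g dg : R -> 'rV[R]_n) (a b C : R) : 0 <= C ->
  (forall t : R, a <= t <= b -> is_derive t 1 g (dg t)) ->
  (forall t, a <= t <= b -> `|dg t| <= C) ->
  forall s t, a <= s <= b -> a <= t <= b -> `|g t - g s| <= C * `|t - s|.
Proof.
move=> C0 Dg dC s t sab tab; apply: norm_le_coord => [|j]; first exact: mulr_ge0.
rewrite !mxE; apply: (@mvt_le (fun x => g x 0 j) (fun x => dg x 0 j) a b) => // x xab.
  exact: is_derive_coord (Dg _ xab).
by rewrite (le_trans (coord_le_norm _ _))// dC.
Qed.

Lemma straddle (be t x y b : R) : `|x - t * be| <= `|be| / 2 * t ->
  `|y - - t * be| <= `|be| / 2 * t -> `|b| <= `|be| * t / 2 ->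
  Num.min y x <= b <= Num.max y x.
Proof.
rewrite !ler_norml => /andP[h1 h2] /andP[h3 h4] /andP[h5 h6].
have [be0|be0] := leP 0 be.
  rewrite ger0_norm// in h1 h2 h3 h4 h5 h6.
  by rewrite ge_min le_max; apply/andP; split; apply/orP; [left|right]; move: h1 h2 h3 h4 h5 h6; clear; lra.
rewrite ltr0_norm// in h1 h2 h3 h4 h5 h6.
by rewrite ge_min le_max; apply/andP; split; apply/orP; [right|left]; move: h1 h2 h3 h4 h5 h6; clear; lra.
Qed.

(** Inverse function theorem for the u0-coordinate of sigma: its derivative
    stays within half of its value at 0, so it is bi-Lipschitz near 0. *)
Lemma transverse_section (sigma : R -> 'rV[R]_3) (delta : R) (u0 : 'rV[R]_3) :
  0 < delta -> (forall t : R, - delta <= t <= delta ->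
    derivable sigma t 1 /\ {for t, continuous (derive1 sigma)}) ->
  dotp u0 (derive1 sigma 0) != 0 ->
  exists b1 C : R, [/\ 0 < b1, 0 < C & exists th : R -> R,
    (forall b, `|b| <= b1 -> `|th b| <= delta /\ dotp u0 (sigma (th b) - sigma 0) = b) /\
    (forall b b', `|b| <= b1 -> `|b'| <= b1 ->
      `|sigma (th b) - sigma (th b')| <= C * `|b - b'|) /\ th 0 = 0].
Proof.
move=> delta0 Hs; set be := dotp u0 _ => be0.
have ab0 : 0 < `|be| by rewrite normr_gt0.
have Ds (t : R) : - delta <= t <= delta -> is_derive t 1 sigma (derive1 sigma t).
  by move=> /Hs[d _]; rewrite derive1E; apply: DeriveDef.
have d00 : - delta <= 0 <= delta by rewrite oppr_le0 ltW.
pose K := 3 * `|u0| + 1.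
have K0 : 0 < K by rewrite ltr_wpDl// mulr_ge0.
have m0 : 0 < Num.min 1 (`|be| / (2 * K)) by rewrite lt_min ltr01 divr_gt0// mulr_gt0.
have [d d0 Hd] := for_continuous_eps (Hs _ d00).2 m0.
pose t1 := Num.min delta (d / 2).
have t10 : 0 < t1 by rewrite lt_min delta0 divr_gt0.
have in_delta t : `|t| <= t1 -> - delta <= t <= delta.
  by rewrite le_min => /andP[+ _]; rewrite ler_norml.
have close t : `|t| <= t1 -> `|derive1 sigma t - derive1 sigma 0| < Num.min 1 (`|be| / (2 * K)).
  rewrite le_min => /andP[_ h]; apply: Hd; rewrite subr0 (le_lt_trans h)//.
  by rewrite ltr_pdivrMr// ltr_pMr// ltr1n.
pose C1 := `|derive1 sigma 0| + 1.
have C10 : 0 < C1 by rewrite ltr_wpDl.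
have dC t : `|t| <= t1 -> `|derive1 sigma t| <= C1.
  move=> /close; rewrite lt_min => /andP[h _].
  have -> : derive1 sigma t = derive1 sigma 0 + (derive1 sigma t - derive1 sigma 0).
    by rewrite addrC subrK.
  by rewrite (le_trans (ler_normD _ _))// lerD2l ltW.
have fC t : `|t| <= t1 -> `|dotp u0 (derive1 sigma t) - be| <= `|be| / 2.
  move=> /close; rewrite lt_min => /andP[_ h].
  rewrite -dotpBr (le_trans (dotp_le _ _))//.
  have h2 : 3 * `|u0| <= K by rewrite lerDl.
  apply: (@le_trans _ _ (K * (`|be| / (2 * K)))); last first.
    by rewrite le_eqVlt; apply/orP; left; apply/eqP; field; rewrite gt_eqF.
  by rewrite ler_pM ?mulr_ge0// ltW.
pose f t := dotp u0 (sigma t - sigma 0).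
have Df (t : R) : - t1 <= t <= t1 -> is_derive t 1 f (dotp u0 (derive1 sigma t)).
  by rewrite -ler_norml => tt; apply/is_derive_dotp_cst/Ds/in_delta.
have est s t : `|s| <= t1 -> `|t| <= t1 ->
    `|f t - f s - (t - s) * be| <= `|be| / 2 * `|t - s|.
  move=> s1 t1'.
  have H := @mvt_le (fun t => f t - t * be) (fun t => dotp u0 (derive1 sigma t) - be) (- t1) t1 (`|be| / 2).
  have -> : (f t - f s) - (t - s) * be = f t - t * be - (f s - s * be) by ring.
  apply: H; [move=> x xt|by move=> x; rewrite -ler_norml; exact: fC|by rewrite -ler_norml|by rewrite -ler_norml].
  have Dl : is_derive x 1 (fun t : R => t * be) be.
    have [d1 E] := is_deriveM (is_derive_id x (1 : R)) (is_derive_cst be x (1 : R)).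
    by apply: DeriveDef; [exact: d1|apply: etrans E _; rewrite scaler0 add0r; exact: mulr1].
  exact: is_deriveB (Df _ xt) Dl.
have lower s t : `|s| <= t1 -> `|t| <= t1 ->
    (`|be| / 2) * `|t - s| <= `|f t - f s|.
  move=> s1 t1'; have := est _ _ s1 t1'; rewrite distrC.
  move=> h; have h2 := lerB_dist ((t - s) * be) (f t - f s).
  have := le_trans h2 h; rewrite normrM (mulrC `|t - s|).
  move: `|t - s| `|f t - f s| => x z; move: `|be| => k; clear; lra.
pose b1 := `|be| * t1 / 2.
have b10 : 0 < b1 by rewrite divr_gt0// mulr_gt0.
have ex b : `|b| <= b1 -> exists t, `|t| <= t1 /\ f t = b.
  move=> bb; have tt : - t1 <= t1 by rewrite ge0_cp// ltW.
  have cf : {within `[- t1, t1], continuous f}.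
    by apply: derivable_within_continuous => x; rewrite in_itv/= => /Df[].
  have nt : `|t1| <= t1 by rewrite gtr0_norm.
  have nt' : `|- t1| <= t1 by rewrite normrN.
  have z0 : `|0 : R| <= t1 by rewrite normr0 ltW.
  have f0 : f 0 = 0 by rewrite /f subrr dotpC dotp0l.
  have sgns : Num.min (f (- t1)) (f t1) <= b <= Num.max (f (- t1)) (f t1).
    have e1 := est _ _ z0 nt; have e2 := est _ _ z0 nt'.
    rewrite f0 !subr0 normrN (gtr0_norm t10) in e1 e2.
    exact: straddle e1 e2 bb.
  have [t] := IVT tt cf sgns.
  by rewrite in_itv/= -ler_norml => t1'; exists t.
pose th b := if pselect (exists t, `|t| <= t1 /\ f t = b) is left H then projT1 (cid H) else 0.
have thP b : `|b| <= b1 -> `|th b| <= t1 /\ f (th b) = b.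
  move=> /ex h; rewrite /th; case: pselect => // H; by case: (cid H).
have thL b b' : `|b| <= b1 -> `|b'| <= b1 -> `|th b - th b'| <= 2 / `|be| * `|b - b'|.
  move=> /thP[h1 h2] /thP[h3 h4]; have := lower _ _ h3 h1; rewrite h2 h4.
  rewrite -(ler_pM2l (divr_gt0 (ltr0n _ 2) ab0)).
  apply: le_trans; rewrite le_eqVlt; apply/orP; left; apply/eqP; field; exact: lt0r_neq0.
exists b1, (C1 * (2 / `|be|)); split=> //; first by rewrite mulr_gt0// divr_gt0.
exists th; split; first by move=> b /thP[h ?]; split=> //; rewrite (le_trans h)// ge_min lexx.
split.
  move=> b b' bb bb'; have [h1 _] := thP _ bb; have [h3 _] := thP _ bb'.
  have : `|sigma (th b) - sigma (th b')| <= C1 * `|th b - th b'|.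
    apply: (@curve_lipschitz 3 sigma (derive1 sigma) (- t1) t1 C1 (ltW C10)); rewrite -?ler_norml//.
      by move=> x; rewrite -ler_norml => /in_delta/Ds.
    by move=> x; rewrite -ler_norml => /dC.
  move=> h; apply: (le_trans h); rewrite -mulrA ler_wpM2l ?(ltW C10)//; exact: thL.
have z0 : `|0 : R| <= b1 by rewrite normr0 ltW.
have z1 : `|0 : R| <= t1 by rewrite normr0 ltW.
have [h1 h2] := thP _ z0; have := lower _ _ z1 h1.
rewrite h2 /f subrr (dotpC u0) dotp0l subrr normr0 subr0.
rewrite pmulr_rle0 ?divr_gt0// normr_le0 => /eqP //.
Qed.

End CurveBounds.

Section SurfaceAtPoint.
Variables (R : realType) (r : nat).
Hypothesis r3 : (3 <= r)%N.
Variable S : oriented_surface R r.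
Let N := normal S.

Lemma dotp_sq_eq0 (u : 'rV[R]_3) : dotp u u = 0 -> u = 0.
Proof. by move/eqP; rewrite dotp_eq0 => /eqP. Qed.

Lemma eq_le_norm (x y : R) : x = y -> `|y| <= `|x|.
Proof. by move=> ->. Qed.

(** In a chart a chord is the image of a vector by the differential up to
    o(|x - y|), and that image is tangent. *)
Lemma surface_flat (p0 : 'rV[R]_3) (eps : R) : carrier S p0 -> 0 < eps ->
  exists2 d : R, 0 < d & forall x y, carrier S x -> carrier S y ->
    `|x - p0| < d -> `|y - p0| < d -> `|dotp (N p0) (x - y)| <= eps * `|x - y|.
Proof.
move=> Sp eps0; have [U [X [q0 [ch Uq Xq]]]] := surface_charts Sp.
have r1 : (0 < r)%N by rewrite (leq_trans _ r3).
have [K [d1 [K0 d10 Hlow]]] := chart_lower r1 ch Uq.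
have [oU /class_CE CX injX _] := ch.
have [dX cX] := Ck_le r1 CX.
have e0 : 0 < eps / (3 * K) by rewrite divr_gt0// mulr_gt0.
have nX : \forall y \near q0, differentiable X y.
  have [d2 d20 Hd2] := open_delta oU Uq.
  by apply/nbhs_deltaP; exists d2 => // y /Hd2; exact: dX.
have [d3 d30 Hs] := strict_diff nX (fun v => cX v _ Uq) e0.
have m0 : 0 < Num.min d1 d3 by rewrite lt_min d10.
have [d d0 Hd] := chart_near ch Uq m0.
exists d => // x y Sx Sy; rewrite -Xq => xd yd.
have [q [Uq1 <- q1]] := Hd _ Sx xd; have [q' [Uq1' <- q1']] := Hd _ Sy yd.
move: q1 q1'; rewrite !lt_min => /andP[a1 a2] /andP[b1 b2].
have h1 := Hlow _ _ a1 b1; have h2 := Hs _ _ a2 b2.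
have NX : dotp (N (X q0)) ('d X q0 (q - q')) = 0 by exact: (normal_orthogonal ch Uq).
have NN : dotp (N (X q0)) (N (X q0)) = 1 by apply: normal_unit; rewrite Xq.
have NE : dotp (N (X q0)) (X q - X q' - 'd X q0 (q - q')) = dotp (N (X q0)) (X q - X q').
  apply: etrans (dotpBr _ _ _) _.
  by apply: etrans (congr1 (fun z => dotp (N (X q0)) (X q - X q') - z) NX) _; exact: subr0.
have h3 := le_trans h2 (ler_wpM2l (ltW e0) h1).
have h4 := dotp_le3 (unit_norm_le1 NN) h3.
have {NE} h5 := le_trans (eq_le_norm NE) h4.
apply: le_trans h5 _.
by rewrite le_eqVlt; apply/orP; left; apply/eqP; field; exact: lt0r_neq0.
Qed.

Lemma curve_tangent (g : R -> 'rV[R]_3) (t : R) (v : 'rV[R]_3) :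
  (\forall s \near t, carrier S (g s)) -> is_derive t 1 g v -> dotp (N (g t)) v = 0.
Proof.
move=> gS gv; have r1 : (0 < r)%N by rewrite (leq_trans _ r3).
have [U [X [q0 [ch Uq Xq]]]] := surface_charts (nbhs_singleton gS).
have [p [a [_ _ <- _ _]]] := chart_lift r1 ch Uq (esym Xq) gS gv.
by rewrite -Xq; exact: (normal_orthogonal ch Uq).
Qed.

(** If v' had a component along N x v, comparing eigenvalues in both frames
    would exchange the two principal curvatures, which are ordered. *)
Lemma principal_unique (max : bool) (x v v' : 'rV[R]_3) :
  principal_direction max S x v -> principal_direction max S x v' ->
  v' = v \/ v' = - v.
Proof.
move=> pv pv'.
have [k [k2 [[Sx vv Nv sv su] ord]]] := principal_frame r3 pv.
have [k' [k2' [[_ vv' Nv' sv' su'] ord']]] := principal_frame r3 pv'.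
have NN : dotp (N x) (N x) = 1 by exact: normal_unit.
have on := orthonormal3_crossp NN vv Nv.
move: sv su sv' su' on; rewrite -/N; set u := crossp (N x) v => sv su sv' su' on.
have [_ _ uu _ Nu vu] := on.
have Ev : v' = dotp v' v *: v + dotp v' u *: u.
  by rewrite [LHS](orthonormal3_expand v' on) (dotpC v' (N x)) Nv' scale0r add0r.
move: Ev; set al := dotp v' v; set be := dotp v' u => Ev.
have nu : crossp (N x) u = - v.
  by rewrite /u crossp_crossp Nv NN scale0r sub0r scale1r.
have Eu : crossp (N x) v' = - be *: v + al *: u.
  by rewrite Ev crosspDr !crosspZr nu -/u scalerN scaleNr addrC.
have ab : al ^+ 2 + be ^+ 2 = 1.
  by rewrite -vv' Ev dotpDl !dotpZl !dotpDr !dotpZr vv uu (dotpC u v) vu; ring.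
have [U [X [q [ch Uq Xq]]]] := surface_charts Sx.
have lift (w : 'rV[R]_3) : dotp (N x) w = 0 -> exists a : 'rV[R]_2, 'd X q a = w.
  by move=> Nw; apply: (tangent_lift ch Uq); rewrite Xq.
have [a av] := lift v Nv; have [b bu] := lift u Nu.
have La := shape_chart r3 sv ch Uq Xq av. have Lb := shape_chart r3 su ch Uq Xq bu.
have comb (c d : R) w : shape_op S x (c *: v + d *: u) w ->
    w = c *: (- k *: v) + d *: (- k2 *: u).
  move=> sw; have E : 'd X q (c *: a + d *: b) = c *: v + d *: u.
    by apply: etrans (linear2 _ _ _ _ _) _; rewrite av bu.
  have <- := shape_chart r3 sw ch Uq Xq E.
  by apply: etrans (linear2 _ _ _ _ _) _; rewrite La Lb.
rewrite Ev in sv'; rewrite Eu in su'.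
have E1 := comb _ _ _ sv'; have E2 := comb _ _ _ su'.
have F1 := congr1 (fun z => dotp z u) E1; have F2 := congr1 (fun z => dotp z v) E2.
move: F1 F2; rewrite !(dotpDl, dotpZl) vv uu vu (dotpC u v) vu => F1 F2.
have be0 : be = 0.
  apply/eqP/negP => /negP be0.
  have k1 : k' = k2.
    by apply: (mulfI be0); move: F1; clear; lra.
  have k22 : k2' = k.
    by apply: (mulfI be0); move: F2; clear; lra.
  move: ord ord'; rewrite k1 k22; case: (max) => h1 h2;
    by have := lt_trans h1 h2; rewrite ltxx.
move: Ev ab; rewrite be0 scale0r addr0 expr0n addr0 => -> /eqP.
rewrite sqrf_eq1 => /orP[/eqP ->|/eqP ->]; first by left; rewrite scale1r.
by right; rewrite scaleN1r.
Qed.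

End SurfaceAtPoint.

(** * Leaves that pass near the cycle cross the transversal *)

Lemma cont_on_dist (R : realType) (a b : R) (V : normedModType R) (f : R -> V) (C : R) :
  0 < C -> (forall s t, a <= s <= b -> a <= t <= b -> `|f s - f t| <= C * `|s - t|) ->
  cont_on a b f.
Proof.
move=> C0 H t tab e e0; exists (e / C) => [|s sab]; first by rewrite divr_gt0.
by rewrite ltr_pdivlMr// mulrC; apply: le_lt_trans; exact: H.
Qed.

Lemma mvt_growth (R : realType) (f df : R -> R) (a b k : R) : a <= b ->
  (forall t : R, a <= t <= b -> is_derive t 1 f (df t)) ->
  (forall t, a <= t <= b -> k <= df t) -> k * (b - a) <= f b - f a.
Proof.
move=> ab Df dk.
have cth : {within `[a, b], continuous f}.
  by apply: derivable_within_continuous => x; rewrite in_itv/= => /Df[].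
have Doo (x : R) : x \in `]a, b[%R -> is_derive x 1 f (df x).
  by rewrite in_itv/= => /andP[/ltW h1 /ltW h2]; apply: Df; rewrite h1.
have [x] := MVT_segment ab Doo cth.
by rewrite in_itv/= => xab ->; rewrite ler_wpM2r ?subr_ge0// dk.
Qed.

Lemma chord (R : realType) (rho : R) (P Q : 'rV[R]_3) : 0 < rho ->
  dotp P P = rho ^+ 2 -> dotp Q Q = rho ^+ 2 ->
  dotp (Q - P) (rho^-1 *: P) = - (dotp (Q - P) (Q - P) / (2 * rho)).
Proof.
move=> r0 PP QQ; rewrite dotpZr !(dotpBl, dotpBr) PP QQ (dotpC P Q).
by field; rewrite gt_eqF.
Qed.

(** r1 is the length of leaf that is followed on both sides, e1 the radius of
    the tube, and b1, C come from [transverse_section].  The quadratic term is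
    the height of the circle above its tangent. *)
Lemma crossing_constants (R : realType) (rho d0 C b1 rb : R) :
  0 < rho -> 0 < d0 -> 0 < C -> 0 < b1 -> 0 < rb ->
  exists r1 e1 : R, [/\ 0 < r1 <= rb, 0 < e1,
    [/\ 2 * r1 <= rho / 48, 4 * r1 <= d0 & 11 * e1 <= r1] &
    [/\ 3 * e1 + 2 / rho * (2 * r1) ^+ 2 <= b1,
        C * (3 * e1 + 2 / rho * (2 * r1) ^+ 2) < d0,
        3 * C * (3 * e1 + 2 / rho * (2 * r1) ^+ 2) <= r1 / 16 & 30 * e1 <= r1 / 16]].
Proof.
move=> rho0 d00 C0 b10 rb0.
pose sq : seq (R * R) := [:: (1, rb); (96, rho); (4, d0); (1, b1); (C, d0); (24 * (32 * C), rho)].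
have [r1 r10 H] : exists2 r1 : R, 0 < r1 & forall p, p \in sq -> r1 * p.1 <= p.2.
  by apply: small_ex => p; rewrite !inE => /or4P[/eqP->|/eqP->|/eqP->|/or3P[] /eqP->].
have h1 : r1 * 1 <= rb by apply: (H (1, rb)); rewrite !inE eqxx.
have h2 : r1 * 96 <= rho by apply: (H (96, rho)); rewrite !inE eqxx ?orbT.
have h3 : r1 * 4 <= d0 by apply: (H (4, d0)); rewrite !inE eqxx ?orbT.
have h4 : r1 * 1 <= b1 by apply: (H (1, b1)); rewrite !inE eqxx ?orbT.
have h5 : r1 * C <= d0 by apply: (H (C, d0)); rewrite !inE eqxx ?orbT.
have h6 : r1 * (24 * (32 * C)) <= rho by apply: (H (24 * (32 * C), rho)); rewrite !inE eqxx ?orbT.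
have r32 : 0 < r1 / 32 by rewrite divr_gt0.
pose sq' : seq (R * R) := [:: (11, r1); (30, r1 / 32); (9 * C, r1 / 32); (12 * C, d0); (6, b1)].
have [e1 e10 H'] : exists2 e1 : R, 0 < e1 & forall p, p \in sq' -> e1 * p.1 <= p.2.
  by apply: small_ex => p; rewrite !inE => /or4P[/eqP->|/eqP->|/eqP->|/orP[] /eqP->].
have k1 : e1 * 11 <= r1 by apply: (H' (11, r1)); rewrite !inE eqxx ?orbT.
have k2 : e1 * 30 <= r1 / 32 by apply: (H' (30, r1 / 32)); rewrite !inE eqxx ?orbT.
have k3 : e1 * (9 * C) <= r1 / 32 by apply: (H' (9 * C, r1 / 32)); rewrite !inE eqxx ?orbT.
have k4 : e1 * (12 * C) <= d0 by apply: (H' (12 * C, d0)); rewrite !inE eqxx ?orbT.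
have k5 : e1 * 6 <= b1 by apply: (H' (6, b1)); rewrite !inE eqxx ?orbT.
clear H H' sq sq'.
have [Q Q0] : exists Q, Q = 2 / rho * (2 * r1) ^+ 2 by exists (2 / rho * (2 * r1) ^+ 2).
have QE : Q = 8 * (r1 * (r1 / rho)) by rewrite Q0; field; rewrite gt_eqF.
have q0 : 0 <= r1 / rho by rewrite divr_ge0 ?ltW.
have q1 : r1 / rho <= 1 / 96 by rewrite ler_pdivrMr//; move: h2; clear; lra.
have q2 : C * (r1 / rho) <= 1 / (24 * 32).
  by rewrite mulrA ler_pdivrMr//; move: h6; clear; lra.
have Q1 : Q <= r1 / 12.
  have := ler_wpM2l (ltW r10) q1; rewrite QE.
  by move: (r1 * _) => x; clear; lra.
have Q2 : C * Q <= r1 / 96.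
  have := ler_wpM2l (ltW r10) q2.
  have -> : C * Q = 8 * (r1 * (C * (r1 / rho))) by rewrite QE; ring.
  by move: (r1 * (C * _)) => x; clear; lra.
have Q3 : C * Q <= r1 * C / 12 by have := ler_wpM2l (ltW C0) Q1; rewrite mulrA (mulrC C r1).
exists r1, e1; rewrite -Q0; clear Q0; split=> //.
- by rewrite r10; move: h1; rewrite mulr1.
- by split; [move: h2; clear; lra|move: h3; clear; lra|move: k1; clear; lra].
- have e1C : C * (3 * e1 + Q) = e1 * (12 * C) / 4 + C * Q by field.
  have e2C : 3 * C * (3 * e1 + Q) = e1 * (9 * C) + 3 * (C * Q) by ring.
  split.
  + by move: k5 Q1 h4 b10 r10; clear; lra.
  + by rewrite e1C; move: k4 Q3 h5 d00; clear; lra.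
  + by rewrite e2C; move: k3 Q2; clear; lra.
  + by move: k2 r10; clear; lra.
Qed.

Section Crossing.
Variables (R : realType) (S : set 'rV[R]_3) (o n : 'rV[R]_3) (rho : R).
Hypothesis nn : dotp n n = 1.
Hypothesis rho0 : 0 < rho.
Let J := rotf o n rho.
Variables (p0 N0 u0 : 'rV[R]_3).
Hypothesis Gp0 : circle o n rho p0.
Hypothesis frame : orthonormal3 N0 (J p0) u0.
Variable d0 : R.
Hypothesis d00 : 0 < d0.
Hypothesis flat0 : forall x y, S x -> S y -> `|x - p0| < d0 -> `|y - p0| < d0 ->
  `|dotp N0 (x - y)| <= 1 / 2 * `|x - y|.

(** A chord of the surface close to p0 is nearly tangent, so it vanishes when
    its tangential components do. *)
Lemma projection_inj x y : S x -> S y -> `|x - p0| < d0 -> `|y - p0| < d0 ->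
  dotp (J p0) (x - y) = 0 -> dotp u0 (x - y) = 0 -> x = y.
Proof.
move=> Sx Sy xd yd v u; have h := flat0 Sx Sy xd yd.
have E : x - y = dotp N0 (x - y) *: N0.
  rewrite {1}(orthonormal3_expand (x - y) frame) (dotpC _ (J p0)) v (dotpC _ u0) u !scale0r !addr0.
  by rewrite dotpC.
have N1 := unit_norm_le1 (on_uu frame).
have : `|x - y| <= `|dotp N0 (x - y)|.
  by rewrite {1}E normrZ ler_piMr.
move=> h2; have h3 := le_trans h2 h.
apply/eqP; rewrite -subr_eq0 -normr_le0.
by move: h3; move: `|x - y| => k; lra.
Qed.

(** The circle is tangent to [J p0] at [p0], hence quadratically close to
    the plane orthogonal to [u0]. *)
Lemma circle_height y : circle o n rho y ->
  `|dotp u0 (y - p0)| <= 2 / rho * `|y - p0| ^+ 2.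
Proof.
move=> Gy; have [np op] : dotp n (p0 - o) = 0 /\ dotp (p0 - o) (p0 - o) = rho ^+ 2 by case: Gp0.
have [ny oy] : dotp n (y - o) = 0 /\ dotp (y - o) (y - o) = rho ^+ 2 by case: Gy.
have [A AE] : exists A, A = rho^-1 *: (p0 - o) by exists (rho^-1 *: (p0 - o)).
have AA : dotp A A = 1 by rewrite AE dotpZl dotpZr op; field; rewrite gt_eqF.
have nA : dotp n A = 0 by rewrite AE dotpZr np mulr0.
have BE : J p0 = crossp n A by rewrite AE crosspZr.
have on := orthonormal3_crossp nn AA nA.
have yp : y - p0 = (y - o) - (p0 - o) by rewrite opprB addrA subrK.
have ynp : dotp (y - p0) n = 0 by rewrite dotpC yp dotpBr ny np subrr.
have u0B : dotp u0 (crossp n A) = 0 by rewrite -BE dotpC (on_vw frame).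
have yA : dotp (y - p0) A = - (dotp (y - p0) (y - p0) / (2 * rho)).
  by rewrite AE yp; exact: chord.
rewrite (dotp_frame_expand u0 (y - p0) on) ynp u0B mulr0 mul0r add0r addr0 yA.
have uA := dotp_unit_le1 (on_ww frame) AA.
rewrite mulrN normrN normrM.
apply: (@le_trans _ _ (1 * (2 / rho * `|y - p0| ^+ 2))); last by rewrite mul1r.
apply: ler_pM => //.
have dp : 0 <= dotp (y - p0) (y - p0) / (2 * rho) by rewrite divr_ge0 ?dotp_ge0// mulr_ge0// ltW.
rewrite (ger0_norm dp).
have h := dotp_le_norm_sq (y - p0).
rewrite ler_pdivrMr ?mulr_gt0//.
have -> : 2 / rho * `|y - p0| ^+ 2 * (2 * rho) = 4 * `|y - p0| ^+ 2.
  by field; rewrite gt_eqF.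
by apply: (le_trans h); rewrite ler_wpM2r ?sqr_ge0// ler_nat.
Qed.

Variables (sigma : R -> 'rV[R]_3) (delta : R).
Hypothesis sigma0 : sigma 0 = p0.
Hypothesis delta0 : 0 < delta.
Hypothesis Ds : forall t : R, - delta <= t <= delta ->
    derivable sigma t 1 /\ {for t, continuous (derive1 sigma)}.
Hypothesis Ss : forall t : R, - delta <= t <= delta -> S (sigma t).
Hypothesis tr : dotp u0 (derive1 sigma 0) != 0.

(** On the surface near p0 the leaf moves with a definite speed along J p0
    while its u0-coordinate stays small.  The point of sigma with the same
    u0-coordinate moves continuously and little, so the difference of the
    J p0-coordinates changes sign; at a zero both points agree by
    [projection_inj]. *)
Lemma crossing (rb : R) : 0 < rb -> exists r1 e1 : R, [/\ 0 < r1 <= rb, 0 < e1 &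
  forall (g dg : R -> 'rV[R]_3) (tau sg : R),
    (forall t : R, tau - r1 <= t <= tau + r1 -> is_derive t 1 g (dg t)) ->
    (forall t : R, tau - r1 <= t <= tau + r1 ->
      [/\ dotp (dg t) (dg t) = 1, S (g t), near_circle o n rho e1 (g t) &
          1 / 2 <= sg * dotp (dg t) (J (g t))]) ->
    sg * sg = 1 -> `|g tau - p0| <= 10 * e1 ->
    exists t s, [/\ tau - r1 <= t <= tau + r1, - delta <= s <= delta & sigma s = g t]].
Proof.
move=> rb0.
have [b1 [C [b10 C0 [th [thP [thL th0]]]]]] := transverse_section delta0 Ds tr.
have [r1 [e1 [r1b e10 [c1 c2 c3] [c4 c5 c6 c7]]]] := crossing_constants rho0 d00 C0 b10 rb0.
have [r10 r1rb] := andP r1b.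
exists r1, e1; split=> // g dg tau sg Dg Hg sg2 gt_.
have sgn : `|sg| = 1.
  by apply/eqP; rewrite -(@eqrXn2 _ 2)// real_normK ?num_real// expr1n expr2 sg2.
set a := tau - r1 in Dg Hg *; set b := tau + r1 in Dg Hg *.
have taub : a <= tau <= b by rewrite /a /b lerBlDr !lerDl ltW.
have ab : a <= b by case/andP: taub => /le_trans; apply.
have lip s t : a <= s <= b -> a <= t <= b -> `|g s - g t| <= `|s - t|.
  move=> sab tab; rewrite -[leRHS]mul1r.
  apply: (@curve_lipschitz R 3 g dg a b 1 ler01) => // x /Hg[h _ _ _]; exact: unit_norm_le1.
have gp t : a <= t <= b -> `|g t - p0| <= r1 + 10 * e1.
  move=> tab; have -> : g t - p0 = (g t - g tau) + (g tau - p0) by rewrite addrA subrK.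
  rewrite (le_trans (ler_normD _ _))// lerD// (le_trans (lip _ _ tab taub))//.
  by rewrite ler_distl.
have gd t : a <= t <= b -> `|g t - p0| < d0.
  by move=> /gp h; apply: (le_lt_trans h); move: c2 c3 r10; lra.
pose B t := dotp u0 (g t - p0).
have BB t : a <= t <= b -> `|B t| <= 3 * e1 + 2 / rho * (2 * r1) ^+ 2.
  move=> tab; have [_ _ [y Gy gy] _] := Hg _ tab.
  have -> : B t = dotp u0 (g t - y) + dotp u0 (y - p0).
    by rewrite -dotpDr addrA subrK.
  rewrite (le_trans (ler_normD _ _))// lerD//.
    by have := dotp_le3 (unit_norm_le1 (on_ww frame)) (ltW gy); rewrite mulr1.
  apply: (le_trans (circle_height Gy)); rewrite ler_wpM2l ?divr_ge0 ?(ltW rho0)//.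
  rewrite ler_pXn2r ?nnegrE// ?mulr_ge0 ?(ltW r10)//.
  have -> : y - p0 = (y - g t) + (g t - p0) by rewrite addrA subrK.
  rewrite (le_trans (ler_normD _ _))// distrC (le_trans (lerD (ltW gy) (gp _ tab)))//.
  by move: c3; lra.
set bm := 3 * e1 + _ in BB c4 c5 c6.
have Bb t : a <= t <= b -> `|B t| <= b1 by move=> /BB h; exact: le_trans c4.
have z0 : `|0 : R| <= b1 by rewrite normr0 ltW.
have sp t : a <= t <= b -> `|sigma (th (B t)) - p0| <= C * bm.
  move=> tab; have := thL _ _ (Bb _ tab) z0; rewrite th0 sigma0 subr0 => h.
  by apply: (le_trans h); rewrite ler_wpM2l ?BB// ltW.
have J1 := unit_norm_le1 (on_vv frame).
pose h t := sg * dotp (J p0) (g t - sigma (th (B t))).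
have ch : cont_on a b h.
  apply: (@cont_on_dist _ _ _ _ _ (3 * (1 + C * 3))); first by rewrite mulr_gt0// addr_gt0// mulr_gt0.
  move=> s t sab tab; rewrite /h -mulrBr normrM sgn mul1r -dotpBr.
  have -> : 3 * (1 + C * 3) * `|s - t| = 3 * 1 * ((1 + C * 3) * `|s - t|) by ring.
  apply: dotp_le3 J1 _.
  have -> : g s - sigma (th (B s)) - (g t - sigma (th (B t))) =
      (g s - g t) - (sigma (th (B s)) - sigma (th (B t))).
    by apply/rowP => i; rewrite !mxE; ring.
  rewrite (le_trans (ler_normB _ _))// mulrDl mul1r lerD ?lip//.
  apply: (le_trans (thL _ _ (Bb _ sab) (Bb _ tab))); rewrite -mulrA ler_wpM2l ?(ltW C0)//.
  rewrite /B -dotpBr opprB addrA subrK.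
  by have := dotp_le3 (unit_norm_le1 (on_ww frame)) (lip _ _ sab tab); rewrite mulr1.
have sig t : a <= t <= b -> `|dotp (J p0) (sigma (th (B t)) - p0)| <= r1 / 16.
  move=> tab; apply: le_trans c6.
  by have := dotp_le3 J1 (sp _ tab); rewrite mulr1 mulrA.
have grow s t : a <= s -> s <= t -> t <= b ->
    1 / 4 * (t - s) <= sg * dotp (J p0) (g t - p0) - sg * dotp (J p0) (g s - p0).
  move=> as_ st tb.
  have D (x : R) : s <= x <= t -> a <= x <= b.
    by move=> /andP[h1 h2]; rewrite (le_trans as_ h1) (le_trans h2 tb).
  apply: (@mvt_growth R (fun x => sg * dotp (J p0) (g x - p0)) (fun x => sg * dotp (J p0) (dg x))) => // x /D xab.
    have [d E] := is_deriveZ sg (is_derive_dotp_cst (J p0) p0 (Dg _ xab)).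
    by apply: DeriveDef; [exact: d|exact: E].
  have [dd _ _ lo] := Hg _ xab.
  have : `|sg * dotp (dg x) (J (g x)) - sg * dotp (J p0) (dg x)| <= 1 / 4.
    rewrite -mulrBr normrM sgn (mul1r `|_|) (dotpC (J p0)) -dotpBr.
    have hh := dotp_le3 (unit_norm_le1 dd) (rotf_lip o nn rho0 (g x) p0). apply: le_trans hh _.
    have -> : 1 / 4 = 3 * 1 * (2 / rho * (rho / 24)) :> R by field; rewrite gt_eqF.
    have p2 : 0 <= 2 / rho by rewrite divr_ge0// ltW.
    rewrite ler_pM2l// ler_wpM2l// (le_trans (gp _ xab))//.
    by move: c1 c3 r10 rho0; lra.
  by move: lo; rewrite ler_norml; move: (sg * _) (sg * _) => p q; lra.
have bA : a <= a <= b by rewrite lexx. have bB : a <= b <= b by rewrite lexx andbT.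
have [at_ tb] := andP taub.
have g1 := grow _ _ (lexx a) at_ tb. have g2 := grow _ _ at_ tb (lexx b).
have s1 := sig _ bA. have s2 := sig _ bB.
have g0 : `|sg * dotp (J p0) (g tau - p0)| <= r1 / 16.
  rewrite normrM sgn mul1r; apply: le_trans c7.
  by have := dotp_le3 J1 gt_; rewrite mulr1 mulrA -natrM.
have hE t : h t = sg * dotp (J p0) (g t - p0) - sg * dotp (J p0) (sigma (th (B t)) - p0).
  by rewrite -mulrBr -dotpBr opprB addrA subrK.
have s1' : `|sg * dotp (J p0) (sigma (th (B a)) - p0)| <= r1 / 16 by rewrite normrM sgn mul1r.
have s2' : `|sg * dotp (J p0) (sigma (th (B b)) - p0)| <= r1 / 16 by rewrite normrM sgn mul1r.
have ha : h a <= 0.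
  move: g1 s1' g0; rewrite hE /a opprB addrC subrK !ler_norml.
  by move: (sg * _) (sg * _) (sg * _) r10 => x y z; lra.
have hb : 0 <= h b.
  move: g2 s2' g0; rewrite hE /b addrAC subrr add0r !ler_norml.
  by move: (sg * _) (sg * _) (sg * _) r10 => x y z; lra.
have sgns : Num.min (h a) (h b) <= 0 <= Num.max (h a) (h b).
  by rewrite ge_min ha le_max hb orbT.
have [t] := IVT ab (cont_on_within ch) sgns.
rewrite in_itv/= => tab ht; have [th1 th2] := thP _ (Bb _ tab).
have [_ Sg _ _] := Hg _ tab.
exists t, (th (B t)); split=> //; first by rewrite -ler_norml.
apply/esym/projection_inj => //.
- by apply: Ss; rewrite -ler_norml.
- exact: gd.
- by apply: (le_lt_trans (sp _ tab)).
- move/eqP: ht; rewrite /h mulf_eq0 => /orP[/eqP z|/eqP //].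
  by move: sgn; rewrite z normr0 => /eqP; rewrite eq_sym oner_eq0.
- rewrite sigma0 in th2; have -> : g t - sigma (th (B t)) = (g t - p0) - (sigma (th (B t)) - p0).
    by rewrite opprB addrA subrK.
  by rewrite dotpBr th2 subrr.
Qed.

End Crossing.

(** * First-order comparison at a point *)

Section Quotients.
Variable R : realType.

(** At a zero of u, difference quotients are quotients of values. *)
Lemma der_quot (V : normedModType R) (u : R -> V) (U : V) : is_derive (0 : R) 1 u U ->
  u 0 = 0 -> h^-1 *: u h @[h --> (0 : R)^'] --> U.
Proof.
move=> [du <-] u0; have := du; rewrite /derivable /derive.
by under eq_fun do rewrite /= u0 subr0 addr0 [_ *: 1]mulr1.
Qed.

Lemma der_sq_le (u v : R -> 'rV[R]_3) (U V : 'rV[R]_3) (K : R) :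
  is_derive (0 : R) 1 u U -> is_derive (0 : R) 1 v V -> u 0 = 0 -> v 0 = 0 ->
  (\forall t \near (0 : R), dotp (u t) (u t) <= K * dotp (v t) (v t)) ->
  dotp U U <= K * dotp V V.
Proof.
move=> du dv u0 v0 H.
have cu := der_quot du u0; have cv := der_quot dv v0.
have c1 := cvg_dotp (dnbhs_filter _) cu cu; have c2 := cvg_dotp (dnbhs_filter _) cv cv.
have c3 : K * dotp (t^-1 *: v t) (t^-1 *: v t) @[t --> (0 : R)^'] --> K * dotp V V.
  by apply: cvgMl_tmp; exact: c2.
refine (@ler_cvg_to R ((0 : R)^') _ R _ _ _ _ c1 c3 _).
have H' : \forall t \near (0 : R)^', dotp (u t) (u t) <= K * dotp (v t) (v t).
  exact: (@cvg_within R (nbhs (0 : R)) _ (fun x => x != 0)).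
apply: filterS H' => t h.
have -> : dotp (t^-1 *: u t) (t^-1 *: u t) = t^-1 ^+ 2 * dotp (u t) (u t).
  by rewrite dotpZl dotpZr; ring.
have -> : K * dotp (t^-1 *: v t) (t^-1 *: v t) = t^-1 ^+ 2 * (K * dotp (v t) (v t)).
  by rewrite dotpZl dotpZr; ring.
by rewrite ler_wpM2l// sqr_ge0.
Qed.

Lemma der_sign (u v A B : R -> 'rV[R]_3) (U V : 'rV[R]_3) :
  is_derive (0 : R) 1 u U -> is_derive (0 : R) 1 v V -> u 0 = 0 -> v 0 = 0 ->
  {for (0 : R), continuous A} -> {for (0 : R), continuous B} ->
  (\forall t \near (0 : R), 0 <= dotp (u t) (A t) * dotp (v t) (B t)) ->
  0 <= dotp U (A 0) * dotp V (B 0).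
Proof.
move=> du dv u0 v0 cA cB H.
have cu := der_quot du u0; have cv := der_quot dv v0.
have c1 := cvg_dotp (dnbhs_filter _) cu (cvg_within_filter (fun x => x != 0) cA).
have c2 := cvg_dotp (dnbhs_filter _) cv (cvg_within_filter (fun x => x != 0) cB).
have c0 : (fun _ : R => 0 : R) h @[h --> (0 : R)^'] --> (0 : R) by exact: cvg_cst.
have c3 : dotp (t^-1 *: u t) (A t) * dotp (t^-1 *: v t) (B t) @[t --> (0 : R)^'] --> dotp U (A 0) * dotp V (B 0).
  by apply: cvgM; [exact: c1|exact: c2].
refine (@ler_cvg_to R ((0 : R)^') _ R _ _ _ _ c0 c3 _).
have H' : \forall t \near (0 : R)^', 0 <= dotp (u t) (A t) * dotp (v t) (B t).
  exact: (@cvg_within R (nbhs (0 : R)) _ (fun x => x != 0)).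
apply: filterS H' => t h.
rewrite /= !dotpZl mulrACA mulr_ge0// -expr2 sqr_ge0//.
Qed.

Lemma le_expR1 (y K : R) : 0 < K -> (forall e : R, 0 < e -> y <= expR (e * K)) -> y <= 1.
Proof.
move=> K0 H; rewrite leNgt; apply/negP => y1.
have y0 : 0 < y by exact: lt_trans y1.
have l0 : 0 < ln y by rewrite ln_gt0.
have e0 : 0 < ln y / (2 * K) by rewrite divr_gt0// mulr_gt0.
have := H _ e0; have -> : ln y / (2 * K) * K = ln y / 2 by field; rewrite gt_eqF.
move=> h.
have : expR (ln y / 2) < expR (ln y) by rewrite ltr_expR ltr_pdivrMr// ltr_pMr// ltr1n.
by rewrite lnK ?posrE// ltNge h.
Qed.

Lemma cont_on_bilinear (V W X : normedModType R) (h : V -> W -> X) (K a b : R)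
    (f : R -> V) (g : R -> W) : 0 <= K ->
  (forall x y x' y', `|h x y - h x' y'| <= K * (`|x - x'| * `|y| + `|x'| * `|y - y'|)) ->
  cont_on a b f -> cont_on a b g -> cont_on a b (fun t => h (f t) (g t)).
Proof.
move=> K0 H cf cg t tab e e0.
have p1 : 0 < `|g t| + 1 by rewrite ltr_wpDl.
have p2 : 0 < `|f t| + 1 by rewrite ltr_wpDl.
have K1 : 0 < K + 1 by rewrite ltr_wpDl.
have q1 : 0 < e / (2 * (K + 1) * (`|g t| + 1)) by rewrite divr_gt0// !mulr_gt0.
have q2 : 0 < Num.min 1 (e / (2 * (K + 1) * (`|f t| + 1))).
  by rewrite lt_min ltr01 divr_gt0// !mulr_gt0.
have [d1 d10 H1] := cf _ tab _ q1; have [d2 d20 H2] := cg _ tab _ q2.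
exists (Num.min d1 d2) => [|s sab]; first by rewrite lt_min d10.
rewrite lt_min => /andP[/(H1 _ sab) a1 /(H2 _ sab)]; rewrite lt_min => /andP[a2 a3].
apply: (le_lt_trans (H _ _ _ _)).
have gs : `|g s| <= `|g t| + 1.
  have -> : g s = g t + (g s - g t) by rewrite addrC subrK.
  by rewrite (le_trans (ler_normD _ _))// lerD2l ltW.
have b1 : `|f s - f t| * `|g s| <= e / (2 * (K + 1)).
  have -> : e / (2 * (K + 1)) = e / (2 * (K + 1) * (`|g t| + 1)) * (`|g t| + 1).
    by field; rewrite !gt_eqF.
  by apply: ler_pM => //; exact: ltW.
have b2 : `|f t| * `|g s - g t| <= e / (2 * (K + 1)).
  have -> : e / (2 * (K + 1)) = (`|f t| + 1) * (e / (2 * (K + 1) * (`|f t| + 1))).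
    by field; rewrite !gt_eqF.
  by apply: ler_pM => //; [rewrite lerDl|exact: ltW].
apply: (@le_lt_trans _ _ (K * (e / (K + 1)))).
  rewrite ler_wpM2l// (le_trans (lerD b1 b2))// le_eqVlt; apply/orP; left; apply/eqP.
  by field; rewrite gt_eqF.
by rewrite mulrCA gtr_pMr// ltr_pdivrMr// mul1r ltrDl.
Qed.

Lemma cont_on_dotp (a b : R) (f g : R -> 'rV[R]_3) :
  cont_on a b f -> cont_on a b g -> cont_on a b (fun t => dotp (f t) (g t)).
Proof.
apply: (@cont_on_bilinear _ _ _ (fun u v : 'rV[R]_3 => dotp u v : R) 3) => // x y x' y'.
have -> : dotp x y - dotp x' y' = dotp (x - x') y + dotp x' (y - y').
  by rewrite dotpBl dotpBr addrA subrK.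
by rewrite (le_trans (ler_normD _ _))// mulrDr !mulrA lerD// dotp_le.
Qed.

Lemma cont_on_crossp (a b : R) (f g : R -> 'rV[R]_3) :
  cont_on a b f -> cont_on a b g -> cont_on a b (fun t => crossp (f t) (g t)).
Proof.
apply: (@cont_on_bilinear _ _ _ (fun u v : 'rV[R]_3 => crossp u v) 2) => // x y x' y'.
have -> : crossp x y - crossp x' y' = crossp (x - x') y + crossp x' (y - y').
  by apply: row3P; rewrite !mxE /=; ring.
by rewrite (le_trans (ler_normD _ _))// mulrDr !mulrA lerD// crossp_le.
Qed.

Lemma cont_on_for (V : normedModType R) (a b t : R) (f : R -> V) : a < t < b ->
  cont_on a b f -> {for t, continuous f}.
Proof.
move=> /andP[at_ tb] cf; apply: eps_for_continuous => e e0.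
have [|d d0 H] := cf t _ e e0; first by rewrite !ltW.
have m0 : 0 < Num.min d (Num.min (t - a) (b - t)) by rewrite !lt_min d0 !subr_gt0 at_.
exists (Num.min d (Num.min (t - a) (b - t))) => // y.
rewrite !lt_min => /and3P[yd]; rewrite !ltr_distl => /andP[h1 _] /andP[_ h2].
by apply: H => //; apply/andP; split; lra.
Qed.

Lemma same_sign (a b : R) (f : R -> R) : a <= b -> cont_on a b f ->
  (forall t, a <= t <= b -> f t != 0) -> 0 < f a * f b.
Proof.
move=> ab cf nz; have [bA bB] : a <= a <= b /\ a <= b <= b by rewrite !lexx ab.
rewrite ltNge; apply/negP => h.
have sg : Num.min (f a) (f b) <= 0 <= Num.max (f a) (f b).
  rewrite ge_min le_max; have := nz _ bA; rewrite neq_lt => /orP[fa|fa].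
    by rewrite (ltW fa) /= -(nmulr_rle0 (f b) fa) h orbT.
  by rewrite (ltW fa) /= andbT -(pmulr_rle0 (f b) fa) h orbT.
have [t tab ft] := IVT ab (cont_on_within cf) sg.
by move: tab; rewrite in_itv/= => /nz; rewrite ft eqxx.
Qed.

End Quotients.

(** * The return map of a circle *)

Section ReturnMap.
Variables (R : realType) (r : nat).
Hypothesis r3 : (3 <= r)%N.
Variable S : oriented_surface R r.
Variables (o n : 'rV[R]_3) (rho kap : R) (C0 : 'rV[R]_3) (max : bool).
Hypothesis nn : dotp n n = 1.
Hypothesis rho0 : 0 < rho.
Let N := normal S.
Let J := rotf o n rho.
Let Gam := circle o n rho.
Let w x := N x + kap *: x - C0.
Hypothesis HG : forall x, Gam x ->
  [/\ principal_direction max S x (J x), shape_op S x (J x) (- kap *: J x) & w x = 0].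
Hypothesis Gcpt : compact Gam.
Variables (p0 : 'rV[R]_3) (sigma : R -> 'rV[R]_3) (delta : R).
Hypothesis Gp0 : Gam p0.
Hypothesis ts : transversal_segment max S sigma delta.
Hypothesis sigma0 : sigma 0 = p0.

Let u0 := crossp (N p0) (J p0).

Lemma segment_derive (t : R) : - delta <= t <= delta ->
  is_derive t 1 sigma (derive1 sigma t).
Proof. by move: ts => [_ _ H] /H[d _ _ _]; rewrite derive1E; apply: DeriveDef. Qed.

Lemma center_frame : orthonormal3 (N p0) (J p0) u0.
Proof.
have [pd _ _] := HG Gp0; have [k [k2 [[Sp vv Nv _ _] _]]] := principal_frame r3 pd.
exact: orthonormal3_crossp (normal_unit Sp) vv Nv.
Qed.

Lemma segment_near : \forall t \near (0 : R), - delta <= t <= delta.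
Proof.
have [d0 _ _] := ts; apply/(@nbhs_deltaP R R); exists delta => // t.
by rewrite subr0 => /ltW; rewrite ler_norml.
Qed.

Lemma segment_carrier_near : \forall t \near (0 : R), carrier S (sigma t).
Proof. by have [_ _ H] := ts; apply: filterS segment_near => t /H[]. Qed.

Lemma zero_in : - delta <= (0 : R) <= delta.
Proof. by have [d0 _ _] := ts; rewrite oppr_le0 ltW. Qed.

(** J p0 spans the principal direction at p0, to which sigma is
    transversal. *)
Lemma transverse_coef : dotp u0 (derive1 sigma 0) != 0.
Proof.
have on := center_frame; have [_ _ H] := ts.
have [_ _ _ [v [pv nx]]] := H _ zero_in; rewrite sigma0 in pv.
have [pd _ _] := HG Gp0.
have N0 : dotp (N p0) (derive1 sigma 0) = 0.
  by rewrite -sigma0; apply: (curve_tangent r3 segment_carrier_near); exact: segment_derive zero_in.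
apply/eqP => z.
have E : derive1 sigma 0 = dotp (J p0) (derive1 sigma 0) *: J p0.
  rewrite {1}(orthonormal3_expand (derive1 sigma 0) on) (dotpC _ (N p0)) N0.
  by rewrite (dotpC _ u0) z !scale0r add0r addr0 dotpC.
have [vE|vE] := principal_unique r3 pd pv.
  by apply: (nx (dotp (J p0) (derive1 sigma 0))); rewrite vE.
by apply: (nx (- dotp (J p0) (derive1 sigma 0))); rewrite vE scalerN scaleNr opprK.
Qed.

(** The differential of w sends the tangential part of sigma'(0) to 0 and
    multiplies its u0-part by kap - k2 <> 0. *)
Lemma segment_deviation : exists2 W0 : 'rV[R]_3,
  is_derive (0 : R) 1 (fun t => w (sigma t)) W0 & dotp W0 u0 != 0.
Proof.
have on := center_frame; have tc := transverse_coef.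
have [pd sj w0] := HG Gp0; have [k [k2 [[Sp vv Nv sv su] ord]]] := principal_frame r3 pd.
have ds := segment_derive zero_in.
have N0 : dotp (N p0) (derive1 sigma 0) = 0.
  by rewrite -sigma0; exact: (curve_tangent r3 segment_carrier_near).
have E : derive1 sigma 0 = dotp (J p0) (derive1 sigma 0) *: J p0 + dotp u0 (derive1 sigma 0) *: u0.
  rewrite {1}(orthonormal3_expand (derive1 sigma 0) on) (dotpC _ (N p0)) N0 scale0r add0r.
  by rewrite (dotpC _ u0) (dotpC _ (J p0)).
move: E; set al := dotp (J p0) _; set be := dotp u0 _ => E.
have [U [X [q [ch Uq Xq]]]] := surface_charts Sp.
have Nu : dotp (N p0) u0 = 0 by exact: on_uw on.
have lift (z : 'rV[R]_3) : dotp (N p0) z = 0 -> exists a : 'rV[R]_2, 'd X q a = z.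
  by move=> Nw; apply: (tangent_lift ch Uq); rewrite Xq.
have [a av] := lift (J p0) Nv; have [b bu] := lift u0 Nu.
have La := shape_chart r3 sv ch Uq Xq av. have Lb := shape_chart r3 su ch Uq Xq bu.
have La' := shape_chart r3 sj ch Uq Xq av.
have kk : k = kap.
  have := congr1 (fun z => dotp z (J p0)) (etrans (esym La) La').
  by rewrite !(dotpZl _ (J p0)) vv !mulr1 => /oppr_inj.
have EX : 'd X q (al *: a + be *: b) = derive1 sigma 0.
  by apply: etrans (linear2 _ _ _ _ _) _; rewrite av bu.
have EN : 'd (normal S \o X) q (al *: a + be *: b) = al *: (- kap *: J p0) + be *: (- k2 *: u0).
  by apply: etrans (linear2 _ _ _ _ _) _; rewrite La' Lb.
have dN : is_derive (0 : R) 1 (N \o sigma) ('d (normal S \o X) q (al *: a + be *: b)).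
  by apply: (is_derive_normal r3 ch Uq _ segment_carrier_near ds EX); rewrite sigma0.
exists ('d (normal S \o X) q (al *: a + be *: b) + kap *: derive1 sigma 0).
  have [d EE] := is_deriveD (is_deriveD dN (is_deriveZ kap ds)) (is_derive_cst (- C0) (0 : R) (1 : R)).
  by apply: DeriveDef; [exact: d|apply: etrans EE _; exact: addr0].
have -> : 'd (normal S \o X) q (al *: a + be *: b) + kap *: derive1 sigma 0 = ((kap - k2) * be) *: u0.
  by rewrite EN E; move: (J p0) u0 => v u; apply/rowP => i; rewrite !mxE; ring.
rewrite (dotpZl _ u0) (on_ww on) mulr1.
rewrite mulf_neq0// subr_eq0 -kk; by move: ord; case: (max) => h; [rewrite gt_eqF|rewrite lt_eqF].
Qed.

Let dev t := dotp (w (sigma t)) (w (sigma t)).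
Let lat x := dotp (w x) (crossp (N x) (J x)).

(** One turn, plus the time needed to reach the segment. *)
Definition max_return_time := turn_time rho + rho.

Lemma near_circle_le (e e' : R) x : e <= e' -> near_circle o n rho e x -> near_circle o n rho e' x.
Proof. by move=> ee [y Gy xy]; exists y => //; exact: lt_le_trans ee. Qed.

Lemma line_shrink (g : R -> 'rV[R]_3) (T T' : R) : T' <= T ->
  principal_line_on max S g T -> principal_line_on max S g T'.
Proof. by move=> TT pl t /andP[t0 tT]; apply: pl; rewrite t0 (le_trans tT). Qed.

(** If the leaf avoided the segment for longer, it would turn once around the
    circle by [revolution] and then cross the segment by [crossing]. *)
Lemma return_time_le (e1 r1 e : R) : 0 < r1 <= rho / 2 -> e <= e1 ->
  (forall (g dg : R -> 'rV[R]_3) (tau sg : R),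
    (forall t : R, tau - r1 <= t <= tau + r1 -> is_derive t 1 g (dg t)) ->
    (forall t : R, tau - r1 <= t <= tau + r1 ->
      [/\ dotp (dg t) (dg t) = 1, carrier S (g t), near_circle o n rho e1 (g t) &
          1 / 2 <= sg * dotp (dg t) (J (g t))]) ->
    sg * sg = 1 -> `|g tau - p0| <= 10 * e1 ->
    exists t s, [/\ tau - r1 <= t <= tau + r1, - delta <= s <= delta & sigma s = g t]) ->
  0 < e -> e <= rho / 24 ->
  forall (g : R -> 'rV[R]_3) (T : R), principal_line_on max S g T ->
  (forall tau, 0 < tau < T -> ~ (sigma @` `[- delta, delta]) (g tau)) ->
  `|g 0 - p0| <= rho / 24 ->
  (T > max_return_time -> forall t, 0 <= t <= max_return_time -> near_circle o n rho e (g t)) ->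
  (T > max_return_time -> forall t, 0 <= t <= max_return_time ->
     1 / 2 <= dotp (derive1 g t) (J (g t)) ^+ 2) ->
  T <= max_return_time.
Proof.
move=> /andP[r10 r1r] ee1 cross e0 er g T pl nohit g0 tube tr.
rewrite leNgt; apply/negP => TT.
have {}tube := tube TT; have {}tr := tr TT.
set Tm := max_return_time in TT tube tr.
have pl' := line_shrink (ltW TT) pl.
have tt0 : 0 < turn_time rho.
  by rewrite /turn_time mulr_gt0// divr_gt0// ?divr_gt0// mulr_gt0 ?pi_gt0// mulr_gt0// exprn_gt0.
have Dg (t : R) : 0 <= t <= Tm -> is_derive t 1 g (derive1 g t).
  by move=> tT; exact: (line_derive pl' tT).
have g1 (t : R) : 0 <= t <= Tm -> dotp (derive1 g t) (derive1 g t) = 1.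
  by move=> /(line_frame r3 pl')[k [k2 [[]]]].
have TmE : turn_time rho <= Tm by rewrite /Tm /max_return_time lerDl ltW.
have [tau [t1 t2 t3]] := revolution nn rho0 Dg g1 tr e0 er tube Gp0 TmE g0.
have sub (t : R) : tau - r1 <= t <= tau + r1 -> 0 <= t <= Tm /\ 0 < t < T.
  move=> /andP[h1 h2]; have h3 : 0 < t by lra.
  have h4 : t <= Tm by apply: (le_trans h2); rewrite /Tm /max_return_time; lra.
  by rewrite (ltW h3) h4 h3 (le_lt_trans h4).
have Tm0 : 0 <= Tm by rewrite (le_trans _ TmE)// ltW.
have [sg sg2 sgP] := turning_bound nn rho0 Dg g1 tr Tm0.
have [||||t [s [/sub[_ tT] sd sE]]] := cross g (derive1 g) tau sg.
- by move=> t /sub[tT _]; exact: Dg.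
- move=> t /sub[tT _]; split; [exact: g1|exact: (line_carrier r3 pl')| |exact: sgP].
  exact: near_circle_le (tube _ tT).
- exact: sg2.
- by rewrite (le_trans t3)// ler_wpM2l.
by apply: (nohit _ tT); exists s => //=; rewrite in_itv.
Qed.

(** For all t close to 0, with a bound on the return time that does not
    depend on eps.  The lateral component of w cannot vanish along a leaf
    that leaves with w <> 0, hence keeps its sign. *)
Lemma return_estimate (eps : R) : 0 < eps -> \forall t \near (0 : R),
  forall (c0 : 'rV[R]_3) (t' : R), first_return max S sigma delta c0 t t' ->
  [/\ dev t' <= expR (eps * (2 * max_return_time)) * dev t,
      dev t <= expR (eps * (2 * max_return_time)) * dev t',
      0 <= lat (sigma t) * lat (sigma t') & (dev t = 0 -> Gam (sigma t'))].
Proof.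
move=> eps0; set Tm := max_return_time.
have [_ _ Hts] := ts.
have Sp : carrier S p0 by have [+ _ _] := HG Gp0 => /(principal_frame r3)[k [k2 [[]]]].
have h20 : 0 < 1 / 2 :> R by rewrite divr_gt0.
have [d0 d00 Hflat] := surface_flat r3 Sp h20.
have r20 : 0 < rho / 2 by rewrite divr_gt0.
have [delta0 _ _] := ts.
have Ds (t : R) : - delta <= t <= delta -> derivable sigma t 1 /\ {for t, continuous (derive1 sigma)}.
  by move=> /Hts[].
have Ss (t : R) : - delta <= t <= delta -> carrier S (sigma t) by move=> /Hts[].
have [r1 [e1 [r1r e10 cross]]] := crossing nn rho0 Gp0 center_frame d00 Hflat sigma0 delta0 Ds Ss transverse_coef r20.
have [et et0 tube] := tube_estimate r3 nn rho0 HG Gcpt eps0.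
pose e := Num.min et (Num.min e1 (rho / 24)).
have e0 : 0 < e by rewrite !lt_min et0 e10 divr_gt0.
have eet : e <= et by rewrite ge_min lexx.
have ee1 : e <= e1 by rewrite !ge_min lexx orbT.
have er : e <= rho / 24 by rewrite !ge_min lexx !orbT.
have tubeE x : carrier S x -> near_circle o n rho e x ->
    (exists2 y, Gam y & `|x - y| <= e^-1 * `|w x|) /\
    forall v k, principal_direction max S x v -> shape_op S x v (- k *: v) ->
        `|(kap - k) * dotp v (w x)| <= eps * dotp (w x) (w x).
  move=> Sx nx; have [[y Gy xy] _ h] := tube _ Sx (near_circle_le eet nx).
  split; last by move=> v k pv sv; have [] := h v k pv sv.
  exists y => //; apply: (le_trans xy); rewrite ler_wpM2r//.
  by rewrite lef_pV2 ?posrE.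
have [W0 dW _] := segment_deviation.
have w0 : w (sigma 0) = 0 by rewrite sigma0; have [] := HG Gp0.
have cw : {for (0 : R), continuous (fun t => w (sigma t))}.
  by apply/differentiable_continuous/derivable1_diffP; case: dW.
have cd : {for (0 : R), continuous dev} by exact: (@continuous_dotp R 3 _ (fun t => w (sigma t)) (fun t => w (sigma t))).
pose E := expR (2 * eps * Tm).
have E0 : 0 < E by exact: expR_gt0.
have m0 : 0 < (e ^+ 2 / 2) ^+ 2 / E by rewrite divr_gt0// exprn_gt0// divr_gt0// exprn_gt0.
have cs : {for (0 : R), continuous sigma}.
  apply/differentiable_continuous/derivable1_diffP.
  by have [d _ _ _] := Hts _ zero_in.
have n1 : \forall t \near (0 : R), `|dev t - dev 0| < (e ^+ 2 / 2) ^+ 2 / E.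
  by apply/(@nbhs_deltaP R R); exact: (for_continuous_eps cd m0).
have n2 : \forall t \near (0 : R), `|sigma t - sigma 0| < e.
  by apply/(@nbhs_deltaP R R); exact: (for_continuous_eps cs e0).
have dev0 : dev 0 = 0 by rewrite /dev w0 dotp0l.
apply: filterS2 n1 n2 => t dt st c0 t' [T [g [[T0 pl g0 _] [t'd gT nohit]]]].
rewrite sigma0 -g0 in st; rewrite dev0 subr0 in dt.
have small : E * dotp (w (g 0)) (w (g 0)) <= (e ^+ 2 / 2) ^+ 2.
  by rewrite mulrC -ler_pdivlMr// g0 ltW// (le_lt_trans (ler_norm _) dt).
have stay T' : 0 <= T' <= T -> T' <= Tm -> forall s, 0 <= s <= T' -> near_circle o n rho e (g s).
  move=> /andP[T'0 T'T] T'm; apply: (@stays_in_tube R r r3 S o n rho kap C0 max g T' (line_shrink T'T pl) eps e Tm) => //.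
    by rewrite T'0.
  by exists p0.
have Tm0 : 0 <= Tm.
  rewrite /Tm /max_return_time addr_ge0// ?(ltW rho0)//.
  by rewrite /turn_time mulr_ge0// divr_ge0// ?ltW// mulr_gt0 ?pi_gt0// mulr_gt0// exprn_gt0.
have g0p : `|g 0 - p0| <= rho / 24 by rewrite ltW// (lt_le_trans st).
have trv T' : 0 <= T' <= T -> T' <= Tm -> forall s, 0 <= s <= T' -> 1 / 2 <= dotp (derive1 g s) (J (g s)) ^+ 2.
  move=> T'T T'm s sT; have {}stay := stay _ T'T T'm _ sT.
  have plT := line_shrink (proj2 (andP T'T)) pl.
  have [k [k2 [[Sg _ _ sv _] _]]] := line_frame r3 plT sT.
  have [_ _ h] := tube _ Sg (near_circle_le eet stay).
  by have [] := h _ _ (proj2 (plT _ sT)) sv.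
have TTm : T <= Tm.
  apply: (return_time_le r1r ee1 cross e0 er pl nohit g0p).
    by move=> h; apply: stay; rewrite ?lexx// Tm0 ltW.
  by move=> h; apply: trv; rewrite ?lexx// Tm0 ltW.
have TT : 0 <= T <= T by rewrite lexx ltW.
have {stay} tubeT := stay _ TT TTm.
have gron s : 0 <= s <= T -> dotp (w (g s)) (w (g s)) <= E * dotp (w (g 0)) (w (g 0)) /\
    dotp (w (g 0)) (w (g 0)) <= E * dotp (w (g s)) (w (g s)).
  move=> sT; have := @line_gronwall R r r3 S o n rho kap C0 max g T pl eps e s sT.
  have [s0 s1] := andP sT.
  have HE : expR (2 * eps * s) <= E.
    by rewrite ler_expR ler_wpM2l ?(le_trans s1)// mulr_ge0// ltW.
  move=> H; have [||h1 h2] := H.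
  - by move=> x Sx nx; have [_] := tubeE x Sx nx; exact.
  - by move=> u /andP[u0' us]; apply: tubeT; rewrite u0' (le_trans (ltW us)).
  split; [apply: (le_trans h1)|apply: (le_trans h2)]; by rewrite ler_wpM2r// dotp_ge0.
have EE : expR (eps * (2 * Tm)) = E by congr expR; ring.
have [G1 G2] := gron _ TT.
have Sg := line_carrier r3 pl TT.
rewrite EE /dev -g0 -gT; split => //.
- have [z|nz] := eqVneq (dotp (w (g 0)) (w (g 0))) 0.
    have -> : lat (g 0) = 0 by rewrite /lat (dotp_sq_eq0 z) dotp0l.
    by rewrite mul0r.
  apply/ltW/(@same_sign R 0 T (fun s => lat (g s)) (ltW T0)).
    have cN : cont_on 0 T (fun s => N (g s)).
      move=> s sT x x0.
      have [d1 d10 H1] := within_eps (@normal_continuous R r S) (line_carrier r3 pl sT) x0.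
      have [d dd0 H] := line_cont pl sT d10.
      by exists d => // s' sT' sd; apply: H1; [exact: (line_carrier r3 pl)|exact: H].
    have cJ : cont_on 0 T (fun s => J (g s)).
      move=> s sT x x0; have x1 : 0 < x / (2 / rho) by rewrite !divr_gt0.
      have [d dd0 H] := line_cont pl sT x1.
      exists d => // s' sT' /(H _ sT'); rewrite ltr_pdivlMr ?divr_gt0// mulrC.
      by apply: le_lt_trans; exact: rotf_lip.
    exact: (cont_on_dotp (line_cont_w r3 kap C0 pl) (cont_on_crossp cN cJ)).
  move=> s sT; apply/eqP => z; have [_ G3] := gron _ sT.
  have [_ h _] := tube _ (line_carrier r3 pl sT) (near_circle_le eet (tubeT _ sT)).
  have h2 : dotp (w (g s)) (w (g s)) = 0.
    apply/eqP; rewrite eq_le dotp_ge0 andbT; move: h.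
    by rewrite -/(lat (g s)) z expr0n mulr0.
  by move: nz; rewrite eq_le dotp_ge0 andbT; rewrite h2 mulr0 in G3; rewrite G3.
- move=> z; have wT : w (g T) = 0.
    apply: dotp_sq_eq0; apply/eqP; rewrite eq_le dotp_ge0 andbT.
    by move: G1; rewrite z mulr0.
  have [[y Gy h] _] := tubeE _ Sg (tubeT _ TT).
  by move: h; rewrite wT normr0 mulr0 normr_le0 subr_eq0 => /eqP ->.
Qed.

End ReturnMap.

Lemma trace_compact (R : realType) (c : R -> 'rV[R]_3) (L : R) :
  closed_frenet_curve c L -> compact (trace c L).
Proof.
move=> hc; apply: continuous_compact; last exact: segment_compact.
by apply: continuous_subspaceT; exact: (smooth_continuous (curve_smooth hc)).
Qed.

Lemma is_derive_rescale (R : realType) (V : normedModType R) (f : R -> V) (P : R -> R)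
    (t p : R) (W : V) :
  is_derive t 1 P p -> is_derive (P t) 1 f W -> is_derive t 1 (fun s => f (P s)) (p *: W).
Proof.
move=> DP [/derivable1_diffP df fW]; have [d E] := is_derive_diff_comp DP df.
apply: DeriveDef; [exact: d|apply: etrans E _].
rewrite -[X in 'd f _ X](mulr1 p) -[p * 1]/(p *: 1) linearZ; congr (p *: _).
by apply: etrans fW; rewrite deriveE.
Qed.

(** The deviation of sigma t is t W0 up to o(t) with W0 <> 0, and the leaf
    carries it to the deviation of sigma (P t) with its length preserved up to
    a factor arbitrarily close to 1 and the sign of its lateral component
    preserved.  Hence P'(0)^2 = 1 and P'(0) >= 0. *)
Lemma circle_not_hyperbolic (R : realType) (r : nat) (c : R -> 'rV[R]_3) (L : R)
    (S : oriented_surface R r) : (3 <= r)%N -> closed_frenet_curve c L ->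
  is_circle c L -> ~ hyperbolic_principal_cycle S c.
Proof.
move=> r3 hc circ [max [pc [s0 [sigma [delta [P [[ts sig0 uniq near_ret] dP P1]]]]]]].
have [ctr [n [rho [kap [C0 [nn rho0 tE HG]]]]]] := circle_setup r3 hc pc circ.
have Gcpt : compact (circle ctr n rho) by rewrite -tE; exact: trace_compact.
have Gp0 : circle ctr n rho (c s0) by rewrite -tE; exact: (trace_curve hc).
pose N := normal S; pose J := rotf ctr n rho.
pose w x := N x + kap *: x - C0.
pose A t := crossp (N (sigma t)) (J (sigma t)).
have est := return_estimate r3 nn rho0 HG Gcpt Gp0 ts sig0.
have [W0 dW Wu] := segment_deviation r3 HG Gp0 ts sig0.
have w0 : w (sigma 0) = 0 by rewrite sig0; have [] := HG _ Gp0.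
have P0 : P 0 = 0.
  have [_ _ _] := nbhs_singleton (est _ ltr01) _ _ (nbhs_singleton near_ret).
  rewrite -/(w (sigma 0)) w0 dotp0l => /(_ erefl).
  rewrite -tE => -[s _ sE]; apply: (uniq s); last exact: sE.
  by have [T [g [_ [tt _ _]]]] := nbhs_singleton near_ret.
pose p := derive1 P 0.
have DP : is_derive (0 : R) 1 P p by rewrite /p derive1E; apply: DeriveDef.
have dWP : is_derive (0 : R) 1 (fun t => w (sigma (P t))) (p *: W0).
  by apply: (@is_derive_rescale _ _ (fun t => w (sigma t)) P 0 p W0 DP); rewrite P0.
have wP0 : w (sigma (P 0)) = 0 by rewrite P0.
have WW : 0 < dotp W0 W0.
  rewrite dotp_gt0; apply: contraNneq Wu => ->; by rewrite dotp0l.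
have K0 : 0 < 2 * max_return_time rho.
  rewrite mulr_gt0// /max_return_time addr_gt0// /turn_time mulr_gt0// divr_gt0// ?divr_gt0//.
  by rewrite mulr_gt0 ?pi_gt0// mulr_gt0// exprn_gt0.
have cmp (e : R) : 0 < e ->
    p ^+ 2 <= expR (e * (2 * max_return_time rho)) /\
    1 <= expR (e * (2 * max_return_time rho)) * p ^+ 2.
  move=> e0; have H := est _ e0.
  have h1 : dotp (p *: W0) (p *: W0) <= expR (e * (2 * max_return_time rho)) * dotp W0 W0.
    by apply: (der_sq_le dWP dW wP0 w0); apply: filterS2 H near_ret => t h /h[].
  have h2 : dotp W0 W0 <= expR (e * (2 * max_return_time rho)) * dotp (p *: W0) (p *: W0).
    by apply: (der_sq_le dW dWP w0 wP0); apply: filterS2 H near_ret => t h /h[].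
  have E : dotp (p *: W0) (p *: W0) = p ^+ 2 * dotp W0 W0 by rewrite dotpZl dotpZr; ring.
  split; first by rewrite -(ler_pM2r WW) -E.
  by rewrite -(ler_pM2r WW) mul1r -mulrA -E.
have p1 : p ^+ 2 <= 1 by apply: (le_expR1 K0) => e /cmp[].
have p0 : p != 0.
  apply/eqP => z; have [_] := cmp _ ltr01; rewrite z expr0n mulr0.
  by rewrite leNgt ltr01.
have p2 : 0 < p ^+ 2 by rewrite exprn_even_gt0.
have p3 : 1 <= p ^+ 2.
  rewrite -invf_le1//; apply: (le_expR1 K0) => e /cmp[_].
  by rewrite -ler_pdivrMr// mul1r.
have cA : {for (0 : R), continuous A}.
  have [d0 _ Hts] := ts.
  apply: (@cont_on_for R _ (- delta) delta); first by rewrite oppr_lt0 d0.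
  have cs : cont_on (- delta) delta sigma by apply: derive_cont_on => t /Hts[].
  apply: cont_on_crossp.
    move=> t tT e e0; have [_ _ St _] := Hts _ tT.
    have [d1 d10 H1] := within_eps (@normal_continuous R r S) St e0.
    have [d dd0 H] := cs t tT _ d10.
    by exists d => // s sT sd; apply: H1; [have [] := Hts _ sT|exact: H].
  move=> t tT e e0; have e1 : 0 < e / (2 / rho) by rewrite !divr_gt0.
  have [d dd0 H] := cs t tT _ e1.
  exists d => // s sT /(H _ sT); rewrite ltr_pdivlMr ?divr_gt0// mulrC.
  by apply: le_lt_trans; exact: rotf_lip.
have cAP : {for (0 : R), continuous (fun t => A (P t))}.
  have cP : {for (0 : R), continuous P} by apply/differentiable_continuous/derivable1_diffP.
  apply: (@continuous_comp _ _ _ P A); first exact: cP.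
  by rewrite P0.
have sgn : 0 <= dotp W0 (A 0) * dotp (p *: W0) (A (P 0)).
  apply: (der_sign dW dWP w0 wP0 cA cAP).
  by apply: filterS2 (est _ ltr01) near_ret => t h /h[].
have A0 : dotp W0 (A 0) != 0 by rewrite /A sig0.
move: sgn; rewrite P0 dotpZl mulrCA -expr2 pmulr_lge0 ?exprn_even_gt0// => pp.
apply: P1; apply/eqP; rewrite -/p -(@eqrXn2 _ 2)//.
by rewrite expr1n eq_le p1 p3.
Qed.

(** * Circles in frame coordinates *)

Section DerivativeRules.
Variable R : realType.
Implicit Types (f g : R -> R) (t a b : R).

Lemma der_eq (V : normedModType R) (f : R -> V) t (a b : V) :
  is_derive t 1 f a -> a = b -> is_derive t 1 f b.
Proof. by move=> h <-. Qed.

Lemma der_cst (V : normedModType R) (k : V) t : is_derive t 1 (fun _ : R => k) 0.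
Proof. exact: is_derive_cst. Qed.

Lemma deriv_add (V : normedModType R) (f g : R -> V) t (a b : V) :
  is_derive t 1 f a -> is_derive t 1 g b -> is_derive t 1 (fun x => f x + g x) (a + b).
Proof. by move=> fa gb; have [d E] := is_deriveD fa gb; apply: DeriveDef; [exact: d|exact: E]. Qed.

Lemma der_opp (V : normedModType R) (f : R -> V) t (a : V) :
  is_derive t 1 f a -> is_derive t 1 (fun x => - f x) (- a).
Proof. by move=> fa; have [d E] := is_deriveN fa; apply: DeriveDef; [exact: d|exact: E]. Qed.

Lemma der_sub (V : normedModType R) (f g : R -> V) t (a b : V) :
  is_derive t 1 f a -> is_derive t 1 g b -> is_derive t 1 (fun x => f x - g x) (a - b).
Proof. by move=> fa gb; exact: deriv_add fa (der_opp gb). Qed.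

Lemma deriv_mul f g t a b : is_derive t 1 f a -> is_derive t 1 g b ->
  is_derive t 1 (fun x => f x * g x) (a * g t + f t * b).
Proof.
move=> fa gb; have [d E] := is_deriveM fa gb; apply: DeriveDef; [exact: d|apply: etrans E _].
by rewrite addrC -![_ *: _]/(_ * _); congr (_ + _); rewrite mulrC.
Qed.

Lemma der_recip f t a : f t != 0 -> is_derive t 1 f a ->
  is_derive t 1 (fun x => (f x)^-1) (- (a / f t ^+ 2)).
Proof.
move=> f0 fa; have [d E] := is_deriveV f0 fa; apply: DeriveDef; [exact: d|apply: etrans E _].
by rewrite -[_ *: _]/(_ * _) mulNr mulrC.
Qed.

Lemma deriv_scale n f (v : R -> 'rV[R]_n) t a (b : 'rV[R]_n) :
  is_derive t 1 f a -> is_derive t 1 v b ->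
  is_derive t 1 (fun x => f x *: v x) (a *: v t + f t *: b).
Proof.
move=> fa vb; apply: coord_is_derive => j; rewrite !mxE.
have -> : (fun s : R => (f s *: v s) 0 j) = fun s => f s * v s 0 j.
  by apply/funext => s; rewrite mxE.
exact: deriv_mul fa (is_derive_coord j vb).
Qed.

Lemma deriv_addr f g t a b : is_derive t 1 f a -> is_derive t 1 g b ->
  is_derive t 1 (fun x => f x + g x) (a + b).
Proof. exact: deriv_add. Qed.

Lemma der_subr f g t a b : is_derive t 1 f a -> is_derive t 1 g b ->
  is_derive t 1 (fun x => f x - g x) (a - b).
Proof. exact: der_sub. Qed.

Lemma der_cstr a t : is_derive t 1 (fun _ : R => a) 0.
Proof. exact: der_cst. Qed.

Lemma der_id t : is_derive t 1 (fun x : R => x) 1.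
Proof. exact: is_derive_id. Qed.

End DerivativeRules.

(** The inversion of the line of the points E / y + (q N + g T - lam E) / 2 is a
    circle through the origin, tangent to E there.  With P the constant vector,
    [gap] is |E + y P|^2, and arcE, arcT, arcN are the coordinates of the point
    D = y (E + y P) / |E + y P|^2 of that circle; the suffixes _y and _s denote
    the derivatives in y, and in a parameter s moving q and g with the speeds
    q' and g'. *)
Section CircleCoordinates.
Variable R : realType.
Implicit Types lam q g y m gp : R.

Definition gap lam q g y : R := (1 - lam * y / 2) ^+ 2 + y ^+ 2 * (q ^+ 2 + g ^+ 2) / 4.
Definition arcE lam q g y : R := y * (1 - lam * y / 2) / gap lam q g y.
Definition arcT lam q g y : R := y ^+ 2 * g / 2 / gap lam q g y.
Definition arcN lam q g y : R := y ^+ 2 * q / 2 / gap lam q g y.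

Definition gap_y lam q g y : R := - lam * (1 - lam * y / 2) + y * (q ^+ 2 + g ^+ 2) / 2.
Definition arcE_y lam q g y : R :=
  ((1 - lam * y) - arcE lam q g y * gap_y lam q g y) / gap lam q g y.
Definition arcT_y lam q g y : R :=
  (y * g - arcT lam q g y * gap_y lam q g y) / gap lam q g y.
Definition arcN_y lam q g y : R :=
  (y * q - arcN lam q g y * gap_y lam q g y) / gap lam q g y.

Definition gap_s q g q' g' y : R := y ^+ 2 * (q * q' + g * g') / 2.
Definition arcE_s lam q g q' g' y : R :=
  - arcE lam q g y * gap_s q g q' g' y / gap lam q g y.
Definition arcT_s lam q g q' g' y : R :=
  (y ^+ 2 * g' / 2 - arcT lam q g y * gap_s q g q' g' y) / gap lam q g y.
Definition arcN_s lam q g q' g' y : R :=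
  (y ^+ 2 * q' / 2 - arcN lam q g y * gap_s q g q' g' y) / gap lam q g y.

Definition stretch lam q g m g' y : R :=
  (gap lam q g y + lam * y + (g' - g ^+ 2 - q * (q - m) - lam ^+ 2) / 2 * y ^+ 2) / gap lam q g y.

Ltac arcs := rewrite /stretch /arcE_s /arcT_s /arcN_s /arcE_y /arcT_y /arcN_y /arcE /arcT /arcN /gap_s /gap_y.

Lemma gap_form lam q g y : gap lam q g y * 4 = (2 - lam * y) ^+ 2 + y ^+ 2 * (q ^+ 2 + g ^+ 2).
Proof. by rewrite /gap; field. Qed.

Lemma gap_neq lam q g y : gap lam q g y != 0 ->
  (2 - lam * y) ^+ 2 + y ^+ 2 * (q ^+ 2 + g ^+ 2) != 0.
Proof. by rewrite -gap_form => h; rewrite mulf_neq0. Qed.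

Lemma stretchE lam q g m g' y : gap lam q g y != 0 ->
  arcE_s lam q g (g * m) g' y - lam * arcT lam q g y - g * y * arcE_y lam q g y
    = - (stretch lam q g m g' y * (g * arcE lam q g y)).
Proof.
move=> h; arcs; rewrite (_ : gap lam q g y = ((2 - lam * y) ^+ 2 + y ^+ 2 * (q ^+ 2 + g ^+ 2)) / 4) //; last by rewrite -gap_form; field.
by field; exact: gap_neq.
Qed.

Lemma stretchT lam q g m g' y : gap lam q g y != 0 ->
  1 + lam * arcE lam q g y + arcT_s lam q g (g * m) g' y - (q - m) * arcN lam q g y
    - g * y * arcT_y lam q g y = stretch lam q g m g' y * (1 - g * arcT lam q g y).
Proof.
move=> h; arcs; rewrite (_ : gap lam q g y = ((2 - lam * y) ^+ 2 + y ^+ 2 * (q ^+ 2 + g ^+ 2)) / 4) //; last by rewrite -gap_form; field.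
by field; exact: gap_neq.
Qed.

Lemma stretchN lam q g m g' y : gap lam q g y != 0 ->
  arcN_s lam q g (g * m) g' y + (q - m) * arcT lam q g y - g * y * arcN_y lam q g y
    = - (stretch lam q g m g' y * (g * arcN lam q g y)).
Proof.
move=> h; arcs; rewrite (_ : gap lam q g y = ((2 - lam * y) ^+ 2 + y ^+ 2 * (q ^+ 2 + g ^+ 2)) / 4) //; last by rewrite -gap_form; field.
by field; exact: gap_neq.
Qed.

Lemma arc_sq lam q g y : gap lam q g y != 0 ->
  arcE lam q g y ^+ 2 + arcT lam q g y ^+ 2 + arcN lam q g y ^+ 2 = y ^+ 2 / gap lam q g y.
Proof.
move=> h; arcs; rewrite (_ : gap lam q g y = ((2 - lam * y) ^+ 2 + y ^+ 2 * (q ^+ 2 + g ^+ 2)) / 4) //; last by rewrite -gap_form; field.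
by field; exact: gap_neq.
Qed.

Lemma arc_y_sq lam q g y : gap lam q g y != 0 ->
  arcE_y lam q g y ^+ 2 + arcT_y lam q g y ^+ 2 + arcN_y lam q g y ^+ 2 = (gap lam q g y)^-1 ^+ 2.
Proof.
move=> h; arcs; rewrite (_ : gap lam q g y = ((2 - lam * y) ^+ 2 + y ^+ 2 * (q ^+ 2 + g ^+ 2)) / 4) //; last by rewrite -gap_form; field.
by field; exact: gap_neq.
Qed.

(** D . D_y.  The next two lemmas then say that the reflections T - g D and
    N - q D of T and N in the plane orthogonal to D are orthogonal to D_y. *)
Lemma arc_velocity lam q g y : gap lam q g y != 0 ->
  arcE lam q g y * arcE_y lam q g y + arcT lam q g y * arcT_y lam q g y
    + arcN lam q g y * arcN_y lam q g y = y * (1 - lam * y / 2) / gap lam q g y ^+ 2.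
Proof.
move=> h; arcs; rewrite (_ : gap lam q g y = ((2 - lam * y) ^+ 2 + y ^+ 2 * (q ^+ 2 + g ^+ 2)) / 4) //; last by rewrite -gap_form; field.
by field; exact: gap_neq.
Qed.

Lemma arcT_y_closed lam q g y : gap lam q g y != 0 ->
  arcT_y lam q g y = g * (y * (1 - lam * y / 2) / gap lam q g y ^+ 2).
Proof.
move=> h; arcs; rewrite (_ : gap lam q g y = ((2 - lam * y) ^+ 2 + y ^+ 2 * (q ^+ 2 + g ^+ 2)) / 4) //; last by rewrite -gap_form; field.
by field; exact: gap_neq.
Qed.

Lemma arcN_y_closed lam q g y : gap lam q g y != 0 ->
  arcN_y lam q g y = q * (y * (1 - lam * y / 2) / gap lam q g y ^+ 2).
Proof.
move=> h; arcs; rewrite (_ : gap lam q g y = ((2 - lam * y) ^+ 2 + y ^+ 2 * (q ^+ 2 + g ^+ 2)) / 4) //; last by rewrite -gap_form; field.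
by field; exact: gap_neq.
Qed.

End CircleCoordinates.

(** * Surfaces swept by circles *)

(** Circles are attached along a closed curve: fE is normal to the given
    plane or sphere, fT is the tangent, fq - fm is the geodesic curvature,
    and fq, fg determine the circles, tangent to fE.  The relation
    fq' = fg fm makes these circles curvature lines of the surface that they
    sweep. *)
Record strip (R : realType) := Strip {
  base : R -> 'rV[R]_3; fE : R -> 'rV[R]_3; fT : R -> 'rV[R]_3; fN : R -> 'rV[R]_3;
  fq : R -> R; fg : R -> R; fm : R -> R; fg1 : R -> R;
  lam : R; per : R;
  per_gt0 : 0 < per;
  frame_on : forall s, orthonormal3 (fE s) (fT s) (fN s);
  base_der : forall s : R, is_derive s 1 base (fT s);
  fE_der : forall s : R, is_derive s 1 fE (lam *: fT s);
  fT_der : forall s : R, is_derive s 1 fT ((fq s - fm s) *: fN s - lam *: fE s);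
  fN_der : forall s : R, is_derive s 1 fN (- (fq s - fm s) *: fT s);
  fq_der : forall s : R, is_derive s 1 fq (fg s * fm s);
  fg_der : forall s : R, is_derive s 1 fg (fg1 s);
  base_smooth : smooth base; fE_smooth : smooth fE; fT_smooth : smooth fT;
  fN_smooth : smooth fN; fq_smooth : smooth fq; fg_smooth : smooth fg;
  fm_cont : continuous fm; fg1_cont : continuous fg1;
  fm_gt0 : forall s, 0 < fm s;
  base_per : forall s, base (s + per) = base s;
  fE_per : forall s, fE (s + per) = fE s; fT_per : forall s, fT (s + per) = fT s;
  fN_per : forall s, fN (s + per) = fN s; fq_per : forall s, fq (s + per) = fq s;
  fg_per : forall s, fg (s + per) = fg s; fm_per : forall s, fm (s + per) = fm s;
  fg1_per : forall s, fg1 (s + per) = fg1 s;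
  base_inj : forall s t, base s = base t -> exists k : int, s = t + k%:~R * per
}.

Section StripSurface.
Variables (R : realType) (D : strip R).
Let E := fE D.
Let T := fT D.
Let N := fN D.
Let q := fq D.
Let g := fg D.
Let m := fm D.
Let g1 := fg1 D.
Let l := lam D.

Definition sgap s y := gap l (q s) (g s) y.
Definition off s y := arcE l (q s) (g s) y *: E s + arcT l (q s) (g s) y *: T s
  + arcN l (q s) (g s) y *: N s.
Definition surf s y := base D s + off s y.
(** nrm and ray are the reflections of fN and fT in the plane orthogonal to
    the chord off. *)
Definition nrm s y := N s - q s *: off s y.
Definition ray s y := T s - g s *: off s y.
Definition surf_y s y := arcE_y l (q s) (g s) y *: E s + arcT_y l (q s) (g s) y *: T s
  + arcN_y l (q s) (g s) y *: N s.
Definition speed s y := stretch l (q s) (g s) (m s) (g1 s) y.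
(** The derivative of surf in s, along the two principal directions. *)
Definition surf_s s y := speed s y *: ray s y + (g s * y) *: surf_y s y.

Section Chain.
Variables (Q G Y : R -> R) (t Q' G' Y' : R).
Hypothesis dQ : is_derive t 1 Q Q'.
Hypothesis dG : is_derive t 1 G G'.
Hypothesis dY : is_derive t 1 Y Y'.
Hypothesis gap0 : gap l (Q t) (G t) (Y t) != 0.

Lemma der_gap : is_derive t 1 (fun x => gap l (Q x) (G x) (Y x))
  (Y' * gap_y l (Q t) (G t) (Y t) + gap_s (Q t) (G t) Q' G' (Y t)).
Proof.
have d1 := der_subr (der_cstr (1 : R) t) (deriv_mul (deriv_mul (der_cstr l t) dY) (der_cstr (2^-1 : R) t)).
have d2 := deriv_mul (deriv_mul (deriv_mul dY dY) (deriv_addr (deriv_mul dQ dQ) (deriv_mul dG dG)))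
  (der_cstr (4^-1 : R) t).
apply: (der_eq (deriv_addr (deriv_mul d1 d1) d2)).
by rewrite /gap_y /gap_s; field.
Qed.

Lemma der_arcE : is_derive t 1 (fun x => arcE l (Q x) (G x) (Y x))
  (Y' * arcE_y l (Q t) (G t) (Y t) + arcE_s l (Q t) (G t) Q' G' (Y t)).
Proof.
have d1 := der_subr (der_cstr (1 : R) t) (deriv_mul (deriv_mul (der_cstr l t) dY) (der_cstr (2^-1 : R) t)).
have d2 := deriv_mul (deriv_mul dY d1) (@der_recip R (fun x => gap l (Q x) (G x) (Y x)) t _ gap0 der_gap).
rewrite /arcE; apply: (der_eq d2).
by rewrite /arcE_y /arcE_s /arcE; move: gap0; move: (gap l _ _ _) (gap_y l _ _ _) (gap_s _ _ _ _ _) => a b c a0; field.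
Qed.

Lemma der_arcT : is_derive t 1 (fun x => arcT l (Q x) (G x) (Y x))
  (Y' * arcT_y l (Q t) (G t) (Y t) + arcT_s l (Q t) (G t) Q' G' (Y t)).
Proof.
have d1 := deriv_mul (deriv_mul (deriv_mul dY dY) dG) (der_cstr (2^-1 : R) t).
have d2 := deriv_mul d1 (@der_recip R (fun x => gap l (Q x) (G x) (Y x)) t _ gap0 der_gap).
rewrite /arcT; apply: (der_eq d2).
by rewrite /arcT_y /arcT_s /arcT; move: gap0; move: (gap l _ _ _) (gap_y l _ _ _) (gap_s _ _ _ _ _) => a b c a0; field.
Qed.

Lemma der_arcN : is_derive t 1 (fun x => arcN l (Q x) (G x) (Y x))
  (Y' * arcN_y l (Q t) (G t) (Y t) + arcN_s l (Q t) (G t) Q' G' (Y t)).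
Proof.
have d1 := deriv_mul (deriv_mul (deriv_mul dY dY) dQ) (der_cstr (2^-1 : R) t).
have d2 := deriv_mul d1 (@der_recip R (fun x => gap l (Q x) (G x) (Y x)) t _ gap0 der_gap).
rewrite /arcN; apply: (der_eq d2).
by rewrite /arcN_y /arcN_s /arcN; move: gap0; move: (gap l _ _ _) (gap_y l _ _ _) (gap_s _ _ _ _ _) => a b c a0; field.
Qed.

End Chain.

Lemma der_after1 (S v : R -> R) (t s' w : R) :
  is_derive t 1 S s' -> is_derive (S t) 1 v w -> is_derive t 1 (fun x => v (S x)) (s' * w).
Proof. exact: is_derive_rescale. Qed.

(** After expansion in the frame this is [stretchE], [stretchT] and
    [stretchN]. *)
Lemma off_chain (S Y : R -> R) (t s' y' : R) : is_derive t 1 S s' -> is_derive t 1 Y y' ->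
  sgap (S t) (Y t) != 0 ->
  is_derive t 1 (fun x => off (S x) (Y x))
    (s' *: (surf_s (S t) (Y t) - T (S t)) + y' *: surf_y (S t) (Y t)).
Proof.
move=> dS dY g0; set s := S t; set y := Y t.
have dq := der_after1 dS (fq_der D s). have dg := der_after1 dS (fg_der D s).
have dE := is_derive_rescale dS (fE_der D s).
have dT := is_derive_rescale dS (fT_der D s).
have dN := is_derive_rescale dS (fN_der D s).
have d := deriv_add (deriv_add (deriv_scale (der_arcE dq dg dY g0) dE) (deriv_scale (der_arcT dq dg dY g0) dT))
  (deriv_scale (der_arcN dq dg dY g0) dN).
apply: (der_eq d).
have hE := stretchE (m s) (g1 s) g0; have hT := stretchT (m s) (g1 s) g0.
have hN := stretchN (m s) (g1 s) g0.
rewrite -/s -/y -/l -/q -/g -/m -/g1 -/E -/T -/N in hE hT hN *.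
have lE : arcE_s l (q s) (g s) (s' * (g s * m s)) (s' * g1 s) y = s' * arcE_s l (q s) (g s) (g s * m s) (g1 s) y.
  by rewrite /arcE_s /gap_s; ring.
have lT : arcT_s l (q s) (g s) (s' * (g s * m s)) (s' * g1 s) y = s' * arcT_s l (q s) (g s) (g s * m s) (g1 s) y.
  by rewrite /arcT_s /gap_s; ring.
have lN : arcN_s l (q s) (g s) (s' * (g s * m s)) (s' * g1 s) y = s' * arcN_s l (q s) (g s) (g s * m s) (g1 s) y.
  by rewrite /arcN_s /gap_s; ring.
rewrite lE lT lN /surf_s /surf_y /ray /off /speed.
move: hE hT hN; move: (arcE_s _ _ _ _ _ _) (arcT_s _ _ _ _ _ _) (arcN_s _ _ _ _ _ _) => es ts ns hE hT hN.
have -> : es = l * arcT l (q s) (g s) y + g s * y * arcE_y l (q s) (g s) y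
    - stretch l (q s) (g s) (m s) (g1 s) y * (g s * arcE l (q s) (g s) y).
  by rewrite -hE; ring.
have -> : ts = stretch l (q s) (g s) (m s) (g1 s) y * (1 - g s * arcT l (q s) (g s) y)
   - 1 - l * arcE l (q s) (g s) y + (q s - m s) * arcN l (q s) (g s) y + g s * y * arcT_y l (q s) (g s) y.
  by rewrite -hT; ring.
have -> : ns = g s * y * arcN_y l (q s) (g s) y - (q s - m s) * arcT l (q s) (g s) y
   - stretch l (q s) (g s) (m s) (g1 s) y * (g s * arcN l (q s) (g s) y).
  by rewrite -hN; ring.
by apply/rowP => i; rewrite !mxE; ring.
Qed.

Lemma surf_chain (S Y : R -> R) (t s' y' : R) : is_derive t 1 S s' -> is_derive t 1 Y y' ->
  sgap (S t) (Y t) != 0 ->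
  is_derive t 1 (fun x => surf (S x) (Y x))
    (s' *: surf_s (S t) (Y t) + y' *: surf_y (S t) (Y t)).
Proof.
move=> dS dY g0; have db := is_derive_rescale dS (base_der D (S t)).
apply: (der_eq (deriv_add db (off_chain dS dY g0))); rewrite -/T.
by move: (surf_s _ _) (surf_y _ _) (T _) => u v z; apply/rowP => i; rewrite !mxE; ring.
Qed.

(** Both principal directions are visible here: nrm moves by - fq times
    surf along the circles, and the additional term is along ray. *)
Lemma nrm_chain (S Y : R -> R) (t s' y' : R) : is_derive t 1 S s' -> is_derive t 1 Y y' ->
  sgap (S t) (Y t) != 0 ->
  is_derive t 1 (fun x => nrm (S x) (Y x))
    ((s' * m (S t)) *: ray (S t) (Y t) -
      q (S t) *: (s' *: surf_s (S t) (Y t) + y' *: surf_y (S t) (Y t))).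
Proof.
move=> dS dY g0; have dN := is_derive_rescale dS (fN_der D (S t)).
have dq := der_after1 dS (fq_der D (S t)).
apply: (der_eq (der_sub dN (deriv_scale dq (off_chain dS dY g0)))).
rewrite /ray -/T -/q -/m -/g.
by move: (surf_s _ _) (surf_y _ _) (T _) (off _ _) => u v z w; apply/rowP => i; rewrite !mxE; ring.
Qed.

Lemma off_dotT s y : dotp (T s) (off s y) = arcT l (q s) (g s) y.
Proof.
have on := frame_on D s.
rewrite /off !dotpDr !dotpZr (on_vv on) (on_vw on) dotpC (on_uv on); ring.
Qed.

Lemma off_dotN s y : dotp (N s) (off s y) = arcN l (q s) (g s) y.
Proof.
have on := frame_on D s.
rewrite /off !dotpDr !dotpZr (on_ww on) (dotpC _ (E s)) (dotpC _ (T s)) (on_vw on) (on_uw on); ring.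
Qed.

Lemma off_dot s y : sgap s y != 0 -> dotp (off s y) (off s y) = y ^+ 2 / sgap s y.
Proof. by move=> g0; rewrite (dotp_frame _ _ _ _ _ _ (frame_on D s)) -!expr2 arc_sq. Qed.

Lemma surf_y_dot s y : sgap s y != 0 -> dotp (surf_y s y) (surf_y s y) = (sgap s y)^-1 ^+ 2.
Proof. by move=> g0; rewrite (dotp_frame _ _ _ _ _ _ (frame_on D s)) -!expr2 arc_y_sq. Qed.

Lemma surf_y_off s y : sgap s y != 0 ->
  dotp (off s y) (surf_y s y) = y * (1 - l * y / 2) / sgap s y ^+ 2.
Proof. by move=> g0; rewrite (dotp_frame _ _ _ _ _ _ (frame_on D s)) arc_velocity. Qed.

Lemma dotp_perturb2 (u v d : 'rV[R]_3) (k k' : R) :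
  dotp (u - k *: d) (v - k' *: d) =
  dotp u v - k' * dotp u d - k * dotp v d + k * k' * dotp d d.
Proof. by rewrite dotpBl !dotpBr !dotpZl !dotpZr (dotpC d v); ring. Qed.

Lemma nrm_unit s y : sgap s y != 0 -> dotp (nrm s y) (nrm s y) = 1.
Proof.
move=> g0; rewrite dotp_perturb2 off_dotN off_dot// (on_ww (frame_on D s)) /arcN -/(sgap s y).
by field.
Qed.

Lemma ray_unit s y : sgap s y != 0 -> dotp (ray s y) (ray s y) = 1.
Proof.
move=> g0; rewrite dotp_perturb2 off_dotT off_dot// (on_vv (frame_on D s)) /arcT -/(sgap s y).
by field.
Qed.

Lemma nrm_ray s y : sgap s y != 0 -> dotp (nrm s y) (ray s y) = 0.
Proof.
move=> g0; rewrite dotp_perturb2 off_dotN off_dotT off_dot// dotpC (on_vw (frame_on D s)).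
by rewrite /arcT /arcN -/(sgap s y); field.
Qed.

Lemma ray_surf_y s y : sgap s y != 0 -> dotp (ray s y) (surf_y s y) = 0.
Proof.
move=> g0; have on := frame_on D s; rewrite dotpBl dotpZl surf_y_off// /surf_y !dotpDr !dotpZr.
rewrite (dotpC _ (E s)) (on_uv on) (on_vv on) (on_vw on) arcT_y_closed// -/(sgap s y); ring.
Qed.

Lemma nrm_surf_y s y : sgap s y != 0 -> dotp (nrm s y) (surf_y s y) = 0.
Proof.
move=> g0; have on := frame_on D s; rewrite dotpBl dotpZl surf_y_off// /surf_y !dotpDr !dotpZr.
rewrite (dotpC _ (E s)) (dotpC _ (T s)) (on_uw on) (on_ww on) (on_vw on) arcN_y_closed// -/(sgap s y); ring.
Qed.

End StripSurface.

(** * Regularity of the swept surface *)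

Section PeriodicBound.
Variable R : realType.

Lemma cont_segment_bounded (f : R -> R) (a b : R) : a <= b -> continuous f ->
  exists2 B : R, 0 < B & forall s, a <= s <= b -> `|f s| <= B.
Proof.
move=> ab cf; have cg : {within `[a, b], continuous (fun s => `|f s|)}.
  apply: continuous_subspaceT => s; apply: (@continuous_comp _ _ _ f (@Num.norm R R)).
    exact: cf.
  exact: norm_continuous.
have [s0 _ H] := EVT_max ab cg.
exists (`|f s0| + 1) => [|s sab]; first by rewrite ltr_wpDl.
by rewrite (le_trans (H s _)) ?in_itv// lerDl.
Qed.

Lemma periodic_bounded (f : R -> R) (L : R) : 0 < L -> continuous f ->
  (forall s, f (s + L) = f s) -> exists2 B : R, 0 < B & forall s, `|f s| <= B.
Proof.
move=> L0 cf fL; have [B B0 H] := cont_segment_bounded (ltW L0) cf.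
exists B => // s; have [k [s' [/andP[s0 s1] ->]]] := periodic_reduce s L0.
by rewrite (periodic_int fL) H// s0 ltW.
Qed.

End PeriodicBound.

Section StripChart.
Variables (R : realType) (D : strip R).

(** The numerator of speed is 1 + O(y^2) because the linear terms of gap and
    lam y cancel. *)
Lemma strip_radius : exists2 e0 : R, 0 < e0 &
  forall s y, `|y| <= e0 -> 1 / 4 <= sgap D s y /\ 0 < speed D s y.
Proof.
pose cc s := (fg1 D s - fg D s ^+ 2 - fq D s * (fq D s - fm D s) - lam D ^+ 2) / 2.
have cg := smooth_continuous (fg_smooth D). have cq := smooth_continuous (fq_smooth D).
have ccont : continuous cc.
  have c1 s : {for s, continuous (fun s => fg D s ^+ 2)} by exact: (@continuousM R _ (fg D) (fg D) s (cg s) (cg s)).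
  have c2 s : {for s, continuous (fun s => fq D s - fm D s)}.
    exact: (@continuousB R _ _ (fq D) (fm D) s (cq s) (@fm_cont _ D s)).
  have c3 s : {for s, continuous (fun s => fq D s * (fq D s - fm D s))}.
    exact: (@continuousM R _ (fq D) (fun s => fq D s - fm D s) s (cq s) (c2 s)).
  have c4 s : {for s, continuous (fun s => fg1 D s - fg D s ^+ 2)}.
    exact: (@continuousB R _ _ (fg1 D) (fun s => fg D s ^+ 2) s (@fg1_cont _ D s) (c1 s)).
  have c5 s : {for s, continuous (fun s => fg1 D s - fg D s ^+ 2 - fq D s * (fq D s - fm D s))}.
    exact: (@continuousB R _ _ _ _ s (c4 s) (c3 s)).
  have c6 s : {for s, continuous (fun s => fg1 D s - fg D s ^+ 2 - fq D s * (fq D s - fm D s) - lam D ^+ 2)}.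
    exact: (@continuousB R _ _ _ _ s (c5 s) (@cst_continuous _ _ (lam D ^+ 2) s)).
  move=> s; exact: (@continuousM R _ _ _ s (c6 s) (@cst_continuous _ _ (2^-1 : R) s)).
have cper s : cc (s + per D) = cc s by rewrite /cc fg1_per fg_per fq_per fm_per.
have [B B0 HB] := periodic_bounded (per_gt0 D) ccont cper.
have l0 : 0 < `|lam D| + 1 by rewrite ltr_wpDl.
pose e0 := Num.min 1 (Num.min (`|lam D| + 1)^-1 (2 * B)^-1).
have e00 : 0 < e0 by rewrite !lt_min ltr01 !invr_gt0 l0 mulr_gt0.
exists e0 => // s y; rewrite !le_min => /and3P[y1 yl yB].
have ly : `|lam D * y| <= 1.
  rewrite normrM; apply: (@le_trans _ _ ((`|lam D| + 1) * (`|lam D| + 1)^-1)).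
    by apply: ler_pM => //; rewrite lerDl.
  by rewrite divff// gt_eqF.
have yy : `|cc s * y ^+ 2| <= 1 / 2.
  have -> : 1 / 2 = B * (1 * (2 * B)^-1) by field; rewrite gt_eqF.
  by rewrite normrM ler_pM// normrX expr2 ler_pM.
have gapE : sgap D s y = (1 - lam D * y / 2) ^+ 2 + y ^+ 2 * (fq D s ^+ 2 + fg D s ^+ 2) / 4 by [].
have pos : 0 <= y ^+ 2 * (fq D s ^+ 2 + fg D s ^+ 2) / 4.
  by rewrite divr_ge0// mulr_ge0// ?addr_ge0 ?sqr_ge0.
have gq : 1 / 4 <= sgap D s y.
  rewrite gapE; apply: (@le_trans _ _ ((1 - lam D * y / 2) ^+ 2)); last by rewrite lerDl.
  have -> : 1 / 4 = (1 / 2) ^+ 2 :> R by field.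
  rewrite ler_pXn2r ?nnegrE ?divr_ge0//; move: ly; rewrite ler_norml => /andP[h1 h2]; lra.
split=> //; rewrite /speed /stretch -/(sgap D s y).
apply: divr_gt0; last by rewrite (lt_le_trans _ gq)// divr_gt0.
have -> : sgap D s y + lam D * y + (fg1 D s - fg D s ^+ 2 - fq D s * (fq D s - fm D s) - lam D ^+ 2) / 2 * y ^+ 2
  = 1 + (lam D * y) ^+ 2 / 4 + y ^+ 2 * (fq D s ^+ 2 + fg D s ^+ 2) / 4 + cc s * y ^+ 2.
  by rewrite gapE /cc; field.
have sq : 0 <= (lam D * y) ^+ 2 / 4 by rewrite divr_ge0// sqr_ge0.
by move: yy; rewrite ler_norml => /andP[h1 _]; move: h1 sq pos;
  move: (cc s * _) (_ / 4) (_ / 4) => u v z; lra.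
Qed.

Variable e0 : R.
Hypothesis Hrad : forall s y, `|y| <= e0 -> 1 / 4 <= sgap D s y /\ 0 < speed D s y.

Definition Om : set 'rV[R]_2 := [set p | `|p 0 1| < e0].
Definition Xs (p : 'rV[R]_2) := surf D (p 0 0) (p 0 1).
Definition Ns (p : 'rV[R]_2) := nrm D (p 0 0) (p 0 1).

Lemma Om_gap p : Om p -> sgap D (p 0 0) (p 0 1) != 0.
Proof.
move=> /ltW /(Hrad (p 0 0))[h _]; rewrite gt_eqF// (lt_le_trans _ h)// divr_gt0//.
Qed.

Lemma coord_lt_open (j : 'I_2) (a b : R) : open [set p : 'rV[R]_2 | `|p 0 j - a| < b].
Proof.
rewrite openE => p /= pab; apply: (nbhs_deltaP p (fun p : 'rV[R]_2 => `|p 0 j - a| < b)).2.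
exists (b - `|p 0 j - a|) => [|y yp].
  by rewrite subr_gt0.
have -> : y 0 j - a = (y - p) 0 j + (p 0 j - a) by rewrite !mxE addrA subrK.
by rewrite (le_lt_trans (ler_normD _ _))// -ltrBrDr (le_lt_trans (coord_le_norm _ _)).
Qed.

Lemma open_Om : open Om.
Proof.
have -> : Om = [set p : 'rV[R]_2 | `|p 0 1 - 0| < e0].
  by apply/seteqP; split=> p; rewrite /Om /= subr0.
exact: coord_lt_open.
Qed.

Lemma smooth_coord (v : R -> 'rV[R]_3) j : smooth v -> smooth (fun s => v s 0 j : R).
Proof. by move=> sv k; apply: Ck_coord; [exact: openT|exact: sv]. Qed.

Lemma Ck_first k (U : set 'rV[R]_2) (f : R -> R) : open U -> smooth f ->
  Ck k U (fun p => f (p 0 0)).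
Proof.
move=> oU sf; apply: (@Ck_comp1 R _ k U setT f (fun p => p 0 0)) => //; first exact: openT.
by apply: (@Ck_lin _ _ _ k U (@coordf R 2 0)); exact: rV_linear_continuous.
Qed.

Lemma Ck_second k (U : set 'rV[R]_2) : open U -> Ck k U (fun p => p 0 1 : R).
Proof.
by move=> oU; apply: (@Ck_lin _ _ _ k U (@coordf R 2 1)); exact: rV_linear_continuous.
Qed.

Lemma Ck_off k j : Ck k Om (fun p => off D (p 0 0) (p 0 1) 0 j : R).
Proof.
have oO := open_Om.
have Cq := Ck_first k oO (fq_smooth D). have Cg := Ck_first k oO (fg_smooth D).
have Cy := @Ck_second k _ oO. have Cc (x : R) : Ck k Om (fun=> x) by exact: Ck_cst.
have CyE : Ck k Om (fun p : 'rV[R]_2 => 1 - lam D * p 0 1 / 2).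
  by apply: (CkB oO (Cc 1)); apply: (CkM oO _ (Cc 2^-1)); exact: (CkM oO (Cc _) Cy).
have Cyy : Ck k Om (fun p : 'rV[R]_2 => p 0 1 * p 0 1) by exact: (CkM oO Cy Cy).
have Cgap : Ck k Om (fun p : 'rV[R]_2 => sgap D (p 0 0) (p 0 1)).
  apply: (CkD oO (CkM oO CyE CyE)); apply: (CkM oO _ (Cc 4^-1)).
  by apply: (CkM oO Cyy); apply: (CkD oO (CkM oO Cq Cq) (CkM oO Cg Cg)).
have Cinv := CkV oO Om_gap Cgap.
have CE := Ck_first k oO (smooth_coord j (fE_smooth D)).
have CT := Ck_first k oO (smooth_coord j (fT_smooth D)).
have CN := Ck_first k oO (smooth_coord j (fN_smooth D)).
have C1 := CkM oO (CkM oO (CkM oO Cy CyE) Cinv) CE.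
have C2 := CkM oO (CkM oO (CkM oO (CkM oO Cyy Cg) (Cc 2^-1)) Cinv) CT.
have C3 := CkM oO (CkM oO (CkM oO (CkM oO Cyy Cq) (Cc 2^-1)) Cinv) CN.
apply: (Ck_eq oO _ (CkD oO (CkD oO C1 C2) C3)) => p _.
by rewrite /off [RHS]mxE [in RHS]mxE !mxE.
Qed.

Lemma Ck_Xs k : Ck k Om Xs.
Proof.
have oO := open_Om; apply: (coord_Ck oO) => j.
have Cb := Ck_first k oO (smooth_coord j (base_smooth D)).
by apply: (Ck_eq oO _ (CkD oO Cb (@Ck_off k j))) => p _; rewrite /Xs /surf [RHS]mxE.
Qed.

Lemma Ck_Ns k : Ck k Om Ns.
Proof.
have oO := open_Om; apply: (coord_Ck oO) => j.
have Cn := Ck_first k oO (smooth_coord j (fN_smooth D)).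
have Cq := Ck_first k oO (fq_smooth D).
apply: (Ck_eq oO _ (CkB oO Cn (CkM oO Cq (@Ck_off k j)))) => p _.
by rewrite /Ns /nrm [RHS]mxE [in RHS]mxE [in RHS]mxE.
Qed.

Lemma Xs_diff p : Om p -> differentiable Xs p.
Proof. by have [d _] := @Ck_Xs 1; exact: d. Qed.

Lemma Ns_diff p : Om p -> differentiable Ns p.
Proof. by have [d _] := @Ck_Ns 1; exact: d. Qed.

Lemma diff_line (W : normedModType R) (f : 'rV[R]_2 -> W) (p a : 'rV[R]_2) (w : W) :
  differentiable f p -> is_derive (0 : R) 1 (fun t : R => f (p + t *: a)) w -> 'd f p a = w.
Proof.
move=> df dw; have := is_derive_diff_comp (is_derive_line p a 0).
by rewrite scale0r addr0 => /(_ _ f df)/is_derive_uniq; apply.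
Qed.

Lemma line_coord (p a : 'rV[R]_2) j : is_derive (0 : R) 1 (fun t : R => (p + t *: a) 0 j : R) (a 0 j).
Proof. exact: (is_derive_coord j (is_derive_line p a 0)). Qed.

Lemma Xs_d p (a : 'rV[R]_2) : Om p ->
  'd Xs p a = a 0 0 *: surf_s D (p 0 0) (p 0 1) + a 0 1 *: surf_y D (p 0 0) (p 0 1).
Proof.
move=> Op; apply: diff_line; first exact: Xs_diff.
have := @surf_chain R D _ _ _ _ _ (line_coord p a 0) (line_coord p a 1).
by rewrite scale0r addr0; apply; exact: Om_gap.
Qed.

Lemma Ns_d p (a : 'rV[R]_2) : Om p ->
  'd Ns p a = (a 0 0 * fm D (p 0 0)) *: ray D (p 0 0) (p 0 1) -
     fq D (p 0 0) *: 'd Xs p a.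
Proof.
move=> Op.
apply: etrans _ (congr1 (fun v => (a 0 0 * fm D (p 0 0)) *: ray D (p 0 0) (p 0 1) -
     fq D (p 0 0) *: v) (esym (Xs_d a Op))).
apply: diff_line; first exact: Ns_diff.
have := @nrm_chain R D _ _ _ _ _ (line_coord p a 0) (line_coord p a 1).
by rewrite scale0r addr0; apply; exact: Om_gap.
Qed.

Lemma Xs_d_ray p a : Om p ->
  dotp ('d Xs p a) (ray D (p 0 0) (p 0 1)) = a 0 0 * speed D (p 0 0) (p 0 1).
Proof.
move=> Op; have g0 := Om_gap Op.
apply: etrans (congr1 (fun v => dotp v (ray D (p 0 0) (p 0 1))) (Xs_d a Op)) _; rewrite /surf_s.
move: (ray_surf_y g0) (ray_unit g0); move: (ray _ _ _) (surf_y _ _ _) => u v uv uu.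
by rewrite !(dotpDl, dotpZl) uu (dotpC v u) uv; ring.
Qed.

Lemma Xs_d_normal p a : Om p -> dotp (Ns p) ('d Xs p a) = 0.
Proof.
move=> Op; have g0 := Om_gap Op.
apply: etrans (congr1 (fun v => dotp (Ns p) v) (Xs_d a Op)) _; rewrite /surf_s /Ns.
move: (nrm_surf_y g0) (nrm_ray g0); move: (nrm _ _ _) (ray _ _ _) (surf_y _ _ _) => n u v nv nu.
by rewrite !(dotpDr, dotpZr) nv nu; ring.
Qed.

Lemma Xs_d_inj p : Om p -> injective ('d Xs p).
Proof.
move=> Op; apply: raddf_inj => a z.
have g0 := Om_gap Op; have [_ sp] := Hrad (p 0 0) (ltW Op).
have z1 := congr1 (fun v => dotp v (ray D (p 0 0) (p 0 1))) z.
have a0 : a 0 0 = 0.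
  have := etrans (esym (Xs_d_ray a Op)) z1; rewrite dotp0l => /eqP.
  by rewrite mulf_eq0 (gt_eqF sp) orbF => /eqP.
have := etrans (esym (Xs_d a Op)) z; rewrite a0 scale0r add0r => /eqP.
rewrite scaler_eq0 => /orP[/eqP a1|/eqP sy].
  by apply/rowP => j; rewrite mxE; move: j; apply: ord2P.
by have := surf_y_dot g0; rewrite sy dotp0l => /eqP; rewrite eq_sym expf_eq0 /= invr_eq0 (negbTE g0).
Qed.

End StripChart.

(** * Embedding of the swept surface *)

Section Embedding.
Variables (R : realType) (D : strip R) (e0 : R).
Hypothesis e00 : 0 < e0.
Hypothesis Hrad : forall s y, `|y| <= e0 -> 1 / 4 <= sgap D s y /\ 0 < speed D s y.
Let L := per D.

Definition vec2 (s y : R) : 'rV[R]_2 := \row_j (if j == 0 then s else y).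

Lemma vec2_0 s y : vec2 s y 0 0 = s. Proof. by rewrite mxE. Qed.
Lemma vec2_1 s y : vec2 s y 0 1 = y. Proof. by rewrite mxE. Qed.

Lemma vec2_eta (p : 'rV[R]_2) : vec2 (p 0 0) (p 0 1) = p.
Proof. by apply/rowP; apply: ord2P; rewrite mxE. Qed.

Lemma Xs_vec2 s y : Xs D (vec2 s y) = surf D s y.
Proof. by rewrite /Xs vec2_0 vec2_1. Qed.

Lemma vec2_lt s y s' y' d : `|s - s'| < d / 2 -> `|y - y'| < d / 2 ->
  `|vec2 s y - vec2 s' y'| < d.
Proof.
move=> h1 h2; have d0 : 0 < d by have := le_lt_trans (normr_ge0 _) h1; lra.
apply: (@le_lt_trans _ _ (d / 2)); last by lra.
apply: norm_le_coord; first by lra.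
by apply: ord2P; rewrite !mxE /= ltW.
Qed.

Lemma surf_per s y (k : int) : surf D (s + k%:~R * L) y = surf D s y.
Proof.
rewrite /surf /off !(periodic_int (@base_per _ D)) !(periodic_int (@fE_per _ D)).
by rewrite !(periodic_int (@fT_per _ D)) !(periodic_int (@fN_per _ D)) !(periodic_int (@fq_per _ D)) !(periodic_int (@fg_per _ D)).
Qed.

Lemma nrm_per s y (k : int) : nrm D (s + k%:~R * L) y = nrm D s y.
Proof.
rewrite /nrm /off !(periodic_int (@fE_per _ D)).
by rewrite !(periodic_int (@fT_per _ D)) !(periodic_int (@fN_per _ D)) !(periodic_int (@fq_per _ D)) !(periodic_int (@fg_per _ D)).
Qed.

Lemma off0 s : off D s 0 = 0.
Proof.
have hE (u v w : R) : arcE u v w 0 = 0 by rewrite /arcE !mul0r.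
have hT (u v w : R) : arcT u v w 0 = 0 by rewrite /arcT expr0n !mul0r.
have hN (u v w : R) : arcN u v w 0 = 0 by rewrite /arcN expr0n !mul0r.
by rewrite /off hE hT hN !scale0r !addr0.
Qed.

Lemma surf0 s : surf D s 0 = base D s.
Proof. by rewrite /surf off0 addr0. Qed.

Lemma Om_axis s : Om e0 (vec2 s 0).
Proof. by rewrite /Om /= vec2_1 normr0. Qed.

(** The period of the curve makes surf injective in s only modulo per; n
    is the number of periods between the parameters. *)
Definition well_separated (e : R) (st : R * R) := forall y y', `|y| < e -> `|y'| < e ->
  exists n : int, e * `|st.1 - st.2 - n%:~R * L| <= `|surf D st.1 y - surf D st.2 y'| /\
    e * `|y - y'| <= `|surf D st.1 y - surf D st.2 y'|.

(** Close parameters, up to periods, are separated because Xs is an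
    immersion; others because the curve is simple. *)
Lemma sep_local (s0 t0 : R) : exists2 d : R, 0 < d &
  forall e s t, 0 < e < d -> `|s - s0| < d -> `|t - t0| < d -> well_separated e (s, t).
Proof.
have oO : open (@Om R e0) by exact: open_Om.
have cX s : {for vec2 s 0, continuous (Xs D)}.
  exact: differentiable_continuous (Xs_diff Hrad (Om_axis s)).
have [same|diff] := EM (base D s0 = base D t0).
  have [n sE] := base_inj same.
  have nX : \forall p \near vec2 s0 0, differentiable (Xs D) p.
    have nO : nbhs (vec2 s0 0) (Om e0) by apply: open_nbhs_nbhs; split; [exact: oO|exact: Om_axis].
    by apply: filterS nO => p Op; exact: (Xs_diff Hrad Op).
  have [_ cd] := @Ck_Xs R D e0 Hrad 1.
  have [K [d [K0 d0 Hlow]]] := strict_diff_lower nX (fun v => cd v _ (Om_axis s0)) (Xs_d_inj Hrad (Om_axis s0)).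
  have m0 : 0 < Num.min (d / 2) K^-1 by rewrite lt_min divr_gt0// invr_gt0.
  exists (Num.min (d / 2) K^-1) => // e s t /andP[e_gt0].
  rewrite !lt_min => /andP[ed eK] /andP[sd _] /andP[td _] y y' ye ye'.
  exists n; rewrite /=.
  have y0 (z : R) : `|z| < e -> `|z - 0| < d / 2 by rewrite subr0 => /lt_trans; apply.
  have td' : `|t + n%:~R * L - s0| < d / 2 by rewrite sE opprD addrACA subrr addr0.
  have := Hlow _ _ (vec2_lt sd (y0 _ ye)) (vec2_lt td' (y0 _ ye')).
  rewrite !Xs_vec2 surf_per => h.
  have eh : e * `|vec2 s y - vec2 (t + n%:~R * L) y'| <= `|surf D s y - surf D t y'|.
    have := ler_wpM2l (ltW e_gt0) h; move/le_trans; apply; rewrite mulrA ler_piMl//.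
    by rewrite -ler_pdivlMr// mul1r ltW.
  split; (apply: le_trans eh; rewrite ler_wpM2l ?(ltW e_gt0)//).
    have -> : s - t - n%:~R * L = (vec2 s y - vec2 (t + n%:~R * L) y') 0 0.
      by rewrite !mxE /= opprD addrA.
    exact: coord_le_norm.
  have -> : y - y' = (vec2 s y - vec2 (t + n%:~R * L) y') 0 1 by rewrite !mxE.
  exact: coord_le_norm.
have eta0 : 0 < `|base D s0 - base D t0| / 4.
  by rewrite divr_gt0// normr_gt0 subr_eq0; apply/eqP.
have [d1 d10 H1] := for_continuous_eps (cX s0) eta0.
have [d2 d20 H2] := for_continuous_eps (cX t0) eta0.
pose k := `|base D s0 - base D t0| / (2 * (`|s0 - t0| + 2)).
have k1 : 0 < `|s0 - t0| + 2 by rewrite ltr_wpDl.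
have k0 : 0 < k by rewrite divr_gt0 ?mulr_gt0// normr_gt0 subr_eq0; apply/eqP.
exists (Num.min 1 (Num.min k (Num.min (d1 / 2) (d2 / 2)))) => [|e s t /andP[e_gt0]].
  by rewrite !lt_min ltr01 k0 !divr_gt0.
rewrite !lt_min => /and4P[e1 ek ed1 ed2] /and4P[s1 _ sd _] /and4P[t1 _ _ td] y y' ye ye'.
have y0 (z d : R) : e < d / 2 -> `|z| < e -> `|z - 0| < d / 2.
  by move=> ed; rewrite subr0 => /lt_trans; apply.
have a1 := H1 _ (vec2_lt sd (y0 _ _ ed1 ye)). have a2 := H2 _ (vec2_lt td (y0 _ _ ed2 ye')).
rewrite !Xs_vec2 !surf0 in a1 a2.
have low : `|base D s0 - base D t0| / 2 <= `|surf D s y - surf D t y'|.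
  move: a1 a2; move: (surf D s y) (surf D t y') (base D s0) (base D t0) => u v b c a1 a2.
  have : `|b - c| <= `|u - b| + `|u - v| + `|v - c|.
    have -> : b - c = - (u - b) + (u - v) + (v - c).
      by apply/rowP => i; rewrite !mxE; ring.
    by rewrite (le_trans (ler_normD _ _))// lerD// (le_trans (ler_normD _ _))// normrN.
  by move: a1 a2; lra.
have up (z : R) : `|z| <= `|s0 - t0| + 2 -> e * `|z| <= `|surf D s y - surf D t y'|.
  move=> zz; apply: (le_trans _ low).
  have -> : `|base D s0 - base D t0| / 2 = k * (`|s0 - t0| + 2) by rewrite /k; field; rewrite gt_eqF.
  by apply: ler_pM => //; [exact: ltW|exact: ltW].
exists 0; rewrite /= mul0r subr0; split; apply: up.
  have -> : s - t = (s - s0) + (s0 - t0) - (t - t0) by ring.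
  rewrite (le_trans (ler_normB _ _))// (le_trans (lerD (ler_normD _ _) (lexx _)))//.
  by move: s1 t1; lra.
have := ler_normB y y'; have := normr_ge0 (s0 - t0); move: ye ye' e1; lra.
Qed.

(** Uniformity by compactness of a square of parameters over one period. *)
Lemma sep_strip : exists2 e : R, 0 < e < e0 & forall s t, well_separated e (s, t).
Proof.
have L0 : 0 < L by exact: per_gt0.
have cpt : compact (`[0, L] `*` `[0, L] : set (R * R)).
  by apply: compact_setX; exact: segment_compact.
have nc := (compact_near_coveringP _).1 cpt.
have H : \forall e \near (0 : R)^'+, `[0, L] `*` `[0, L] `<=` (well_separated e : set (R * R)).
  apply: nc => -[s0 t0] _; have [d d0 Hd] := sep_local s0 t0.
  exists (ball (s0, t0) d, [set e | 0 < e < d]).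
    split=> /=; first exact: nbhsx_ballx.
    near=> e => /=; apply/andP; split; first by near: e; exact: nbhs_right_gt.
    by near: e; exact: nbhs_right_lt.
  move=> [[s t] e] /= [[/= sb tb] ed]; apply: Hd => //.
    by move: sb; rewrite -ball_normE /= distrC.
  by move: tb; rewrite -ball_normE /= distrC.
have [e [e1 e2 He]] : exists e : R, [/\ 0 < e, e < e0 & `[0, L] `*` `[0, L] `<=` (well_separated e : set (R * R))].
  near (0 : R)^'+ => e; exists e; split; near: e;
    [exact: nbhs_right_gt|exact: nbhs_right_lt|exact: H].
exists e; first by rewrite e1.
move=> s t; have [k [s' [/andP[s0 s1] sE]]] := periodic_reduce s L0.
have [k' [t' [/andP[t0 t1] tE]]] := periodic_reduce t L0.
move=> y y' ye ye'; have [|n [h1 h2]] := He (s', t') _ y y' ye ye'.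
  by split; rewrite /= in_itv/= ?s0 ?t0 ltW.
exists (n + k - k'); rewrite /= sE tE !surf_per; split; last exact: h2.
apply: le_trans h1; rewrite le_eqVlt; apply/orP; left; apply/eqP; congr (_ * `|_|).
by rewrite /= intrB intrD; ring.
Unshelve. all: by end_near. Qed.

End Embedding.

(** * The swept surface as an oriented surface *)

Lemma eps_within (R : realType) (V W : normedModType R) (A : set V) (f : V -> W) :
  (forall x, A x -> forall e : R, 0 < e -> exists2 d : R, 0 < d &
     forall y, A y -> `|y - x| < d -> `|f y - f x| < e) -> {within A, continuous f}.
Proof.
move=> H; apply/subspace_continuousP => x Ax; apply/cvgrPdistC_lt => e e0.
have [d d0 Hd] := H _ Ax _ e0.
rewrite near_withinE; apply/nbhs_deltaP; exists d => // y yx Ay; exact: Hd.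
Qed.

Lemma int_small (R : realType) (n : int) (L : R) : 0 < L -> `|n%:~R * L| < L -> n = 0.
Proof.
move=> L0; rewrite normrM (gtr0_norm L0) gtr_pMl// -intr_norm ltrz1.
by rewrite -(gez0_abs (normr_ge0 n)) => h; apply/eqP; rewrite -normr_eq0; move: h; case: `|n| => -[].
Qed.

Section StripEmbedded.
Variables (R : realType) (r : nat) (D : strip R) (e0 e : R).
Hypothesis r1 : (0 < r)%N.
Hypothesis Hrad : forall s y, `|y| <= e0 -> 1 / 4 <= sgap D s y /\ 0 < speed D s y.
Hypothesis e_gt0 : 0 < e.
Hypothesis e_lt : e < e0.
Hypothesis sep : forall s t, well_separated D e (s, t).
Let L := per D.
Let L0 : 0 < L. Proof. exact: per_gt0. Qed.

Definition strip_set : set 'rV[R]_3 := [set x | exists s y, `|y| < e /\ x = surf D s y].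
Definition tile (s0 : R) : set 'rV[R]_2 :=
  [set p | `|p 0 0 - s0| < L / 4] `&` [set p | `|p 0 1 - 0| < e].

Lemma patch_Om s0 p : tile s0 p -> Om e0 p.
Proof. by move=> [_]; rewrite /= subr0 => h; rewrite /Om /= (lt_trans h). Qed.

Lemma open_patch s0 : open (tile s0).
Proof. by apply: openI; exact: coord_lt_open. Qed.

Lemma patch_close s0 p p' : tile s0 p -> tile s0 p' -> `|Xs D p - Xs D p'| < e * (L / 4) ->
  e * `|p - p'| <= `|Xs D p - Xs D p'|.
Proof.
move=> [/= a1 a2] [/= b1 b2]; rewrite subr0 in a2; rewrite subr0 in b2 => h.
have [n [/= h1 h2]] := sep (p 0 0) (p' 0 0) a2 b2.
have n0 : n = 0.
  apply: (int_small L0).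
  have h3 : `|p 0 0 - p' 0 0 - n%:~R * L| < L / 4.
    by rewrite -(ltr_pM2l e_gt0); exact: le_lt_trans h.
  have -> : n%:~R * L = (p 0 0 - s0) - (p' 0 0 - s0) - (p 0 0 - p' 0 0 - n%:~R * L) by ring.
  rewrite (le_lt_trans (ler_normB _ _))//.
  have h4 := ler_normB (p 0 0 - s0) (p' 0 0 - s0).
  by move: h3 h4 a1 b1 L0; lra.
rewrite n0 mul0r subr0 in h1.
rewrite -ler_pdivlMl//; apply: norm_le_coord; first by rewrite mulr_ge0// invr_ge0 ltW.
by apply: ord2P; rewrite ler_pdivlMl// !mxE.
Qed.

Lemma patch_inj s0 p p' : tile s0 p -> tile s0 p' -> Xs D p = Xs D p' -> p = p'.
Proof.
move=> Up Up' E; have := patch_close Up Up'; rewrite E subrr normr0.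
move=> /(_ (mulr_gt0 e_gt0 (divr_gt0 L0 (ltr0n _ 4)))).
by rewrite pmulr_rle0// normr_le0 subr_eq0 => /eqP.
Qed.

(** By separation every point of the surface close to Xs p has a parameter
    close to p. *)
Lemma strip_set_shift x (p : 'rV[R]_2) : strip_set x -> `|p 0 1| < e ->
  exists p' : 'rV[R]_2, [/\ `|p' 0 1| < e, Xs D p' = x, e * `|p' 0 0 - p 0 0| <= `|x - Xs D p| &
    e * `|p' 0 1 - p 0 1| <= `|x - Xs D p|].
Proof.
move=> [s [y [ye ->]]] pe; have [n [/= h1 h2]] := sep s (p 0 0) ye pe.
exists (vec2 (s - n%:~R * L) y); rewrite vec2_0 vec2_1 Xs_vec2; split => //.
  have -> : s - n%:~R * L = s + (- n)%:~R * L by rewrite intrN mulNr.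
  exact: surf_per.
by move: h1; rewrite addrAC.
Qed.

Lemma strip_chart s0 : chart r strip_set (tile s0) (Xs D).
Proof.
split.
- exact: open_patch.
- apply/class_CE; apply: (Ck_sub _ (@Ck_Xs R D e0 Hrad r)) => p; exact: patch_Om.
- by move=> p Up; exact: (Xs_d_inj Hrad (patch_Om Up)).
pose V : set 'rV[R]_3 := [set x | exists2 p, tile s0 p & `|x - Xs D p| < e * (L / 4 - `|p 0 0 - s0|)].
pose Y x : 'rV[R]_2 := if pselect (exists2 p, tile s0 p & Xs D p = x) is left H then projT1 (cid2 H) else 0.
have YX p : tile s0 p -> Y (Xs D p) = p.
  move=> Up; rewrite /Y; case: pselect => [H|[]]; last by exists p.
  by case: (cid2 H) => p' /= Up' E; exact: (patch_inj Up' Up E).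
have img : Xs D @` tile s0 = V `&` strip_set.
  apply/seteqP; split=> x.
    move=> [p Up <-]; have [/= u1 u2] := Up; split.
      by exists p => //; rewrite subrr normr0 mulr_gt0// subr_gt0.
    by exists (p 0 0), (p 0 1); rewrite subr0 in u2; split.
  move=> [[p [/= u1 u2] xp] Sx]; rewrite subr0 in u2.
  have [p' [h1 h2 h3 h4]] := strip_set_shift Sx u2.
  exists p' => //; split=> /=; last by rewrite subr0.
  have : `|p' 0 0 - p 0 0| < L / 4 - `|p 0 0 - s0|.
    by rewrite -(ltr_pM2l e_gt0); exact: le_lt_trans xp.
  have -> : p' 0 0 - s0 = (p' 0 0 - p 0 0) + (p 0 0 - s0) by ring.
  by rewrite ltrBrDr; apply: le_lt_trans; exact: ler_normD.
exists V, Y; split=> //.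
  rewrite openE => x [p Up xp]; apply: (nbhs_deltaP x V).2.
  exists (e * (L / 4 - `|p 0 0 - s0|) - `|x - Xs D p|); first by rewrite subr_gt0.
  move=> y yx; exists p => //; have -> : y - Xs D p = (y - x) + (x - Xs D p) by rewrite addrA subrK.
  by rewrite (le_lt_trans (ler_normD _ _))// -ltrBrDr.
rewrite -img; apply: eps_within => _ [p Up <-] eps eps0.
have m0 : 0 < Num.min (e * (L / 4)) (e * eps) by rewrite lt_min !mulr_gt0// divr_gt0.
exists (Num.min (e * (L / 4)) (e * eps)) => // _ [p' Up' <-].
rewrite lt_min !YX// => /andP[h1 h2].
by rewrite -(ltr_pM2l e_gt0) (le_lt_trans (patch_close Up' Up h1)).
Qed.

Definition strip_normal x : 'rV[R]_3 :=
  if pselect (exists p : 'rV[R]_2, `|p 0 1| < e /\ Xs D p = x) is left H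
  then Ns D (projT1 (cid H)) else 0.

Lemma strip_normalE (p : 'rV[R]_2) : `|p 0 1| < e -> strip_normal (Xs D p) = Ns D p.
Proof.
move=> pe; rewrite /strip_normal; case: pselect => [H|[]]; last by exists p.
case: (cid H) => p' /= [pe' E]; have [n [/= ]] := sep (p' 0 0) (p 0 0) pe' pe.
rewrite -/(Xs D p') -/(Xs D p) E subrr normr0 !pmulr_rle0// !normr_le0 => /eqP h1 /eqP h2.
rewrite /Ns; have -> : p' 0 1 = p 0 1 by apply/eqP; rewrite -subr_eq0 h2.
have -> : p' 0 0 = p 0 0 + n%:~R * L by move: h1 => /eqP; rewrite subr_eq0 subr_eq addrC => /eqP.
exact: nrm_per.
Qed.

Lemma strip_Om (p : 'rV[R]_2) : `|p 0 1| < e -> Om e0 p.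
Proof. by move=> h; rewrite /Om /= (lt_trans h). Qed.

Lemma strip_setP x : strip_set x -> exists2 p : 'rV[R]_2, `|p 0 1| < e & Xs D p = x.
Proof. by move=> [s [y [ye ->]]]; exists (vec2 s y); rewrite ?vec2_1 ?Xs_vec2. Qed.

Lemma patch_center (p : 'rV[R]_2) : `|p 0 1| < e -> tile (p 0 0) p.
Proof. by move=> pe; split; rewrite /= ?subr0// subrr normr0 divr_gt0. Qed.

Lemma strip_charts x : strip_set x -> exists U X q, [/\ chart r strip_set U X, U q & X q = x].
Proof.
move=> /strip_setP[p pe <-]; exists (tile (p 0 0)), (Xs D), p.
by split=> //; [exact: strip_chart|exact: patch_center].
Qed.

Lemma strip_normal_unit x : strip_set x -> dotp (strip_normal x) (strip_normal x) = 1.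
Proof.
move=> /strip_setP[p pe <-]; rewrite strip_normalE//.
exact: (nrm_unit (Om_gap Hrad (strip_Om pe))).
Qed.

(** Tangent vectors in an arbitrary chart are tangent vectors in one of
    the charts [tile], by [chart_lift]. *)
Lemma strip_normal_orthogonal U X q : chart r strip_set U X -> U q ->
  forall a, dotp (strip_normal (X q)) ('d X q a) = 0.
Proof.
move=> ch Uq a; have [oU /class_CE CX _ [V [Y [_ E _ _]]]] := ch.
have SX p : U p -> strip_set (X p) by move=> Up; have [] : (V `&` strip_set) (X p) by rewrite -E; exists p.
have [dX _] := Ck_le r1 CX.
have [p pe Xp] := strip_setP (SX _ Uq).
pose g (t : R) := X (q + t *: a).
have dg : is_derive (0 : R) 1 g ('d X q a).
  have := is_derive_diff_comp (is_derive_line q a 0).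
  by rewrite scale0r addr0; apply; exact: dX.
have gS : \forall t \near (0 : R), strip_set (g t).
  by apply: filterS (near_line a oU Uq) => t; exact: SX.
have g0 : g 0 = Xs D p by rewrite /g scale0r addr0 Xp.
have [_ [b [_ _ bE _ _]]] := chart_lift r1 (strip_chart (p 0 0)) (patch_center pe) g0 gS dg.
have H := Xs_d_normal Hrad b (strip_Om pe).
rewrite -Xp strip_normalE//; apply: etrans H; exact: (congr1 (fun v => dotp (Ns D p) v) (esym bE)).
Qed.

Lemma strip_normal_continuous : {within strip_set, continuous strip_normal}.
Proof.
apply: eps_within => x /strip_setP[p pe <-] eps eps0.
have cN : {for p, continuous (Ns D)}.
  exact: (differentiable_continuous (Ns_diff Hrad (strip_Om pe))).
have [d d0 Hd] := for_continuous_eps cN eps0.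
exists (e * (d / 2)); first by rewrite mulr_gt0// divr_gt0.
move=> y Sy yx; have [p' [h1 pE h3 h4]] := strip_set_shift Sy pe.
rewrite -pE !strip_normalE//; apply: Hd.
rewrite -(vec2_eta p') -(vec2_eta p); apply: vec2_lt.
  by rewrite -(ltr_pM2l e_gt0) (le_lt_trans h3 yx).
by rewrite -(ltr_pM2l e_gt0) (le_lt_trans h4 yx).
Qed.

Definition strip_surface : oriented_surface R r :=
  OrientedSurface strip_charts strip_normal_unit strip_normal_orthogonal strip_normal_continuous.

End StripEmbedded.

(** * Its principal directions *)

Lemma inf_attained (R : realType) (A : set R) (x : R) : A x -> lbound A x -> inf A = x.
Proof.
move=> Ax lb; apply/eqP; rewrite eq_le; apply/andP; split.
  by apply: ge_inf => //; exists x.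
by apply: lb_le_inf => //; exists x.
Qed.

Lemma sup_attained (R : realType) (A : set R) (x : R) : A x -> ubound A x -> sup A = x.
Proof.
move=> Ax ub; apply/eqP; rewrite eq_le; apply/andP; split.
  by apply: ge_sup => //; exists x.
by apply: ub_le_sup => //; exists x.
Qed.

Section StripPrincipal.
Variables (R : realType) (r : nat) (D : strip R) (e0 e : R).
Hypothesis r1 : (0 < r)%N.
Hypothesis Hrad : forall s y, `|y| <= e0 -> 1 / 4 <= sgap D s y /\ 0 < speed D s y.
Hypothesis e_gt0 : 0 < e.
Hypothesis e_lt : e < e0.
Hypothesis sep : forall s t, well_separated D e (s, t).
Let S := strip_surface r1 Hrad e_gt0 e_lt sep.

Lemma strip_normal_d (p b : 'rV[R]_2) : `|p 0 1| < e ->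
  'd (normal S \o Xs D) p b = 'd (Ns D) p b.
Proof.
move=> pe; have Op := strip_Om e_lt pe.
have nE : \forall p' \near p, Ns D p' = (normal S \o Xs D) p'.
  have nP : nbhs p [set p' : 'rV[R]_2 | `|p' 0 1 - 0| < e].
    by apply: open_nbhs_nbhs; split; [exact: coord_lt_open|rewrite /= subr0].
  apply: filterS nP => p' /=; rewrite subr0 => pe'.
  exact: (esym (strip_normalE e_gt0 sep pe')).
have [_ EE] := near_eq_diff nE (Ns_diff Hrad Op).
exact: (congr1 (fun f => f b) EE).
Qed.

(** The normal curvature in a unit direction b is fq - (fm / speed) times the
    squared component of b along ray: the principal curvatures are
    fq - fm / speed, along ray, and fq, along the circles. *)
Lemma strip_form2 (p b : 'rV[R]_2) : `|p 0 1| < e ->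
  form2 S (Xs D) p b b = fq D (p 0 0) * form1 (Xs D) p b b
    - fm D (p 0 0) / speed D (p 0 0) (p 0 1) * (b 0 0 * speed D (p 0 0) (p 0 1)) ^+ 2.
Proof.
move=> pe; have Op := strip_Om e_lt pe; have [_ sp] := Hrad (p 0 0) (ltW Op).
have E1 := etrans (strip_normal_d b pe) (Ns_d Hrad b Op).
have E2 := Xs_d_ray Hrad b Op.
apply: etrans (congr1 (fun v => dotp (- v) ('d (Xs D) p b)) E1) _.
rewrite /form1; move: E2; move: ('d (Xs D) p b) (ray _ _ _) (speed _ _ _) sp => v u mu sp vu.
by rewrite dotpNl dotpBl !dotpZl (dotpC u v) vu; field; rewrite gt_eqF.
Qed.

Lemma ray_principal s y : `|y| < e -> principal_direction false S (surf D s y) (ray D s y).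
Proof.
move=> ye; pose p := vec2 s y.
have p0 : p 0 0 = s by rewrite /p vec2_0. have p1 : p 0 1 = y by rewrite /p vec2_1.
have pe : `|p 0 1| < e by rewrite p1.
have Op := strip_Om e_lt pe.
have [gq sp] := Hrad s (ltW (lt_trans ye e_lt)).
have g0 : sgap D s y != 0 by rewrite gt_eqF// (lt_le_trans _ gq)// divr_gt0.
have r_unit := ray_unit g0.
pose a := vec2 (speed D s y)^-1 (- (fg D s * y / speed D s y)).
have dA : 'd (Xs D) p a = ray D s y.
  apply: etrans (Xs_d Hrad a Op) _; rewrite p0 p1 /a vec2_0 vec2_1 /surf_s.
  move: (ray _ _ _) (surf_y _ _ _) (speed D s y) sp => u v mu sp.
  by apply/rowP => i; rewrite !mxE; field; rewrite gt_eqF.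
have fa : form1 (Xs D) p a a = 1.
  by apply: etrans (f_equal2 (fun u v => dotp u v) dA dA) _.
have a0 : a 0 0 * speed D s y = 1 by rewrite /a vec2_0 mulVf// gt_eqF.
have curv b : form1 (Xs D) p b b = 1 ->
   form2 S (Xs D) p b b = fq D s - fm D s / speed D s y * (b 0 0 * speed D s y) ^+ 2.
  by move=> fb; have := strip_form2 b pe; rewrite fb mulr1 p0 p1.
have k0 : 0 < fm D s / speed D s y by rewrite divr_gt0// fm_gt0.
have pmin : principal_curvature false S (Xs D) p = fq D s - fm D s / speed D s y.
  apply: inf_attained; first by exists a => //; rewrite curv// a0 expr1n mulr1.
  move=> _ [b /= fb <-]; rewrite curv// lerD2l lerN2 ger_pMr//.
  have := Xs_d_ray Hrad b Op; rewrite p0 p1 => <-.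
  apply: le_trans (dotp_CS _ _) _; rewrite r_unit mulr1.
  by move: fb; rewrite /form1 => ->.
have pmax : principal_curvature true S (Xs D) p = fq D s.
  apply: sup_attained.
    pose b := vec2 0 (sgap D s y).
    have db : 'd (Xs D) p b = sgap D s y *: surf_y D s y.
      by apply: etrans (Xs_d Hrad b Op) _; rewrite p0 p1 /b vec2_0 vec2_1 scale0r add0r.
    have fb : form1 (Xs D) p b b = 1.
      apply: etrans (f_equal2 (fun u v => dotp u v) db db) _.
      by rewrite dotpZl dotpZr surf_y_dot//; field.
    by exists b => //; rewrite curv// /b vec2_0 mul0r expr0n mulr0 subr0.
  by move=> _ [b /= fb <-]; rewrite curv// lerBlDr lerDl mulr_ge0 ?sqr_ge0// ltW.
exists (tile D e s), (Xs D), p, a; split.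
  split=> //; [exact: (strip_chart r Hrad e_gt0 e_lt sep)| |exact: Xs_vec2].
  by rewrite -p0; exact: patch_center.
split=> //; last by rewrite curv// pmin a0 expr1n mulr1.
rewrite /umbilic pmin pmax => h; move: k0; rewrite -oppr_lt0.
have -> : - (fm D s / speed D s y) = 0 by move: h; lra.
by rewrite ltxx.
Qed.

End StripPrincipal.

(** * Its leaves and its return map *)

Section Antiderivative.
Variable R : realType.

Lemma antiderivative (f : R -> R) (a b : R) :
  (forall s, a <= s <= b -> {for s, continuous f}) ->
  exists H : R -> R, forall s : R, a < s < b -> is_derive s 1 H (f s).
Proof.
move=> cf; exists (fun x => \int[lebesgue_measure]_(t in `[a, x]) f t)%R => s /andP[as_ sb].
have cw : {within `[a, b], continuous f}.
  apply: eps_within => x /=; rewrite in_itv/= => xab e e0.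
  by have [d d0 H] := for_continuous_eps (cf _ xab) e0; exists d => // y _; exact: H.
have int : lebesgue_measure.-integrable `[a, b] (EFin \o f).
  by apply: continuous_compact_integrable => //; exact: segment_compact.
have sab : a <= s <= b by rewrite !ltW.
have [d E] := continuous_FTC1_closed sb int as_ (cf _ sab).
by rewrite derive1E in E; apply: DeriveDef.
Qed.

Lemma cont_on_bounded (f : R -> R) (a b : R) : a <= b -> cont_on a b f ->
  exists2 B : R, 0 < B & forall s, a <= s <= b -> `|f s| <= B.
Proof.
move=> ab cf; have cg : cont_on a b (fun s => `|f s|).
  move=> t tab e e0; have [d d0 H] := cf t tab e e0.
  by exists d => // s sab sd; apply: le_lt_trans (H s sab sd); exact: ler_dist_dist.
have [s0 _ H] := EVT_max ab (cont_on_within cg).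
exists (`|f s0| + 1) => [|s sab]; first by rewrite ltr_wpDl.
by rewrite (le_trans (H s _)) ?in_itv// lerDl.
Qed.

End Antiderivative.

Lemma speed_cancel (R : realType) (u v : 'rV[R]_3) (k g y : R) : k != 0 ->
  k^-1 *: (k *: u + (g * y) *: v) + (k^-1 * (- g * y)) *: v = u.
Proof. by move=> k0; apply/rowP => i; rewrite !mxE; field. Qed.

Section StripReturn.
Variables (R : realType) (r : nat) (D : strip R) (e0 e : R).
Hypothesis r1 : (0 < r)%N.
Hypothesis Hrad : forall s y, `|y| <= e0 -> 1 / 4 <= sgap D s y /\ 0 < speed D s y.
Hypothesis e_gt0 : 0 < e.
Hypothesis e_lt : e < e0.
Hypothesis sep : forall s t, well_separated D e (s, t).
Let S := strip_surface r1 Hrad e_gt0 e_lt sep.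
Let L := per D.
Let L0 : 0 < L. Proof. exact: per_gt0. Qed.
Variable rho : R -> R.
Hypothesis drho : forall s : R, -1 < s < L + 1 -> is_derive s 1 rho (- fg D s * rho s).
Hypothesis rho0 : rho 0 = 1.

Let far (s : R) : - (1 / 2) <= s <= L + 1 / 2 -> -1 < s < L + 1.
Proof. by move=> /andP[h1 h2]; apply/andP; split; lra. Qed.

(** Since rho' = - g rho, the velocity of s |-> surf s (t rho s) is speed times
    the unit vector ray; the leaf is this curve reparametrized by the inverse
    of an antiderivative of its speed. *)
Lemma strip_leaf (t : R) :
  (forall s, - (1 / 2) <= s <= L + 1 / 2 -> `|t * rho s| < e) ->
  exists (T : R) (gamma : R -> 'rV[R]_3) (inv : R -> R),
  [/\ 0 < T, gamma 0 = surf D 0 t, gamma T = surf D L (t * rho L),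
     forall tau : R, 0 <= tau <= T -> [/\ `|t * rho (inv tau)| < e,
       gamma tau = surf D (inv tau) (t * rho (inv tau)) &
       is_derive tau 1 gamma (ray D (inv tau) (t * rho (inv tau)))] &
     inv 0 = 0 /\ forall tau, 0 < tau < T -> 0 < inv tau < L].
Proof.
move=> small; pose y s := t * rho s.
have small' s : - (1 / 2) <= s <= L + 1 / 2 -> `|y s| <= e0.
  by move=> /small h; rewrite ltW// (lt_trans h).
have dy (s : R) : - (1 / 2) <= s <= L + 1 / 2 -> is_derive s 1 y (- fg D s * y s).
  move=> /far/drho h; apply: (der_eq (deriv_mul (der_cstr t s) h)).
  by rewrite /y; ring.
pose f s := speed D s (y s).
have f0 s : - (1 / 2) <= s <= L + 1 / 2 -> 0 < f s.
  by move=> /small' h; have [] := Hrad s h.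
have cder (h : R -> R) (s l : R) : is_derive s 1 h l -> {for s, continuous h}.
  by move=> [d _]; apply/differentiable_continuous/derivable1_diffP.
have cf s : - (1 / 2) <= s <= L + 1 / 2 -> {for s, continuous f}.
  move=> sI; have cy := cder _ _ _ (dy _ sI).
  have cq := cder _ _ _ (fq_der D s). have cg := cder _ _ _ (fg_der D s).
  have cm := @fm_cont _ D s. have cg1 := @fg1_cont _ D s.
  have cc (k : R) : {for s, continuous (fun _ : R => k)} by exact: cst_continuous.
  have M (u v : R -> R) : {for s, continuous u} -> {for s, continuous v} ->
     {for s, continuous (fun x => u x * v x)} by exact: continuousM.
  have A (u v : R -> R) : {for s, continuous u} -> {for s, continuous v} ->
     {for s, continuous (fun x => u x + v x)} by exact: continuousD.
  have B (u v : R -> R) : {for s, continuous u} -> {for s, continuous v} ->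
     {for s, continuous (fun x => u x - v x)} by exact: continuousB.
  have cyy : {for s, continuous (fun x => y x ^+ 2)} by exact: (M _ _ cy cy).
  have cqq : {for s, continuous (fun x => fq D x ^+ 2)} by exact: (M _ _ cq cq).
  have cgg : {for s, continuous (fun x => fg D x ^+ 2)} by exact: (M _ _ cg cg).
  have cl : {for s, continuous (fun x => 1 - lam D * y x / 2)}.
    exact: (B _ _ (cc 1) (M _ _ (M _ _ (cc (lam D)) cy) (cc 2^-1))).
  have cgap : {for s, continuous (fun x => sgap D x (y x))}.
    exact: (A _ _ (M _ _ cl cl) (M _ _ (M _ _ cyy (A _ _ cqq cgg)) (cc 4^-1))).
  have [gq _] := Hrad s (small' _ sI).
  have gn : sgap D s (y s) != 0 by rewrite gt_eqF// (lt_le_trans _ gq)// divr_gt0.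
  have cinv : {for s, continuous (fun x => (sgap D x (y x))^-1)} by exact: continuousV.
  have c1 := B _ _ (B _ _ (B _ _ cg1 cgg) (M _ _ cq (B _ _ cq cm))) (cc (lam D ^+ 2)).
  exact: (M _ _ (A _ _ (A _ _ cgap (M _ _ (cc (lam D)) cy)) (M _ _ (M _ _ c1 (cc 2^-1)) cyy)) cinv).
have [H0 DH] := antiderivative cf.
pose l s := H0 s - H0 0.
have Dl (s : R) : - (1 / 2) < s < L + 1 / 2 -> is_derive s 1 l (f s).
  by move=> /DH h; apply: (der_eq (der_subr h (der_cstr (H0 0) s))); rewrite subr0.
have lt s s' : - (1 / 2) < s -> s < s' -> s' < L + 1 / 2 -> l s < l s'.
  move=> h1 h2 h3.
  have D1 (x : R) : s <= x <= s' -> is_derive x 1 l (f x).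
    move=> /andP[a1 a2]; apply: Dl; apply/andP; split; lra.
  have cl : {within `[s, s'], continuous l}.
    by apply: derivable_within_continuous => x; rewrite in_itv/= => /D1[].
  have D2 (x : R) : x \in `]s, s'[%R -> is_derive x 1 l (f x).
    by rewrite in_itv/= => /andP[/ltW a1 /ltW a2]; apply: D1; rewrite a1.
  have [x xI E] := MVT h2 D2 cl; rewrite in_itv/= in xI.
  have [a1 a2] := andP xI.
  rewrite -subr_gt0 E mulr_gt0 ?subr_gt0// f0//; apply/andP; split; lra.
have linj s s' : - (1 / 2) < s < L + 1 / 2 -> - (1 / 2) < s' < L + 1 / 2 -> l s = l s' -> s = s'.
  move=> /andP[a1 a2] /andP[b1 b2] E; have [h|h|//] := ltgtP s s'.
    by have := lt _ _ a1 h b2; rewrite E ltxx.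
  by have := lt _ _ b1 h a2; rewrite E ltxx.
pose inv tau := if pselect (exists s, - (1 / 2) < s < L + 1 / 2 /\ l s = tau) is left H
  then projT1 (cid H) else 0.
have invK s : - (1 / 2) < s < L + 1 / 2 -> inv (l s) = s.
  move=> sI; rewrite /inv; case: pselect => [H|[]]; last by exists s.
  by case: (cid H) => s' /= [s'I E]; exact: linj.
have l0 : l 0 = 0 by rewrite /l subrr.
have z0 : - (1 / 2) < (0 : R) < L + 1 / 2 by apply/andP; split; move: L0; lra.
have zL : - (1 / 2) < L < L + 1 / 2 by apply/andP; split; move: L0; lra.
have T0 : 0 < l L by rewrite -[ltLHS]l0; exact: (lt 0 L (proj1 (andP z0)) L0 (proj2 (andP zL))).
have i0 : inv 0 = 0 by rewrite -{1}l0 invK.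
have iT : inv (l L) = L by rewrite invK.
have ex tau : 0 <= tau <= l L -> exists2 s, 0 <= s <= L & l s = tau.
  move=> tT; have cl : {within `[0, L], continuous l}.
    apply: derivable_within_continuous => x; rewrite in_itv/= => /andP[h1 h2].
    by have [] := Dl x; first by apply/andP; split; lra.
  have sg : Num.min (l 0) (l L) <= tau <= Num.max (l 0) (l L).
    by rewrite l0 min_l ?max_r ?(ltW T0).
  by have [s sI E] := IVT (ltW L0) cl sg; exists s => //; rewrite in_itv in sI.
exists (l L), (fun tau => surf D (inv tau) (y (inv tau))), inv; split=> //.
- by rewrite i0 /y rho0 mulr1.
- by rewrite iT.
- move=> tau /ex[s /andP[s0 s1] <-].
  have sI : - (1 / 2) < s < L + 1 / 2 by apply/andP; split; move: s0 s1; lra.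
  have sI' : - (1 / 2) <= s <= L + 1 / 2 by have [h1 h2] := andP sI; rewrite !ltW.
  rewrite (invK _ sI); split=> //; first exact: small.
  have oI : open [set x : R | - (1 / 2) < x < L + 1 / 2].
    have -> : [set x : R | - (1 / 2) < x < L + 1 / 2] = `](- (1 / 2)), (L + 1 / 2)[%classic.
      by apply/seteqP; split=> x /=; rewrite in_itv.
    exact: interval_open.
  have nI : nbhs s [set x : R | - (1 / 2) < x < L + 1 / 2] by apply: open_nbhs_nbhs; split.
  have n1 : {near s, cancel l inv} by apply: filterS nI => x; exact: invK.
  have n2 : \forall x \near s, {for x, continuous l}.
    by apply: filterS nI => x /Dl; exact: cder.
  have di : is_derive (l s) 1 inv (f s)^-1.
    by apply: (is_derive_inverse n1 n2 (Dl _ sI)); rewrite gt_eqF// f0.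
  have sE := invK _ sI.
  have dyi : is_derive (l s) 1 (fun x => y (inv x)) ((f s)^-1 * (- fg D s * y s)).
    by apply: (der_after1 di); rewrite sE; exact: dy.
  have [gq sp] := Hrad s (small' _ sI').
  have gn : sgap D (inv (l s)) (y (inv (l s))) != 0.
    by rewrite sE gt_eqF// (lt_le_trans _ gq)// divr_gt0.
  apply: (der_eq (surf_chain di dyi gn)); rewrite sE -/(y s) /surf_s.
  have fn : f s != 0 by rewrite gt_eqF// f0.
  exact: speed_cancel.
- split=> // tau /andP[t0 t1]; have [|s /andP[s0 s1] E] := ex tau; first by rewrite !ltW.
  have sI : - (1 / 2) < s < L + 1 / 2 by apply/andP; split; move: s0 s1; lra.
  rewrite -E invK// !lt_def s0 s1 !andbT; apply/andP; split; apply/eqP => z.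
    by move: t0; rewrite -E z l0 ltxx.
  by move: t1; rewrite -E -z ltxx.
Qed.

Let sig (t : R) := surf D 0 t.

Lemma strip_gap (s y : R) : `|y| < e -> sgap D s y != 0.
Proof.
move=> ye; have [gq _] := Hrad s (ltW (lt_trans ye e_lt)).
by rewrite gt_eqF// (lt_le_trans _ gq)// divr_gt0.
Qed.

Lemma strip_segment_der (t : R) : `|t| < e -> is_derive t 1 sig (surf_y D 0 t).
Proof.
move=> te; have g0 := strip_gap 0 te.
apply: (der_eq (surf_chain (der_cstr 0 t) (der_id t) g0)).
by rewrite scale0r add0r scale1r.
Qed.

Lemma strip_segment_cont (t : R) : `|t| < e -> {for t, continuous (derive1 sig)}.
Proof.
move=> te; pose v := vec2 0 (1 : R).
have dE (x : R) : `|x| < e -> derive1 sig x = 'd (Xs D) (vec2 0 x) v.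
  move=> xe; have [_ h] := strip_segment_der xe; rewrite derive1E h.
  have Op : Om e0 (vec2 0 x) by rewrite /Om /= vec2_1 (lt_trans xe).
  apply: etrans _ (esym (Xs_d Hrad v Op)).
  by rewrite !vec2_0 !vec2_1 scale0r add0r scale1r.
have Ot : Om e0 (vec2 0 t) by rewrite /Om /= vec2_1 (lt_trans te).
have [_ /(_ v) cd] := @Ck_Xs R D e0 Hrad 1.
apply: eps_for_continuous => eps eps0.
have [d d0 H] := for_continuous_eps (cd _ Ot) eps0.
exists (Num.min (d / 2) (e - `|t|)) => [|x]; first by rewrite lt_min divr_gt0// subr_gt0.
rewrite lt_min => /andP[xd xt].
have xe : `|x| < e.
  have -> : x = (x - t) + t by rewrite subrK.
  by rewrite (le_lt_trans (ler_normD _ _))// -ltrBrDr.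
have := H (vec2 0 x); rewrite (dE _ xe) (dE _ te); apply.
by apply: vec2_lt; rewrite ?subrr ?normr0// divr_gt0.
Qed.

Lemma strip_transversal : transversal_segment false S sig (e / 2).
Proof.
have inI (t : R) : - (e / 2) <= t <= e / 2 -> `|t| < e.
  by rewrite -ler_norml => h; apply: (le_lt_trans h); move: e_gt0; lra.
split; first by rewrite divr_gt0.
  move=> t t'; rewrite !in_itv/= => /inI te /inI te' E.
  have [n [/= _]] := sep 0 0 te te'; rewrite -/(sig t) -/(sig t') E subrr normr0.
  by rewrite pmulr_rle0// normr_le0 subr_eq0 => /eqP.
move=> t /inI te; have dt := strip_segment_der te; split.
- by case: dt.
- exact: strip_segment_cont.
- by exists 0, t.
exists (ray D 0 t); split; first exact: (ray_principal r1 Hrad e_gt0 e_lt sep).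
move=> x; have [_ h] := dt; rewrite derive1E h => E.
have g0 := strip_gap 0 te.
have := surf_y_dot g0; rewrite {1}E dotpZl ray_surf_y// mulr0 => /eqP.
by rewrite eq_sym expf_eq0 /= invr_eq0 (negbTE g0).
Qed.

Lemma ray0 s : ray D s 0 = fT D s.
Proof. by rewrite /ray off0 scaler0 subr0. Qed.

Lemma base_derive1 s : derive1 (base D) s = fT D s.
Proof. by have [_ h] := base_der D s; rewrite derive1E h. Qed.

Lemma strip_cycle : principal_cycle false S (base D).
Proof.
move=> s; rewrite base_derive1 -surf0 -ray0.
by apply: ray_principal; rewrite normr0.
Qed.

Hypothesis rhoL : rho L != 1.

(** The segment is met again only when the parameter of the curve has
    increased by a full period, by separation. *)
Lemma strip_first_return : \forall t \near (0 : R),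
  first_return false S sig (e / 2) (derive1 (base D) 0) t (t * rho L).
Proof.
have cr : cont_on (- (1 / 2)) (L + 1 / 2) rho.
  by apply: derive_cont_on => s /far/drho[].
have ab : - (1 / 2) <= L + 1 / 2 by move: L0; lra.
have [B B0 HB] := cont_on_bounded ab cr.
have b0 : 0 < Num.min (e / 2 / (B + 1)) (Num.min (1 / 2) (2 * (`|fg D 0| + 1))^-1).
  by rewrite !lt_min !divr_gt0 ?invr_gt0 ?mulr_gt0 ?ltr_wpDl// ltW.
apply/(@nbhs_deltaP R R); exists (Num.min (e / 2 / (B + 1)) (Num.min (1 / 2) (2 * (`|fg D 0| + 1))^-1)) => //.
move=> t; rewrite subr0 !lt_min => /and3P[t1 t2 t3].
have small s : - (1 / 2) <= s <= L + 1 / 2 -> `|t * rho s| <= e / 2.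
  move=> /HB h; rewrite normrM.
  have -> : e / 2 = e / 2 / (B + 1) * (B + 1) by rewrite divfK// gt_eqF// addr_gt0.
  by apply: ler_pM => //; [exact: ltW|rewrite (le_trans h)// lerDl].
have small' s : - (1 / 2) <= s <= L + 1 / 2 -> `|t * rho s| < e.
  by move=> /small h; apply: (le_lt_trans h); move: e_gt0; lra.
have [T [g [inv [T0 g0 gT leaf [i0 iI]]]]] := strip_leaf small'.
have zI : - (1 / 2) <= (0 : R) <= L + 1 / 2 by apply/andP; split; move: L0; lra.
have LI : - (1 / 2) <= L <= L + 1 / 2 by apply/andP; split; move: L0; lra.
have te : `|t| < e by have := small' _ zI; rewrite rho0 mulr1.
exists T, g; split; split => //.
- move=> tau /leaf[ye gE [d dE]]; split=> //.
  by rewrite derive1E dE gE; exact: (ray_principal r1 Hrad e_gt0 e_lt sep).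
- have [|_ _ [_ dE]] := leaf 0; first by rewrite lexx ltW.
  rewrite derive1E dE i0 rho0 mulr1 base_derive1 dotpC.
  have gn := strip_gap 0 te.
  rewrite /ray dotpBr (on_vv (frame_on D 0)) dotpZr off_dotT /arcT subr_gt0.
  have [gq _] := Hrad 0 (ltW (lt_trans te e_lt)).
  rewrite -/(sgap D 0 t) mulrA ltr_pdivrMr ?mul1r; last by rewrite (lt_le_trans _ gq)// divr_gt0.
  apply: (@lt_le_trans _ _ (1 / 4)) => //.
  have -> : fg D 0 * (t ^+ 2 * fg D 0 / 2) = (t * fg D 0) ^+ 2 / 2 by ring.
  have h : `|t * fg D 0| <= 1 / 2.
    have -> : 1 / 2 = (2 * (`|fg D 0| + 1))^-1 * (`|fg D 0| + 1).
      by field; rewrite gt_eqF// ltr_wpDl.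
    by rewrite normrM; apply: ler_pM => //; [exact: ltW|rewrite lerDl].
  have : `|t * fg D 0| ^+ 2 <= (1 / 2) ^+ 2 by rewrite ler_pXn2r// nnegrE divr_ge0.
  by rewrite real_normK ?num_real//; lra.
- by rewrite -ler_norml; exact: small.
- rewrite gT /sig; have -> : L = 0 + (1 : int)%:~R * L by rewrite add0r mul1r.
  by rewrite surf_per add0r mul1r.
- move=> tau tT [t' /=]; rewrite in_itv/= -ler_norml => t'e sE.
  have tT' : 0 <= tau <= T by have [h1 h2] := andP tT; rewrite !ltW.
  have [ye gE _] := leaf _ tT'.
  have t'e' : `|t'| < e by apply: (le_lt_trans t'e); move: e_gt0; lra.
  have [n [/= h1 _]] := sep (inv tau) 0 ye t'e'.
  move: h1; rewrite -gE -/(sig t') sE subrr normr0 pmulr_rle0// normr_le0 subr0 subr_eq0 => /eqP h1.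
  have /andP[i1 i2] := iI _ tT; rewrite h1 in i1 i2.
  have n0 : n = 0 by apply: (int_small L0); rewrite gtr0_norm.
  by move: i1; rewrite n0 mul0r ltxx.
Qed.

Lemma strip_hyperbolic : hyperbolic_principal_cycle S (base D).
Proof.
exists false; split; first exact: strip_cycle.
have dP : is_derive (0 : R) 1 (fun t : R => t * rho L) (rho L).
  by apply: (der_eq (deriv_mul (der_id 0) (der_cstr (rho L) 0))); rewrite mul1r mulr0 addr0.
exists 0, sig, (e / 2), (fun t => t * rho L); split.
- split; [exact: strip_transversal|exact: surf0| |exact: strip_first_return].
  move=> s t; rewrite -ler_norml => h; rewrite -surf0 => E.
  have te : `|t| < e by apply: (le_lt_trans h); move: e_gt0; lra.
  have z0 : `|0 : R| < e by rewrite normr0.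
  have [n [/= _]] := sep s 0 z0 te; rewrite E subrr normr0.
  by rewrite pmulr_rle0// normr_le0 sub0r oppr_eq0 => /eqP.
- by case: dP.
- by have [_ h] := dP; rewrite derive1E h; exact/eqP.
Qed.

End StripReturn.

(** * Curves of constant geodesic curvature *)

Section CircleCriterion.
Variable R : realType.

Lemma angle_exists (u v : R) : u ^+ 2 + v ^+ 2 = 1 -> exists th, cos th = u /\ sin th = v.
Proof.
move=> uv; have u1 : -1 <= u <= 1.
  rewrite -ler_norml -(@ler_pXn2r _ 2) ?nnegrE// expr1n real_normK ?num_real//.
  by rewrite -uv lerDl sqr_ge0.
have vE : 1 - u ^+ 2 = v ^+ 2 by rewrite -uv; ring.
have ca : cos (acos u) = u by apply: acosK; rewrite in_itv.
have sa : sin (acos u) = `|v| by rewrite sin_acos// vE sqrtr_sqr.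
have [v0|v0] := leP 0 v; first by exists (acos u); rewrite ca sa ger0_norm.
by exists (- acos u); rewrite cosN sinN ca sa ltr0_norm// opprK.
Qed.

Lemma der_cst_eq n (f : R -> 'rV[R]_n) : (forall s : R, is_derive s 1 f 0) ->
  forall s t, f s = f t.
Proof.
move=> df s t; pose b := `|s| + `|t|.
have sb : - b <= s <= b by rewrite -ler_norml lerDl.
have tb : - b <= t <= b by rewrite -ler_norml lerDr.
have z (x : R) : - b <= x <= b -> `|0 : 'rV[R]_n| <= 0 by rewrite normr0.
have := @curve_lipschitz R n f (fun=> 0) (- b) b 0 (lexx 0) (fun x _ => df x) z t s tb sb.
by rewrite mul0r normr_le0 subr_eq0 => /eqP.
Qed.

Variables (c : R -> 'rV[R]_3) (L : R).
Hypothesis hc : closed_frenet_curve c L.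
Let T := derive1 c.
Variables (E N : R -> 'rV[R]_3) (l k : R).
Hypothesis on : forall s, orthonormal3 (E s) (T s) (N s).
Hypothesis dE : forall s : R, is_derive s 1 E (l *: T s).
Hypothesis dT : forall s : R, is_derive s 1 T (k *: N s - l *: E s).
Hypothesis dN : forall s : R, is_derive s 1 N (- k *: T s).

(** For constant k the centre c + c'' / (k^2 + l^2) and the axis l N + k E do
    not move, so c lies on a circle.  That it covers the circle follows from
    the explicit solution of c'' = - (k^2 + l^2) (c - centre). *)
Lemma constant_curvature_circle : is_circle c L.
Proof.
have accE s : derive1n 2 c s = k *: N s - l *: E s.
  exact: is_derive_uniq (curve_derive2 hc s) (dT s).
have kl s (x y x' y' : R) : dotp (x *: N s - y *: E s) (x' *: N s - y' *: E s) = x * x' + y * y'.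
  have o := on s; rewrite dotpBl !dotpBr !dotpZl !dotpZr (on_ww o) (on_uu o).
  by rewrite (dotpC (N s)) (on_uw o); ring.
pose ka := Num.sqrt (k ^+ 2 + l ^+ 2).
have ka2 : ka ^+ 2 = k ^+ 2 + l ^+ 2 by rewrite sqr_sqrtr// addr_ge0// sqr_ge0.
have ka0 : 0 < ka.
  have := cfc_curvature_gt0 hc 0.
  by rewrite /curvature accE kl -!expr2.
have kan : ka != 0 by rewrite gt_eqF.
have dc (s : R) : is_derive s 1 c (T s) by exact: (curve_derive hc s).
pose V s := k *: N s - l *: E s.
have dV (s : R) : is_derive s 1 V (- ka ^+ 2 *: T s).
  have H1 := deriv_scale (der_cst k s) (dN s).
  have H2 := deriv_scale (der_cst l s) (dE s).
  apply: (der_eq (der_sub H1 H2)); rewrite ka2.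
  by apply/rowP => i; rewrite !mxE; ring.
pose ctr := c 0 + ka ^- 2 *: V 0.
have ctrE s : c s + ka ^- 2 *: V s = ctr.
  apply: (@der_cst_eq 3 (fun s => c s + ka ^- 2 *: V s)) => {}s.
  apply: (der_eq (deriv_add (dc s) (deriv_scale (der_cst (ka ^- 2) s) (dV s)))).
  by apply/rowP => i; rewrite !mxE; field.
have cE s : c s - ctr = - (ka ^- 2 *: V s) by rewrite -(ctrE s) opprD addrA subrr sub0r.
pose A s := l *: N s + k *: E s.
have AE s : A s = A 0.
  apply: der_cst_eq => {}s.
  apply: (der_eq (deriv_add (deriv_scale (der_cst l s) (dN s)) (deriv_scale (der_cst k s) (dE s)))).
  by apply/rowP => i; rewrite !mxE; ring.
have AV s : dotp (A 0) (V s) = 0.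
  have o := on s; rewrite -(AE s) /A /V dotpDl !dotpBr !dotpZl !dotpZr (on_ww o) (on_uu o).
  by rewrite (dotpC (N s)) (on_uw o); ring.
have AT : dotp (A 0) (T 0) = 0.
  have o := on 0; rewrite /A dotpDl !dotpZl (on_uv o) (dotpC (N 0)) (on_vw o); ring.
have AA : dotp (A 0) (A 0) = ka ^+ 2.
  have o := on 0; rewrite /A dotpDl !dotpDr !dotpZl !dotpZr (on_ww o) (on_uu o) ka2.
  by rewrite (dotpC (N 0)) (on_uw o); ring.
have VV s : dotp (V s) (V s) = ka ^+ 2 by rewrite kl ka2 -!expr2.
exists ctr, (A 0), ka^-1; split; [|by rewrite invr_gt0|].
  by apply: contraTneq ka0 => z; have := AA; rewrite z dotp0l => /esym/eqP; rewrite expf_eq0 /= (negbTE kan).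
apply/seteqP; split=> x.
  move=> [s _ <-]; split; rewrite /plane /sphere /= cE.
    by rewrite dotpNr dotpZr AV mulr0 oppr0.
  by rewrite dotpNl dotpNr opprK dotpZl dotpZr VV; field.
move=> [px sx]; rewrite /plane /sphere /= in px sx.
(* c - ctr and T, rotated back by the angle ka s; both are constant, which is
   the explicit form of the uniform rotation *)
pose y s := cos (ka * s) *: (c s - ctr) + (- sin (ka * s) / ka) *: T s.
pose z s := sin (ka * s) *: (c s - ctr) + (cos (ka * s) / ka) *: T s.
have dcc (s : R) : is_derive s 1 (fun s => c s - ctr) (T s).
  by apply: (der_eq (der_sub (dc s) (der_cst ctr s))); rewrite subr0.
have dl (s : R) : is_derive s 1 (fun s : R => ka * s) ka.
  by apply: (der_eq (deriv_mul (der_cstr ka s) (der_id s))); rewrite mul0r add0r mulr1.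
have dco (s : R) : is_derive s 1 (fun s => cos (ka * s)) (ka * - sin (ka * s)).
  exact: (@der_after1 R (fun s => ka * s) (@cos R) s ka _ (dl s) (is_derive_cos (ka * s))).
have dsi (s : R) : is_derive s 1 (fun s => sin (ka * s)) (ka * cos (ka * s)).
  exact: (@der_after1 R (fun s => ka * s) (@sin R) s ka _ (dl s) (is_derive_sin (ka * s))).
have ccE s : V s = - ka ^+ 2 *: (c s - ctr).
  by rewrite cE; apply/rowP => i; rewrite !mxE; field.
have dT' (s : R) : is_derive s 1 T (- ka ^+ 2 *: (c s - ctr)) by rewrite -ccE; exact: dT.
have yE s : y s = y 0.
  apply: der_cst_eq => {}s.
  have d1 := deriv_mul (is_derive_opp (dsi s)) (der_cstr ka^-1 s).
  apply: (der_eq (deriv_add (deriv_scale (dco s) (dcc s)) (deriv_scale d1 (dT' s)))).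
  by apply/rowP => i; rewrite !mxE; field.
have zE s : z s = z 0.
  apply: der_cst_eq => {}s.
  have d1 := deriv_mul (dco s) (der_cstr ka^-1 s).
  apply: (der_eq (deriv_add (deriv_scale (dsi s) (dcc s)) (deriv_scale d1 (dT' s)))).
  by apply/rowP => i; rewrite !mxE; field.
have y0 : y 0 = - (ka ^- 2 *: V 0) by rewrite /y mulr0 cos0 sin0 oppr0 mul0r scale0r addr0 scale1r cE.
have z0 : z 0 = ka^-1 *: T 0 by rewrite /z mulr0 cos0 sin0 scale0r add0r div1r.
have cyz s : c s - ctr = cos (ka * s) *: y 0 + sin (ka * s) *: z 0.
  rewrite -(yE s) -(zE s) /y /z.
  have cs := cos2Dsin2 (ka * s); move: cs (c s - ctr) (T s); move: (cos _) (sin _) => u v uv p q.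
  have -> : p = (u ^+ 2 + v ^+ 2) *: p by rewrite uv scale1r.
  by rewrite uv scale1r; apply/rowP => i; rewrite !mxE -[LHS]mul1r -uv; ring.
have TV : dotp (T 0) (V 0) = 0.
  have o := on 0; rewrite /V dotpBr !dotpZr (on_vw o) (dotpC (T 0)) (on_uv o); ring.
have o3 : orthonormal3 (ka^-1 *: A 0) (ka^-1 *: V 0) (T 0).
  have o := on 0; split; rewrite ?dotpZl ?dotpZr ?AA ?VV ?AV ?AT ?mulr0//; try by field.
    exact: (on_vv o).
  by rewrite dotpC TV mulr0.
have xe := orthonormal3_expand (x - ctr) o3.
have xA : dotp (x - ctr) (ka^-1 *: A 0) = 0 by rewrite dotpZr dotpC px mulr0.
have sq := dotp_sq3 (x - ctr) o3.
rewrite xA sx expr0n add0r in sq; rewrite xA scale0r add0r in xe.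
move: sq xe; set al := dotp _ (ka^-1 *: V 0); set be := dotp _ (T 0) => sq xe.
have [th [c1 s1]] : exists th, cos th = - (ka * al) /\ sin th = ka * be.
  apply: angle_exists; have -> : (- (ka * al)) ^+ 2 + (ka * be) ^+ 2 = ka ^+ 2 * (al ^+ 2 + be ^+ 2) by ring.
  by rewrite -sq; field.
have <- : c (th / ka) = x; last exact: (trace_curve hc).
apply: (addIr (- ctr)); rewrite cyz xe mulrC divfK// c1 s1 y0 z0.
by move: (V 0) (T 0) => u v; apply/rowP => i; rewrite !mxE; field.
Qed.

End CircleCriterion.

(** * The swept surface of a given curve *)

Section SmoothCurves.
Variable R : realType.

Lemma smoothM (f g : R -> R) : smooth f -> smooth g -> smooth (fun s => f s * g s).
Proof. by move=> cf cg k; apply: CkM; [exact: openT|exact: cf|exact: cg]. Qed.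

Lemma smoothD (W : normedModType R) (f g : R -> W) : smooth f -> smooth g -> smooth (fun s => f s + g s).
Proof. by move=> cf cg k; apply: CkD; [exact: openT|exact: cf|exact: cg]. Qed.

Lemma smoothB (f g : R -> R) : smooth f -> smooth g -> smooth (fun s => f s - g s).
Proof. by move=> cf cg k; apply: CkB; [exact: openT|exact: cf|exact: cg]. Qed.

Lemma smooth_cst (W : normedModType R) (w : W) : smooth (fun _ : R => w).
Proof. by move=> k; exact: Ck_cst. Qed.

Lemma smoothV (f : R -> R) : (forall s, f s != 0) -> smooth f -> smooth (fun s => (f s)^-1).
Proof. by move=> f0 cf k; apply: CkV; [exact: openT|move=> x _; exact: f0|exact: cf]. Qed.

Lemma coord_smooth n (f : R -> 'rV[R]_n) : (forall j, smooth (fun s => f s 0 j : R)) -> smooth f.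
Proof. by move=> H k; apply: coord_Ck; [exact: openT|move=> j; exact: H]. Qed.

Lemma smooth_dotp (u v : R -> 'rV[R]_3) : smooth u -> smooth v -> smooth (fun s => dotp (u s) (v s)).
Proof.
move=> su sv; have H j := smoothM (smooth_coord j su) (smooth_coord j sv).
have -> : (fun s => dotp (u s) (v s)) =
   fun s => u s 0 o0 * v s 0 o0 + u s 0 o1 * v s 0 o1 + u s 0 o2 * v s 0 o2.
  by apply/funext => s; rewrite dotpE.
by apply: smoothD; [apply: smoothD|].
Qed.

Lemma smooth_crossp (u v : R -> 'rV[R]_3) : smooth u -> smooth v -> smooth (fun s => crossp (u s) (v s)).
Proof.
move=> su sv; have H i j := smoothM (smooth_coord i su) (smooth_coord j sv).
apply: coord_smooth; apply: ord3P.
- have -> : (fun s => crossp (u s) (v s) 0 o0 : R) = fun s => u s 0 o1 * v s 0 o2 - u s 0 o2 * v s 0 o1.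
    by apply/funext => s; rewrite crosspE.
  exact: smoothB.
- have -> : (fun s => crossp (u s) (v s) 0 o1 : R) = fun s => u s 0 o2 * v s 0 o0 - u s 0 o0 * v s 0 o2.
    by apply/funext => s; rewrite crosspE.
  exact: smoothB.
- have -> : (fun s => crossp (u s) (v s) 0 o2 : R) = fun s => u s 0 o0 * v s 0 o1 - u s 0 o1 * v s 0 o0.
    by apply/funext => s; rewrite crosspE.
  exact: smoothB.
Qed.

Lemma deriv_crossp (u v : R -> 'rV[R]_3) (t : R) (u' v' : 'rV[R]_3) :
  is_derive t 1 u u' -> is_derive t 1 v v' ->
  is_derive t 1 (fun s => crossp (u s) (v s)) (crossp u' (v t) + crossp (u t) v').
Proof.
move=> du dv; have H i j := deriv_mul (is_derive_coord i du) (is_derive_coord j dv).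
apply: coord_is_derive; apply: ord3P.
- have -> : (fun s => crossp (u s) (v s) 0 o0 : R) = fun s => u s 0 o1 * v s 0 o2 - u s 0 o2 * v s 0 o1.
    by apply/funext => s; rewrite crosspE.
  by apply: (der_eq (der_subr (H o1 o2) (H o2 o1))); rewrite [RHS]mxE !crosspE; ring.
- have -> : (fun s => crossp (u s) (v s) 0 o1 : R) = fun s => u s 0 o2 * v s 0 o0 - u s 0 o0 * v s 0 o2.
    by apply/funext => s; rewrite crosspE.
  by apply: (der_eq (der_subr (H o2 o0) (H o0 o2))); rewrite [RHS]mxE !crosspE; ring.
- have -> : (fun s => crossp (u s) (v s) 0 o2 : R) = fun s => u s 0 o0 * v s 0 o1 - u s 0 o1 * v s 0 o0.
    by apply/funext => s; rewrite crosspE.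
  by apply: (der_eq (der_subr (H o0 o1) (H o1 o0))); rewrite [RHS]mxE !crosspE; ring.
Qed.

Lemma derive1_per (W : normedModType R) (f : R -> W) (L : R) : smooth f ->
  (forall s, f (s + L) = f s) -> forall s, derive1 f (s + L) = derive1 f s.
Proof.
move=> sf fL s; have dS : is_derive s 1 (fun x : R => x + L) 1.
  by apply: (der_eq (deriv_addr (der_id s) (der_cstr L s))); rewrite addr0.
have := is_derive_rescale dS (smooth_is_derive (s + L) sf).
have -> : (fun x => f (x + L)) = f by apply/funext.
by rewrite scale1r => H; exact: is_derive_uniq H (smooth_is_derive s sf).
Qed.

End SmoothCurves.

Lemma profile_identity (R : realType) (b a a1 b1 M x k : R) : b != 0 -> a1 = b - M ->
  (b1 * x + b * (- (0 * a + M * a1 + a1 * a1) * x)) * k + b * x * 0 =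
  - (b * (a1 - b1 * (b^-1 * b^-1))) * (b * x * k).
Proof. by move=> b0 ->; field. Qed.

Lemma ratio_one (R : realType) (b x y : R) : b != 0 -> y != 0 ->
  b * x / (b * y) = 1 -> x = y.
Proof.
move=> b0 y0 h; have /eqP : b * x / (b * y) * (b * y) = b * y by rewrite h mul1r.
by rewrite divfK ?mulf_neq0// (inj_eq (mulfI b0)) => /eqP.
Qed.

Lemma itv_widen (R : realType) (s L : R) : 0 <= s <= L -> -1 < s < L + 1.
Proof. by move=> /andP[h1 h2]; apply/andP; split; lra. Qed.

Lemma bound_shift (R : realType) (B x : R) : `|x| <= B -> 0 < B + 1 + x.
Proof. by rewrite ler_norml => /andP[h1 _]; lra. Qed.

Section Frames.
Variables (R : realType) (c : R -> 'rV[R]_3) (L : R).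
Hypothesis hc : closed_frenet_curve c L.
Let T := derive1 c.

Lemma curve_inj s t : c s = c t -> exists k : int, s = t + k%:~R * L.
Proof.
have L0 := cfc_length_gt0 hc.
have [k [s' [sI ->]]] := periodic_reduce s L0; have [k' [t' [tI ->]]] := periodic_reduce t L0.
rewrite !(periodic_int (cfc_periodic hc)) => /(cfc_simple hc sI tI) ->.
by exists (k - k'); rewrite intrB; ring.
Qed.

Definition surface_frame (E : R -> 'rV[R]_3) (l : R) :=
  [/\ smooth E, forall s, dotp (E s) (E s) = 1, forall s, dotp (E s) (T s) = 0,
      forall s : R, is_derive s 1 E (l *: T s) & forall s, E (s + L) = E s].

(** E is the unit normal of the plane (l = 0), or of the sphere of radius rho
    (l = 1 / rho), along the curve. *)
Lemma surface_frame_exists : planar c L \/ spherical c L -> exists E l, surface_frame E l.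
Proof.
move=> [[ctr [n0 [n00 sub]]]|[ctr [rho [rho0 sub]]]].
  have [n nn pE] := unit_axis ctr n00; rewrite pE in sub.
  exists (fun=> n), 0; split=> //.
  - exact: smooth_cst.
  - move=> s; have H := is_derive_dotp_cst n ctr (curve_derive hc s).
    exact: (is_derive_cst_eq (fun s => sub _ (trace_curve hc s)) H).
  - by move=> s; rewrite scale0r; exact: der_cst.
have dcc (s : R) : is_derive s 1 (fun s => c s - ctr) (T s).
  by apply: (der_eq (der_sub (curve_derive hc s) (der_cst ctr s))); rewrite subr0.
exists (fun s => rho^-1 *: (c s - ctr)), rho^-1; split.
- apply: coord_smooth => j.
  have -> : (fun s => (rho^-1 *: (c s - ctr)) 0 j : R) = fun s => rho^-1 * (c s 0 j - ctr 0 j).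
    by apply/funext => s; rewrite !mxE.
  apply: smoothM; first exact: smooth_cst.
  by apply: smoothB; [exact: (smooth_coord j (curve_smooth hc))|exact: smooth_cst].
- move=> s; rewrite dotpZl dotpZr (sub _ (trace_curve hc s)).
  by field; rewrite gt_eqF.
- move=> s; rewrite dotpZl.
  have H := is_derive_dotp (dcc s) (dcc s).
  have := is_derive_cst_eq (fun s => sub _ (trace_curve hc s)) H.
  by rewrite (dotpC (T s)) -mulr2n => /eqP; rewrite mulrn_eq0 /= => /eqP ->; rewrite mulr0.
- move=> s; apply: (der_eq (deriv_scale (der_cst rho^-1 s) (dcc s))).
  by rewrite scale0r add0r.
- by move=> s; rewrite (cfc_periodic hc).
Qed.

Variables (E : R -> 'rV[R]_3) (l : R).
Hypothesis fr : surface_frame E l.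
Let N s := crossp (E s) (T s).
Let a s := dotp (N s) (derive1n 2 c s).

Let on s : orthonormal3 (E s) (T s) (N s).
Proof. by have [_ e1 e2 _ _] := fr; apply: orthonormal3_crossp => //; exact: (cfc_arclength hc). Qed.

Let sT : smooth T. Proof. exact: smooth_derive1 (curve_smooth hc). Qed.
Let sN : smooth N. Proof. by have [sE _ _ _ _] := fr; exact: smooth_crossp. Qed.
Let sA : smooth (derive1n 2 c). Proof. exact: smooth_derive1 sT. Qed.
Let sa : smooth a. Proof. exact: smooth_dotp. Qed.

Let dE (s : R) : is_derive s 1 E (l *: T s). Proof. by have [_ _ _ h _] := fr. Qed.

Let dT (s : R) : is_derive s 1 T (a s *: N s - l *: E s).
Proof.
have d := curve_derive2 hc s; apply: (der_eq d).
have [_ _ eT _ _] := fr.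
have aE : dotp (derive1n 2 c s) (E s) = - l.
  have := is_derive_cst_eq eT (is_derive_dotp (dE s) d).
  rewrite dotpZl (cfc_arclength hc) mulr1 (dotpC (E s)) => /eqP.
  by rewrite addrC addr_eq0 => /eqP.
rewrite {1}(orthonormal3_expand (derive1n 2 c s) (on s)) aE (dotpC _ (T s)).
rewrite (_ : dotp (T s) _ = 0); last exact: (curve_acc_orth hc).
by rewrite scale0r addr0 scaleNr addrC /a dotpC.
Qed.

Let dN (s : R) : is_derive s 1 N (- a s *: T s).
Proof.
have [_ e1 e2 _ _] := fr.
apply: (der_eq (deriv_crossp (dE s) (dT s))).
have TT : crossp (T s) (T s) = 0 by apply: row3P; rewrite !mxE /=; ring.
have EE : crossp (E s) (E s) = 0 by apply: row3P; rewrite !mxE /=; ring.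
have EN : crossp (E s) (N s) = - T s by rewrite /N crossp_crossp e2 e1 scale0r sub0r scale1r.
rewrite crosspZl TT scaler0 add0r.
have -> : a s *: N s - l *: E s = a s *: N s + (- l) *: E s by rewrite scaleNr.
by rewrite crosspDr !crosspZr EE EN scaler0 addr0 scalerN scaleNr.
Qed.

Let pT s : T (s + L) = T s.
Proof. exact: (derive1_per (curve_smooth hc) (cfc_periodic hc)). Qed.
Let pN s : N (s + L) = N s.
Proof. by have [_ _ _ _ pE] := fr; rewrite /N pE pT. Qed.
Let pa s : a (s + L) = a s.
Proof. exact: (f_equal2 (fun u v => dotp u v) (pN s) (derive1_per sT pT s)). Qed.

Let a1 := derive1 a.
Let sa1 : smooth a1. Proof. exact: smooth_derive1. Qed.
Let pa1 s : a1 (s + L) = a1 s. Proof. exact: derive1_per. Qed.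
Let da (s : R) : is_derive s 1 a (a1 s). Proof. exact: smooth_is_derive. Qed.
Let L0 : 0 < L. Proof. exact: (cfc_length_gt0 hc). Qed.

Section Build.
Variable M : R.
Hypothesis HM : forall s, 0 < M + a1 s.
Let b s := M + a1 s.
Let b0 s : b s != 0. Proof. by rewrite gt_eqF// HM. Qed.
Let sb : smooth b. Proof. by apply: smoothD; [exact: smooth_cst|]. Qed.
Let b1 := derive1 a1.
Let db (s : R) : is_derive s 1 b (b1 s).
Proof. by apply: (der_eq (deriv_addr (der_cstr M s) (smooth_is_derive s sa1))); rewrite add0r. Qed.
Let sb1 : smooth b1. Proof. exact: smooth_derive1. Qed.
Let m s := (b s)^-1.
Let sm : smooth m. Proof. exact: smoothV. Qed.
Let q s := a s + m s.
Let g s := b s * (a1 s - b1 s * (m s * m s)).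
Let sq : smooth q. Proof. exact: smoothD. Qed.
Let sg : smooth g.
Proof. by apply: smoothM => //; apply: smoothB => //; apply: smoothM => //; exact: smoothM. Qed.
Let dq (s : R) : is_derive s 1 q (g s * m s).
Proof.
apply: (der_eq (deriv_addr (da s) (der_recip (b0 s) (db s)))).
by rewrite /g /m; field; exact: b0.
Qed.
Let pb s : b (s + L) = b s. Proof. by rewrite /b pa1. Qed.
Let pm s : m (s + L) = m s. Proof. by rewrite /m pb. Qed.
Let pg s : g (s + L) = g s.
Proof. by rewrite /g pb pm pa1 /b1 (derive1_per sa1 pa1). Qed.
Let qma s : q s - m s = a s. Proof. by rewrite /q addrK. Qed.

(** The choice of the circles: b = M + a' is positive, m = 1 / b,
    q = a + m, and g is defined by q' = g m. *)
Lemma curve_strip : exists D : strip R, [/\ base D = c, per D = L & fg D = g].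
Proof.
have [sE _ _ _ pE] := fr.
have dT' (s : R) : is_derive s 1 T ((q s - m s) *: N s - l *: E s) by rewrite qma.
have dN' (s : R) : is_derive s 1 N (- (q s - m s) *: T s) by rewrite qma.
have m0 s : 0 < m s by rewrite invr_gt0; exact: HM.
have pq s : q (s + L) = q s by rewrite /q pa pm.
have dg (s : R) : is_derive s 1 g (derive1 g s) by exact: smooth_is_derive.
exists (@Strip R c E T N q g m (derive1 g) l L L0 on (curve_derive hc) dE dT' dN' dq dg
  (curve_smooth hc) sE sT sN sq sg (smooth_continuous sm) (smooth_continuous (smooth_derive1 sg))
  m0 (cfc_periodic hc) pE pT pN pq pg pm (derive1_per sg pg) curve_inj).
by [].
Qed.

(** Heights along a leaf: the logarithmic derivative of b exp(-(M a + h)) is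
    - g when h' = (a')^2, so that the return map multiplies heights by
    exp(-h), and h grows because a is not constant. *)
Lemma leaf_profile : (exists s, a s != a 0) -> exists rho : R -> R,
  [/\ forall s : R, -1 < s < L + 1 -> is_derive s 1 rho (- g s * rho s),
      rho 0 = 1 & rho L != 1].
Proof.
move=> [s1 as1].
have ca1 : continuous a1 by exact: smooth_continuous.
have [h dh] := @antiderivative R (fun s => a1 s * a1 s) (-1) (L + 1)
  (fun s _ => @continuousM R _ a1 a1 s (ca1 s) (ca1 s)).
pose ex s := expR (- (M * a s + h s)).
pose rho s := b s * ex s / (b 0 * ex 0).
have ex0 s : ex s != 0 by rewrite gt_eqF// expR_gt0.
exists rho; split.
- move=> s sI; have d1 := is_derive_opp (deriv_addr (deriv_mul (der_cstr M s) (da s)) (dh _ sI)).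
  have d2 := @der_after1 R (fun s => - (M * a s + h s)) (@expR R) s _ _ d1 (is_derive_expR _).
  apply: (der_eq (deriv_mul (deriv_mul (db s) d2) (der_cstr (b 0 * ex 0)^-1 s))).
  by apply: profile_identity; [exact: b0|rewrite /b addrC addKr].
- by rewrite /rho divff// mulf_neq0.
have bL : b L = b 0 by rewrite -[L in b L]add0r pb.
have aL : a L = a 0 by rewrite -[L in a L]add0r pa.
apply/eqP => rL; have {rL} hL : h L = h 0.
  have E1 : ex L = ex 0.
    by apply: (@ratio_one R (b 0) (ex L) (ex 0) (b0 0) (ex0 0)); rewrite -{1}bL.
  move: E1.
  by move=> /expR_inj/oppr_inj; rewrite aL => /addrI.
have inI s : 0 <= s <= L -> -1 < s < L + 1 by exact: itv_widen.
have grow s t : 0 <= s -> s <= t -> t <= L -> h s <= h t.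
  move=> s0 st tL; rewrite -subr_ge0.
  have := @mvt_growth R h (fun s => a1 s * a1 s) s t 0 st; rewrite mul0r; apply.
    by move=> x /andP[x1 x2]; apply/dh/inI; rewrite (le_trans s0 x1) (le_trans x2 tL).
  by move=> x _; exact: sqr_ge0.
have hc0 s : 0 <= s <= L -> h s = h 0.
  move=> /andP[s0 sL]; apply/eqP; rewrite eq_le -{1}hL !grow//.
have a10 s : 0 < s < L -> a1 s = 0.
  move=> sI; have [s0 sL] := andP sI.
  have nh : \forall x \near s, cst (h 0) x = h x.
    have oI : open [set x : R | 0 < x < L].
      have -> : [set x : R | 0 < x < L] = `]0, L[%classic by apply/seteqP; split=> x /=; rewrite in_itv.
      exact: interval_open.
    have nI : nbhs s [set x : R | 0 < x < L] by apply: open_nbhs_nbhs; split.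
    apply: filterS nI => x /andP[/ltW x0 /ltW xL].
    have xI : 0 <= x <= L by rewrite x0 xL.
    exact: (esym (hc0 x xI)).
  have d0 : is_derive s 1 h 0 by exact: (near_eq_is_derive nh (is_derive_cst (h 0) s (1 : R))).
  have sI' : -1 < s < L + 1 by apply: inI; rewrite (ltW s0) (ltW sL).
  have /eqP := is_derive_uniq (dh _ sI') d0; rewrite mulf_eq0 orbb => /eqP //.
have ac s : 0 <= s < L -> a s = a 0.
  move=> /andP[s00 sL]; have [<-|sn] := eqVneq 0 s; first exact: erefl.
  have s0 : 0 < s by rewrite lt_def eq_sym sn.
  have Doo (x : R) : x \in `]0, s[%R -> is_derive x 1 a (a1 x) by move=> _; exact: da.
  have cth : {within `[0, s], continuous a}.
    by apply: continuous_subspaceT; exact: smooth_continuous.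
  have [x] := MVT s0 Doo cth; rewrite in_itv/= => /andP[x0 xs].
  have xI : 0 < x < L by rewrite x0 (lt_trans xs sL).
  by rewrite (a10 x xI) mul0r => /eqP; rewrite subr_eq0 => /eqP.
have [k [s' [sI sE]]] := periodic_reduce s1 L0.
by move: as1; rewrite sE (periodic_int pa) (ac s' sI) eqxx.
Qed.

End Build.

(** A constant geodesic curvature would make the curve a circle. *)
Lemma noncircle_strip : ~ is_circle c L ->
  exists (D : strip R) (rho : R -> R), [/\ base D = c, per D = L,
   forall s : R, -1 < s < per D + 1 -> is_derive s 1 rho (- fg D s * rho s),
      rho 0 = 1 & rho (per D) != 1].
Proof.
move=> nc; have nonc : exists s, a s != a 0.
  apply: contrapT => H; apply: nc.
  have ac s : a s = a 0 by apply: contrapT => h; apply: H; exists s; exact/eqP.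
  apply: (@constant_curvature_circle R c L hc E N l (a 0) on dE).
    by move=> s; rewrite -(ac s); exact: dT.
  by move=> s; rewrite -(ac s); exact: dN.
have [B B0 HB] := periodic_bounded L0 (smooth_continuous sa1) pa1.
have HM s : 0 < (B + 1) + a1 s.
  by exact: bound_shift.
have [rho [h1 h2 h3]] := leaf_profile HM nonc.
have [D [e1 e2 e3]] := curve_strip HM.
by exists D, rho; rewrite e2 e3.
Qed.

End Frames.

Lemma noncircle_hyperbolic (R : realType) (r : nat) (c : R -> 'rV[R]_3) (L : R) :
  (0 < r)%N -> closed_frenet_curve c L -> planar c L \/ spherical c L -> ~ is_circle c L ->
  exists S : oriented_surface R r, trace c L `<=` carrier S /\ hyperbolic_principal_cycle S c.
Proof.
move=> r1 hc hps nc; have [E [l fr]] := surface_frame_exists hc hps.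
have [D [rho [bE pE d1 d2 d3]]] := noncircle_strip hc fr nc.
have [e0 e00 Hrad] := strip_radius D.
have [e /andP[e_gt0 e_lt] sep] := sep_strip e00 Hrad.
exists (strip_surface r1 Hrad e_gt0 e_lt sep); split.
  by move=> _ [s _ <-]; exists s, 0; rewrite normr0 surf0 bE.
by rewrite -bE; exact: (strip_hyperbolic r1 Hrad e_gt0 e_lt sep d1 d2 d3).
Qed.

Theorem corollary1 (R : realType) (r : nat) (hr : (4 <= r)%N)
  (c : R -> 'rV[R]_3) (L : R) (hc : closed_frenet_curve c L)
  (hps : planar c L \/ spherical c L) :
  (exists S : oriented_surface R r,
     trace c L `<=` carrier S /\ hyperbolic_principal_cycle S c) <->
  ~ is_circle c L.
Proof.
split; last by apply: noncircle_hyperbolic => //; exact: leq_trans hr.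
move=> [S [_ hyp]] circ.
by apply: (circle_not_hyperbolic (leq_trans _ hr) hc circ hyp).
Qed.
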